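(* Let $d\geq2$ and let $p,q\in\mathcal{P}_d$ with $p\in{\rm Bif}(\mathcal{P}_d)$. Then the product map $(p,q)\in\mathcal{H}_d(\mathbb{P}^2)$ is a limit in $\mathcal{H}_d(\mathbb{P}^2)$ of polynomial skew products $f$ such that some iterate of $f$ has a blender of repelling type. Likewise, $(p,q)$ is a limit in $\mathcal{H}_d(\mathbb{P}^2)$ of polynomial skew products $f$ such that some iterate of $f$ has a blender of saddle type.
   Context: $\mathcal{P}_d$ is the space of complex polynomials of degree $d$ in one variable and ${\rm Bif}(\mathcal{P}_d)$ its (one-variable) bifurcation locus. $\mathcal{H}_d(\mathbb{P}^2)$ is the space of holomorphic endomorphisms of $\mathbb{P}^2$ of algebraic degree $d$. The product map $(p,q)$ is $(z,w)\mapsto(p(z),q(w))$ on $\mathbb{C}^2$, extended to $\mathbb{P}^2$ by $[z:w:t]\mapsto[t^dp(z/t):t^dq(w/t):t^d]$. A polynomial skew product is a polynomial map of $\mathbb{C}^2$ of the form $(z,w)\mapsto(h(z,w),q(w))$ extending to a holomorphic endomorphism of $\mathbb{P}^2$. Hyperbolicity for an endomorphism $f$: for a compact invariant set $\Lambda$, let $\widehat\Lambda=\{(x_i)_{i\le0}: x_i\in\Lambda, f(x_i)=x_{i+1}\}$ (natural extension); $\Lambda$ is hyperbolic if the tangent bundle pulled back to $\widehat\Lambda$ splits continuously and $Df$-invariantly as $E^s\oplus E^u$ with $\|Df^nu\|\le C\lambda^n\|u\|$ on $E^s$ and $\|(Df^n)^{-1}v\|\le C\lambda^n\|v\|$ on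 $E^u$ for some $C>0$, $0<\lambda<1$. It is repelling if $E^u$ is the whole tangent space, and of saddle type if $\dim E^s=\dim E^u=1$. Blender of repelling type: for a holomorphic map $F$ defined on an open subset of $\mathbb{C}^2$, a compact set $\Lambda$ is a blender of repelling type if there exist open sets $H_1,H_2,H_3,V_1,V_2,V_3\subset\mathbb{C}$ with $Z:=\bigcup_{i=1}^3H_i\times V_i$ contained in the domain of $F$, and constants $\delta>0$, $\alpha>0$, such that $\Lambda=\bigcap_{n\ge0}F^{-n}(\overline Z)$, $\Lambda$ is contained in a repelling hyperbolic set of $F$, and for every holomorphic map $G$ on $Z$ with $\|G-F\|_{C^1,Z}\le\alpha$, every $i\in\{1,2,3\}$ and every holomorphic $\sigma\colon V_i\to H_i$ with $\sup_{V_i}|\sigma'|<\delta$, the set $\bigcap_{n\ge0}G^{-n}(\overline Z)$ intersects the graph $\{(\sigma(w),w): w\in V_i\}$. Blender of saddle type: for $f\in\mathcal{H}_D(\mathbb{P}^2)$ and an open set $Z\subset\mathbb{P}^2$ with $\overline Z\subset f(Z)$, if for all $g\in\mathcal{H}_D(\mathbb{P}^2)$ sufficiently close to $f$ the set $\Lambda_g:=\bigcap_{n\ge0}g^{-n}(\overline Z)$ is a hyperbolic set of saddle type, then $\Lambda_f$ is a blender of saddle type of $f$. *)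

(* Defs.v *)
(* Complex numbers are R[i] (mathcomp
   real-closed) for an arbitrary R : realType, used through the regular
   normed-module view (R[i])^o, so that the topology / differentiability
   notions of MathComp-Analysis are the complex ones. *)
From HB Require Import structures.
From mathcomp Require Import all_boot all_order all_algebra.
From mathcomp Require Import complex.
From mathcomp Require Import all_classical all_reals all_analysis.
Import Order.TTheory GRing.Theory Num.Theory.
Import numFieldNormedType.Exports.

Set Implicit Arguments.
Unset Strict Implicit.
Unset Printing Implicit Defensive.

Local Open Scope ring_scope.
Local Open Scope classical_set_scope.

Section Defs.
Variable R : realType.
Local Notation C := ((R[i])^o).

(* A polynomial of degree <= d is given by its coefficient vector
   a = (a_0, ..., a_d); P_d is the open set {a_d <> 0} of C^(d+1).     *)
Definition inPd (d : nat) (a : 'rV[C]_(d.+1)) : Prop := a ord0 ord_max != 0.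

Definition pev (d : nat) (a : 'rV[C]_(d.+1)) (z : C) : C :=
  \sum_(i < d.+1) a ord0 i * z ^+ i.

Definition filledJulia (d : nat) (a : 'rV[C]_(d.+1)) : set C :=
  [set z | exists M : C, forall n, `|iter n (pev a) z| <= M].

Definition julia (d : nat) (a : 'rV[C]_(d.+1)) : set C :=
  closure (filledJulia a) `\` interior (filledJulia a).

Definition holo_on (V W : normedModType (R[i])) (U : set V) (f : V -> W) : Prop :=
  forall x, U x -> differentiable f x.

(* J-stability (Mane-Sad-Sullivan): the Julia set moves holomorphically
   over a neighbourhood of the parameter. *)
Definition Jstable (d : nat) (a : 'rV[C]_(d.+1)) : Prop :=
  exists U : set 'rV[C]_(d.+1),
    [/\ open U, U a, (forall b, U b -> inPd b) &
    exists h : 'rV[C]_(d.+1) -> C -> C,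
      [/\ forall z, julia a z -> h a z = z,
          forall b, U b -> forall z1 z2, julia a z1 -> julia a z2 ->
                h b z1 = h b z2 -> z1 = z2,
          forall b, U b -> h b @` julia a = julia b &
          forall z, julia a z -> holo_on U (fun b => h b z)]].

Definition Bif (d : nat) (a : 'rV[C]_(d.+1)) : Prop := inPd a /\ ~ Jstable a.

(* 2. Holomorphic endomorphisms of P^2 of degree D, via homogeneous     *)
(*    lifts C^3 -> C^3 given by their coefficients.                    *)

(* monomials x^i y^j t^(D-i-j) of degree D *)
Definition mon (D : nat) := {m : 'I_D.+1 * 'I_D.+1 | (m.1 + m.2 <= D)%N}.

Definition coefs (D : nat) := 'I_3 -> mon D -> C.

Definition expx (D : nat) (m : mon D) : nat := nat_of_ord (val m).1.
Definition expy (D : nat) (m : mon D) : nat := nat_of_ord (val m).2.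

Definition cc (x : 'rV[C]_3) (k : nat) : C := x ord0 (inord k).

Definition row3 (u v w : C) : 'rV[C]_3 := \row_(k < 3) nth 0 [:: u; v; w] k.

Definition hev (D : nat) (G : coefs D) (x : 'rV[C]_3) : 'rV[C]_3 :=
  \row_(i < 3) \sum_(m : mon D)
     G i m * cc x 0 ^+ expx m * cc x 1 ^+ expy m * cc x 2 ^+ (D - expx m - expy m).

(* the lift defines an element of H_D(P^2): no common zero but 0 *)
Definition inH (D : nat) (G : coefs D) : Prop :=
  forall x, hev G x = 0 -> x = 0.

(* distance on coefficient space (neighbourhoods in H_D are images of
   neighbourhoods of lifts, the conditions used are scale invariant) *)
Definition coef_close (D : nat) (G F : coefs D) (e : C) : Prop :=
  forall i m, `|G i m - F i m| < e.

(* the product map (p,q) : [z:w:t] |-> [t^d p(z/t) : t^d q(w/t) : t^d] *)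
Definition prodmap (d : nat) (a b : 'rV[C]_(d.+1)) : coefs d :=
  fun i m =>
    if i == 0 :> nat then (if expy m == 0%N then a ord0 (val m).1 else 0)
    else if i == 1 :> nat then (if expx m == 0%N then b ord0 (val m).2 else 0)
    else (if (expx m == 0%N) && (expy m == 0%N) then 1 else 0).

(* polynomial skew products (z,w) |-> (h(z,w), q(w)): lifts of the form
   (H(z,w,t), Q(w,t), c t^d), c <> 0, lying in H_d *)
Definition skewprod (d : nat) (G : coefs d) : Prop :=
  [/\ inH G,
      forall m : mon d, expx m != 0%N -> G 1 m = 0,
      forall m : mon d, (expx m != 0%N) || (expy m != 0%N) -> G 2 m = 0 &
      forall m : mon d, expx m = 0%N -> expy m = 0%N -> G 2 m != 0].

Definition affmap (D : nat) (G : coefs D) (p : C * C) : C * C :=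
  let y := hev G (row3 p.1 p.2 1) in (cc y 0 / cc y 2, cc y 1 / cc y 2).

(* Subsets of P^2 are represented by cones of C^3 \ {0}.               *)

Definition cross (x y : 'rV[C]_3) : 'rV[C]_3 :=
  row3 (cc x 1 * cc y 2 - cc x 2 * cc y 1)
       (cc x 2 * cc y 0 - cc x 0 * cc y 2)
       (cc x 0 * cc y 1 - cc x 1 * cc y 0).

Definition bil (n v : 'rV[C]_3) : C := \sum_(k < 3) n ord0 k * v ord0 k.

(* a metric equivalent to the Fubini-Study distance on P^2 *)
Definition dP2 (x y : 'rV[C]_3) : C := `|cross x y| / (`|x| * `|y|).

(* a norm equivalent to the Fubini-Study norm of the tangent vector
   d pi(x) v at [x] (v in C^3 represents an element of C^3 / C x) *)
Definition tnorm (x v : 'rV[C]_3) : C := `|cross x v| / (`|x| ^+ 2).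

Definition cone (A : set 'rV[C]_3) : Prop :=
  ~ A 0 /\ forall x c, A x -> c != 0 -> A (c *: x).

Definition P2open (A : set 'rV[C]_3) : Prop := cone A /\ open A.
Definition P2closed (A : set 'rV[C]_3) : Prop := cone A /\ closed (A `|` [set 0]).
Definition P2closure (A : set 'rV[C]_3) : set 'rV[C]_3 := closure A `\` [set 0].

Definition P2img (D : nat) (G : coefs D) (A : set 'rV[C]_3) : set 'rV[C]_3 :=
  [set y | y != 0 /\ exists x c, [/\ A x, c != 0 & y = c *: hev G x]].

Definition LamP2 (D : nat) (G : coefs D) (Z : set 'rV[C]_3) : set 'rV[C]_3 :=
  [set x | x != 0 /\ forall n, P2closure Z (iter n (hev G) x)].

(* natural extension: xs i represents x_{-i} *)
Definition natext (D : nat) (G : coefs D) (L : set 'rV[C]_3) : set (nat -> 'rV[C]_3) :=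
  [set xs | forall i, L (xs i) /\ cross (hev G (xs i.+1)) (xs i) = 0].

Definition fshift (D : nat) (G : coefs D) (xs : nat -> 'rV[C]_3) : nat -> 'rV[C]_3 :=
  fun i => if i is j.+1 then xs j else hev G (xs 0%N).

(* a line field over the natural extension, given by normal vectors:
   the line at xs is {v | bil (n xs) v = 0} / C (xs 0), a complex line of
   T_[xs 0] P^2 (as bil (n xs) (xs 0) = 0, n xs <> 0) *)
Definition linefield (D : nat) (G : coefs D) (L : set 'rV[C]_3)
    (n : (nat -> 'rV[C]_3) -> 'rV[C]_3) : Prop :=
  [/\ forall xs, natext G L xs -> n xs != 0 /\ bil (n xs) (xs 0%N) = 0,
      forall xs, natext G L xs -> forall v, bil (n xs) v = 0 ->
          bil (n (fshift G xs)) ('D_v (hev G) (xs 0%N)) = 0 &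
      (* continuity on the natural extension (product topology) *)
      forall xs, natext G L xs -> forall e : C, 0 < e ->
        exists (N : nat) (del : C), 0 < del /\
          forall ys, natext G L ys -> (forall i, (i <= N)%N -> dP2 (ys i) (xs i) < del) ->
             dP2 (n ys) (n xs) < e].

Definition hyp_saddle (D : nat) (G : coefs D) (L : set 'rV[C]_3) : Prop :=
  [/\ P2closed L, P2img G L = L &
   exists (ns nu : (nat -> 'rV[C]_3) -> 'rV[C]_3) (K lam : C),
     [/\ linefield G L ns /\ linefield G L nu,
         forall xs, natext G L xs -> cross (ns xs) (nu xs) != 0,
         0 < K, 0 < lam < 1 &
         forall xs, natext G L xs -> forall (n : nat) (v : 'rV[C]_3),
           let x := xs 0%N in
           (bil (ns xs) v = 0 ->
              tnorm (iter n (hev G) x) ('D_v (iter n (hev G)) x)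
                <= K * lam ^+ n * tnorm x v) /\
           (bil (nu xs) v = 0 ->
              tnorm x v <= K * lam ^+ n *
                 tnorm (iter n (hev G) x) ('D_v (iter n (hev G)) x))]].

Definition saddle_blender (D : nat) (F : coefs D) (L : set 'rV[C]_3) : Prop :=
  exists Z : set 'rV[C]_3,
    [/\ P2open Z, (P2closure Z `<=` P2img F Z), L = LamP2 F Z, (L !=set0) &
      (exists e : C, 0 < e /\
        forall G : coefs D, inH G -> coef_close G F e -> hyp_saddle G (LamP2 G Z))].

Definition iter_saddle_blender (D : nat) (F : coefs D) : Prop :=
  exists n : nat, (0 < n)%N /\
    exists Fn : coefs (D ^ n),
      (forall x, hev Fn x = iter n (hev F) x) /\ exists L, saddle_blender Fn L.

Definition preIter (Dom : set (C * C)) (F : C * C -> C * C) (n : nat)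
    (S : set (C * C)) : set (C * C) :=
  [set x | (forall j, (j < n)%N -> Dom (iter j F x)) /\ S (iter n F x)].

Definition LamC2 (Dom : set (C * C)) (F : C * C -> C * C) (Z : set (C * C)) :=
  [set x | forall n, preIter Dom F n (closure Z) x].

Definition rep_hyp (Dom : set (C * C)) (F : C * C -> C * C) (L : set (C * C)) :=
  [/\ compact L, L `<=` Dom, F @` L = L &
   exists K lam : C, [/\ 0 < K, 0 < lam < 1 &
     forall x, L x -> forall (n : nat) (v : C * C),
       `|v| <= K * lam ^+ n * `|'D_v (iter n F) x| ]].

Definition C1close (Z : set (C * C)) (G F : C * C -> C * C) (alp : C) : Prop :=
  forall p, Z p -> `|G p - F p| <= alp /\
     forall v : C * C, `|'D_v G p - 'D_v F p| <= alp * `|v|.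

Definition rep_blender (Dom : set (C * C)) (F : C * C -> C * C) (L : set (C * C)) :=
  exists (H V : 'I_3 -> set C) (del alp : C),
    let Z := \bigcup_(i in setT) (H i `*` V i) in
    [/\ 0 < del /\ 0 < alp,
        forall i, [/\ open (H i), open (V i), (H i !=set0) & (V i !=set0)],
        (Z `<=` Dom), L = LamC2 Dom F Z &
     [/\ exists L', rep_hyp Dom F L' /\ L `<=` L' &
      forall G : C * C -> C * C, holo_on Z G -> C1close Z G F alp ->
      forall (i : 'I_3) (sig : C -> C),
        holo_on (V i) sig -> (forall w, V i w -> H i (sig w)) ->
        (exists d' : C, d' < del /\ forall w, V i w -> `|sig^`() w| <= d') ->
        exists w, V i w /\ LamC2 Z G Z (sig w, w)]].

Definition iter_rep_blender (D : nat) (F : coefs D) : Prop :=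
  exists n : nat, (0 < n)%N /\ exists L, rep_blender setT (iter n (affmap F)) L.

End Defs.

Notation Cplx R := ((R[i])^o).

(* Main.v *)
(* A bifurcation polynomial is a limit of polynomials with a neutral cycle: otherwise all periodic points near [a] move
   holomorphically, and by the lambda-lemma so does the Julia set. So [p] can be perturbed to have a cycle through [z] whose
   multiplier is near a primitive cube root of unity [w], inside or outside the unit circle; three turns have a multiplier
   [Lam] near [1]. Take [f (x, y) = (p x + k c (y - ws), q y)] with [ws] a repelling fixed point of a generic [q] and [k]
   small. A homoclinic orbit of [ws], delayed by 0, 1 or 2 turns, gives three small discs in the [y]-plane which an iterate
   of [q] maps over the same disc, while the coordinate [x] near [z], in units of [k], is sent near [Lam x + w ^+ i].
   The three maps [x |-> Lam x + w ^+ i] cover a disc robustly, even though each one is almost a translation: this yields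
   a repelling blender if [1 < nm Lam] and a saddle one if [nm Lam < 1]. *)
Require Import Defs.
From HB Require Import structures.
From mathcomp Require Import all_boot all_order all_algebra.
From mathcomp Require Import complex.
From mathcomp Require Import all_classical all_reals all_analysis.
From mathcomp Require Import ring lra zify.
Import Order.TTheory GRing.Theory Num.Theory.
Import numFieldNormedType.Exports.
Set Implicit Arguments.
Unset Strict Implicit.
Unset Printing Implicit Defensive.
Local Open Scope ring_scope.
Local Open Scope classical_set_scope.

(** After a multiple of three turns the derivative along the cycle is close to 1, so the [x]-motion
    is governed by the accumulated kicks [c (y - ws)], each weighted by the derivatives that the
    cycle still applies to it. One turn multiplies a weight by [w]; hence a delay of [i] turns
    multiplies the whole sum by [w ^+ i]. The sum along the homoclinic orbit must not be small, for
    [c] is its inverse: the backward orbit is built so that its weighted sum is as large as desired.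
    The obstacle is the order of the choices. The number of iterates and the expansions [A i] are
    fixed before [nm Lam] is moved off 1, and the admissible gap between [nm Lam] and 1 depends on
    them. Two tolerances are therefore kept apart: [eta], relative to the strong expansion in [y],
    and a much smaller [ep], for the dependence on [x], which is small even against the gap. The
    complex analysis in one variable is done with finite averages over roots of unity of order a
    power of 3, obtained by repeated cube roots. *)

Ltac xlra := repeat match goal with H : @eq _ _ _ |- _ => clear H end; lra.

(** * Real-valued norms and compactness *)

Section Norms.
Variable R : realType.
Local Notation C := (Cplx R).

(** The norm of a normed module over [R[i]] is an element of [R[i]]; its real part carries the same
    information and gives inequalities in [R], within reach of [lra]. *)
Definition nm (V : normedModType R[i]) (x : V) : R := complex.Re `|x|.
Definition rc (x : R) : C := x%:C%C.

Lemma ge0_rc (y : C) : 0 <= y -> y = rc (complex.Re y).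
Proof. by case: y => a b; rewrite lecE /= => /andP[/eqP-> _]. Qed.

Lemma rc_lt (x y : R) : (rc x < rc y) = (x < y).
Proof. by rewrite /rc ltcR. Qed.
Lemma rc_le (x y : R) : (rc x <= rc y) = (x <= y).
Proof. by rewrite /rc lecR. Qed.
Lemma rc0 : rc 0 = 0. Proof. by []. Qed.
Lemma rc1 : rc 1 = 1. Proof. by []. Qed.
Lemma rcD (x y : R) : rc (x + y) = rc x + rc y.
Proof. by rewrite /rc rmorphD. Qed.
Lemma rcM (x y : R) : rc (x * y) = rc x * rc y.
Proof. by rewrite /rc rmorphM. Qed.
Lemma rcN (x : R) : rc (- x) = - rc x.
Proof. by rewrite /rc rmorphN. Qed.
Lemma rcX (x : R) n : rc (x ^+ n) = rc x ^+ n.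
Proof. by rewrite /rc rmorphXn. Qed.
Lemma rcV (x : R) : rc (x^-1) = (rc x)^-1.
Proof. by rewrite /rc fmorphV. Qed.
Lemma rc_inj : injective rc.
Proof. by move=> x y []. Qed.
Lemma rc_nat n : rc n%:R = n%:R.
Proof. by rewrite /rc rmorph_nat. Qed.

Lemma pos_rc (y : C) : 0 < y -> exists2 x : R, 0 < x & y = rc x.
Proof.
move=> y0; exists (complex.Re y); last exact/ge0_rc/ltW.
by rewrite -rc_lt rc0 -ge0_rc // ltW.
Qed.

Section V.
Variable V : normedModType R[i].
Implicit Types x y : V.
Lemma normE x : `|x| = rc (nm x).
Proof. by apply: ge0_rc; rewrite normr_ge0. Qed.
Lemma nm_ge0 x : 0 <= nm x.
Proof. by rewrite -rc_le rc0 -normE normr_ge0. Qed.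
Lemma nm0 : nm (0 : V) = 0.
Proof. by rewrite /nm normr0. Qed.
Lemma nm_eq0 x : (nm x == 0) = (x == 0).
Proof.
rewrite -[RHS]normr_eq0 normE; apply/eqP/eqP => [->//|h].
exact: rc_inj.
Qed.
Lemma nm_gt0 x : (0 < nm x) = (x != 0).
Proof. by rewrite lt_neqAle nm_ge0 andbT eq_sym nm_eq0. Qed.
Lemma nmN x : nm (- x) = nm x.
Proof. by rewrite /nm normrN. Qed.
Lemma nmB x y : nm (x - y) = nm (y - x).
Proof. by rewrite -nmN opprB. Qed.
Lemma nmD x y : nm (x + y) <= nm x + nm y.
Proof. by rewrite -rc_le rcD -!normE ler_normD. Qed.
Lemma nmBD x y : nm (x - y) <= nm x + nm y.
Proof. by rewrite (le_trans (nmD _ _)) // nmN. Qed.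
Lemma nm_tri z x y : nm (x - y) <= nm (x - z) + nm (z - y).
Proof. by rewrite (le_trans _ (nmD _ _)) // addrA subrK. Qed.
Lemma nm_lo x y : nm x - nm y <= nm (x - y).
Proof. by have := nmD (x - y) y; rewrite subrK; lra. Qed.
Lemma nm_loD x y : nm x - nm y <= nm (x + y).
Proof. by have := nm_lo x (- y); rewrite nmN opprK. Qed.
Lemma nmZ (c : C) x : nm (c *: x) = nm c * nm x.
Proof. by apply: rc_inj; rewrite rcM -!normE normrZ. Qed.
Lemma nm_sum (I : Type) (r : seq I) (P : pred I) (F : I -> V) :
  nm (\sum_(i <- r | P i) F i) <= \sum_(i <- r | P i) nm (F i).
Proof.
elim/big_rec2: _ => [|i y1 y2 _ h]; first by rewrite nm0.
by rewrite (le_trans (nmD _ _)) // lerD2l.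
Qed.
Lemma nm_lt x (e : R) : (`|x| < rc e) = (nm x < e).
Proof. by rewrite normE rc_lt. Qed.
Lemma nm_le x (e : R) : (`|x| <= rc e) = (nm x <= e).
Proof. by rewrite normE rc_le. Qed.
Lemma nm_small0 x : (forall e : R, 0 < e -> nm x <= e) -> x = 0.
Proof.
move=> h; apply/eqP; rewrite -nm_eq0 eq_le nm_ge0 andbT.
by apply/ler_addgt0Pl => e e0; rewrite addr0 h.
Qed.
End V.

Implicit Types c x y : C.
Lemma nmM x y : nm (x * y) = nm x * nm y.
Proof. exact: nmZ. Qed.
Lemma nm1 : nm (1 : C) = 1.
Proof. by apply: rc_inj; rewrite -normE normr1. Qed.
Lemma nmX x n : nm (x ^+ n) = nm x ^+ n.
Proof. by elim: n => [|n ih]; rewrite ?expr0 ?nm1 // !exprS nmM ih. Qed.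
Lemma nmV x : nm (x^-1) = (nm x)^-1.
Proof. by apply: rc_inj; rewrite rcV -!normE; exact: normfV. Qed.
Lemma nm_div x y : nm (x / y) = nm x / nm y.
Proof. by rewrite nmM nmV. Qed.
Lemma nm_prod (I : Type) (r : seq I) (P : pred I) (F : I -> C) :
  nm (\prod_(i <- r | P i) F i) = \prod_(i <- r | P i) nm (F i).
Proof. by elim/big_rec2: _ => [|i y1 y2 _ h]; rewrite ?nm1 // nmM h. Qed.
Lemma nm_rc (x : R) : nm (rc x) = `|x|.
Proof.
apply: rc_inj; rewrite -normE /rc.
have -> : `|(x%:C)%C : C| = `|(x%:C)%C : R[i]| by [].
by rewrite normc_def /= expr0n /= addr0 sqrtr_sqr.
Qed.
Lemma nm_nat n : nm (n%:R : C) = n%:R.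
Proof. by rewrite -rc_nat nm_rc ger0_norm // ler0n. Qed.

Lemma nm_sqr x : nm x ^+ 2 = complex.Re x ^+ 2 + complex.Im x ^+ 2.
Proof.
have -> : nm x = Num.sqrt (complex.Re x ^+ 2 + complex.Im x ^+ 2).
  by rewrite /nm; have -> : `|x| = `|(x : R[i])| by []; rewrite normc_def.
by rewrite sqr_sqrtr // addr_ge0 // sqr_ge0.
Qed.

Lemma nm_Re x : `|complex.Re x| <= nm x.
Proof.
rewrite -[leRHS]ger0_norm ?nm_ge0 // -ler_sqr ?nnegrE // !real_normK ?num_real //.
by rewrite nm_sqr lerDl sqr_ge0.
Qed.
Lemma nm_Im x : `|complex.Im x| <= nm x.
Proof.
rewrite -[leRHS]ger0_norm ?nm_ge0 // -ler_sqr ?nnegrE // !real_normK ?num_real //.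
by rewrite nm_sqr lerDr sqr_ge0.
Qed.
Lemma nm_ReIm x : nm x <= `|complex.Re x| + `|complex.Im x|.
Proof.
rewrite -ler_sqr ?nnegrE ?nm_ge0 ?addr_ge0 // nm_sqr sqrrD !real_normK ?num_real //.
by rewrite lerD2r lerDl mulrn_wge0 // mulr_ge0.
Qed.

Lemma nm_pair (V W : normedModType R[i]) (p : (V * W)%type) :
  nm p = Num.max (nm p.1) (nm p.2).
Proof.
apply: rc_inj; rewrite -normE prod_normE !normE.
by rewrite /Num.max /Order.max; have -> := rc_lt (nm p.1) (nm p.2); case: ifP.
Qed.
Lemma nm_pair_le (V W : normedModType R[i]) (p : (V * W)%type) e :
  (nm p <= e) = (nm p.1 <= e) && (nm p.2 <= e).
Proof. by rewrite nm_pair ge_max. Qed.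
Lemma nm_pair_lt (V W : normedModType R[i]) (p : (V * W)%type) e :
  (nm p < e) = (nm p.1 < e) && (nm p.2 < e).
Proof. by rewrite nm_pair gt_max. Qed.

Lemma nm_entry n (v : 'rV[C]_n.+1) i : nm (v ord0 i) <= nm v.
Proof.
rewrite -rc_le -!normE.
have [_ h] : `|v| <= `|v| /\ forall j, `|v ord0 j| <= `|v|.
  split=> // j; rewrite {2}/Num.norm /= mx_normE.
  exact: (le_bigmax _ (fun ij : 'I_1 * 'I_n.+1 => `|v ij.1 ij.2|%:nng) (ord0, j)).
exact: h.
Qed.

Lemma nm_row_le n (v : 'rV[C]_n.+1) (e : R) :
  (forall i, nm (v ord0 i) <= e) -> nm v <= e.
Proof.
move=> h; have e0 : 0 <= e by apply: le_trans (h ord0); exact: nm_ge0.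
rewrite -rc_le -normE {1}/Num.norm /= mx_normE.
have e0' : 0 <= rc e by rewrite -rc0 rc_le.
have -> : rc e = (NngNum e0')%:num by [].
rewrite num_le; apply: bigmax_le => [|[i j] _].
  by rewrite -num_le /= rc_le.
by rewrite -num_le /= ord1 normE rc_le.
Qed.

Lemma pow_small (x e : R) : 0 <= x < 1 -> 0 < e ->
  exists n, forall k, (n <= k)%N -> x ^+ k < e.
Proof.
move=> /andP[x0 x1] e0.
have /cvgrPdist_lt /(_ _ e0) [n _ h] : (fun n => x ^+ n) @ \oo --> (0 : R).
  by apply: cvg_expr; rewrite ger0_norm.
exists n => k nk; have := h k nk.
by rewrite /= sub0r normrN ger0_norm // exprn_ge0.
Qed.

Lemma pow_large (x M : R) : 1 < x -> exists n, forall k, (n <= k)%N -> M < x ^+ k.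
Proof.
move=> x1; have x0 : 0 < x by lra.
have [n h] : exists n, forall k, (n <= k)%N -> x^-1 ^+ k < (`|M| + 1)^-1.
  by apply: pow_small; rewrite ?invr_ge0 ?invf_lt1 ?x1 ?ltW ?invr_gt0 ?ltr_wpDl.
exists n => k /h; rewrite exprVn ltf_pV2 ?posrE ?exprn_gt0 ?ltr_wpDl //.
by apply: le_lt_trans; rewrite (le_trans (ler_norm _)) // lerDl.
Qed.

Lemma inv_small (e : R) : 0 < e -> exists n : nat, forall k, (n <= k)%N -> k.+1%:R^-1 < e.
Proof.
move=> e0; exists (Num.truncn (e^-1)) => k h.
rewrite invf_plt ?posrE ?ltr0n //.
by rewrite (lt_le_trans (truncnS_gt _)) // ler_nat.
Qed.

Lemma nat_above (x : R) : exists n : nat, x < n%:R.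
Proof. by exists (Num.truncn x).+1; exact: truncnS_gt. Qed.

(** The form in which compactness is used below: a cluster point visited at arbitrarily late times,
    with no subsequence extracted. *)
Lemma compact_cluster (V : normedModType R[i]) (A : set V) (u : nat -> V) :
  compact A -> (forall n, A (u n)) ->
  exists2 l, A l & forall (e : R) N, 0 < e -> exists2 n, (N <= n)%N & nm (u n - l) < e.
Proof.
move=> cA uA; have [|l [Al ll]] := cA (u @ \oo) _.
  by exists 0%N => // n _; exact: uA.
exists l => // e N e0.
have e0' : 0 < rc e by rewrite -rc0 rc_lt.
have [|y [[n /= Nn <-] yl]] := ll [set u n | n in [set n | (N <= n)%N]] (ball l (rc e)) _ (nbhsx_ballx _ _ e0').
  by exists N => // n /= Nn; exists n.
by exists n => //; move: yl; rewrite -ball_normE /= nm_lt nmB.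
Qed.

Lemma closed_nm (V : normedModType R[i]) (v : V) (M : R) : closed [set x : V | nm (x - v) <= M].
Proof.
move=> x cx /=; apply/ler_addgt0Pl => e e0.
have e0' : 0 < rc e by rewrite -rc0 rc_lt.
have [y [/= yM]] := cx _ (nbhsx_ballx x _ e0'); rewrite -ball_normE /= nm_lt => h.
by have := nm_tri y x v; lra.
Qed.

Lemma compact_disc (M : R) : compact [set x : C | nm x <= M].
Proof.
pose f (p : R * R) : C := (p.1 +i* p.2)%C.
have cf : continuous f.
  move=> p; apply/cvgrPdist_lt => e e0.
  have [x x0 ->] := pos_rc e0.
  have x20 : 0 < x / 2 by lra.
  exists (ball p.1 (x / 2), ball p.2 (x / 2)).
    by split; exact: nbhsx_ballx.
  move=> q [/=]; rewrite -ball_normE /= => h1 h2; rewrite nm_lt.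
  have -> : f p - f q = ((p.1 - q.1) +i* (p.2 - q.2))%C by [].
  by apply: le_lt_trans (nm_ReIm _) _ => /=; move: (ltrD h1 h2); lra.
have cK : compact (f @` (`[- M, M]%classic `*` `[- M, M]%classic)).
  apply: continuous_compact; first by apply: continuous_subspaceT.
  by apply: compact_setX; exact: segment_compact.
apply: subclosed_compact cK _.
  by have := @closed_nm C 0 M; under eq_set do rewrite subr0.
move=> x /= xM; exists (complex.Re x, complex.Im x); last by case: (x).
have h1 := nm_Re x; have h2 := nm_Im x; rewrite /= !in_itv /=.
by rewrite -!ler_norml; split; lra.
Qed.

Lemma compact_rdisc n (v : 'rV[C]_n.+1) (M : R) :
  compact [set x : 'rV[C]_n.+1 | nm (x - v) <= M].
Proof.
have cK : compact [set w : 'rV[C]_n.+1 | forall i, [set x : C | nm x <= nm v + M] (w ord0 i)].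

  by apply: (@rV_compact C n.+1 (fun=> [set x : C | nm x <= nm v + M])) => i; exact: compact_disc.
apply: subclosed_compact cK _.
  exact: closed_nm.
move=> x /= h i; apply: le_trans (nm_entry _ _) _.
by have := nmD v (x - v); rewrite addrC subrK; lra.
Qed.
End Norms.

(** * Roots of unity of order a power of 3, and averages of polynomials over them *)

Lemma prod_prim (F : fieldType) N (z u v : F) : N.-primitive_root z ->
  \prod_(k < N) (u * z ^+ k - v) = (-1) ^+ N.+1 * (u ^+ N - v ^+ N) .
Proof.
move=> zN; have N0 := prim_order_gt0 zN.
have [->|u0] := eqVneq u 0.
  under eq_bigr do rewrite mul0r sub0r.
  by rewrite prodr_const card_ord expr0n (gtn_eqF N0) sub0r [(-1) ^+ N.+1]exprS mulN1r mulrNN -exprNn.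
transitivity (\prod_(k < N) (- u * (v / u - z ^+ k))).
  by apply: eq_bigr => k _; field.
rewrite big_split /= prodr_const card_ord.
have := congr1 (horner^~ (v / u)) (factor_Xn_sub_1 zN).
rewrite horner_prod big_mkord.
rewrite hornerD hornerN -polyC1 hornerC hornerXn.
have -> : \prod_(i < N) (v / u - z ^+ i) = \prod_(i < N) ('X - (z ^+ i)%:P).[v / u].
  by apply: eq_bigr => i _; rewrite hornerXsubC.
move=> ->.
rewrite [(- u) ^+ N]exprNn [(-1) ^+ N.+1]exprSr -!mulrA; congr (_ * _).
by rewrite mulN1r opprB mulrBr mulr1 expr_div_n mulrC divfK // expf_neq0.
Qed.

Section Polys.
Variable R : realType.
Local Notation C := (Cplx R).
Implicit Types (f q : {poly C}) (x y z : C).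

Lemma cube_root_exists : exists w : C, w ^+ 2 + w + 1 = 0.
Proof.
have : size ('X^2 + 'X + 1 : {poly C}) != 1%N.
  by rewrite -addrA size_polyDl size_polyXn // (leq_ltn_trans (size_polyD _ _)) // size_polyX size_poly1.
by case/closed_rootP => w; rewrite /root !hornerE => /eqP; exists w; rewrite expr2.
Qed.

Lemma cube3 (w : C) : w ^+ 2 + w + 1 = 0 -> [/\ w ^+ 3 = 1, nm w = 1 & w != 1].
Proof.
move=> h; have w3 : w ^+ 3 = 1.
  have e : w ^+ 3 - 1 = (w - 1) * (w ^+ 2 + w + 1) by ring.
  by apply/eqP; rewrite -subr_eq0 e h mulr0.
split=> //.
  by apply/eqP; rewrite -(@pexpr_eq1 _ _ 3) ?nm_ge0 // -nmX w3 nm1.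
apply/eqP => w1; move: h; rewrite w1 expr1n -!mulr2n -mulrSr => /eqP.
by rewrite -nm_eq0 nm_nat pnatr_eq0.
Qed.

Lemma ReM x y : complex.Re (x * y) = complex.Re x * complex.Re y - complex.Im x * complex.Im y.
Proof. by case: x y => [a b] [c d]. Qed.
Lemma ReD x y : complex.Re (x + y) = complex.Re x + complex.Re y.
Proof. by case: x y => [a b] [c d]. Qed.
Lemma ImD x y : complex.Im (x + y) = complex.Im x + complex.Im y.
Proof. by case: x y => [a b] [c d]. Qed.
Lemma ImM x y : complex.Im (x * y) = complex.Re x * complex.Im y + complex.Im x * complex.Re y.
Proof. by case: x y => [a b] [c d]. Qed.

Lemma cube_ReIm (w : C) : w ^+ 2 + w + 1 = 0 ->
  complex.Re w = - 2^-1 /\ complex.Im w ^+ 2 = 3 / 4.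
Proof.
move=> h; have [_ n1 w1] := cube3 h.
have := congr1 (@complex.Re R) h; have := congr1 (@complex.Im R) h.
rewrite !ReD !ImD expr2 ReM ImM /=; move: (complex.Re w : R) (complex.Im w : R) => a b.
move=> h1' h2'; have h1 : a * b + b * a + b + 0 = 0 :> R := h1'.
have h2 : a * a - b * b + a + 1 = 0 :> R := h2'; clear h1' h2'.
have b0 : b != 0.
  apply/eqP => b0; rewrite b0 in h2; have := sqr_ge0 (a + 2^-1); rewrite expr2; lra.
have e : a = - 2^-1.
  by apply: (mulfI b0); move: h1; lra.
by split=> //; move: h2; rewrite e expr2; lra.
Qed.

(** Here [a] and [- a / 2 +- u] are the scalar products of a vector of length [n] with three unit
    vectors at mutual angles of 120 degrees. Multiplying the last two inequalities gives [(n + a) ^+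
    2 > 4 u ^+ 2 = 3 (n ^+ 2 - a ^+ 2)], that is [(n + a) (4 a - 2 n) > 0], which contradicts
    [2 a < n] since [n + a > 0]. *)
Lemma cube_dir_aux (a t n u : R) : a ^+ 2 + t ^+ 2 = n ^+ 2 -> 0 <= n -> u ^+ 2 = 3 / 4 * t ^+ 2 ->
  2 * a < n -> 2 * (- 2^-1 * a + u) < n -> 2 * (- 2^-1 * a - u) < n -> False.
Proof.
rewrite !expr2 => est n0 eu c0 c1 c2.
have : 0 < (n + a) * (4 * a - 2 * n) by nra.
by rewrite pmulr_rgt0 //; lra.
Qed.

(* one of the three rotations of [x] points into a given half-plane *)
Lemma cube_dir (w x y : C) : w ^+ 2 + w + 1 = 0 -> nm y = 1 ->
  exists i : 'I_3, nm (x - y * w ^+ i) ^+ 2 <= nm x ^+ 2 - nm x + 1.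
Proof.
move=> h y1; have [h1 h2] := cube_ReIm h; have [w3 n1 _] := cube3 h.
have key i : nm (x - y * w ^+ i) ^+ 2 = nm x ^+ 2 + 1 -
   2 * (complex.Re x * complex.Re (y * w ^+ i) + complex.Im x * complex.Im (y * w ^+ i)).
  have := nm_sqr (y * w ^+ i); rewrite nmM nmX y1 n1 expr1n mulr1 expr1n.
  rewrite !nm_sqr; case: (y * w ^+ i) => c d; case: (x) => a b /= e.
  by rewrite !expr2 in e *; lra.
pose s i := complex.Re x * complex.Re (y * w ^+ i) + complex.Im x * complex.Im (y * w ^+ i).
suff [i hi] : exists i : 'I_3, nm x <= 2 * s i by exists i; rewrite key -/(s i); lra.
have ex : nm x ^+ 2 = complex.Re x ^+ 2 + complex.Im x ^+ 2 := nm_sqr x.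
have ey := nm_sqr y; rewrite y1 expr1n in ey.
have e0 : s 0%N = complex.Re x * complex.Re y + complex.Im x * complex.Im y by rewrite /s expr0 mulr1.
pose t := complex.Im x * complex.Re y - complex.Re x * complex.Im y.
have e1 : s 1%N = - 2^-1 * s 0%N + complex.Im w * t.
  by rewrite /s expr1 expr0 mulr1 ReM ImM h1 /t; lra.
have e2 : s 2%N = - 2^-1 * s 0%N - complex.Im w * t.
  have -> : s 2%N = - s 0%N - s 1%N; last by rewrite e1; lra.
  have -> : s 2%N = complex.Re x * complex.Re (y * (- w - 1)) + complex.Im x * complex.Im (y * (- w - 1)).
    by rewrite /s (_ : w ^+ 2 = - w - 1) //; apply/eqP; rewrite -subr_eq0 opprB -h; apply/eqP; ring.
  rewrite /s expr0 expr1 mulrBr mulrN !mulr1; set v := y * w.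
  have -> : complex.Re (- v - y) = - complex.Re v - complex.Re y by case: (v) (y) => [? ?] [? ?].
  have -> : complex.Im (- v - y) = - complex.Im v - complex.Im y by case: (v) (y) => [? ?] [? ?].
  lra.
have est : s 0%N ^+ 2 + t ^+ 2 = nm x ^+ 2.
  rewrite e0 /t ex -[RHS]mulr1 ey; ring.
have n0 := nm_ge0 x.
case: (lerP (nm x) (2 * s 0%N)) => [hh|c0]; first by exists ord0.
case: (lerP (nm x) (2 * s 1%N)) => [hh|c1]; first by exists (Ordinal (isT : 1 < 3)%N).
case: (lerP (nm x) (2 * s 2%N)) => [hh|c2]; first by exists (Ordinal (isT : 2 < 3)%N).
exfalso; have eu : (complex.Im w * t) ^+ 2 = 3 / 4 * t ^+ 2 by rewrite exprMn h2.
by apply: (cube_dir_aux est n0 eu c0); rewrite -?e1 -?e2.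
Qed.

(** Among the three cube roots of a unit [z] one, [t], has [Re t >= 1 / 2] by [cube_dir]. Then
    [z - 1 = (t - 1) (t ^+ 2 + t + 1)], and [t ^+ 2 + t + 1 = t (1 + 2 Re t)] has modulus at least
    2, so each extraction at least halves the distance to 1. *)
Lemma unit_root (w c : C) n : w ^+ 2 + w + 1 = 0 -> nm c = 1 ->
  exists z, [/\ nm z = 1, z ^+ (3 ^ n) = c & nm (z - 1) <= 2 / 2 ^+ n].
Proof.
move=> h c1; have [w3 n1 _] := cube3 h; elim: n => [|n [z [z1 zn z2]]].
  by exists c; rewrite expn0 expr1 expr0 divr1; split=> //; rewrite (le_trans (nmBD _ _)) // c1 nm1; lra.
have [y yz] : exists y, y ^+ 3 = z.
  have : size ('X^3 - z%:P) != 1%N by rewrite size_XnsubC.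
  by case/closed_rootP => y; rewrite /root !hornerE ?hornerXn subr_eq0 => /eqP; exists y.
have y1 : nm y = 1 by apply/eqP; rewrite -(@pexpr_eq1 _ _ 3) ?nm_ge0 // -nmX yz z1.
have [i hi] := cube_dir 1 h y1.
set t := y * w ^+ i in hi.
have t3 : t ^+ 3 = z by rewrite /t exprMn yz -exprM mulnC exprM w3 expr1n mulr1.
have t1 : nm t = 1 by rewrite /t nmM nmX y1 n1 expr1n mulr1.
exists t; split=> //; first by rewrite expnS exprM t3.
have et : t ^+ 2 + t + 1 = t * (t + 1 + (complex.Re t -i* complex.Im t)%C).
  have tt : t * (complex.Re t -i* complex.Im t)%C = 1.
    have := nm_sqr t; rewrite t1 expr1n; case: (t) => a b /= e.
    by apply/eqP; rewrite eq_complex /= e !expr2; apply/andP; split; apply/eqP; lra.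
  by rewrite mulrDr tt; ring.
have Ret : 2^-1 <= complex.Re t.
  move: hi; rewrite nm1 expr1n subrr add0r nmB nm_sqr; have := nm_sqr t; rewrite t1 expr1n.
  by case: (t) => a b /=; rewrite !expr2 => h3 h4; lra.
have n2 : 2 <= nm (t ^+ 2 + t + 1).
  rewrite et nmM t1 mul1r (le_trans _ (nm_Re _)) // (le_trans _ (ler_norm _)) //.
  by move: Ret; case: (t) => a b /=; lra.
have : nm (z - 1) = nm (t - 1) * nm (t ^+ 2 + t + 1).
  by rewrite -nmM -t3; congr nm; ring.
have := nm_ge0 (t - 1); rewrite (exprS 2 n) invfM; set X := nm (t - 1) => X0 e.
have : 2 * X <= 2 / 2 ^+ n by apply: le_trans z2; rewrite e mulrC ler_wpM2l.
lra.
Qed.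

(** Together with [prim_small], a primitive root of unity of order [3 ^ n.+1] as close to 1 as
    desired: the substitute for [exp (2 i pi / N)] in the averages over circles. *)
Lemma small_root (w : C) n : w ^+ 2 + w + 1 = 0 ->
  exists z, [/\ nm z = 1, z ^+ (3 ^ n) = w & nm (z - 1) <= 2 / 2 ^+ n].
Proof. by move=> h; apply: (unit_root _ h); case: (cube3 h). Qed.

Lemma prim_small (w z : C) n : w ^+ 2 + w + 1 = 0 -> z ^+ (3 ^ n) = w ->
  (3 ^ n.+1).-primitive_root z.
Proof.
move=> h zn; have [w3 _ w1] := cube3 h.
have [||m mz] := @prim_order_exists _ (3 ^ n.+1) z; first by rewrite expn_gt0.
  by rewrite expnS mulnC exprM zn.
move=> /(@dvdn_pfactor 3)-/(_ isT)[k kn em]; rewrite em in mz.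
move: kn; rewrite leq_eqVlt => /orP[/eqP<-//|]; rewrite ltnS => kn.
by move: w1; rewrite -zn -(subnKC kn) expnD exprM (prim_expr_order mz) expr1n eqxx.
Qed.

Lemma sum_prim N (z : C) j : N.-primitive_root z -> ~~ (N %| j)%N ->
  \sum_(k < N) z ^+ (k * j) = 0.
Proof.
move=> zN Nj; have z1 : z ^+ j - 1 != 0.
  by rewrite subr_eq0 -(expr0 z) (eq_prim_root_expr zN) mod0n.
apply: (mulfI z1); rewrite mulr0.
have := subrX1 (z ^+ j) N; rewrite -exprM mulnC exprM (prim_expr_order zN) expr1n subrr => /esym.
by under eq_bigr do rewrite -exprM mulnC.
Qed.


Lemma prod_const_seq (I : Type) (s : seq I) (c : R) : \prod_(y <- s) c = c ^+ size s.
Proof. by elim: s => [|y s ih]; rewrite ?big_nil // big_cons ih exprS. Qed.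

(** [nm f.[x]] is the modulus of the leading coefficient times the product of the distances to the
    roots, none of which is below the distance to the nearest root. It serves as Hoelder continuity
    of roots. *)
Lemma root_near f x : (1 < size f)%N ->
  exists2 y, f.[y] = 0 & nm (lead_coef f) * nm (x - y) ^+ (size f).-1 <= nm f.[x].
Proof.
move=> sf; have [r e] := closed_field_poly_normal f.
have f0 : f != 0 by rewrite -size_poly_gt0 ltnW.
have sr : size r = (size f).-1.
  by rewrite {1}e size_scale ?lead_coef_eq0 // size_prod_XsubC.
have : exists2 y, y \in r & forall y', y' \in r -> nm (x - y) <= nm (x - y').
  have : (0 < size r)%N by rewrite sr -ltnS prednK // ltnW.
  clear; elim: r => // y r ih _; case: r ih => [_|y' r ih].
    by exists y; rewrite ?mem_head // => y'; rewrite inE => /eqP->.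
  have [//|y0 y0r h] := ih.
  case: (leP (nm (x - y)) (nm (x - y0))) => hh.
    exists y; rewrite ?mem_head // => t; rewrite inE => /orP[/eqP->//|/h]; lra.
  exists y0; first by rewrite inE y0r orbT.
  move=> t; rewrite inE => /orP[/eqP->|/h//]; lra.
case=> y yr h; exists y.
  by apply/eqP; rewrite e hornerZ mulf_eq0 -/(root _ y) root_prod_XsubC yr orbT.
have -> : f.[x] = lead_coef f * \prod_(y <- r) (x - y).
  by rewrite {1}e hornerZ horner_prod; congr (_ * _); apply: eq_bigr => t _; rewrite hornerXsubC.
rewrite nmM ler_wpM2l ?nm_ge0 // nm_prod -sr -prod_const_seq big_seq [leRHS]big_seq.
by apply: ler_prod => t tr; rewrite nm_ge0 h.
Qed.

(** A discrete Jensen formula. The product over the circle of the factors of one root [y] is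
    [(x0 - z) ^+ N - (y - z) ^+ N] up to sign, and since [nm (y - z) >= Rr] its modulus exceeds
    [nm (y - z) ^+ N] at most by the factor [1 + (nm (x0 - z) / Rr) ^+ N]. *)
Lemma circle_product f z x0 (N : nat) (Rr : R) (u : C) : N.-primitive_root u ->
  (1 < size f)%N -> nm (x0 - z) < Rr -> (forall y, nm (y - z) < Rr -> f.[y] != 0) ->
  \prod_(k < N) nm f.[z + (x0 - z) * u ^+ k] <=
    nm f.[z] ^+ N * (1 + (nm (x0 - z) / Rr) ^+ N) ^+ (size f).-1.
Proof.
move=> uN sf xR nz; have [s e] := closed_field_poly_normal f.
have f0 : f != 0 by rewrite -size_poly_gt0 ltnW.
have sr : size s = (size f).-1.
  by rewrite {1}e size_scale ?lead_coef_eq0 // size_prod_XsubC.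
have fE x : f.[x] = lead_coef f * \prod_(y <- s) (x - y).
  by rewrite {1}e hornerZ horner_prod; congr (_ * _); apply: eq_bigr => y _; rewrite hornerXsubC.
have sR y : y \in s -> Rr <= nm (y - z).
  move=> ys; rewrite leNgt; apply/negP => /nz; rewrite e hornerZ mulf_eq0 negb_or.
  by rewrite -/(root _ y) root_prod_XsubC ys andbF.
have R0 : 0 < Rr by apply: le_lt_trans xR; exact: nm_ge0.
rewrite -nm_prod; under eq_bigr do rewrite fE.
rewrite big_split /= prodr_const card_ord fE !nmM nmX exprMn -mulrA.
rewrite ler_wpM2l ?exprn_ge0 ?nm_ge0 // exchange_big /= !nm_prod -sr.
rewrite -prodrXl -prod_const_seq -big_split /= big_seq [leRHS]big_seq.
apply: ler_prod => y ys; rewrite nm_ge0 /=.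
under eq_bigr do rewrite [z + _]addrC -addrA -[z - y]opprB.
rewrite prod_prim // nmM nmX nmN nm1 expr1n mul1r (le_trans (nmBD _ _)) // !nmX.
rewrite [nm (z - y)]nmB; have h := sR _ ys.
rewrite mulrDr mulr1 addrC lerD2l expr_div_n mulrA mulrAC -expr_div_n ler_peMl ?exprn_ge0 ?nm_ge0 //.
by rewrite exprn_ege1 // ler_pdivlMr // mul1r.
Qed.

(** The average of [g.[r u ^+ k] u ^+ (- k)] over the powers of a primitive [N]-th root of unity
    isolates the coefficient of degree 1, because [N] exceeds the size of [g]; the exponent
    [k * N.-1] stands for [- k]. *)
Lemma poly_cauchy f z (r M : R) : 0 < r ->
  (forall x, nm (x - z) = r -> nm f.[x] <= M) -> nm (f^`()).[z] * r <= M.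
Proof.
move=> r0 hM; have [w hw] := cube_root_exists; have [w3 w1 _] := cube3 hw.
pose g := f \Po ('X + z%:P).
have g1 : (f^`()).[z] = g`_1.
  have -> : g`_1 = (g^`()).[0] by rewrite horner_coef0 coef_deriv mulr1n.
  by rewrite /g deriv_comp hornerM horner_comp !hornerE derivD derivX derivC addr0 hornerC mulr1.
pose n := size g; pose N := (3 ^ n.+1)%N.
have nN : (n.+1 < N)%N by exact: ltn_expl.
have [u [u1 un _]] := small_root n hw; have uN := prim_small hw un.
have key : \sum_(k < N) g.[rc r * u ^+ k] * u ^+ (k * N.-1) = N%:R * (rc r * g`_1).
  under eq_bigr do rewrite (@horner_coef_wide _ N) ?(leq_trans _ (ltnW nN)) // mulr_suml.
  rewrite exchange_big /=.
  have i1 : (1 < N)%N by exact: leq_trans nN.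
  rewrite (bigD1 (Ordinal i1)) //= [X in _ + X]big1 => [|i ni].
    rewrite addr0 (eq_bigr (fun=> rc r * g`_1)); last first.
      move=> k _; have uk : u ^+ k * u ^+ (k * N.-1) = 1.
        by rewrite -exprD -{1}[nat_of_ord k]muln1 -mulnDr add1n prednK ?(ltnW i1) // mulnC exprM (prim_expr_order uN) expr1n.
      by rewrite -[RHS]mulr1 -uk expr1 -!mulrA mulrCA.
    by rewrite sumr_const card_ord mulr_natl.
  transitivity (g`_i * rc r ^+ i * \sum_(k < N) u ^+ (k * (i + N.-1))).
    rewrite mulr_sumr; apply: eq_bigr => k _.
    by rewrite exprMn -exprM !mulrA -!mulrA; do 2 congr (_ * _); rewrite mulnDr exprD.
  rewrite (sum_prim uN) ?mulr0 //; apply/negP; have iN := ltn_ord i.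
  have -> : (i + N.-1 = i + N - 1)%N by lia.
  have i1' : (nat_of_ord i != 1)%N by apply: contra ni => /eqP e; apply/eqP/val_inj.
  case: (nat_of_ord i) iN i1' => [|[//|j]] jN _.
    by rewrite add0n => /dvdn_leq; lia.
  have -> : (j.+2 + N - 1 = j.+1 + N)%N by lia.
  by rewrite dvdn_addl ?dvdnn // => /dvdn_leq; lia.
have : nm (N%:R * (rc r * g`_1)) <= N%:R * M.
  rewrite -key (le_trans (nm_sum _ _ _)) // -[N in leRHS]card_ord -sumr_const mulr_suml.
  apply: ler_sum => k _; rewrite nmM nmX u1 expr1n mulr1 mul1r.
  rewrite /g horner_comp !hornerE hM // addrK nmM nm_rc nmX u1 expr1n mulr1.
  by rewrite gtr0_norm.
rewrite !nmM nm_nat nm_rc gtr0_norm // ler_pM2l ?ltr0n ?expn_gt0 // g1.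
by rewrite mulrC.
Qed.

Definition itp q n : {poly C} := iter n (fun r => q \Po r) 'X.
Definition it q n x : C := iter n (horner q) x.

Lemma itpE q n x : (itp q n).[x] = it q n x.
Proof. by elim: n => [|n ih]; rewrite /= ?hornerX // horner_comp ih. Qed.
Lemma itS q n x : it q n.+1 x = q.[it q n x]. Proof. by []. Qed.
Lemma itSr q n x : it q n.+1 x = it q n q.[x]. Proof. exact: iterSr. Qed.
Lemma itD q m n x : it q (m + n) x = it q m (it q n x). Proof. exact: iterD. Qed.
Lemma itM q m n x : it q (n * m) x = iter n (it q m) x.
Proof. by elim: n => // n ih; rewrite mulSn itD ih. Qed.
Lemma itp_it q m n : itp (itp q m) n = itp q (n * m).
Proof.
apply/eqP; rewrite -subr_eq0; apply/eqP.
elim: n => [|n ih]; first by rewrite /= subrr.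
have cD a b : itp q (a + b) = itp q a \Po itp q b.
  by elim: a => [|a iha]; rewrite ?comp_polyX //= iha comp_polyA.
apply/eqP; rewrite subr_eq0; rewrite mulSn cD /=.
by have /eqP := ih; rewrite subr_eq0 => /eqP ->.
Qed.
Lemma itp_deriv q n x : (itp q n)^`().[x] = \prod_(j < n) q^`().[it q j x].
Proof.
elim: n => [|n ih]; first by rewrite /= derivX hornerC big_ord0.
by rewrite big_ord_recr /= deriv_comp hornerM horner_comp ih itpE mulrC.
Qed.
Lemma size_itp q d n : size q = d.+2 -> size (itp q n) = (d.+1 ^ n).+1.
Proof.
move=> sq; elim: n => [|n ih]; first by rewrite size_polyX.
have := size_comp_poly q (itp q n); rewrite sq ih /= => h.
have : size (q \Po itp q n) != 0.
  rewrite size_poly_eq0 comp_poly_eq0 ?ih ?ltnS ?expn_gt0 //.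
  by rewrite -size_poly_eq0 sq.
by rewrite expnS -h; case: (size _).
Qed.
End Polys.

(** * Escape to infinity, and preimages near the Julia set *)

Section Dynamics.
Variable R : realType.
Local Notation C := (Cplx R).
Implicit Types (f q : {poly C}) (x y z : C).

Lemma expr_near1 (e : R) N : 0 < e -> exists2 g : R, 1 < g & g ^+ N <= 1 + e.
Proof.
move=> e0; have M0 : 0 < 2 ^+ N :> R by rewrite exprn_gt0.
have h2 (c : R) : 1 <= c <= 2 -> c ^+ N <= 1 + (2 ^+ N - 1) * (c - 1).
  move=> /andP[c1 c2]; elim: (N) => [|k ih]; first by rewrite !expr0; lra.
  rewrite !exprS; have : 1 <= 2 ^+ k :> R by apply: exprn_ege1; lra.
  set P := 2 ^+ k in ih * => P1.
  have : c * c ^+ k <= c * (1 + (P - 1) * (c - 1)) by rewrite ler_wpM2l //; lra.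
  have : 0 <= (P - 1) * (c - 1) * (2 - c) by rewrite !mulr_ge0 //; lra.
  lra.
exists (1 + Num.min 1 (e / 2 ^+ N)).
  by rewrite ltrDl lt_min ltr01 divr_gt0.
have m0 : 0 <= Num.min 1 (e / 2 ^+ N) by rewrite le_min ler01 divr_ge0 ?ltW.
have m1 : Num.min 1 (e / 2 ^+ N) <= 1 by rewrite ge_min lexx.
have m2 : Num.min 1 (e / 2 ^+ N) <= e / 2 ^+ N by rewrite ge_min lexx orbT.
rewrite (le_trans (h2 _ _)) //; first by apply/andP; split; lra.
move: m2; rewrite ler_pdivlMr //; lra.
Qed.

Lemma nm_horner_le f (M : R) : exists2 B, 0 <= B & forall x, nm x <= M -> nm f.[x] <= B.
Proof.
exists (\sum_(i < size f) nm f`_i * `|M| ^+ i).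
  by apply: sumr_ge0 => i _; rewrite mulr_ge0 ?nm_ge0 ?exprn_ge0.
move=> x xM; rewrite horner_coef (le_trans (nm_sum _ _ _)) //.
apply: ler_sum => i _; rewrite nmM nmX ler_wpM2l ?nm_ge0 // lerXn2r ?nnegrE ?nm_ge0 //.
by rewrite (le_trans xM) ?ler_norm.
Qed.

Lemma poly_quad f (M : R) : exists2 B, 0 < B & forall x y, nm x <= M -> nm y <= M ->
  nm (f.[y] - f.[x] - (f^`()).[x] * (y - x)) <= B * nm (y - x) ^+ 2.
Proof.
elim/poly_ind: f => [|f c [B B0 h]].
  exists 1 => // x y _ _; rewrite deriv0 !horner0 mul0r !subr0 nm0 mul1r.
  by rewrite exprn_ge0 ?nm_ge0.
have [D D0 hD] := nm_horner_le f^`() M.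
exists (B * `|M| + D + 1); first by rewrite ltr_wpDl // addr_ge0 // mulr_ge0 // ltW.
move=> x y xM yM.
have -> : (f * 'X + c%:P).[y] - (f * 'X + c%:P).[x] - ((f * 'X + c%:P)^`()).[x] * (y - x) =
   (f.[y] - f.[x] - (f^`()).[x] * (y - x)) * y + (f^`()).[x] * (y - x) ^+ 2.
  by rewrite derivD derivC derivM derivX addr0 mulr1 !hornerD !hornerM !hornerX !hornerC; ring.
rewrite (le_trans (nmD _ _)) // (nmM _ y) (nmM f^`().[x]) nmX.
have h1 := h _ _ xM yM; have h2 := hD _ xM; have := nm_ge0 (y - x).
set d := nm (y - x) in h1 *; move=> d0.
have d2 : 0 <= d ^+ 2 by exact: exprn_ge0.
have yM' : nm y <= `|M| by rewrite (le_trans yM) ?ler_norm.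
have : nm (f.[y] - f.[x] - (f^`()).[x] * (y - x)) * nm y <= B * d ^+ 2 * `|M|.
  by apply: ler_pM; rewrite ?nm_ge0.
have : nm (f^`()).[x] * d ^+ 2 <= D * d ^+ 2 by rewrite ler_wpM2r.
by rewrite !mulrDl mul1r; lra.
Qed.

Lemma poly_lip f (M : R) : exists2 B, 0 < B & forall x y, nm x <= M -> nm y <= M ->
  nm (f.[y] - f.[x]) <= B * nm (y - x).
Proof.
have [B B0 h] := poly_quad f M; have [D D0 hD] := nm_horner_le f^`() M.
exists (B * (2 * `|M|) + D + 1) => [|x y xM yM].
  by rewrite ltr_wpDl // addr_ge0 ?mulr_ge0 // ltW.
have := h _ _ xM yM; have := hD _ xM; have d0 := nm_ge0 (y - x).
have : nm (y - x) <= 2 * `|M|.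
  by have := nmBD y x; have := ler_norm M; lra.
set d := nm (y - x) in d0 *; move=> hd h1 h2.
have -> : f.[y] - f.[x] = (f.[y] - f.[x] - f^`().[x] * (y - x)) + f^`().[x] * (y - x) by ring.
rewrite (le_trans (nmD _ _)) // nmM -/d.
have : B * d ^+ 2 <= B * (2 * `|M|) * d by rewrite expr2 mulrA ler_wpM2r // ler_wpM2l // ltW.
have : nm f^`().[x] * d <= D * d by rewrite ler_wpM2r.
by rewrite !mulrDl mul1r; lra.
Qed.

(** In the unit [c] the map grows at least like a pure power, a form that iterates without loss.
    [Rd] makes the lower-order terms at most half of the leading one, and [c <= b / 2] with [c <= 1]
    absorbs the remaining coefficient [b / 2]. The constants depend only on the degree and on the
    bounds [b] and [B], hence serve a whole family. *)
Lemma escape_growth (b B : R) d : (0 < d)%N -> 0 < b ->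
  exists Rd c : R, [/\ 1 <= Rd, 0 < c, 2 <= c * Rd & forall q, size q = d.+2 ->
    b <= nm (lead_coef q) -> (forall i, nm q`_i <= B) -> forall x, Rd <= nm x ->
    (c * nm x) ^+ d.+1 <= c * nm q.[x] /\ 2 * nm x <= nm q.[x]].
Proof.
move=> d0 b0; pose c := Num.min 1 (b / 2).
have c0 : 0 < c by rewrite lt_min ltr01 divr_gt0.
have c1 : c <= 1 by rewrite ge_min lexx.
have c2 : c <= b / 2 by rewrite ge_min lexx orbT.
pose Rd := 1 + 2 / c + 2 * (`|B| * d.+1%:R) / b.
have cR : 2 <= c * Rd.
  have e : c * Rd = c + 2 + c * (2 * (`|B| * d.+1%:R) / b) by rewrite /Rd; field; lra.
  by rewrite e; have : 0 <= c * (2 * (`|B| * d.+1%:R) / b) by [rewrite !mulr_ge0 ?invr_ge0 ?ler0n // ltW]; lra.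
have R1 : 1 <= Rd.
  have : 0 <= 2 / c by rewrite divr_ge0 // ltW.
  have : 0 <= 2 * (`|B| * d.+1%:R) / b by rewrite !mulr_ge0 ?invr_ge0 ?ler0n // ltW.
  by rewrite /Rd; lra.
exists Rd, c; split=> // q sq bq qB x xR.
have x1 : 1 <= nm x by lra.
have low : b / 2 * nm x ^+ d.+1 <= nm q.[x].
  rewrite horner_coef sq big_ord_recr /=.
  have hs : nm (\sum_(i < d.+1) q`_i * x ^+ i) <= `|B| * d.+1%:R * nm x ^+ d.
    rewrite (le_trans (nm_sum _ _ _)) // (le_trans (_ : _ <= \sum_(i < d.+1) `|B| * nm x ^+ d)) //.
      apply: ler_sum => i _; rewrite nmM nmX ler_pM ?nm_ge0 ?exprn_ge0 ?nm_ge0 //.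
        by rewrite (le_trans (qB _)) ?ler_norm.
      by rewrite ler_weXn2l // -ltnS.
    by rewrite sumr_const card_ord -mulr_natr le_eqVlt; apply/orP; left; apply/eqP; ring.
  have hl : b * nm x ^+ d.+1 <= nm (q`_d.+1 * x ^+ d.+1).
    by rewrite nmM nmX ler_wpM2r ?exprn_ge0 ?nm_ge0 // (le_trans bq) // lead_coefE sq.
  have : `|B| * d.+1%:R * nm x ^+ d <= b / 2 * nm x ^+ d.+1.
    rewrite exprS mulrA ler_wpM2r ?exprn_ge0 ?nm_ge0 //.
    have : 2 * (`|B| * d.+1%:R) / b <= nm x.
      by have : 0 <= 2 / c by [rewrite divr_ge0 // ltW]; move: xR; rewrite /Rd; lra.
    by rewrite ler_pdivrMr //; lra.
  by rewrite addrC; have := nm_loD (q`_d.+1 * x ^+ d.+1) (\sum_(i < d.+1) q`_i * x ^+ i); lra.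
have low2 : (c * nm x) ^+ d.+1 <= c * nm q.[x].
  rewrite exprMn exprS -mulrA ler_wpM2l // ?(ltW c0) //; apply: le_trans low.
  rewrite ler_wpM2r ?exprn_ge0 ?nm_ge0 //; apply: le_trans c2.
  by case: (d) d0 => // k _; rewrite exprS ler_piMr ?(ltW c0) // exprn_ile1 // ltW.
split=> //; rewrite -(ler_pM2l c0); apply: le_trans low2.
have cx : 2 <= c * nm x by apply: le_trans cR _; rewrite ler_wpM2l // ltW.
rewrite exprS mulrCA mulrC ler_wpM2l //; first by lra.
by case: (d) d0 => // k _; rewrite exprS (le_trans cx) // ler_peMr ?exprn_ege1 //; lra.
Qed.

Lemma escape_radius q d : (0 < d)%N -> size q = d.+2 ->
  exists Rd c : R, [/\ 1 <= Rd, 0 < c, 2 <= c * Rd & forall x, Rd <= nm x ->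
    (c * nm x) ^+ d.+1 <= c * nm q.[x] /\ 2 * nm x <= nm q.[x]].
Proof.
move=> d0 sq; have l0 : 0 < nm (lead_coef q).
  by rewrite nm_gt0 lead_coef_eq0 -size_poly_eq0 sq.
have [Rd [c [h1 h2 h3 h4]]] := escape_growth (\sum_(i < d.+2) nm q`_i) d0 l0.
exists Rd, c; split=> // x; apply: h4 => // i.
case: (ltnP i d.+2) => [id|]; last first.
  by move=> id; rewrite nth_default ?sq // nm0 sumr_ge0 // => j _; exact: nm_ge0.
by rewrite (bigD1 (Ordinal id)) //= lerDl sumr_ge0 // => j _; exact: nm_ge0.
Qed.

Definition bounded_orbit q x := exists M : R, forall n, nm (it q n x) <= M.

Lemma bounded_orbitP q (Rd : R) x : 1 <= Rd -> (forall x, Rd <= nm x -> 2 * nm x <= nm q.[x]) ->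
  bounded_orbit q x <-> forall n, nm (it q n x) <= Rd.
Proof.
move=> R1 h; split=> [[M hM] n|]; last by exists Rd.
rewrite leNgt; apply/negP => hn.
have key k : 2 ^+ k * Rd <= nm (it q (k + n) x).
  elim: k => [|k ih]; first by rewrite expr0 mul1r ltW.
  have R2 : Rd <= nm (it q (k + n) x).
    by apply: le_trans ih; rewrite ler_peMl ?exprn_ege1 //; lra.
  by rewrite addSn itS (le_trans _ (h _ R2)) // exprS -mulrA ler_wpM2l.
have [k /(_ k (leqnn _)) hk] := @pow_large R 2 M (ltac:(lra)).
by have := hM (k + n)%N; have := key k; have : 2 ^+ k <= 2 ^+ k * Rd by [rewrite ler_peMr ?exprn_ge0]; lra.
Qed.

Lemma escape_fast q d x : (0 < d)%N -> size q = d.+2 -> ~ bounded_orbit q x ->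
  exists (G : R) n0, 1 < G /\ forall n, (n0 <= n)%N -> G ^+ (d.+1 ^ n) <= nm (it q n x).
Proof.
move=> d0 sq nb; have [Rd [c [R1 c0 cR h]]] := escape_radius d0 sq.
have [k hk] : exists k, Rd < nm (it q k x).
  apply: contrapT => hn; apply: nb; exists Rd => n; rewrite leNgt; apply/negP => hh.
  by apply: hn; exists n.
have grow n : 2 ^+ (d.+1 ^ n) <= c * nm (it q (n + k) x) /\ Rd <= nm (it q (n + k) x).
  elim: n => [|n [ih1 ih2]].
    rewrite expn0 expr1; split; last exact: ltW.
    by rewrite (le_trans cR) // ler_wpM2l // ltW.
  have [h1 h2] := h _ ih2; rewrite addSn itS; split; last by have := nm_ge0 (it q (n + k) x); lra.
  apply: le_trans h1; rewrite expnS mulnC exprM lerXn2r ?nnegrE ?exprn_ge0 //.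
  by rewrite mulr_ge0 ?nm_ge0 // ltW.
(* Split 2 as [4 / 3] times [3 / 2]: the powers of [4 / 3] absorb [c], and [g] with
   [g ^+ (d.+1 ^ k) <= 3 / 2] absorbs the delay [k]. *)
have [g g1 hg] := @expr_near1 (2^-1) (d.+1 ^ k) (ltac:(lra)).
have [n1 hn1] := @pow_large R (4 / 3) c (ltac:(lra)).
exists g, (n1 + k)%N; split=> // n nk.
have [m em] : exists m, n = (m + k)%N by exists (n - k)%N; lia.
have mn : (n1 <= d.+1 ^ m)%N by rewrite (leq_trans _ (ltnW (ltn_expl _ _))) //; lia.
have [h1 _] := grow m; rewrite em -(ler_pM2l c0); apply: le_trans h1.
rewrite expnD mulnC exprM; have := hn1 _ mn => hc.
apply: (@le_trans _ _ ((4 / 3) ^+ (d.+1 ^ m) * (1 + 2^-1) ^+ (d.+1 ^ m))).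
  apply: ler_pM; rewrite ?exprn_ge0 ?(ltW c0) ?(ltW hc) //; try lra.
  by rewrite lerXn2r ?nnegrE ?exprn_ge0 //; lra.
by rewrite -exprMn (_ : 4 / 3 * (1 + 2^-1) = 2 :> R) //; lra.
Qed.

Lemma nat_ub4 a b c e : exists n, [/\ a <= n, b <= n, c <= n & e <= n]%N.
Proof. by exists (a + b + c + e)%N; split; lia. Qed.

(* Zeros of [q^n - tau] in a disc meeting the Julia set: a zero-free [q^n - tau] would have
   its mean over a circle through an escaping point controlled by its value at the centre. *)
Lemma hit q d (tau : {poly C}) z x0 (Rr : R) : (0 < d)%N -> size q = d.+2 -> (size tau <= 2)%N ->
  bounded_orbit q z -> ~ bounded_orbit q x0 -> nm (x0 - z) < Rr ->
  (forall y, nm (y - z) < Rr -> forall i, it q i.+1 tau.[y] != tau.[y]) ->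
  exists n y, [/\ nm (y - z) < Rr & it q n.+1 y = tau.[y]].
Proof.
move=> d0 sq st [M hM] nb xR np; apply: contrapT => nh.
have [G [n0 [G1 hG]]] := escape_fast d0 sq nb.
have [w hw] := cube_root_exists R; set r := nm (x0 - z) in xR.
have r0 : 0 <= r := nm_ge0 _; have R0 : 0 < Rr by lra.
(* One factor [G'] pays for the right-hand side of [circle_product] and one for the threshold of the
   bad points, since [g ^+ N <= G']; what remains of [G] still exceeds 1, and its powers beat the
   constants. *)
have [G' [G'1 hG']] : exists G' : R, 1 < G' /\ G' ^+ 4 <= G.
  by have [g g1 hg] := @expr_near1 (G - 1) 4 (ltac:(lra)); exists g; split=> //; move: hg; lra.
have [n1 hn1] := @pow_small R (r / Rr) (G' - 1) (ltac:(by rewrite divr_ge0 ?(ltW R0) // ltr_pdivrMr // mul1r)) (ltac:(lra)).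
have [N [u [N0 uN u1 kap]]] : exists N (u : C), [/\ (0 < N)%N, N.-primitive_root u, nm u = 1 & 1 + (r / Rr) ^+ N <= G'].
  have [u [u1 un _]] := small_root n1 hw; have uN := prim_small hw un.
  exists (3 ^ n1.+1)%N, u; split=> //; first by rewrite expn_gt0.
  by have := hn1 _ (ltnW (ltnW (ltn_expl n1.+1 (isT : 1 < 3)%N))); lra.
have [g g1 hg] := @expr_near1 (G' - 1) N (ltac:(lra)).
pose X (k : 'I_N) := z + (x0 - z) * u ^+ k.
have XR k : nm (X k - z) < Rr by rewrite /X addrC addKr nmM nmX u1 expr1n mulr1.
pose f n := itp q n.+1 - tau.
have fE n x : (f n).[x] = it q n.+1 x - tau.[x] by rewrite hornerD hornerN itpE.
have sf n : size (f n) = (d.+1 ^ n.+1).+1.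
  rewrite /f size_polyDl (size_itp _ sq) // size_polyN.
  by rewrite ltnS (leq_trans st) // expnS (leq_trans _ (leq_pmulr _ _)) // expn_gt0.
(* return times: two bad times for the same sample point make [tau] almost periodic there *)
have [del del0 hdel] : exists2 del : R, 0 < del & forall k i, (i < N)%N -> del <= nm (it q i.+1 tau.[X k] - tau.[X k]).
  exists (\big[Num.min/1]_(k < N) \big[Num.min/1]_(i < N) nm (it q i.+1 tau.[X k] - tau.[X k])).
    apply/bigmin_gtP; split=> // k _; apply/bigmin_gtP; split=> // i _.
    by rewrite nm_gt0 subr_eq0 np.
  move=> k i iN; apply: (bigmin_inf k) => //.
  exact: (bigmin_inf (Ordinal iN)).
have [T hT] : exists T, forall k, nm tau.[X k] <= T.
  exists (\big[Num.max/0]_(k < N) nm tau.[X k]) => k; exact: le_bigmax.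
have [L hL0 hL] : exists2 L : R, 0 < L & forall i, (i < N)%N -> forall x y, nm x <= T + 1 -> nm y <= T + 1 ->
    nm (it q i.+1 y - it q i.+1 x) <= L * nm (y - x).
  elim: (N) => [|m [L L0 ih]]; first by exists 1.
  have [B B0 hB] := poly_lip (itp q m.+1) (T + 1).
  exists (L + B) => [|i]; first lra.
  rewrite ltnS leq_eqVlt => /orP[/eqP->|im] x y hx hy.
    have := hB x y hx hy; rewrite !itpE => h; apply: le_trans h _.
    by rewrite ler_wpM2r ?nm_ge0 //; lra.
  by apply: le_trans (ih _ im _ _ hx hy) _; rewrite ler_wpM2r ?nm_ge0 //; lra.
have g0 : 0 <= g^-1 < 1 by rewrite invr_ge0 (le_trans _ (ltW g1)) ?ler01 //= invf_lt1 //; lra.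
have [n2 hn2] := @pow_small R g^-1 (Num.min 1 (del / (L + 1) / 2)) g0
  (ltac:(by rewrite lt_min ltr01 !divr_gt0 //; lra)).
have GG : 1 < G / (G' * G') by rewrite ltr_pdivlMr ?mul1r; [move: hG'; rewrite !exprS expr0; nra|nra].
have [n3 hn3] := @pow_large R _ (2 * (M + nm tau.[z]) ^+ N) GG.
have [n4 hn4] := @pow_large R G (2 * nm tau.[x0]) G1.
have [n5 [n05 n25 n35 n45]] := nat_ub4 n0 n2 n3 n4.
pose bad n (k : 'I_N) := nm (f n).[X k] < g^-1 ^+ (d.+1 ^ n.+1).
have lexp n : (n <= d.+1 ^ n.+1)%N by rewrite (leq_trans _ (ltnW (ltn_expl n.+1 _))).
have ge0t n : 0 <= g^-1 ^+ n by rewrite exprn_ge0 //; case/andP: g0.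
have once n n' k : (n5 <= n)%N -> (n < n')%N -> (n' <= n + N)%N -> bad n k -> bad n' k -> False.
  move=> nn nn' n'N b1 b2.
  have nn5 := leq_trans nn (ltnW nn').
  have e1 := hn2 _ (leq_trans (leq_trans n25 nn) (lexp n)).
  have e2 := hn2 _ (leq_trans (leq_trans n25 nn5) (lexp n')).
  have := lt_trans b1 e1; have := lt_trans b2 e2; rewrite !fE.
  rewrite !lt_min => /andP[_ h2] /andP[h1 h3].
  have en : it q n'.+1 (X k) = it q (n' - n.+1).+1 (it q n.+1 (X k)).
    by rewrite -itD; congr (it q _ _); rewrite subnSK // addnS subnK // ltnW.
  have i1 : (n' - n.+1 < N)%N by rewrite subnSK // leq_subLR.
  have hd := hdel k _ i1.
  have := hL _ i1 tau.[X k] (it q n.+1 (X k)).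
  have hT1 : nm tau.[X k] <= T + 1 by rewrite (le_trans (hT k)) // lerDl.
  move=> /(_ hT1) hl.
  have h4 : nm (it q n.+1 (X k)) <= T + 1.
    by have := nm_lo (it q n.+1 (X k)) tau.[X k]; have := hT k; lra.
  have := hl h4; rewrite -en => h5.
  have := nm_tri (it q n'.+1 (X k)) (it q (n' - n.+1).+1 tau.[X k]) tau.[X k].
  rewrite [X in _ <= X + _]nmB => h6.
  have L1 : 0 < L + 1 by lra.
  have : L * nm (it q n.+1 (X k) - tau.[X k]) <= L * (del / (L + 1) / 2).
    by rewrite ler_wpM2l ?ltW.
  have : del / (L + 1) / 2 * (L + 1) = del / 2 by rewrite mulrAC divfK ?gt_eqF.
  lra.
(* If every sample point other than [x0] were good, the product over the circle, with the escaping
   factor at [x0], would exceed the bound that [circle_product] gives for a zero-free polynomial. *)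
have key n : (n5 <= n)%N -> exists k : 'I_N, bad n k /\ k != Ordinal N0.
  move=> nn; apply: contrapT => hno.
  have good k : k != Ordinal N0 -> g^-1 ^+ (d.+1 ^ n.+1) <= nm (f n).[X k].
    by move=> k0; rewrite leNgt; apply/negP => hh; apply: hno; exists k.
  have nz y : nm (y - z) < Rr -> (f n).[y] != 0.
    move=> yR; apply/eqP; rewrite fE => /eqP; rewrite subr_eq0 => /eqP e.
    by apply: nh; exists n, y.
  have := @circle_product R (f n) z x0 N Rr u uN; rewrite sf => /(_ (ltac:(by rewrite ltnS expn_gt0)) xR nz).
  rewrite -/r /= (bigD1 (Ordinal N0)) //= expr0 mulr1 addrC subrK.
  set D := (d.+1 ^ n.+1)%N.
  have h1 : 2^-1 * G ^+ D <= nm (f n).[x0].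
    rewrite fE; have := hG n.+1 (leq_trans n05 (leq_trans nn (leqnSn _))); rewrite -/D.
    have := hn4 D (leq_trans (leq_trans n45 nn) (lexp n)).
    by have := nm_lo (it q n.+1 x0) tau.[x0]; lra.
  have h2 : (g^-1 ^+ D) ^+ N <= \prod_(k < N | k != Ordinal N0) nm (f n).[z + (x0 - z) * u ^+ k].
    apply: le_trans (_ : \prod_(k < N | k != Ordinal N0) (g^-1 ^+ D) <= _); last first.
      by apply: ler_prod => k k0; rewrite ge0t /= good.
    rewrite prodr_const; set m := #|_|.
    have mN : (m <= N)%N by rewrite /m (leq_trans (max_card _)) // card_ord.
    apply: ler_wiXn2l => //; rewrite exprn_ile1 //; first by case/andP: g0.
    by case/andP: g0 => _ /ltW.
  have h3 : nm (f n).[z] ^+ N <= (M + nm tau.[z]) ^+ N.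
    rewrite lerXn2r ?nnegrE ?nm_ge0 ?fE //; first by rewrite addr_ge0 ?nm_ge0 // (le_trans _ (hM 0%N)) ?nm_ge0.
    by rewrite (le_trans (nmBD _ _)) // lerD2r hM.
  have h4 : (1 + (r / Rr) ^+ N) ^+ D <= G' ^+ D.
    by rewrite lerXn2r ?nnegrE //; [rewrite addr_ge0 ?exprn_ge0 // divr_ge0 // ltW|lra].
  move=> h5; have : 2^-1 * G ^+ D * (g^-1 ^+ D) ^+ N <= (M + nm tau.[z]) ^+ N * G' ^+ D.
    apply: le_trans (le_trans h5 _).
      by apply: ler_pM; rewrite ?mulr_ge0 ?invr_ge0 ?exprn_ge0 //; lra.
    by apply: ler_pM; rewrite ?exprn_ge0 ?nm_ge0 // addr_ge0 ?exprn_ge0 // divr_ge0 // ltW.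
  have gN : G'^-1 ^+ D <= (g^-1 ^+ D) ^+ N.
    rewrite -!exprM mulnC exprM lerXn2r ?nnegrE ?invr_ge0 ?exprn_ge0 //; try (by case/andP: g0); first lra.
    by rewrite exprVn lef_pV2 ?posrE ?exprn_gt0 //; lra.
  have := hn3 D (leq_trans (leq_trans n35 nn) (lexp n)); rewrite expr_div_n exprMn.
  have G'D : 0 < G' ^+ D by rewrite exprn_gt0 //; lra.
  rewrite ltr_pdivlMr ?mulr_gt0 // => h6 h7.
  have : 2^-1 * G ^+ D * G'^-1 ^+ D <= (M + nm tau.[z]) ^+ N * G' ^+ D.
    by apply: le_trans h7; rewrite ler_wpM2l // mulr_ge0 ?exprn_ge0 //; lra.
  by rewrite exprVn ler_pdivrMr //; lra.
(* By [once], [N] consecutive times have [N] distinct bad points, none of them the sample point of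
   index 0: too many for [N] sample points. *)
have /choice [kk hk] : forall j : 'I_N, exists k : 'I_N, bad (n5 + j)%N k /\ k != Ordinal N0.
  by move=> j; apply: key; rewrite leq_addr.
have kinj : injective kk.
  move=> j j' e; apply/val_inj/eqP; have [b1 _] := hk j; have [b2 _] := hk j'; rewrite -e in b2.
  case: (ltngtP j j') => // h; exfalso.
    apply: (once (n5 + j)%N (n5 + j')%N (kk j)) => //; rewrite ?leq_addr ?ltn_add2l // -addnA leq_add2l.
    by rewrite (leq_trans (ltnW (ltn_ord j'))) // leq_addl.
  apply: (once (n5 + j')%N (n5 + j)%N (kk j)) => //; rewrite ?leq_addr ?ltn_add2l // -addnA leq_add2l.
  by rewrite (leq_trans (ltnW (ltn_ord j))) // leq_addl.
have [j ej] : exists j, kk j = Ordinal N0.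
  by have /bij_inj : bijective kk by [exact: injF_bij]; have [g' _ hg'] := injF_bij kinj; exists (g' (Ordinal N0)).
by have [_] := hk j; rewrite ej eqxx.
Qed.
End Dynamics.

(** * Quantitative holomorphy and the Cauchy estimate *)

Section Quad.
Variable R : realType.
Local Notation C := (Cplx R).

(* [f] is holomorphic on [S] with derivative [l], quantitatively *)
Definition quad (V : normedModType R[i]) (S : set V) (f : V -> C) (l : V -> V -> C) (B : R) :=
  [/\ 0 <= B, forall w, S w -> nm (f w) <= B,
      forall w, S w -> forall h, nm (l w h) <= B * nm h,
      forall w, S w -> forall c h h', l w (c *: h + h') = c * l w h + l w h' &
      forall w w', S w -> S w' -> nm (f w' - f w) <= B * nm (w' - w) /\
        nm (f w' - f w - l w (w' - w)) <= B * nm (w' - w) ^+ 2].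
Definition qd (V : normedModType R[i]) (S : set V) (f : V -> C) := exists l B, quad S f l B.

Section Closure.
Variables (V : normedModType R[i]) (S : set V).
Implicit Types f g : V -> C.

Lemma quadW f l B B' : quad S f l B -> B <= B' -> quad S f l B'.
Proof.
case=> B0 h1 h2 h3 h4 BB; split=> //.
- by rewrite (le_trans B0).
- by move=> w /h1 h; rewrite (le_trans h).
- by move=> w /h2 h v; rewrite (le_trans (h v)) // ler_wpM2r ?nm_ge0.
- move=> w w' Sw Sw'; have [h5 h6] := h4 _ _ Sw Sw'.
  by split; [rewrite (le_trans h5)|rewrite (le_trans h6)] => //; rewrite ler_wpM2r ?exprn_ge0 ?nm_ge0.
Qed.

Lemma qd_cst (c : C) : qd S (fun=> c).
Proof.
exists (fun _ _ => 0), (nm c); split=> [|//|w _ h|w _ a h h'|w w' _ _]; first exact: nm_ge0.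
- by rewrite nm0 mulr_ge0 ?nm_ge0.
- by rewrite mulr0 addr0.
- by rewrite subrr subr0 nm0 !mulr_ge0 ?nm_ge0.
Qed.

Lemma qd_lin f (K M : R) : 0 <= K -> (forall c h h', f (c *: h + h') = c * f h + f h') ->
  (forall h, nm (f h) <= K * nm h) -> (forall w, S w -> nm w <= M) -> qd S f.
Proof.
move=> K0 fl fK SM; exists (fun _ => f), (K * (1 + `|M|)); split=> [|w Sw|w _ h|//|w w' _ _].
- by rewrite mulr_ge0 // addr_ge0.
- rewrite (le_trans (fK _)) // ler_wpM2l //.
  by rewrite (le_trans (SM _ Sw)) // (le_trans (ler_norm _)) // lerDr.
- by rewrite (le_trans (fK _)) // ler_wpM2r ?nm_ge0 // ler_peMr // lerDl.
- have fB : f (w' - w) = f w' - f w by rewrite [w' - w]addrC -scaleN1r fl mulN1r addrC.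
  rewrite fB subrr nm0 !mulr_ge0 ?exprn_ge0 ?nm_ge0 ?addr_ge0 //; split=> //.
  by rewrite -fB (le_trans (fK _)) // ler_wpM2r ?nm_ge0 // ler_peMr // lerDl.
Qed.

Lemma qd_add f g : qd S f -> qd S g -> qd S (fun w => f w + g w).
Proof.
case=> l [B [B0 h1 h2 h3 h4]] [l' [B' [B0' k1 k2 k3 k4]]].
exists (fun w h => l w h + l' w h), (B + B'); split=> [|w Sw|w Sw h|w Sw c h h'|w w' Sw Sw'].
- exact: addr_ge0.
- by rewrite (le_trans (nmD _ _)) // lerD ?h1 ?k1.
- by rewrite (le_trans (nmD _ _)) // mulrDl lerD ?h2 ?k2.
- by rewrite h3 // k3 //; ring.
- have [a1 a2] := h4 _ _ Sw Sw'; have [b1 b2] := k4 _ _ Sw Sw'; split.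
    have -> : f w' + g w' - (f w + g w) = (f w' - f w) + (g w' - g w) by ring.
    by rewrite (le_trans (nmD _ _)) // mulrDl lerD.
  have -> : f w' + g w' - (f w + g w) - (l w (w' - w) + l' w (w' - w)) =
    (f w' - f w - l w (w' - w)) + (g w' - g w - l' w (w' - w)) by ring.
  by rewrite (le_trans (nmD _ _)) // mulrDl lerD.
Qed.

Lemma qd_mul f g : qd S f -> qd S g -> qd S (fun w => f w * g w).
Proof.
case=> l [B1 q1] [l' [B2 q2]]; pose B := B1 + B2.
have [B10 B20] : 0 <= B1 /\ 0 <= B2 by case: q1; case: q2.
have [B0 h1 h2 h3 h4] : quad S f l B by apply: quadW q1 _; rewrite /B; lra.
have [_ k1 k2 k3 k4] : quad S g l' B by apply: quadW q2 _; rewrite /B; lra.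
have BB : 0 <= B * B by exact: mulr_ge0.
have t1 (a b : C) (x y : R) : nm a <= x -> nm b <= y -> nm (a * b) <= x * y.
  by move=> ha hb; rewrite nmM ler_pM ?nm_ge0.
exists (fun w h => f w * l' w h + g w * l w h), (3 * (B * B)).
split=> [|w Sw|w Sw h|w Sw c h h'|w w' Sw Sw'].
- lra.
- by have := t1 _ _ _ _ (h1 _ Sw) (k1 _ Sw); lra.
- rewrite (le_trans (nmD _ _)) //.
  have := t1 _ _ _ _ (h1 _ Sw) (k2 _ Sw h); have := t1 _ _ _ _ (k1 _ Sw) (h2 _ Sw h).
  have : 0 <= B * B * nm h by rewrite mulr_ge0 ?nm_ge0.
  by rewrite !mulrA; lra.
- by rewrite h3 // k3 //; ring.
- have [a1 a2] := h4 _ _ Sw Sw'; have [b1 b2] := k4 _ _ Sw Sw'.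
  have n0 := nm_ge0 (w' - w); set n := nm (w' - w) in a1 a2 b1 b2 n0 *; split.
    have -> : f w' * g w' - f w * g w = f w' * (g w' - g w) + g w * (f w' - f w) by ring.
    rewrite (le_trans (nmD _ _)) //.
    have := t1 _ _ _ _ (h1 _ Sw') b1; have := t1 _ _ _ _ (k1 _ Sw) a1.
    have : 0 <= B * B * n by exact: mulr_ge0.
    by rewrite !mulrA; lra.
  have -> : f w' * g w' - f w * g w - (f w * l' w (w' - w) + g w * l w (w' - w)) =
    (f w' - f w) * (g w' - g w) + f w * (g w' - g w - l' w (w' - w)) + g w * (f w' - f w - l w (w' - w)) by ring.
  rewrite (le_trans (nmD _ _)) // (le_trans (lerD (nmD _ _) (lexx _))) //.
  have := t1 _ _ _ _ a1 b1; have := t1 _ _ _ _ (h1 _ Sw) b2; have := t1 _ _ _ _ (k1 _ Sw) a2.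
  have -> : B * n * (B * n) = B * B * n ^+ 2 by ring.
  by rewrite !mulrA; lra.
Qed.

Lemma qd_ext f g : (forall w, f w = g w) -> qd S f -> qd S g.
Proof. by move=> /funext->. Qed.
Lemma qd_opp f : qd S f -> qd S (fun w => - f w).
Proof. by move=> h; apply: (qd_ext (f := fun w => -1 * f w)) => [w|]; [rewrite mulN1r|apply: qd_mul => //; exact: qd_cst]. Qed.
Lemma qd_sub f g : qd S f -> qd S g -> qd S (fun w => f w - g w).
Proof. by move=> hf hg; apply: qd_add => //; exact: qd_opp. Qed.
Lemma qd_exp f n : qd S f -> qd S (fun w => f w ^+ n).
Proof.
move=> h; elim: n => [|n ih]; first by apply: (qd_ext (f := fun=> 1)) => //; exact: qd_cst.
by apply: (qd_ext (f := fun w => f w * f w ^+ n)) => [w|]; [rewrite exprS|exact: qd_mul].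
Qed.
Lemma qd_sum (I : Type) (r : seq I) (F : I -> V -> C) : (forall i, qd S (F i)) ->
  qd S (fun w => \sum_(i <- r) F i w).
Proof.
move=> h; elim: r => [|i r ih]; first by apply: (qd_ext (f := fun=> 0)) => [w|]; [rewrite big_nil|exact: qd_cst].
by apply: (qd_ext (f := fun w => F i w + \sum_(i <- r) F i w)) => [w|]; [rewrite big_cons|exact: qd_add].
Qed.
End Closure.

Section MeanValue.
Variables (V : normedModType R[i]) (S : set V) (f : V -> C) (l : V -> V -> C) (B : R).
Hypothesis qf : quad S f l B.

(** Over [n + 1] equal pieces of the segment the quadratic remainders add up to [O(1 / n)]. *)
Lemma quad_mvt x y (L0 : C) (K : R) : (forall t : R, 0 <= t <= 1 -> S (x + rc t *: (y - x))) ->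
  (forall t : R, 0 <= t <= 1 -> nm (l (x + rc t *: (y - x)) (y - x) - L0) <= K) ->
  nm (f y - f x - L0) <= K.
Proof.
move=> hS hK; have [B0 _ _ hl hq] := qf; apply/ler_addgt0Pl => e e0.
have D0 := nm_ge0 (y - x); set D := nm (y - x) in D0.
have D1 : 0 < B * D ^+ 2 + 1 by rewrite ltr_wpDl // mulr_ge0 // exprn_ge0.
have [n /(_ n (leqnn _)) hn] := inv_small (divr_gt0 e0 D1).
pose p (i : nat) := x + rc (i%:R / n.+1%:R) *: (y - x).
have ht (i : nat) : (i <= n.+1)%N -> 0 <= (i%:R / n.+1%:R : R) <= 1.
  by move=> h; rewrite divr_ge0 ?ler0n //= ler_pdivrMr // mul1r ler_nat.
have stp (i : nat) : (i <= n)%N -> nm (f (p i.+1) - f (p i) - rc n.+1%:R^-1 * L0) <= n.+1%:R^-1 * K + B * (n.+1%:R^-1 * D) ^+ 2.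
  move=> hi; have e1 : p i.+1 - p i = rc n.+1%:R^-1 *: (y - x).
    rewrite /p opprD addrACA subrr add0r -scalerBl -rcN -rcD; congr (rc _ *: _).
    by rewrite -mulrBl -natr1 addrC addKr mul1r.
  have ni : 0 <= n.+1%:R^-1 :> R by rewrite invr_ge0 ltW.
  have [_ h2] := hq _ _ (hS _ (ht _ (leqW hi))) (hS _ (ht i.+1 hi)).
  rewrite -/(p i) -/(p i.+1) e1 nmZ nm_rc (ger0_norm ni) in h2.
  have e2 : l (p i) (rc n.+1%:R^-1 *: (y - x)) = rc n.+1%:R^-1 * l (p i) (y - x).
    have Sp := hS _ (ht _ (leqW hi)).
    have := hl _ Sp (rc n.+1%:R^-1) (y - x) 0; rewrite addr0 => ->.
    have := hl _ Sp 1 0 0; rewrite scaler0 addr0 mul1r => /eqP.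
    by rewrite -subr_eq subrr eq_sym => /eqP ->; rewrite addr0.
  rewrite e2 in h2; have h3 := hK _ (ht _ (leqW hi)); rewrite -/(p i) in h3.
  have -> : f (p i.+1) - f (p i) - rc n.+1%:R^-1 * L0 =
    (f (p i.+1) - f (p i) - rc n.+1%:R^-1 * l (p i) (y - x)) + rc n.+1%:R^-1 * (l (p i) (y - x) - L0) by ring.
  rewrite (le_trans (nmD _ _)) // addrC lerD //.
  by rewrite nmM nm_rc (ger0_norm ni) ler_wpM2l.
have tel m : (m <= n.+1)%N -> nm (f (p m) - f (p 0%N) - rc (m%:R / n.+1%:R) * L0) <= m%:R * (n.+1%:R^-1 * K + B * (n.+1%:R^-1 * D) ^+ 2).
  elim: m => [_|m ih hm]; first by rewrite mul0r rc0 !mul0r subrr subr0 nm0.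
  have -> : f (p m.+1) - f (p 0%N) - rc (m.+1%:R / n.+1%:R) * L0 =
    (f (p m) - f (p 0%N) - rc (m%:R / n.+1%:R) * L0) + (f (p m.+1) - f (p m) - rc n.+1%:R^-1 * L0).
    by rewrite -natr1 mulrDl mul1r rcD; ring.
  by rewrite (le_trans (nmD _ _)) // -[m.+1%:R]natr1 mulrDl mul1r lerD ?ih ?stp // ltnW.
have := tel _ (leqnn _).
rewrite divff ?gt_eqF // mul1r (_ : p n.+1 = y); last by rewrite /p divff ?gt_eqF // scale1r addrC subrK.
rewrite (_ : p 0%N = x); last by rewrite /p mul0r rc0 scale0r addr0.
rewrite mulrDr mulrA divff ?gt_eqF // mul1r => h; apply: le_trans h _.
rewrite addrC lerD2r exprMn; move: hn; rewrite ltr_pdivlMr //.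
rewrite (_ : n.+1%:R * (B * (n.+1%:R^-1 ^+ 2 * D ^+ 2)) = n.+1%:R^-1 * (B * D ^+ 2)); last by field; rewrite gt_eqF.
have : 0 < n.+1%:R^-1 :> R by rewrite invr_gt0.
by move=> a b; apply: le_trans (ltW b); rewrite mulrDr lerDl mulr1 ltW.
Qed.

Lemma quad_lip x y (K : R) : (forall t : R, 0 <= t <= 1 -> S (x + rc t *: (y - x))) ->
  (forall t : R, 0 <= t <= 1 -> nm (l (x + rc t *: (y - x)) (y - x)) <= K) -> nm (f y - f x) <= K.
Proof.
move=> hS hK; rewrite -[f y - f x]subr0; apply: quad_mvt => // t ht.
by rewrite subr0 hK.
Qed.
End MeanValue.

(* telescoping the increments along polygons inscribed in concentric circles *)
Lemma annulus_mean (g lam : C -> C) (B r1 r2 : R) (u : C) N n :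
  0 <= B -> 0 < r1 -> r1 <= r2 -> N.-primitive_root u -> nm u = 1 -> u != 1 ->
  (forall t t', r1 <= nm t <= r2 -> r1 <= nm t' <= r2 ->
     nm (g t' - g t - lam t * (t' - t)) <= B * nm (t' - t) ^+ 2) ->
  nm (\sum_(k < N) g (rc r2 * u ^+ k) - \sum_(k < N) g (rc r1 * u ^+ k)) <=
    N%:R * (B * (r2 - r1) * ((r2 - r1) / n.+1%:R + r2 * nm (u - 1))).
Proof.
move=> B0 r10 r12 uN u1 un1 hq; pose del := (r2 - r1) / n.+1%:R.
have n0 : (0 : R) < n.+1%:R by rewrite ltr0n.
have d0 : 0 <= del by apply: divr_ge0; [lra|rewrite ltW].
pose rho (j : nat) := r1 + j%:R * del.
have rhoR j : (j <= n.+1)%N -> r1 <= rho j <= r2.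
  move=> jn; rewrite /rho lerDl mulr_ge0 ?ler0n //= -lerBrDl /del mulrCA ler_piMr //; first lra.
  by rewrite ler_pdivrMr // mul1r ler_nat.
pose E := B * del ^+ 2 + B * del * r2 * nm (u - 1).
have rho0 j : (j <= n.+1)%N -> 0 < rho j by move=> /rhoR /andP[h _]; lra.
have nr j k : (j <= n.+1)%N -> nm (rc (rho j) * u ^+ k) = rho j.
  by move=> /rho0 h; rewrite nmM nmX u1 expr1n mulr1 nm_rc gtr0_norm.
have stp j : (j <= n)%N -> nm (\sum_(k < N) g (rc (rho j.+1) * u ^+ k) - \sum_(k < N) g (rc (rho j) * u ^+ k)) <= N%:R * E.
  move=> jn; have jn' := leqW jn; have rj0 : rc (rho j) != 0.
    by rewrite -nm_eq0 nm_rc gtr0_norm ?gt_eqF ?rho0.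
  have u10 : u - 1 != 0 by rewrite subr_eq0.
  (* [c] turns the tangential chord at [t] into the radial step. Subtracting [c] times the
     tangential increments, whose sum is zero, cancels the derivative and leaves only remainders of
     second order. *)
  pose c := rc del / (rc (rho j) * (u - 1)).
  have tel : \sum_(k < N) (g (rc (rho j) * u ^+ k.+1) - g (rc (rho j) * u ^+ k)) = 0.
    rewrite -(big_mkord xpredT (fun k => g (rc (rho j) * u ^+ k.+1) - g (rc (rho j) * u ^+ k))).
    by rewrite telescope_sumr // (prim_expr_order uN) expr0 subrr.
  rewrite -sumrB -[X in nm X]subr0 -{2}(mulr0 c) -{2}tel mulr_sumr -sumrB.
  rewrite (le_trans (nm_sum _ _ _)) // -[N in leRHS]card_ord -sumr_const mulr_suml.
  apply: ler_sum => k _; rewrite mul1r.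
  set t := rc (rho j) * u ^+ k.
  have nt : nm t = rho j by exact: nr.
  have e1 : rc (rho j.+1) * u ^+ k - t = rc del * u ^+ k.
    by rewrite /t -mulrBl -rcN -rcD; congr (rc _ * _); rewrite /rho -natr1; ring.
  have e2 : rc (rho j) * u ^+ k.+1 - t = t * (u - 1) by rewrite exprS /t; ring.
  have h1 := hq t (rc (rho j.+1) * u ^+ k) (ltac:(by rewrite nt rhoR)) (ltac:(by rewrite nr // rhoR)).
  have h2 := hq t (rc (rho j) * u ^+ k.+1) (ltac:(by rewrite nt rhoR)) (ltac:(by rewrite nr // rhoR)).
  rewrite e1 in h1; rewrite e2 in h2.
  have -> : g (rc (rho j.+1) * u ^+ k) - g t - c * (g (rc (rho j) * u ^+ k.+1) - g t) =
    (g (rc (rho j.+1) * u ^+ k) - g t - lam t * (rc del * u ^+ k)) -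
    c * (g (rc (rho j) * u ^+ k.+1) - g t - lam t * (t * (u - 1))).
    have ct : c * (t * (u - 1)) = rc del * u ^+ k by rewrite /c /t; field; rewrite u10 rj0.
    by rewrite -ct; ring.
  rewrite (le_trans (nmBD _ _)) // /E; apply: lerD.
    by rewrite (le_trans h1) // nmM nmX u1 expr1n mulr1 nm_rc ger0_norm.
  rewrite nmM; have nc0 : nm c = del / (rho j * nm (u - 1)).
    by rewrite /c nm_div nmM !nm_rc ger0_norm // gtr0_norm // rho0.
  have [ra rb] := andP (rhoR _ jn').
  have nu : 0 < nm (u - 1) by rewrite nm_gt0.
  apply: le_trans (ler_wpM2l (nm_ge0 c) h2) _; rewrite nc0 nmM nt.
  have -> : del / (rho j * nm (u - 1)) * (B * (rho j * nm (u - 1)) ^+ 2) = B * del * rho j * nm (u - 1).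
    by field; rewrite !gt_eqF ?rho0.
  by rewrite ler_wpM2r ?nm_ge0 // ler_wpM2l // mulr_ge0.
have all m : (m <= n.+1)%N -> nm (\sum_(k < N) g (rc (rho m) * u ^+ k) - \sum_(k < N) g (rc (rho 0%N) * u ^+ k)) <= m%:R * (N%:R * E).
  elim: m => [_|m ih hm]; first by rewrite subrr nm0 mul0r.
  rewrite (le_trans (nm_tri (\sum_(k < N) g (rc (rho m) * u ^+ k)) _ _)) // -natr1 mulrDl mul1r addrC.
  by rewrite lerD ?ih ?stp // ltnW.
have := all _ (leqnn _); rewrite {1}/rho (_ : r1 + n.+1%:R * del = r2); last by rewrite /del; field; rewrite gt_eqF.
rewrite /rho mul0r addr0 => h; apply: le_trans h _; rewrite mulrCA ler_wpM2l ?ler0n //.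
rewrite le_eqVlt; apply/orP; left; apply/eqP.
by rewrite /E -/del mulrDr; have -> : r2 - r1 = n.+1%:R * del by [rewrite /del; field; rewrite gt_eqF]; ring.
Qed.

(** The averages of [f t / t] over two circles are compared by [annulus_mean]. On the circle of
    radius [r] the average is at most [M / r]; on a small circle of radius [r1] it is [lam 0] up to
    [B * r1], because [f 0 / t] has average zero. *)
Lemma cauchy_estimate (f lam : C -> C) (B M r : R) : 0 < r -> 0 <= B ->
  (forall t, nm t <= r -> nm (lam t) <= B) -> (forall t, nm t <= r -> nm (f t) <= M) ->
  (forall t t', nm t <= r -> nm t' <= r -> nm (f t' - f t - lam t * (t' - t)) <= B * nm (t' - t) ^+ 2) ->
  nm (lam 0) * r <= M.
Proof.
move=> r0 B0 hl hM hq; rewrite -ler_pdivlMr //.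
have M0 : 0 <= M by apply: le_trans (hM 0 _); rewrite ?nm_ge0 // nm0 ltW.
apply/ler_addgt0Pl => e e0.
pose r1 := Num.min r (e / 2 / (B + 1)).
have B10 : 0 < B + 1 by lra.
have r10 : 0 < r1 by rewrite lt_min r0 !divr_gt0.
have r1r : r1 <= r by rewrite ge_min lexx.
have r1e : B * r1 <= e / 2.
  have : r1 <= e / 2 / (B + 1) by rewrite ge_min lexx orbT.
  by rewrite ler_pdivlMr //; lra.
pose g t := f t / t; pose mu t := lam t / t - f t / t ^+ 2.
pose B2 := B / r1 + M / r1 ^+ 3 + B / r1 ^+ 2.
have B20 : 0 <= B2 by rewrite !addr_ge0 // divr_ge0 // ?exprn_ge0 // ltW.
have hg t t' : r1 <= nm t <= r -> r1 <= nm t' <= r -> nm (g t' - g t - mu t * (t' - t)) <= B2 * nm (t' - t) ^+ 2.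
  move=> /andP[a1 a2] /andP[b1 b2].
  have t0 : t != 0 by rewrite -nm_gt0; lra.
  have t0' : t' != 0 by rewrite -nm_gt0; lra.
  have -> : g t' - g t - mu t * (t' - t) = (f t' - f t - lam t * (t' - t)) / t' +
     f t * (t' - t) ^+ 2 / (t ^+ 2 * t') - lam t * (t' - t) ^+ 2 / (t * t').
    by rewrite /g /mu; field; rewrite t0 t0'.
  have h1 := hq _ _ a2 b2; have d2 : 0 <= nm (t' - t) ^+ 2 by rewrite exprn_ge0 ?nm_ge0.
  rewrite (le_trans (nmBD _ _)) // (le_trans (lerD (nmD _ _) (lexx _))) // !nm_div.
  rewrite (nmM (f t)) (nmM (lam t)) (nmM (t ^+ 2) t') (nmM t t') nmX (nmX t 2) /B2 !mulrDl.
  have nt : 0 < nm t by lra.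
  have nt' : 0 < nm t' by lra.
  apply: lerD; first apply: lerD.
  - rewrite mulrAC; apply: ler_pM; rewrite ?nm_ge0 ?invr_ge0 ?nm_ge0 //.
    by rewrite lef_pV2.
  - rewrite mulrAC ler_wpM2r //; apply: ler_pM; rewrite ?nm_ge0 ?invr_ge0 ?mulr_ge0 ?exprn_ge0 ?nm_ge0 ?hM //.
    rewrite lef_pV2 ?posrE ?mulr_gt0 ?exprn_gt0 // exprSr ler_pM ?exprn_ge0 ?(ltW r10) //.
    by rewrite lerXn2r ?nnegrE // ltW.
  - rewrite mulrAC ler_wpM2r //; apply: ler_pM; rewrite ?nm_ge0 ?invr_ge0 ?mulr_ge0 ?exprn_ge0 ?nm_ge0 ?hl //.
    by rewrite lef_pV2 ?posrE ?mulr_gt0 ?exprn_gt0 // expr2 ler_pM // ltW.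
have [w hw] := cube_root_exists R.
pose A := B2 * (r - r1).
have A0 : 0 <= A by rewrite mulr_ge0 //; lra.
pose eta := e / 2 / (A + 1) / 2.
have eta0 : 0 < eta by rewrite !divr_gt0 //; lra.
have r11 : 0 < r + 1 by lra.
have [n /(_ n (leqnn _)) hn] := inv_small (divr_gt0 eta0 r11).
have [m hm] := @pow_small R (2^-1) (eta / (2 * r)) (ltac:(lra)) (ltac:(by rewrite divr_gt0 //; lra)).
have {}hm := hm m (leqnn _).
have [u [u1 um u2]] := small_root m hw; have uN := prim_small hw um.
move: uN; set N := (3 ^ m.+1)%N => uN; have N0 : (0 : R) < N%:R by rewrite ltr0n expn_gt0.
have un1 : u != 1.
  by apply/eqP => u11; have [_ _] := cube3 hw; rewrite -um u11 expr1n eqxx.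
have hA := annulus_mean n B20 r10 r1r uN u1 un1 hg.
have h1 : nm (\sum_(k < N) g (rc r * u ^+ k)) <= N%:R * (M / r).
  rewrite (le_trans (nm_sum _ _ _)) // -[N in leRHS]card_ord -sumr_const mulr_suml.
  apply: ler_sum => k _; rewrite mul1r /g nm_div nmM nmX u1 expr1n mulr1 nm_rc gtr0_norm //.
  by rewrite ler_wpM2r ?invr_ge0 ?(ltW r0) // hM // nmM nmX u1 expr1n mulr1 nm_rc gtr0_norm.
have h2 : nm (\sum_(k < N) g (rc r1 * u ^+ k) - N%:R * lam 0) <= N%:R * (B * r1).
  have z0 : \sum_(k < N) (f 0 / (rc r1 * u ^+ k)) = 0.
    transitivity (f 0 / rc r1 * \sum_(k < N) u ^+ (k * N.-1)).
      rewrite mulr_sumr; apply: eq_bigr => k _; rewrite invfM mulrA; congr (_ * _).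
      have uk : u ^+ (k * N.-1) * u ^+ k = 1.
        by rewrite -exprD -{2}[nat_of_ord k]muln1 -mulnDr addn1 prednK ?expn_gt0 // mulnC exprM (prim_expr_order uN) expr1n.
      by apply: (mulIf (expf_neq0 k (_ : u != 0))); rewrite ?uk ?mulVf ?expf_neq0 // -nm_gt0 u1.
    rewrite (sum_prim uN) ?mulr0 //; apply/negP => /dvdn_leq.
    have N3 : (2 < N)%N by rewrite /N expnS leq_pmulr // expn_gt0.
    by case: (N) N3 => [|[|[|k]]] //= _ /(_ isT); rewrite ltnn.
  have -> : N%:R * lam 0 = \sum_(k < N) (f 0 / (rc r1 * u ^+ k) + lam 0).
    by rewrite big_split /= z0 add0r sumr_const card_ord mulr_natl.
  rewrite -sumrB (le_trans (nm_sum _ _ _)) // -[N in leRHS]card_ord -sumr_const mulr_suml.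
  apply: ler_sum => k _; rewrite mul1r; set t := rc r1 * u ^+ k.
  have nt : nm t = r1 by rewrite /t nmM nmX u1 expr1n mulr1 nm_rc gtr0_norm.
  have t0 : t != 0 by rewrite -nm_gt0 nt.
  have := hq 0 t (ltac:(by rewrite nm0 ltW)) (ltac:(by rewrite nt)); rewrite subr0 nt => h.
  have -> : g t - (f 0 / t + lam 0) = (f t - f 0 - lam 0 * t) / t by rewrite /g; field.
  by rewrite nm_div nt ler_pdivrMr // -mulrA -expr2.
have h3 : nm (N%:R * lam 0) <= N%:R * (M / r + B * r1 + B2 * (r - r1) * ((r - r1) / n.+1%:R + r * nm (u - 1))).
  have -> : N%:R * lam 0 = \sum_(k < N) g (rc r * u ^+ k) - (\sum_(k < N) g (rc r * u ^+ k) - \sum_(k < N) g (rc r1 * u ^+ k))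
     - (\sum_(k < N) g (rc r1 * u ^+ k) - N%:R * lam 0) by ring.
  rewrite (le_trans (nmBD _ _)) // (le_trans (lerD (nmBD _ _) (lexx _))) //.
  by apply: le_trans (lerD (lerD h1 hA) h2) _; rewrite -!mulrDr addrAC.
rewrite nmM nm_nat ler_pM2l // in h3; apply: le_trans h3 _; rewrite -/A.
have e1 : (r - r1) / n.+1%:R <= eta.
  have nn : 0 < n.+1%:R^-1 :> R by rewrite invr_gt0 ltr0n.
  move: hn; rewrite ltr_pdivlMr; last lra.
  by set x := n.+1%:R^-1 in nn *; nra.
have e2 : r * nm (u - 1) <= eta.
  move: hm; rewrite ltr_pdivlMr; last lra.
  by rewrite exprVn => hm; have : r * nm (u - 1) <= r * (2 / 2 ^+ m) by [rewrite ler_wpM2l // ltW]; lra.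
have : A * ((r - r1) / n.+1%:R + r * nm (u - 1)) <= A * (eta + eta) by rewrite ler_wpM2l // lerD.
have : A * (eta + eta) <= e / 2.
  have -> : A * (eta + eta) = A * (e / 2 / (A + 1)) by rewrite /eta; field; lra.
  by rewrite mulrCA ler_piMr // ?ler_pdivrMr; lra.
move=> k1 k2; rewrite -addrA [e + _]addrC lerD2l.
by apply: le_trans (lerD r1e (le_trans k2 k1)) _; rewrite -splitr.
Qed.
End Quad.

(** * Uniform estimates, and holomorphic sections of roots *)

Section Sections.
Variable R : realType.
Local Notation C := (Cplx R).

Lemma ball_convex (V : normedModType R[i]) (a b b' : V) (r t : R) : 0 <= t <= 1 ->
  nm (b - a) <= r -> nm (b' - a) <= r -> nm (b + rc t *: (b' - b) - a) <= r.
Proof.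
move=> /andP[t0 t1] h h'.
have -> : b + rc t *: (b' - b) - a = rc (1 - t) *: (b - a) + rc t *: (b' - a).
  have -> : b' - b = (b' - a) - (b - a) by rewrite opprB addrA subrK.
  by rewrite addrAC rcD rcN scalerBl scale1r scalerBr addrA addrAC.
rewrite (le_trans (nmD _ _)) // !nmZ !nm_rc !ger0_norm ?subr_ge0 //.
have : (1 - t) * nm (b - a) <= (1 - t) * r by rewrite ler_wpM2l ?subr_ge0.
have : t * nm (b' - a) <= t * r by rewrite ler_wpM2l.
lra.
Qed.

Section Cauchy.
Variables (V : normedModType R[i]).
Implicit Types (f : V -> C) (l : V -> V -> C).

Lemma lin0 S f l B w : quad S f l B -> S w -> l w 0 = 0.
Proof.
case=> _ _ _ hl _ Sw; have := hl _ Sw 1 0 0; rewrite scaler0 addr0 mul1r => /eqP.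
by rewrite -subr_eq subrr eq_sym => /eqP.
Qed.
Lemma linZ S f l B w c h : quad S f l B -> S w -> l w (c *: h) = c * l w h.
Proof. by move=> q Sw; have [_ _ _ hl _] := q; have := hl _ Sw c h 0; rewrite addr0 (lin0 q Sw) addr0. Qed.

Lemma line_cauchy S f l B M (b h : V) (r : R) : quad S f l B -> 0 < r ->
  (forall w, nm (w - b) <= r -> S w /\ nm (f w) <= M) -> nm (l b h) * r <= M * nm h.
Proof.
move=> q r0 hS; have [B0 _ hl hlin hq] := q.
have [Sb Mb] : S b /\ nm (f b) <= M by apply: hS; rewrite subrr nm0 ltW.
have [->|h0] := eqVneq h 0; first by rewrite (lin0 q Sb) !nm0 mul0r mulr0.
have nh : 0 < nm h by rewrite nm_gt0.
have inS (t : C) : nm t <= r / nm h -> S (b + t *: h) /\ nm (f (b + t *: h)) <= M.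
  by move=> ht; apply: hS; rewrite addrC addKr nmZ -ler_pdivlMr.
have := @cauchy_estimate R (fun t => f (b + t *: h)) (fun t => l (b + t *: h) h)
  (B * nm h + B * nm h ^+ 2) M (r / nm h).
rewrite scale0r addr0 mulrA ler_pdivrMr //; apply.
- by rewrite divr_gt0.
- by rewrite addr_ge0 // mulr_ge0 ?exprn_ge0 // ltW.
- by move=> t /inS [St _]; rewrite (le_trans (hl _ St h)) // lerDl mulr_ge0 // exprn_ge0 // ltW.
- by move=> t /inS [].
- move=> t t' /inS [St _] /inS [St' _]; have [_] := hq _ _ St St'.
  have -> : b + t' *: h - (b + t *: h) = (t' - t) *: h.
    by rewrite opprD addrACA subrr add0r scalerBl.
  rewrite (linZ _ _ q St) mulrC nmZ => h1; apply: le_trans h1 _.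
  by rewrite exprMn mulrCA mulrC ler_wpM2r ?exprn_ge0 ?nm_ge0 // lerDr mulr_ge0 // ltW.
Qed.

Variables (a : V) (rho : R) (f : V -> C) (l : V -> V -> C) (B M : R).
Hypothesis rho0 : 0 < rho.
Let S := [set w : V | nm (w - a) <= rho].
Hypothesis q : quad S f l B.
Hypothesis hM : forall w, S w -> nm (f w) <= M.

Lemma unif_lip b b' : nm (b - a) <= rho / 2 -> nm (b' - a) <= rho / 2 ->
  nm (f b' - f b) <= 2 * M / rho * nm (b' - b).
Proof.
move=> hb hb'; have r0 := rho0.
have inS t : 0 <= t <= 1 -> nm (b + rc t *: (b' - b) - a) <= rho / 2.
  by move=> ht; exact: ball_convex.
apply: (quad_lip q) => t /inS h; first by rewrite /S /=; lra.
have := @line_cauchy _ _ _ _ M (b + rc t *: (b' - b)) (b' - b) (rho / 2) q.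
rewrite -ler_pdivlMr; last lra.
move=> H; apply: le_trans (H _ _) _; first lra.
  move=> w hw; have Sw : S w by have := nm_tri (b + rc t *: (b' - b)) w a; rewrite /S /=; lra.
  by split=> //; exact: hM.
by rewrite le_eqVlt; apply/orP; left; apply/eqP; field; rewrite gt_eqF.
Qed.

(** As in [unif_lip] the constant involves only the bound [M] and the radius, not [B], so the
    estimate passes to limits of bounded families. [line_cauchy] is applied to the difference
    [f (w + k) - f w], which [unif_lip] bounds by a multiple of [nm h]. *)
Lemma unif_quad b b' : nm (b - a) <= rho / 8 -> nm (b' - a) <= rho / 8 ->
  nm (f b' - f b - l b (b' - b)) <= 16 * M / rho ^+ 2 * nm (b' - b) ^+ 2.
Proof.
move=> hb hb'; have r0 := rho0; set h := b' - b.
have M0 : 0 <= M by apply: le_trans (hM (w := a) _); rewrite ?nm_ge0 // /S /= subrr nm0 ltW.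
have nh : nm h <= rho / 4 by have := nm_tri a b' b; rewrite [nm (a - b)]nmB /h; lra.
have inS t : 0 <= t <= 1 -> nm (b + rc t *: h - a) <= rho / 8.
  by move=> ht; exact: ball_convex.
apply: (quad_mvt q) => t ht; first by have := inS _ ht; rewrite /S /=; lra.
rewrite -/h; pose k := rc t *: h.
have nk : nm k <= nm h by rewrite /k nmZ nm_rc; case/andP: ht => t0 t1; rewrite ger0_norm // ler_piMl ?nm_ge0.
pose S' := [set w : V | nm (w - a) <= rho / 4].
have Sk w : S' w -> nm (w + k - a) <= rho / 2.
  by rewrite /S' /= => hw; have := nmD (w - a) k; rewrite addrAC; lra.
have SS w : S' w -> S w by rewrite /S' /S /=; lra.
have Sk' w : S' w -> S (w + k) by move=> /Sk; rewrite /S /=; lra.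
have [B0 h1 h2 h3 h4] := q.
have q' : quad S' (fun w => f (w + k) - f w) (fun w v => l (w + k) v - l w v) (B + B).
  split=> [|w Sw|w Sw v|w Sw c v v'|w w' Sw Sw'].
  - exact: addr_ge0.
  - by rewrite (le_trans (nmBD _ _)) // (lerD (h1 _ (Sk' _ Sw)) (h1 _ (SS _ Sw))).
  - by rewrite (le_trans (nmBD _ _)) // mulrDl (lerD (h2 _ (Sk' _ Sw) v) (h2 _ (SS _ Sw) v)).
  - by rewrite (h3 _ (Sk' _ Sw)) (h3 _ (SS _ Sw)); ring.
  - have [a1 a2] := h4 _ _ (SS _ Sw) (SS _ Sw'); have [b1 b2] := h4 _ _ (Sk' _ Sw) (Sk' _ Sw').
    have e : w' + k - (w + k) = w' - w by rewrite opprD addrACA subrr addr0.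
    rewrite e in b1 b2; split; rewrite mulrDl.
      have -> : f (w' + k) - f w' - (f (w + k) - f w) = (f (w' + k) - f (w + k)) - (f w' - f w) by ring.
      by rewrite (le_trans (nmBD _ _)) // lerD.
    have -> : f (w' + k) - f w' - (f (w + k) - f w) - (l (w + k) (w' - w) - l w (w' - w)) =
      (f (w' + k) - f (w + k) - l (w + k) (w' - w)) - (f w' - f w - l w (w' - w)) by ring.
    by rewrite (le_trans (nmBD _ _)) // lerD.
have := @line_cauchy _ _ _ _ (2 * M / rho * nm h) b h (rho / 8) q'.
rewrite -ler_pdivlMr; last lra.
move=> H; apply: le_trans (H _ _) _; first lra.
  move=> w hw; have Sw : S' w by have := nm_tri b w a; rewrite /S' /=; lra.
  split=> //; have e : nm (w + k - w) <= nm h by rewrite addrC addKr.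
  apply: le_trans (unif_lip _ (Sk _ Sw)) _; first by move: Sw; rewrite /S' /=; lra.
  by rewrite ler_wpM2l // divr_ge0 ?mulr_ge0 // ltW.
by rewrite le_eqVlt; apply/orP; left; apply/eqP; field; rewrite gt_eqF.
Qed.
End Cauchy.

Section Roots.
Variables (V : normedModType R[i]) (U : set V) (Dm rho A m B : R) (D : nat).
Variables (F : V * C -> C) (l : V * C -> V * C -> C).
Hypothesis Ucvx : forall b b' t, U b -> U b' -> 0 <= t <= 1 -> U (b + rc t *: (b' - b)).
Hypothesis Udiam : forall b b', U b -> U b' -> nm (b' - b) <= Dm.
Let S : set (V * C) := [set w | U w.1 /\ nm w.2 <= rho].
Hypothesis qF : quad S F l B.
Hypothesis D0 : (0 < D)%N.
Hypothesis A0 : 0 <= A.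
Hypothesis Froot : forall b x, U b -> nm x <= rho ->
  exists y, [/\ nm y <= rho, F (b, y) = 0 & nm (x - y) ^+ D <= A * nm (F (b, x))].
Hypothesis m0 : 0 < m.
Hypothesis Fnd : forall b x, U b -> nm x <= rho -> F (b, x) = 0 -> m <= nm (l (b, x) (0, 1)).

Definition isroot b x := [/\ U b, nm x <= rho & F (b, x) = 0].
Let kap := m / (B + 1).
Let B0 : 0 <= B. Proof. by case: qF. Qed.
Let kap0 : 0 < kap. Proof. by rewrite divr_gt0 // ltr_wpDl. Qed.
Let Bkap : B * kap <= m.
Proof. by rewrite /kap mulrCA ler_piMr ?(ltW m0) // ler_pdivrMr ?ltr_wpDl // mul1r lerDl. Qed.

Let lsplit b x v t : S (b, x) -> l (b, x) (v, t) = l (b, x) (v, 0) + t * l (b, x) (0, 1).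
Proof.
move=> Sw; have [_ _ _ hl _] := qF; rewrite -[RHS]addrC -hl //; congr (l _ _).
by apply: injective_projections; rewrite /= ?scaler0 ?add0r // addr0 -[LHS]mulr1.
Qed.
Let nm0r (v : C) : nm ((0, v) : V * C) = nm v.
Proof. by rewrite nm_pair /= nm0; apply: max_idPr; exact: nm_ge0. Qed.
Let nmr0 (v : V) : nm ((v, 0) : V * C) = nm v.
Proof. by rewrite nm_pair /= nm0; apply: max_idPl; exact: nm_ge0. Qed.

(** At a root the [x]-derivative is at least [m] in modulus, and the quadratic remainder cannot
    compensate it at a distance below [m / B]. *)
Lemma sec_sep b y y' : isroot b y -> isroot b y' -> nm (y' - y) < kap -> y = y'.
Proof.
move=> [Ub hy Fy] [_ hy' Fy'] h; apply/eqP; rewrite eq_sym -subr_eq0 -nm_eq0; apply/eqP.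
have [_ _ _ _ hq] := qF; have Sy : S (b, y) by [].
have [_] := hq (b, y) (b, y') Sy (conj Ub hy').
have -> : (b, y') - (b, y) = (0, y' - y) :> V * C by congr pair; rewrite subrr.
rewrite Fy Fy' subrr sub0r nmN nm0r lsplit // (lin0 qF Sy) add0r nmM => h1.
have h2 := Fnd Ub hy Fy; have n0 := nm_ge0 (y' - y).
move: (nm (y' - y)) n0 h h1 => n n0 h h1; apply/eqP; rewrite eq_le n0 andbT leNgt; apply/negP => n1.
have : n * m <= B * n ^+ 2 by apply: le_trans h1; rewrite ler_wpM2l.
rewrite expr2 mulrCA ler_pM2l // => h3.
have : B * n < m; last by lra.
have [/eqP b0|b0] := eqVneq B 0; first by rewrite (eqP b0) mul0r.
by apply: lt_le_trans Bkap; rewrite ltr_pM2l // lt_neqAle eq_sym b0.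
Qed.

Let L := 2 * B * (1 + `|Dm|) / m.
Let L0 : 0 <= L. Proof. by rewrite divr_ge0 ?(ltW m0) // !mulr_ge0 // addr_ge0. Qed.

Lemma sec_step : exists2 eta : R, 0 < eta & forall b b' x, isroot b x -> U b' -> nm (b' - b) < eta ->
  exists x', [/\ isroot b' x', nm (x' - x) < kap / 4 & nm (x' - x) <= L * nm (b' - b)].
Proof.
have m0' := m0; have k0 := kap0; have Bk := Bkap; have B0' := B0; have k4 : 0 < kap / 4 by lra.
have AB : 0 < A * B + 1 by rewrite ltr_wpDl // mulr_ge0.
exists ((kap / 4) ^+ D / (A * B + 1)); first by rewrite divr_gt0 ?exprn_gt0.
move=> b b' x rx Ub' hd; have [Ub hx Fx] := rx; have [_ _ hl _ hq] := qF.
have [y [hy Fy hxy]] := Froot Ub' hx; exists y.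
have Sx : S (b, x) by [].
set del := nm (b' - b) in hd *; have d0 : 0 <= del := nm_ge0 _.
have F1 : nm (F (b', x)) <= B * del.
  have [] := hq (b, x) (b', x) Sx (conj Ub' hx); rewrite Fx subr0 => h _; apply: le_trans h _.
  by have -> : (b', x) - (b, x) = (b' - b, 0) :> V * C by [congr pair; rewrite subrr]; rewrite nmr0.
have n1 : nm (y - x) < kap / 4.
  rewrite nmB -(ltr_pXn2r D0) ?nnegrE ?nm_ge0 ?(ltW k4) //; apply: le_lt_trans hxy _.
  move: hd; rewrite ltr_pdivlMr // => hd; apply: le_lt_trans hd.
  have : A * nm (F (b', x)) <= A * (B * del) by rewrite ler_wpM2l.
  by rewrite mulrA mulrDr mulr1; lra.
split=> //; rewrite /L mulrAC ler_pdivlMr //.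
have [_] := hq (b, x) (b', y) Sx (conj Ub' hy).
rewrite Fx Fy subrr sub0r nmN.
have -> : (b', y) - (b, x) = (b' - b, y - x) :> V * C by [].
rewrite lsplit // => h1; have h2 := Fnd Ub hx Fx; have h3 := hl _ Sx (b' - b, 0).
rewrite nmr0 -/del in h3.
have := nm_loD ((y - x) * l (b, x) (0, 1)) (l (b, x) (b' - b, 0)); rewrite [X in _ <= nm X]addrC => h4.
rewrite nmM nm_pair /= -/del in h1 h4.
have n0 := nm_ge0 (y - x); set n := nm (y - x) in n0 n1 h1 h4 *.
have h5 : Num.max del n ^+ 2 <= del ^+ 2 + n ^+ 2.
  have : 0 <= del ^+ 2 by exact: exprn_ge0.
  have : 0 <= n ^+ 2 by exact: exprn_ge0.
  have [->|->] : Num.max del n = del \/ Num.max del n = n by rewrite /Num.max /Order.max; case: ifP => _; [right|left].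
    by lra.
  by lra.
have h6 : n * m <= n * nm (l (b, x) (0, 1)) by rewrite ler_wpM2l.
have h7 : B * Num.max del n ^+ 2 <= B * (del ^+ 2 + n ^+ 2) by rewrite ler_wpM2l.
have h8 : B * n ^+ 2 <= m / 4 * n.
  by rewrite expr2 mulrA ler_wpM2r //; have : B * n <= B * (kap / 4) by [rewrite ler_wpM2l // ltW]; lra.
have dD : del <= `|Dm| by rewrite (le_trans (Udiam Ub Ub')) ?ler_norm.
have h9 : B * del ^+ 2 <= B * `|Dm| * del by rewrite expr2 mulrA ler_wpM2r // ler_wpM2l.
have : n * m <= B * del + B * `|Dm| * del + m / 4 * n by rewrite mulrDr in h7; lra.
have : 0 <= n * m by rewrite mulr_ge0 // ltW.
have : 0 <= B * del by rewrite mulr_ge0.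
have : 0 <= B * `|Dm| * del by rewrite !mulr_ge0.
by rewrite mulrDr mulr1 mulrDl; lra.
Qed.

Let pt b0 b (n j : nat) : V := b0 + rc (j%:R / n.+1%:R) *: (b - b0).
Let frac01 (n j : nat) : (j <= n.+1)%N -> 0 <= (j%:R / n.+1%:R : R) <= 1.
Proof. by move=> h; rewrite divr_ge0 ?ler0n //= ler_pdivrMr ?ltr0n // mul1r ler_nat. Qed.
Let ptU b0 b n j : U b0 -> U b -> (j <= n.+1)%N -> U (pt b0 b n j).
Proof. by move=> h0 h hj; apply: Ucvx => //; exact: frac01. Qed.
Let pt0 b0 b n : pt b0 b n 0 = b0. Proof. by rewrite /pt mul0r rc0 scale0r addr0. Qed.
Let pt1 b0 b n : pt b0 b n n.+1 = b.
Proof. by rewrite /pt divff ?pnatr_eq0 // scale1r addrC subrK. Qed.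
Let ptS b0 b n j : nm (pt b0 b n j.+1 - pt b0 b n j) = nm (b - b0) / n.+1%:R.
Proof.
rewrite /pt opprD addrACA subrr add0r -scalerBl -rcN -rcD -mulrBl -natr1 addrC addKr mul1r.
by rewrite nmZ nm_rc ger0_norm ?invr_ge0 ?ler0n // mulrC.
Qed.
Let fine_step (e : R) : 0 < e -> exists n : nat, forall b b', U b -> U b' -> nm (b' - b) / n.+1%:R < e.
Proof.
move=> e0; have D1 : 0 < `|Dm| + 1 by rewrite ltr_wpDl.
have [n /(_ n (leqnn _)) hn] := inv_small (divr_gt0 e0 D1).
exists n => b b' Ub Ub'; move: hn; rewrite ltr_pdivlMr //; apply: le_lt_trans.
rewrite mulrC ler_wpM2l ?invr_ge0 ?ler0n //.
by rewrite (le_trans (Udiam Ub Ub')) // (le_trans (ler_norm _)) // lerDl.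
Qed.

Lemma sec_unique (s t : V -> C) (K : R) b1 b : 0 <= K ->
  (forall b, U b -> isroot b (s b)) -> (forall b, U b -> isroot b (t b)) ->
  (forall b b', U b -> U b' -> nm (s b' - s b) <= K * nm (b' - b)) ->
  (forall b b', U b -> U b' -> nm (t b' - t b) <= K * nm (b' - b)) ->
  U b1 -> U b -> s b1 = t b1 -> s b = t b.
Proof.
move=> K0 hs ht Ls Lt Ub1 Ub e; have k0 := kap0.
have K1 : 0 < 2 * K + 1 by lra.
have [n hn] := fine_step (divr_gt0 kap0 K1).
suff h j : (j <= n.+1)%N -> s (pt b1 b n j) = t (pt b1 b n j) by have := h _ (leqnn _); rewrite pt1.
elim: j => [_|j ih hj]; first by rewrite pt0.
have Uj := ptU Ub1 Ub (ltnW hj); have Uj' := ptU Ub1 Ub hj.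
apply: (sec_sep (hs _ Uj') (ht _ Uj')).
have h1 := Ls _ _ Uj Uj'; have h2 := Lt _ _ Uj Uj'; rewrite ptS in h1 h2; rewrite ih ?(ltnW hj) // in h1.
have h3 := nm_tri (t (pt b1 b n j)) (t (pt b1 b n j.+1)) (s (pt b1 b n j.+1)).
rewrite [X in _ <= _ + X]nmB in h3; have := hn _ _ Ub1 Ub; rewrite ltr_pdivlMr //.
have : 0 <= nm (b - b1) / n.+1%:R by rewrite divr_ge0 ?nm_ge0 ?ler0n.
by move: (nm (b - b1) / n.+1%:R) h1 h2 h3 => x; lra.
Qed.

(** Continuation along the straight segment from [b0], in a fixed number of short steps; convexity
    of [U] leaves no room for monodromy. Chains that end at nearby parameters stay close: at each
    step four gaps below [kap / 4] fit under the separation [kap] of roots. The derivative is the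
    one of the implicit function theorem. *)
Lemma sec_exists b0 x0 : isroot b0 x0 ->
  exists s : V -> C, [/\ s b0 = x0, forall b, U b -> isroot b (s b) & qd U s].
Proof.
move=> r0; have k0 := kap0; have [Ub0 _ _] := r0; have [eta eta0 hstep] := sec_step.
have [nx hnx] : exists nx : V -> V -> C -> C, forall b b' x, isroot b x -> U b' -> nm (b' - b) < eta ->
  [/\ isroot b' (nx b b' x), nm (nx b b' x - x) < kap / 4 & nm (nx b b' x - x) <= L * nm (b' - b)].
  have /choice [g hg] : forall w : V * V * C, exists x', isroot w.1.1 w.2 -> U w.1.2 -> nm (w.1.2 - w.1.1) < eta ->
    [/\ isroot w.1.2 x', nm (x' - w.2) < kap / 4 & nm (x' - w.2) <= L * nm (w.1.2 - w.1.1)].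
    move=> [[b b'] x] /=; have [[h1 [h2 h3]]|hn] := pselect (isroot b x /\ U b' /\ nm (b' - b) < eta).
      by have [x' hx'] := hstep _ _ _ h1 h2 h3; exists x'.
    by exists 0 => h1 h2 h3; case: hn.
  by exists (fun b b' x => g (b, b', x)) => b b' x; exact: (hg (b, b', x)).
have [n hn] := fine_step eta0.
pose ch b := fix ch j : C := if j is j'.+1 then nx (pt b0 b n j') (pt b0 b n j) (ch j') else x0.
have chr b j : U b -> (j <= n.+1)%N -> isroot (pt b0 b n j) (ch b j).
  move=> Ub; elim: j => [_|j ih hj]; first by rewrite pt0.
  have [||//] := hnx _ (pt b0 b n j.+1) _ (ih (ltnW hj)); first exact: ptU.
  by rewrite ptS hn.
have chs b j : U b -> (j < n.+1)%N -> nm (ch b j.+1 - ch b j) < kap / 4.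
  move=> Ub hj; have [||//] := hnx _ (pt b0 b n j.+1) _ (chr b j Ub (ltnW hj)); first exact: ptU.
  by rewrite ptS hn.
pose s b := ch b n.+1; have sr b : U b -> isroot b (s b) by move=> Ub; have := chr b _ Ub (leqnn _); rewrite pt1.
have lip1 b b' : U b -> U b' -> nm (b' - b) < eta -> nm (s b' - s b) <= L * nm (b' - b).
  move=> Ub Ub' hbb.
  have ptd j : (j <= n.+1)%N -> nm (pt b0 b' n j - pt b0 b n j) <= nm (b' - b).
    move=> hj; rewrite /pt opprD addrACA subrr add0r -scalerBr opprB addrA subrK nmZ nm_rc.
    by have /andP[f0 f1] := frac01 hj; rewrite ger0_norm // ler_piMl ?nm_ge0.
  suff h j : (j <= n.+1)%N -> nm (ch b' j - ch b j) < kap / 4 /\ nm (ch b' j - ch b j) <= L * nm (pt b0 b' n j - pt b0 b n j).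
    by have [_] := h _ (leqnn _); rewrite !pt1.
  elim: j => [_|j ih hj]; first by rewrite subrr nm0 mulr_ge0 ?nm_ge0 //; split=> //; have := kap0; lra.
  have [h1 _] := ih (ltnW hj).
  have [||y [ry y1 y2]] := hstep _ (pt b0 b' n j.+1) _ (chr b _ Ub hj); first exact: ptU.
    by apply: le_lt_trans hbb; exact: ptd.
  suff <- : y = ch b' j.+1 by [].
  apply: (sec_sep ry (chr b' _ Ub' hj)).
  have := nm_tri (ch b' j) (ch b' j.+1) y; have := nm_tri (ch b j) (ch b' j) y.
  have := nm_tri (ch b j.+1) (ch b j) y; have := chs b j Ub hj; have := chs b' j Ub' hj.
  by rewrite [nm (ch b j - ch b j.+1)]nmB [nm (ch b j.+1 - y)]nmB; lra.
have lip b b' : U b -> U b' -> nm (s b' - s b) <= L * nm (b' - b).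
  move=> Ub Ub'; have n0 : (0 : R) < n.+1%:R by rewrite ltr0n.
  suff h j : (j <= n.+1)%N -> nm (s (pt b b' n j) - s b) <= j%:R * (L * (nm (b' - b) / n.+1%:R)).
    have := h _ (leqnn _); rewrite pt1 => h1; apply: le_trans h1 _.
    by rewrite le_eqVlt; apply/orP; left; apply/eqP; field; rewrite gt_eqF.
  elim: j => [_|j ih hj]; first by rewrite pt0 subrr nm0 mul0r.
  rewrite (le_trans (nm_tri (s (pt b b' n j)) _ _)) // -[j.+1%:R]natr1 mulrDl mul1r addrC lerD ?ih ?(ltnW hj) //.
  have Uj := ptU Ub Ub' (ltnW hj); have Uj' := ptU Ub Ub' hj.
  have := lip1 _ _ Uj Uj'; rewrite ptS; apply; exact: hn.
exists s; split=> //.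
  have := hnx b0 b0; rewrite /s; suff h j : (j <= n.+1)%N -> ch b0 j = x0 by rewrite h.
  elim: j => [//|j ih hj]; apply/eqP; rewrite -(ih (ltnW hj)) -subr_eq0 -nm_eq0 eq_le nm_ge0 andbT.
  have [||_ _] := hnx _ (pt b0 b0 n j.+1) _ (chr b0 j Ub0 (ltnW hj)); first exact: ptU.
    by rewrite ptS hn.
  by rewrite ptS subrr nm0 mul0r mulr0.
have [_ _ hl hlin hq] := qF.
pose lam b v := - (l (b, s b) (v, 0) / l (b, s b) (0, 1)).
have nd b : U b -> m <= nm (l (b, s b) (0, 1)) by move=> Ub; have [_ h1 h2] := sr _ Ub; exact: Fnd.
have Sb b : U b -> S (b, s b) by move=> Ub; have [_ h1 _] := sr _ Ub.
pose K := `|rho| + B / m + L + B * (1 + L) ^+ 2 / m.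
have t1 : 0 <= B / m by rewrite divr_ge0 // ltW.
have t2 : 0 <= B * (1 + L) ^+ 2 / m by rewrite divr_ge0 ?(ltW m0) // mulr_ge0 // sqr_ge0.
have t0 : 0 <= `|rho| by [].
exists lam, K; split=> [|b Ub|b Ub v|b Ub c v v'|b b' Ub Ub'].
- by rewrite /K; have := L0; lra.
- by have [_ h _] := sr _ Ub; rewrite (le_trans h) // (le_trans (ler_norm _)) // /K; have := L0; lra.
- rewrite /lam nmN nm_div; apply: le_trans (_ : _ <= B / m * nm v) _.
    rewrite mulrAC; apply: ler_pM; rewrite ?nm_ge0 ?invr_ge0 ?nm_ge0 //.
      by have := hl _ (Sb _ Ub) (v, 0); rewrite nmr0.
    by rewrite lef_pV2 ?posrE ?nd // (lt_le_trans m0) ?nd.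
  by rewrite ler_wpM2r ?nm_ge0 // /K; have := L0; lra.
- rewrite /lam; have -> : (c *: v + v', 0) = c *: (v, 0) + (v', 0) :> V * C by congr pair; rewrite /= scaler0 addr0.
  by rewrite hlin; [ring|exact: Sb].
- have h1 := lip _ _ Ub Ub'; split.
    by rewrite (le_trans h1) // ler_wpM2r ?nm_ge0 // /K; lra.
  have [_] := hq _ _ (Sb _ Ub) (Sb _ Ub'); have [_ _ ->] := sr _ Ub; have [_ _ ->] := sr _ Ub'.
  rewrite subrr sub0r nmN.
  have -> : (b', s b') - (b, s b) = (b' - b, s b' - s b) :> V * C by [].
  rewrite lsplit ?nm_pair /=; last exact: Sb.
  set fx := l (b, s b) (0, 1); set lv := l (b, s b) (b' - b, 0) => h2.
  have fx0 : 0 < nm fx by rewrite (lt_le_trans m0) // nd.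
  have -> : s b' - s b - lam b (b' - b) = (lv + (s b' - s b) * fx) / fx.
    by rewrite /lam -/fx -/lv; field; rewrite -nm_gt0.
  apply: le_trans (_ : _ <= B * (1 + L) ^+ 2 / m * nm (b' - b) ^+ 2) _; last first.
    by rewrite ler_wpM2r ?exprn_ge0 ?nm_ge0 // /K; have := L0; lra.
  rewrite nm_div mulrAC; apply: ler_pM; rewrite ?nm_ge0 ?invr_ge0 ?nm_ge0 //; last first.
    by rewrite lef_pV2 ?posrE // nd.
  apply: le_trans h2 _; rewrite -mulrA ler_wpM2l // -exprMn lerXn2r ?nnegrE ?le_max ?nm_ge0 //.
    by rewrite mulr_ge0 ?nm_ge0 // addr_ge0.
  have := nm_ge0 (b' - b); rewrite ge_max mulrDl mul1r => n0.
  have : 0 <= L * nm (b' - b) by rewrite mulr_ge0.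
  by move=> h3; apply/andP; split; lra.
Qed.
End Roots.
End Sections.

(** * Differentials from quantitative expansions *)

Section Calculus.
Variable R : realType.
Local Notation C := (Cplx R).

Section Diff.
Variables V W : normedModType R[i].

Lemma diff_intro (f l : V -> W) (x : V) (K : R) : linear l ->
  (forall v, nm (l v) <= K * nm v) ->
  (forall e : R, 0 < e -> exists2 del : R, 0 < del & forall y, nm (y - x) < del ->
     nm (f y - f x - l (y - x)) <= e * nm (y - x)) ->
  differentiable f x /\ forall v, 'd f x v = l v.
Proof.
move=> ll lK h.
pose L : {linear V -> W} := HB.pack l (GRing.isLinear.Build _ _ _ _ l ll).
have cL : continuous L.
  move=> y; apply/cvgrPdist_lt => e /pos_rc[e' e'0 ->].
  apply/nbhs_normP; exists (rc (e' / (`|K| + 1))) => [|z] /=.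
    by rewrite -rc0 rc_lt divr_gt0.
  rewrite /ball_ /= nm_lt => hz; have -> : l y - l z = l (y - z) by rewrite -[l y]/(L y) -[l z]/(L z) -linearB.
  rewrite nm_lt (le_lt_trans (lK _)) //.
  move: hz; rewrite ltr_pdivlMr // => hz; apply: le_lt_trans hz; rewrite mulrC ler_wpM2l ?nm_ge0 //.
  by rewrite (le_trans (ler_norm _)) // lerDl.
have oE : f \o shift x = cst (f x) + L +o_ 0 id.
  apply/eqaddoP => e /pos_rc[e' e'0 ->]; have [del del0 hd] := h _ e'0.
  apply/nbhs_normP; exists (rc del) => [|z] /=; first by rewrite -rc0 rc_lt.
  rewrite /ball_ /= sub0r nm_lt nmN => hz; rewrite !normE -rcM rc_le.
  have -> : (f \o +%R^~ x - (cst (f x) + L)) z = f (z + x) - (f x + l z) by [].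
  by have := hd (z + x); rewrite addrK opprD addrA; apply.
have dE := diff_unique cL oE.
split; last by move=> v; rewrite dE.
by apply/diff_locallyP; rewrite dE.
Qed.

Lemma diff_local (f : V -> W) (x : V) (e : R) : differentiable f x -> 0 < e ->
  exists2 del : R, 0 < del & forall y, nm (y - x) < del ->
    nm (f y - f x - 'd f x (y - x)) <= e * nm (y - x).
Proof.
move=> /diff_locallyP[_ /eqaddoP h] e0.
have e0' : 0 < rc e by rewrite -rc0 rc_lt.
have /nbhs_normP [d /= /pos_rc[d' d0 ->] hd] := h _ e0'.
exists d' => // y hy; have := hd (y - x); rewrite /ball_ /= sub0r nm_lt nmN => /(_ hy).
have -> : (f \o +%R^~ x - (cst (f x) + 'd f x)) (y - x) = f (y - x + x) - (f x + 'd f x (y - x)) by [].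
by rewrite !normE -rcM rc_le subrK opprD addrA.
Qed.
End Diff.

Lemma small_zero (c : C) (K r : R) : 0 < r ->
  (forall t : R, 0 < t < r -> nm c * t <= K * t ^+ 2) -> c = 0.
Proof.
move=> r0 h; apply: nm_small0 => e e0.
pose t := Num.min (r / 2) (e / (`|K| + 1)).
have t0 : 0 < t by rewrite lt_min !divr_gt0.
have tr : t < r by rewrite gt_min; apply/orP; left; lra.
have := h t; rewrite t0 tr expr2 mulrA ler_pM2r // => /(_ isT) h1; apply: le_trans h1 _.
have : t <= e / (`|K| + 1) by rewrite ge_min lexx orbT.
rewrite ler_pdivlMr // => h2.
by apply: le_trans h2; rewrite mulrC ler_wpM2l ?(ltW t0) // (le_trans (ler_norm _)) // lerDl.
Qed.
End Calculus.

(** * Polynomials as functions of their coefficients *)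

Section ParamPolys.
Variables (R : realType) (d : nat).
Local Notation C := (Cplx R).
Local Notation V := 'rV[C]_d.+2.

Definition pol (b : V) : {poly C} := \poly_(i < d.+2) b ord0 (inord i).

Lemma polE b x : (pol b).[x] = pev b x.
Proof. by rewrite horner_poly; apply: eq_bigr => i _; rewrite inord_val. Qed.
Lemma iter_pev b n x : iter n (pev b) x = it (pol b) n x.
Proof. by elim: n => //= n ->; rewrite polE. Qed.
Lemma size_pol b : inPd b -> size (pol b) = d.+2.
Proof.
move=> hb; rewrite /pol size_poly_eq //; apply: contraNneq hb => <-.
by apply/eqP; congr (b _ _); apply: val_inj; rewrite /= inordK.
Qed.
Lemma lead_pol b : inPd b -> lead_coef (pol b) = b ord0 ord_max.
Proof.
move=> hb; rewrite lead_coefE size_pol // coef_poly ltnSn; congr (b _ _).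
by apply: val_inj; rewrite /= inordK.
Qed.
Lemma coef_pol b i : nm (pol b)`_i <= nm b.
Proof. by rewrite coef_poly; case: ifP => _; rewrite ?nm_entry // nm0 nm_ge0. Qed.

Lemma filledJuliaP b x : filledJulia b x <-> bounded_orbit (pol b) x.
Proof.
split=> [[M hM]|[M hM]].
  exists (complex.Re M) => n; have h := hM n; rewrite iter_pev in h.
  have M0 : 0 <= M by apply: le_trans h; rewrite normr_ge0.
  by rewrite -rc_le -normE -ge0_rc.
by exists (rc M) => n; rewrite iter_pev nm_le.
Qed.

Variables (a : V) (rho : R).
Hypothesis aP : inPd a.

Lemma near_inPd : exists2 r : R, 0 < r & forall b : V, nm (b - a) <= r ->
  nm (a ord0 ord_max) / 2 <= nm (b ord0 ord_max) /\ inPd b.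
Proof.
have l0 : 0 < nm (a ord0 ord_max) by rewrite nm_gt0.
exists (nm (a ord0 ord_max) / 2) => [|b hb]; first by rewrite divr_gt0.
have h : nm (a ord0 ord_max) / 2 <= nm (b ord0 ord_max).
  have := nm_entry (b - a) ord_max; rewrite !mxE => h1.
  by have := nm_lo (a ord0 ord_max) (b ord0 ord_max); rewrite nmB; lra.
by split=> //; rewrite /inPd -nm_gt0; lra.
Qed.

Let S (M : R) : set (V * C) := [set w | nm (w.1 - a) <= rho /\ nm w.2 <= M].

Lemma qd_coord M i : qd (S M) (fun w => w.1 ord0 i).
Proof.
apply: (@qd_lin _ _ _ _ 1 (nm a + `|rho| + `|M|)) => //.
- by move=> c h h'; rewrite !mxE.
- by move=> h; rewrite mul1r nm_pair le_max nm_entry.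
- move=> w [h1 h2]; rewrite nm_pair_le; apply/andP; split.
    have := nmD (w.1 - a) a; rewrite subrK; have := ler_norm rho; have : 0 <= `|M| by [].
    lra.
  by have := nm_ge0 a; have := ler_norm M; have : 0 <= `|rho| by []; lra.
Qed.
Lemma qd_snd M : qd (S M) (fun w => w.2).
Proof.
apply: (@qd_lin _ _ _ _ 1 (nm a + `|rho| + `|M|)) => //.
- by move=> h; rewrite mul1r nm_pair le_max lexx orbT.
- move=> w [h1 h2]; rewrite nm_pair_le; apply/andP; split.
    have := nmD (w.1 - a) a; rewrite subrK; have := ler_norm rho; have : 0 <= `|M| by [].
    lra.
  by have := nm_ge0 a; have := ler_norm M; have : 0 <= `|rho| by []; lra.
Qed.
Lemma qd_pol M f : qd (S M) f -> qd (S M) (fun w => (pol w.1).[f w]).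
Proof.
move=> hf; have -> : (fun w => (pol w.1).[f w]) = (fun w => \sum_(i < d.+2) w.1 ord0 i * f w ^+ i).
  by apply/funext => w; rewrite polE.
by apply: qd_sum => i; apply: qd_mul; [exact: qd_coord|exact: qd_exp].
Qed.
Lemma qd_dpol M f : qd (S M) f -> qd (S M) (fun w => (pol w.1)^`().[f w]).
Proof.
move=> hf; have -> : (fun w => (pol w.1)^`().[f w]) =
  (fun w => \sum_(i < d.+1) (i.+1%:R * w.1 ord0 (inord i.+1)) * f w ^+ i).
  apply/funext => w; rewrite (@horner_coef_wide _ d.+1); last first.
    by rewrite (leq_trans (size_poly _ _)) // -subn1 leq_subLR add1n size_poly.
  by apply: eq_bigr => i _; rewrite coef_deriv coef_poly ltnS ltn_ord mulr_natl.
apply: qd_sum => i; apply: qd_mul; last exact: qd_exp.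
by apply: qd_mul; [exact: qd_cst|exact: qd_coord].
Qed.
Lemma qd_it M n : qd (S M) (fun w => it (pol w.1) n w.2).
Proof. by elim: n => [|n ih]; [exact: qd_snd|exact: qd_pol]. Qed.
Lemma qd_mult M n : qd (S M) (fun w => (itp (pol w.1) n)^`().[w.2]).
Proof.
elim: n => [|n ih]; first by rewrite (_ : (fun w : V * C => _) = fun=> 1); [exact: qd_cst|apply/funext => w; rewrite /= derivX hornerC].
have -> : (fun w : V * C => (itp (pol w.1) n.+1)^`().[w.2]) =
  (fun w => (pol w.1)^`().[it (pol w.1) n w.2] * (itp (pol w.1) n)^`().[w.2]).
  by apply/funext => w; rewrite /= deriv_comp hornerM horner_comp itpE.
by apply: qd_mul => //; apply: qd_dpol; exact: qd_it.
Qed.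

(** [quad] comes with some derivative [l]; comparing two second-order expansions along the [x]-axis
    shows that in this direction it is the formal one. *)
Lemma quad_dx M F l B b x f : quad (S M) F l B -> nm (b - a) <= rho -> nm x < M ->
  (forall y, F (b, y) = f.[y]) -> l (b, x) (0, 1) = f^`().[x].
Proof.
move=> q hb hx hf; have [_ _ _ hl hq] := q.
have [B' B'0 hB] := poly_quad f M.
apply/eqP; rewrite -subr_eq0; apply/eqP.
apply: (@small_zero _ _ (B + B') (M - nm x)); first lra.
move=> t /andP[t0 t1]; have Sx : S M (b, x) by split=> //=; exact: ltW.
have nx : nm (x + rc t) <= M by have := nmD x (rc t); rewrite nm_rc gtr0_norm //; lra.
have Sx' : S M (b, x + rc t) by split.
have [_] := hq _ _ Sx Sx'; have := hB x (x + rc t) (ltW hx) nx; rewrite !hf.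
have -> : (b, x + rc t) - (b, x) = rc t *: (0, 1) :> V * C.
  by congr pair; rewrite /= ?subrr ?scaler0 // addrC addKr /GRing.scale /= mulr1.
rewrite (linZ _ _ q Sx) (_ : x + rc t - x = rc t); last by rewrite addrC addKr.
rewrite (_ : nm (rc t) = t); last by rewrite nm_rc gtr0_norm.
rewrite (_ : nm (rc t *: (0, 1) : V * C) = t); last first.
  rewrite nmZ nm_rc gtr0_norm // nm_pair /= nm0 nm1 (_ : Num.max 0 1 = 1 :> R) ?mulr1 //.
  by apply: max_idPr; exact: ler01.
move=> h1 h2; rewrite -{1}(gtr0_norm t0) -nm_rc -nmM [leRHS]mulrDl.
have -> : (l (b, x) (0, 1) - f^`().[x]) * rc t = (f.[x + rc t] - f.[x] - f^`().[x] * rc t) - (f.[x + rc t] - f.[x] - rc t * l (b, x) (0, 1)) by ring.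
by rewrite (le_trans (nmBD _ _)) // addrC lerD.
Qed.
End ParamPolys.

(** * Periodic sections over a ball without neutral cycles *)

Section NoNeutral.
Variables (R : realType) (d : nat).
Local Notation C := (Cplx R).
Local Notation V := 'rV[C]_d.+2.
Variables (a : V) (rho Rd beta : R).
Hypothesis d0 : (0 < d)%N.
Hypothesis rho0 : 0 < rho.
Hypothesis Rd1 : 1 <= Rd.
Hypothesis beta0 : 0 < beta.
Let U := [set b : V | nm (b - a) <= rho].
Hypothesis UP : forall b, U b -> inPd b /\ beta <= nm (b ord0 ord_max).
Hypothesis Uesc : forall b, U b -> forall x, Rd <= nm x -> 2 * nm x <= nm (pol b).[x].
Hypothesis NN : forall b, U b -> forall n x, it (pol b) n.+1 x = x ->
  nm ((itp (pol b) n.+1)^`().[x]) != 1.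

Let M := Rd + 1.
Let S (M : R) : set (V * C) := [set w | nm (w.1 - a) <= rho /\ nm w.2 <= M].

Lemma qd_fst M' s : qd U s -> qd (S M') (fun w => s w.1).
Proof.
case=> l [B [B0 h1 h2 h3 h4]]; exists (fun w h => l w.1 h.1), B.
have f1 (h : V * C) : nm h.1 <= nm h by rewrite nm_pair le_max lexx.
split=> // [w [w1 _]|w [w1 _] h|w [w1 _] c h h'|w w' [w1 _] [w1' _]]; rewrite ?h1 //.
- by rewrite (le_trans (h2 _ w1 _)) // ler_wpM2l.
- exact: h3.
- have [k1 k2] := h4 _ _ w1 w1'; have := f1 (w' - w) => k3; split.
    by rewrite (le_trans k1) // ler_wpM2l.
  by rewrite (le_trans k2) // ler_wpM2l // lerXn2r ?nnegrE ?nm_ge0.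
Qed.

Lemma qd_limit (W : normedModType R[i]) (T : set W) f (c : C) w : qd T f -> T w ->
  (forall e : R, 0 < e -> exists u, [/\ T u, nm (u - w) < e & nm (f u - c) <= e]) -> f w = c.
Proof.
case=> l [B [B0 _ _ _ h4]] Tw h; apply/eqP; rewrite -subr_eq0; apply/eqP/nm_small0 => e e0.
have B1 : 0 < B + 1 by lra.
have [u [Tu u1 u2]] := h _ (divr_gt0 e0 B1); have [k _] := h4 _ _ Tu Tw.
have := nm_tri (f u) (f w) c; rewrite [nm (w - u)]nmB in k.
have : B * nm (u - w) <= B * (e / (B + 1)) by rewrite ler_wpM2l // ltW.
have : e / (B + 1) * (B + 1) = e by rewrite divfK // gt_eqF.
by lra.
Qed.

Definition Per n (b : V) (x : C) := it (pol b) n.+1 x = x.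

Lemma Per_bound n b x : U b -> Per n b x -> nm x <= Rd.
Proof.
move=> Ub e; rewrite leNgt; apply/negP => h.
suff : nm x < nm (it (pol b) n.+1 x) by rewrite e ltxx.
have R1 := Rd1; elim: n {e} => [|n ih].
  by rewrite /=; have := Uesc Ub (ltW h); lra.
rewrite itS; have := @Uesc _ Ub (it (pol b) n.+1 x); lra.
Qed.

Let PerM n b x : U b -> Per n b x -> nm x < M.
Proof. by move=> h h'; rewrite (le_lt_trans (Per_bound h h')) // ltrDl. Qed.

Lemma Per_mul n k b x : Per n b x -> it (pol b) (k * n.+1) x = x.
Proof. by move=> h; rewrite itM; elim: k => //= k ->. Qed.

Lemma lead_itp n : exists2 c : R, 0 < c & forall b, U b -> c <= nm (lead_coef (itp (pol b) n)).
Proof.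
elim: n => [|n [c c0 ih]]; first by exists 1 => // b _; rewrite lead_coefX nm1.
exists (beta * c ^+ d.+1) => [|b Ub]; first by rewrite mulr_gt0 ?exprn_gt0.
have [bP bl] := UP Ub; have sp := size_pol bP.
rewrite /= lead_coef_comp; last by rewrite (size_itp n sp) ltnS expn_gt0.
rewrite sp nmM nmX lead_pol //; apply: ler_pM; rewrite ?exprn_ge0 ?(ltW beta0) ?(ltW c0) //.
by rewrite lerXn2r ?nnegrE ?nm_ge0 ?(ltW c0) // ih.
Qed.

Let Fp n (w : V * C) := it (pol w.1) n.+1 w.2 - w.2.

Let Fp0 n b x : Per n b x -> Fp n (b, x) = 0.
Proof. by move=> h; apply/eqP; rewrite subr_eq0; apply/eqP. Qed.
Let Fp0P n b x : Fp n (b, x) = 0 -> Per n b x.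
Proof. by move=> /eqP; rewrite subr_eq0 => /eqP. Qed.

(** The hypotheses needed to continue roots, for the equation of the points of period [n.+1]. The
    lower bound [m] comes from the distance of the multipliers to 1: by compactness a failure would
    produce a periodic point of multiplier 1, which [NN] forbids. *)
Lemma per_roots n : exists l B A m, [/\ quad (S M) (Fp n) l B, 0 <= A,
  (forall b x, U b -> nm x <= M ->
    exists y, [/\ nm y <= M, Fp n (b, y) = 0 & nm (x - y) ^+ (d.+1 ^ n.+1) <= A * nm (Fp n (b, x))]), 0 < m &
  (forall b x, U b -> nm x <= M -> Fp n (b, x) = 0 -> m <= nm (l (b, x) (0, 1)))].
Proof.
have [l [B q]] : qd (S M) (Fp n) by apply: qd_sub; [exact: qd_it|exact: qd_snd].
have R1 := Rd1; have r0 := rho0; have [c c0 hc] := lead_itp n.+1.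
have poly b : U b -> (forall y, Fp n (b, y) = (itp (pol b) n.+1 - 'X).[y]) /\
    size (itp (pol b) n.+1 - 'X) = (d.+1 ^ n.+1).+1 /\ c <= nm (lead_coef (itp (pol b) n.+1 - 'X)).
  move=> Ub; have [bP _] := UP Ub; have si := size_itp n.+1 (size_pol bP).
  have lt : (size (- 'X : {poly C}) < size (itp (pol b) n.+1))%N.
    rewrite si size_polyN size_polyX ltnS expnS.
    by rewrite (leq_trans _ (leq_pmulr _ _)) // expn_gt0.
  split; first by move=> y; rewrite hornerD hornerN hornerX itpE.
  by rewrite size_polyDl // lead_coefDl // hc.
have nd : exists2 m : R, 0 < m & forall b x, U b -> Per n b x -> m <= nm ((itp (pol b) n.+1)^`().[x] - 1).
  apply: contrapT => hno.
  have /choice [u hu] : forall k : nat, exists w : V * C, [/\ U w.1, Per n w.1 w.2 &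
      nm ((itp (pol w.1) n.+1)^`().[w.2] - 1) < k.+1%:R^-1].
    move=> k; apply: contrapT => hk; apply: hno; exists k.+1%:R^-1; first by rewrite invr_gt0 ltr0n.
    move=> b x Ub Pb; rewrite leNgt; apply/negP => hh; apply: hk; exists (b, x); split=> //.
  have cK : compact ([set b : V | nm (b - a) <= rho] `*` [set x : C | nm x <= M]).
    by apply: compact_setX; [exact: compact_rdisc|exact: compact_disc].
  have uS k : S M (u k) by have [h1 h2 _] := hu k; split=> //; exact: ltW (PerM h1 h2).
  have [w Sw hw] := compact_cluster (cK : compact (S M)) uS.
  have lim f : qd (S M) f -> forall c0, (forall k, nm (f (u k) - c0) <= k.+1%:R^-1) -> f w = c0.
    move=> qf c1 hf; apply: (qd_limit qf Sw) => e e0; have [N hN] := inv_small e0.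
    have [k Nk hk] := hw _ N e0; exists (u k); split=> //.
    by rewrite (le_trans (hf k)) // ltW // hN.
  have Pw : Per n w.1 w.2.
    have := lim (Fp n) (ex_intro _ l (ex_intro _ B q)) 0 _; rewrite /Per => h.
    apply/eqP; rewrite -subr_eq0; apply/eqP/h => k; have [_ h2 _] := hu k.
    by rewrite /Fp h2 subrr subr0 nm0 invr_ge0 ler0n.
  have := lim _ (qd_mult a rho M n.+1) 1 _ => h.
  have /eqP : nm ((itp (pol w.1) n.+1)^`().[w.2]) = 1.
    by rewrite h ?nm1 // => k; have [_ _ /ltW] := hu k.
  by case: Sw => Uw _; rewrite (negbTE (NN Uw Pw)).
have [m m0 hm] := nd; exists l, B, c^-1, m; split=> //.
- by rewrite invr_ge0 ltW.
- move=> b x Ub xM; have [pE [sp lp]] := poly b Ub.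
  have [|y y0 hy] := @root_near _ (itp (pol b) n.+1 - 'X) x; first by rewrite sp ltnS expn_gt0.
  have Fy : Fp n (b, y) = 0 by rewrite pE.
  exists y; split=> //; first exact: ltW (PerM Ub (Fp0P Fy)).
  rewrite sp /= in hy; rewrite pE mulrC ler_pdivlMr // mulrC; apply: le_trans hy.
  by rewrite ler_wpM2r ?exprn_ge0 ?nm_ge0.
- move=> b x Ub xM /Fp0P Px; have [pE _] := poly b Ub.
  rewrite (quad_dx q Ub _ pE); last exact: PerM Px.
  by rewrite derivD derivN derivX hornerD hornerN hornerC hm.
Qed.

Let Ucvx (b b' : V) t : U b -> U b' -> 0 <= t <= 1 -> U (b + rc t *: (b' - b)).
Proof. by move=> hb hb' ht; exact: ball_convex. Qed.
Let Udiam (b b' : V) : U b -> U b' -> nm (b' - b) <= 2 * rho.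
Proof. by rewrite /U /= => h h'; have := nm_tri a b' b; rewrite [nm (a - b)]nmB; lra. Qed.

Definition Sec (s : V -> C) := qd U s /\ exists n, forall b, U b -> Per n b (s b).

Lemma Sec_exists n b0 x : U b0 -> Per n b0 x -> exists2 s, Sec s & s b0 = x.
Proof.
move=> Ub0 Px; have [l [B [A [m [q A0 hr m0 hm]]]]] := per_roots n; have R1 := Rd1.
have r0 : isroot U M (Fp n) b0 x.
  by split=> //; [exact: ltW (PerM Ub0 Px)|exact: Fp0].
have [|s [s0 sr sq]] := sec_exists Ucvx Udiam q _ A0 hr m0 hm r0; first by rewrite expn_gt0.
exists s => //; split=> //; by exists n => b /sr[_ _ /Fp0P].
Qed.

Lemma Sec_bound s b : Sec s -> U b -> nm (s b) <= Rd.
Proof. by move=> [_ [n hn]] Ub; apply: Per_bound (hn _ Ub). Qed.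

(** Both sections are read in a common period, where distinct roots are uniformly separated. *)
Lemma Sec_pair s t : Sec s -> Sec t -> (exists2 b1, U b1 & s b1 = t b1) \/
    (exists2 k : R, 0 < k & forall b, U b -> k <= nm (s b - t b)).
Proof.
move=> [sq [n hn]] [tq [m hm]].
have [h|hno] := pselect (exists2 b1, U b1 & s b1 = t b1); [by left|right].
have [N eN] : exists N, (n.+1 * m.+1 = N.+1)%N by exists (n.+1 * m.+1).-1; rewrite prednK ?muln_gt0.
have [l [B [A [k [q A0 hr k0 hk]]]]] := per_roots N; have R1 := Rd1.
have rs b : U b -> isroot U M (Fp N) b (s b).
  move=> Ub; split=> //; first exact: ltW (PerM Ub (hn _ Ub)).
  by apply: Fp0; rewrite /Per -eN mulnC; exact: Per_mul (hn _ Ub).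
have rt b : U b -> isroot U M (Fp N) b (t b).
  move=> Ub; split=> //; first exact: ltW (PerM Ub (hm _ Ub)).
  by apply: Fp0; rewrite /Per -eN; exact: Per_mul (hm _ Ub).
have B0 : 0 <= B by case: q.
exists (k / (B + 1)) => [|b Ub]; first by rewrite divr_gt0 //; lra.
rewrite leNgt; apply/negP => h; apply: hno; exists b => //; symmetry.
exact: (sec_sep q k0 hk (rt _ Ub) (rs _ Ub) h).
Qed.

Lemma Sec_unique s t b1 b : Sec s -> Sec t -> U b1 -> s b1 = t b1 -> U b -> s b = t b.
Proof.
move=> [sq [n hn]] [tq [m hm]] Ub1 e Ub.
have [N eN] : exists N, (n.+1 * m.+1 = N.+1)%N by exists (n.+1 * m.+1).-1; rewrite prednK ?muln_gt0.
have [l [B [A [k [q A0 hr k0 hk]]]]] := per_roots N; have R1 := Rd1.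
have rs c : U c -> isroot U M (Fp N) c (s c).
  move=> Uc; split=> //; first exact: ltW (PerM Uc (hn _ Uc)).
  by apply: Fp0; rewrite /Per -eN mulnC; exact: Per_mul (hn _ Uc).
have rt c : U c -> isroot U M (Fp N) c (t c).
  move=> Uc; split=> //; first exact: ltW (PerM Uc (hm _ Uc)).
  by apply: Fp0; rewrite /Per -eN; exact: Per_mul (hm _ Uc).
have [l1 [K1 [K10 _ _ _ L1]]] := sq; have [l2 [K2 [K20 _ _ _ L2]]] := tq.
apply: (sec_unique Ucvx Udiam q k0 hk (K := K1 + K2) _ rs rt _ _ Ub1 Ub e); first lra.
  by move=> b' b'' h h'; have [h1 _] := L1 _ _ h h'; rewrite (le_trans h1) // ler_wpM2r ?nm_ge0 //; lra.
by move=> b' b'' h h'; have [h1 _] := L2 _ _ h h'; rewrite (le_trans h1) // ler_wpM2r ?nm_ge0 //; lra.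
Qed.

(* the K-th root of a zero-free difference of sections, and the Cauchy estimate for it *)
Lemma Sec_root s t K : (0 < K)%N -> Sec s -> Sec t ->
  (exists2 k : R, 0 < k & forall b, U b -> k <= nm (s b - t b)) ->
  exists2 g : V -> C, (forall b, U b -> g b ^+ K = (s b - t b) / rc (2 * Rd)) &
    forall b b', nm (b - a) <= rho / 8 -> nm (b' - a) <= rho / 8 -> nm (g b' - g b) <= 2^-1.
Proof.
move=> K0 Ss St [k k0 hk]; have R1 := Rd1; have r0 := rho0.
pose D b := (s b - t b) / rc (2 * Rd).
have Dn b : nm (D b) = nm (s b - t b) / (2 * Rd) by rewrite /D nm_div nm_rc gtr0_norm //; lra.
have D1 b : U b -> nm (D b) <= 1.
  move=> Ub; rewrite Dn ler_pdivrMr ?mul1r; last lra.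
  by have := nmBD (s b) (t b); have := Sec_bound Ss Ub; have := Sec_bound St Ub; lra.
have Dk b : U b -> k / (2 * Rd) <= nm (D b).
  by move=> Ub; rewrite Dn ler_wpM2r ?invr_ge0 ?hk //; lra.
pose F (w : V * C) := w.2 ^+ K - D w.1.
have qF : qd (S 2) F.
  apply: qd_sub; first by apply: qd_exp; exact: qd_snd.
  apply: qd_mul; last exact: qd_cst.
  by apply: qd_sub; [apply: qd_fst; case: Ss|apply: qd_fst; case: St].
have [l [B q]] := qF.
have poly b y : F (b, y) = ('X^K - (D b)%:P).[y] by rewrite hornerD hornerN hornerXn hornerC.
have rt1 b y : U b -> F (b, y) = 0 -> nm y ^+ K = nm (D b) /\ nm y <= 1.
  move=> Ub /eqP; rewrite subr_eq0 => /eqP /= e; rewrite -nmX e; split=> //.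
  by rewrite -(expr_le1 K0) ?nm_ge0 // -nmX e D1.
have hr b x : U b -> nm x <= 2 -> exists y, [/\ nm y <= 2, F (b, y) = 0 & nm (x - y) ^+ K <= 1 * nm (F (b, x))].
  move=> Ub xM; have [|y y0 hy] := @root_near _ ('X^K - (D b)%:P) x; first by rewrite size_XnsubC.
  rewrite -poly in y0; exists y; split=> //; first by have [_ h] := rt1 _ _ Ub y0; rewrite (le_trans h) // ler1n.
  by rewrite size_XnsubC // lead_coefXnsubC // nm1 !mul1r in hy *; rewrite poly.
(* The derivative [K x ^+ K.-1] is at least [nm x ^+ K = nm (D b)] in modulus, as [nm x <= 1]. *)
have hm b x : U b -> nm x <= 2 -> F (b, x) = 0 -> k / (2 * Rd) <= nm (l (b, x) (0, 1)).
  move=> Ub _ e; have [e1 e2] := rt1 _ _ Ub e.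
  rewrite (quad_dx q Ub _ (poly b)); last by rewrite (le_lt_trans e2) // ltr1n.
  have -> : ('X^K - (D b)%:P)^`().[x] = K%:R * x ^+ K.-1 by rewrite derivB derivC subr0 derivXn hornerMn hornerXn mulr_natl.
  rewrite nmM nm_nat nmX.
  apply: le_trans (Dk _ Ub) _; rewrite -e1 -{1}(prednK K0) exprS.
  have p0 : 0 <= nm x ^+ K.-1 by rewrite exprn_ge0 ?nm_ge0.
  rewrite ler_wpM2r // (le_trans e2) // ler1n.
  done.
have m0 : 0 < k / (2 * Rd) by rewrite divr_gt0 //; lra.
have Ua : U a by rewrite /U /= subrr nm0 ltW.
have [y [y2 Fy _]] := hr a 0 Ua (ltac:(by rewrite nm0; lra)).
have ry : isroot U 2 F a y by [].
have [g [_ gr gq]] := sec_exists Ucvx Udiam q K0 ler01 hr m0 hm ry.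
exists g; first by move=> b /gr[_ _ /eqP]; rewrite subr_eq0 => /eqP.
move=> b b' hb hb'; have [l' [B' q']] := gq.
have g1 w : U w -> nm (g w) <= 1 by move=> Uw; have [_ _ h] := gr _ Uw; have [] := rt1 _ _ Uw h.
have := @unif_lip R V a rho g l' B' 1 rho0 q' g1 b b'.
have : nm (b' - b) <= rho / 4 by have := nm_tri a b' b; rewrite [nm (a - b)]nmB; lra.
move=> h1 /(_ (ltac:(lra)) (ltac:(lra))) h2; apply: le_trans h2 _.
rewrite mulr1 mulrAC ler_pdivrMr //; lra.
Qed.

(** The equicontinuity behind the lambda-lemma, through roots of high order. If two sections never
    meet, the [K]-th root [g] of their normalised difference is holomorphic of modulus at most 1, so
    it varies by at most [1 / 2] on the smaller ball, whatever [K] is. Hence [nm (g b) < 1 / 4]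
    forces [nm (g b') <= 3 / 4], and [(3 / 4) ^+ K] is as small as desired. *)
Lemma Sec_lambda (e : R) : 0 < e -> exists2 del : R, 0 < del & forall s t, Sec s -> Sec t ->
  forall b b', nm (b - a) <= rho / 8 -> nm (b' - a) <= rho / 8 ->
  nm (s b - t b) < del -> nm (s b' - t b') < e.
Proof.
move=> e0; have R1 := Rd1; have r0 := rho0; have R2 : 0 < 2 * Rd by lra.
have [K hK] := @pow_small R (3 / 4) (e / (2 * Rd)) (ltac:(lra)) (divr_gt0 e0 R2).
have {}hK := hK K.+1 (leqnSn _).
exists ((1 / 4) ^+ K.+1 * (2 * Rd)); first by rewrite mulr_gt0 // exprn_gt0 //; lra.
move=> s t Ss St b b' hb hb' h.
have Ub : U b by rewrite /U /=; lra.
have Ub' : U b' by rewrite /U /=; lra.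
have [[b1 Ub1 e1]|hk] := Sec_pair Ss St.
  by rewrite (Sec_unique Ss St Ub1 e1 Ub') subrr nm0.
have [g hg glip] := Sec_root (ltn0Sn K) Ss St hk.
have gE c : U c -> nm (g c) ^+ K.+1 * (2 * Rd) = nm (s c - t c).
  by move=> Uc; rewrite -nmX hg // nm_div nm_rc gtr0_norm // divfK // gt_eqF.
have g1 : nm (g b) < 1 / 4.
  have q4 : 0 <= 1 / 4 :> R by rewrite divr_ge0.
  rewrite -(ltr_pXn2r (ltn0Sn K)) ?nnegrE ?nm_ge0 //.
  by rewrite -(ltr_pM2r R2) gE.
have g2 : nm (g b') <= 3 / 4.
  by have := glip _ _ hb hb'; have := nm_lo (g b') (g b); lra.
rewrite -gE // -ltr_pdivlMr //; apply: le_lt_trans hK.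
by rewrite lerXn2r ?nnegrE ?nm_ge0 //; lra.
Qed.
End NoNeutral.

(** * Attracting cycles, and discs with bounded orbits *)

Lemma nat_id1 (l k n m : nat) : ((l + (k * m + l * m) + k) * n.+1 = ((l + k) * n.+1) * m.+1)%N.
Proof. by nia. Qed.

Section Attracting.
Variable R : realType.
Local Notation C := (Cplx R).
Implicit Types (q f : {poly C}) (x y z u : C).

Lemma poly_mvt f x y (K : R) : (forall t : R, 0 <= t <= 1 -> nm (f^`()).[x + rc t * (y - x)] <= K) ->
  nm (f.[y] - f.[x]) <= K * nm (y - x).
Proof.
move=> hK; pose M := nm x + nm (y - x).
pose T := [set w : C | nm w <= M].
have [B1 B10 h1] := poly_quad f M; have [B2 B20 h2] := poly_lip f M.
have [B3 B30 h3] := nm_horner_le f M; have [B4 B40 h4] := nm_horner_le f^`() M.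
have q : quad T (fun x => f.[x]) (fun x h => f^`().[x] * h) (B1 + B2 + B3 + B4).
  split=> [|w hw|w hw h|w hw c h h'|w w' hw hw'].
  - by move: B10 B20 B30 B40; xlra.
  - by rewrite (le_trans (h3 _ hw)) //; move: B10 B20 B30 B40; xlra.
  - by rewrite nmM ler_wpM2r ?nm_ge0 // (le_trans (h4 _ hw)) //; move: B10 B20 B30 B40; xlra.
  - rewrite mulrDr; congr (_ + _); rewrite mulrCA; congr (_ * _).
  - split; [rewrite (le_trans (h2 _ _ hw hw'))|rewrite (le_trans (h1 _ _ hw hw'))] => //;
      rewrite ler_wpM2r ?exprn_ge0 ?nm_ge0 //; move: B10 B20 B30 B40; xlra.
apply: (quad_lip q) => t ht.
  rewrite /T /= (le_trans (nmD _ _)) // lerD2l nmZ nm_rc.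
  by case/andP: ht => t0 t1; rewrite ger0_norm // ler_piMl ?nm_ge0.
by rewrite nmM ler_wpM2r ?nm_ge0 // hK.
Qed.

Lemma itp_deriv_fixed q m k x : it q m x = x -> (itp q (k * m))^`().[x] = (itp q m)^`().[x] ^+ k.
Proof.
move=> e; rewrite -itp_it itp_deriv.
have fx j : it (itp q m) j x = x by elim: j => //= j ->; rewrite itpE.
by rewrite (eq_bigr (fun=> (itp q m)^`().[x])) ?prodr_const ?card_ord // => j _; rewrite fx.
Qed.

Lemma it_fixed q m k x : it q m x = x -> it q (k * m) x = x.
Proof. by move=> e; rewrite itM; elim: k => //= k ->. Qed.

Lemma per_bounded q n x : it q n.+1 x = x -> bounded_orbit q x.
Proof.
move=> e; exists (\sum_(j < n.+1) nm (it q j x)) => k.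
rewrite (divn_eq k n.+1) addnC itD (it_fixed _ e).
have h : (k %% n.+1 < n.+1)%N by rewrite ltn_mod.
by rewrite (bigD1 (Ordinal h)) //= lerDl sumr_ge0 // => j _; exact: nm_ge0.
Qed.

Lemma basin q n x : it q n.+1 x = x -> nm (itp q n.+1)^`().[x] < 1 ->
  exists (r th : R), [/\ 0 < r, 0 <= th < 1 & forall u, nm (u - x) < r -> forall k,
    nm (it q (k * n.+1) u - x) <= th ^+ k * nm (u - x)].
Proof.
move=> e mu1; set mu := nm _ in mu1; have mu0 : 0 <= mu := nm_ge0 _.
have [B B0 hB] := poly_quad (itp q n.+1) (nm x + 1).
pose th := (1 + mu) / 2; have th1 : 0 <= th < 1 by rewrite /th; move: mu0 mu1; xlra.
pose r := Num.min 1 ((1 - mu) / 2 / B).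
have r0 : 0 < r by rewrite lt_min ltr01 divr_gt0 //; move: mu1; xlra.
have r1 : r <= 1 by rewrite ge_min lexx.
have rB : B * r <= (1 - mu) / 2.
  have : r <= (1 - mu) / 2 / B by rewrite ge_min lexx orbT.
  by rewrite ler_pdivlMr // mulrC.
have stp u : nm (u - x) < r -> nm (it q n.+1 u - x) <= th * nm (u - x).
  move=> hu; have ux : nm u <= nm x + 1.
    by have := nm_lo u x; move: hu r1; xlra.
  have := hB x u (ltac:(by rewrite lerDl)) ux; rewrite !itpE e => h.
  have -> : it q n.+1 u - x = (it q n.+1 u - x - (itp q n.+1)^`().[x] * (u - x)) + (itp q n.+1)^`().[x] * (u - x) by ring.
  rewrite (le_trans (nmD _ _)) // nmM -/mu.
  have n0 := nm_ge0 (u - x); move: h hu rB n0 B0; rewrite /th; set t := nm (u - x).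
  rewrite expr2 => h hu rB n0 B0.
  have : B * (t * t) <= (1 - mu) / 2 * t.
    rewrite mulrA ler_wpM2r //; apply: le_trans rB; by rewrite ler_wpM2l // ltW.
  lra.
exists r, th; split=> // u hu; elim=> [|k ih]; first by rewrite mul0n expr0 mul1r.
have th1k : th ^+ k <= 1 by case/andP: th1 => t0 /ltW; exact: exprn_ile1.
rewrite mulSn itD exprS -mulrA; apply: le_trans (stp _ _) _.
  by apply: le_lt_trans hu; apply: le_trans ih _; rewrite ler_piMl ?nm_ge0.
by rewrite ler_wpM2l //; case/andP: th1.
Qed.

Lemma attr_interior q n x : it q n.+1 x = x -> nm (itp q n.+1)^`().[x] < 1 ->
  exists2 r : R, 0 < r & forall u, nm (u - x) < r -> bounded_orbit q u.
Proof.
move=> e mu1; have [r [th [r0 th1 h]]] := basin e mu1; exists r => // u hu.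
have /choice [B hB] : forall j, exists B, forall v, nm v <= nm x + r -> nm (it q j v) <= B.
  by move=> j; have [B _ hB] := nm_horner_le (itp q j) (nm x + r); exists B => v /hB; rewrite itpE.
exists (\sum_(j < n.+1) `|B j|) => k; rewrite (divn_eq k n.+1) addnC itD.
have hk : (k %% n.+1 < n.+1)%N by rewrite ltn_mod.
rewrite (bigD1 (Ordinal hk)) //=.
apply: le_trans (_ : `|B (k %% n.+1)%N| <= _); last by rewrite lerDl sumr_ge0.
apply: le_trans (ler_norm _); apply: hB.
have h1 := h _ hu (k %/ n.+1)%N.
have := nm_lo (it q (k %/ n.+1 * n.+1) u) x.
have : th ^+ (k %/ n.+1) * nm (u - x) <= nm (u - x).
  by rewrite ler_piMl ?nm_ge0 //; case/andP: th1 => t0 /ltW; exact: exprn_ile1.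
by move: h1 hu; xlra.
Qed.

Section Disc.
Variables (q : {poly C}) (y : C) (Rr Rd : R).
Hypothesis R0 : 0 < Rr.
Hypothesis hK : forall u, nm (u - y) < Rr -> forall n, nm (it q n u) <= Rd.

Lemma disc_deriv k u : nm (u - y) <= Rr / 2 -> nm (itp q k)^`().[u] <= Rd / (Rr / 4).
Proof.
move=> hu; have r0 := R0; rewrite ler_pdivlMr ?divr_gt0 //; apply: poly_cauchy; first by rewrite divr_gt0.
move=> x hx; rewrite itpE; apply: hK; have := nm_tri u x y.
by move: hx hu r0; xlra.
Qed.

Lemma disc_lip k u v : nm (u - y) <= Rr / 2 -> nm (v - y) <= Rr / 2 ->
  nm (it q k v - it q k u) <= Rd / (Rr / 4) * nm (v - u).
Proof.
move=> hu hv; rewrite -!itpE; apply: poly_mvt => t ht; apply: disc_deriv.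
exact: (ball_convex ht hu hv).
Qed.

(** By the Cauchy estimate the derivatives of all iterates are bounded on the smaller disc, whereas
    those at a repelling cycle grow without bound. *)
Lemma disc_nonrep n x : nm (x - y) <= Rr / 2 -> it q n.+1 x = x -> nm (itp q n.+1)^`().[x] <= 1.
Proof.
move=> hx e; rewrite leNgt; apply/negP => h.
have [k /(_ k (leqnn _))] := pow_large (Rd / (Rr / 4)) h.
have := disc_deriv (k * n.+1) hx; rewrite itp_deriv_fixed // nmX; move: (nm _ ^+ k) (Rd / _) => X Y.
by xlra.
Qed.

(** Bounded orbits make the iterates equicontinuous on the disc, so attraction to [x] spreads along
    the segment to [x'], from each point of a fine subdivision to the next. Then [x'] is both
    periodic and attracted by [x]. *)
Lemma disc_unique n x n' x' : nm (x - y) <= Rr / 2 -> nm (x' - y) <= Rr / 2 ->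
  it q n.+1 x = x -> it q n'.+1 x' = x' -> nm (itp q n.+1)^`().[x] < 1 -> x' = x.
Proof.
move=> hx hx' e e' mu1; have [r [th [r0 /andP[t0 t1] hb]]] := basin e mu1.
pose L := Rd / (Rr / 4).
have L0 : 0 <= L.
  apply: divr_ge0; last by rewrite divr_ge0 // ltW.
  by apply: le_trans (hK (u := y) _ 0%N); rewrite ?nm_ge0 // subrr nm0.
pose conv u := exists k, nm (it q (k * n.+1) u - x) < r.
have D1 : 0 < L * nm (x' - x) + 1 by rewrite ltr_wpDl // mulr_ge0 ?nm_ge0.
have r2 : 0 < r / 2 by rewrite divr_gt0.
have [N /(_ N (leqnn _)) hN] := inv_small (divr_gt0 r2 D1).
pose p j := x + rc (j%:R / N.+1%:R) * (x' - x).
have pin j : (j <= N.+1)%N -> nm (p j - y) <= Rr / 2.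
  move=> hj; apply: ball_convex => //.
  by rewrite divr_ge0 ?ler0n //= ler_pdivrMr ?ltr0n // mul1r ler_nat.
have pc j : (j <= N.+1)%N -> conv (p j).
  elim: j => [_|j ih hj].
    by exists 0%N; rewrite /p mul0r rc0 mul0r addr0 mul0n subrr nm0.
  have [k hk] := ih (ltnW hj).
  have [l /(_ l (leqnn _)) hl] := @pow_small _ th (2^-1) (ltac:(by rewrite t0 t1)) (ltac:(by rewrite invr_gt0)).
  have h1 := hb _ hk l; exists (l + k)%N; rewrite mulnDl.
  have h2 := disc_lip (l * n.+1 + k * n.+1) (pin _ (ltnW hj)) (pin _ hj).
  have ps : nm (p j.+1 - p j) = nm (x' - x) / N.+1%:R.
    have -> : p j.+1 - p j = rc N.+1%:R^-1 * (x' - x).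
      rewrite /p -[j.+1%:R]natr1 mulrDl mul1r rcD; ring.
    by rewrite nmM nm_rc ger0_norm ?invr_ge0 ?ler0n // mulrC.
  rewrite ps -/L in h2; have := nm_tri (it q (l * n.+1 + k * n.+1) (p j)) (it q (l * n.+1 + k * n.+1) (p j.+1)) x.
  rewrite -itD in h1; move=> h3.
  have h4 : th ^+ l * nm (it q (k * n.+1) (p j) - x) <= 2^-1 * r.
    by apply: ler_pM; rewrite ?exprn_ge0 ?nm_ge0 // ltW.
  have h5 : L * (nm (x' - x) / N.+1%:R) < r / 2.
    move: hN; rewrite ltr_pdivlMr // mulrDr mulr1 => hN; apply: le_lt_trans hN.
    have : 0 < N.+1%:R^-1 :> R by rewrite invr_gt0 ltr0n.
    by move: (N.+1%:R^-1) (nm (x' - x)) => X Y; xlra.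
  apply: le_lt_trans h3 _; apply: le_lt_trans (lerD h2 (le_trans h1 h4)) _.
  by move: (L * _) h5 => X; xlra.
have [k hk] : conv x' by have := pc _ (leqnn _); rewrite /p divff ?pnatr_eq0 // mul1r addrC subrK.
apply/eqP; rewrite -subr_eq0; apply/eqP/nm_small0 => e0 e00.
have [l hl] := @pow_small _ th (e0 / r) (ltac:(by rewrite t0 t1)) (divr_gt0 e00 r0).
(* The number of turns makes the total time a multiple of both periods: [x'] is back at itself while
   its distance to [x] has contracted below [e0]. *)
have := hb _ hk (l + (k * n' + l * n'))%N; rewrite -itD -mulnDl.
rewrite nat_id1.
rewrite it_fixed // => h; apply: le_trans h _.
have h6 := hl (l + (k * n' + l * n'))%N (leq_addr _ _).
apply: le_trans (_ : e0 / r * r <= _); last by rewrite divfK // gt_eqF.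
by apply: ler_pM; rewrite ?exprn_ge0 ?nm_ge0 // ltW.
Qed.
End Disc.
End Attracting.

(** * The Julia set as a closure of periodic points *)

Section JuliaChar.
Variables (R : realType) (d : nat).
Local Notation C := (Cplx R).
Local Notation V := 'rV[C]_d.+2.
Variables (b : V) (Rd : R).
Hypothesis d0 : (0 < d)%N.
Hypothesis bP : inPd b.
Hypothesis Rd1 : 1 <= Rd.
Hypothesis esc : forall x, Rd <= nm x -> 2 * nm x <= nm (pol b).[x].
Hypothesis NN : forall n x, it (pol b) n.+1 x = x -> nm ((itp (pol b) n.+1)^`().[x]) != 1.

Definition perclos (b : V) (z : C) := forall e : R, 0 < e -> exists n x, Per n b x /\ nm (x - z) < e.
Definition attr (b : V) (z : C) := exists n, Per n b z /\ nm (itp (pol b) n.+1)^`().[z] < 1.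

Lemma nbhs_nm (z : C) (A : set C) : nbhs z A <-> exists2 e : R, 0 < e & forall y, nm (y - z) < e -> A y.
Proof.
split=> [/nbhs_normP[e /= /pos_rc[e' e0 ->] h]|[e e0 h]].
  by exists e' => // y hy; apply: h; rewrite /ball_ /= nm_lt nmB.
have e0' : 0 < rc e by rewrite -rc0 rc_lt.
by apply: filterS (nbhsx_ballx z _ e0') => y; rewrite -ball_normE /= nm_lt nmB; exact: h.
Qed.

(** Near a boundary point of the filled Julia set some orbit escapes, and [hit] with [tau = 'X]
    yields periodic points; attracting ones are interior. Conversely a limit [z] of periodic points
    is in the closure. Were it interior, the periodic points near it would be attracting, since none
    is neutral, hence all equal by [disc_unique], and [z] would be that point. *)
Lemma juliaP z : julia b z <-> perclos b z /\ ~ attr b z.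
Proof.
have bo u := bounded_orbitP u Rd1 esc.
split=> [[cz nz]|[cz nat]].
  have Kz : bounded_orbit (pol b) z.
    apply/bo => n; apply/ler_addgt0Pl => e e0.
    have [B B0 hB] := poly_lip (itp (pol b) n) (nm z + 1).
    have B1 : 0 < B + 1 by rewrite ltr_wpDl // ltW.
    have e1 : 0 < Num.min 1 (e / (B + 1)) by rewrite lt_min ltr01 divr_gt0.
    have [|y [/filledJuliaP/bo Ky hy]] := cz [set y | nm (y - z) < Num.min 1 (e / (B + 1))].
      by apply/nbhs_nm; exists (Num.min 1 (e / (B + 1))).
    move: hy; rewrite /= lt_min => /andP[y1 y2].
    have := hB y z (ltac:(have := nm_lo y z; move: y1; xlra)) (ltac:(by rewrite lerDl)).
    rewrite !itpE => h; have := nm_lo (it (pol b) n z) (it (pol b) n y); have := Ky n.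
    move: y2; rewrite ltr_pdivlMr // => y2; rewrite [nm (z - y)]nmB in h.
    by have := nm_ge0 (y - z); move: h y2 B0; xlra.
  split=> [e e0|[n [Pz mz]]]; last first.
    apply: nz; have [r r0 h] := attr_interior Pz mz; apply/nbhs_nm; exists r => // y /h.
    by move/filledJuliaP.
  have [x0 [x0e nx0]] : exists x0, nm (x0 - z) < e /\ ~ bounded_orbit (pol b) x0.
    apply: contrapT => hno; apply: nz; apply/nbhs_nm; exists e => // y hy; apply/filledJuliaP.
    by apply: contrapT => hb; apply: hno; exists y.
  apply: contrapT => hno.
  have [||n [y [hy ey]]] := @hit R (pol b) d 'X z x0 e d0 (size_pol bP) _ Kz nx0 x0e.
  - by rewrite size_polyX.
  - move=> y hy i; apply/eqP; rewrite hornerX => ey; apply: hno; exists i, y; split=> //.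
  - by apply: hno; exists n, y; split=> //; rewrite hornerX in ey.
split.
  move=> A /nbhs_nm[e e0 hA]; have [n [x [Px hx]]] := cz _ e0; exists x; split; last exact: hA.
  by apply/filledJuliaP; exact: per_bounded Px.
move=> /nbhs_nm[e e0 hA]; apply: nat.
have hK u : nm (u - z) < e -> forall n, nm (it (pol b) n u) <= Rd.
  by move=> /hA /filledJuliaP/bo.
have e2 : 0 < e / 2 by rewrite divr_gt0.
have [n [x [Px hx]]] := cz _ e2.
have m1 : nm (itp (pol b) n.+1)^`().[x] < 1.
  rewrite lt_neqAle NN //=; exact: (disc_nonrep e0 hK (ltW hx) Px).
exists n; suff <- : x = z by [].
apply/eqP; rewrite -subr_eq0; apply/eqP/nm_small0 => e' e'0.
have e3 : 0 < Num.min e' (e / 2) by rewrite lt_min e'0 e2.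
have [n' [x' [Px' ]]] := cz _ e3; rewrite lt_min => /andP[h1 h2].
by rewrite -(disc_unique e0 hK (ltW hx) (ltW h2) Px Px' m1) ltW.
Qed.

Lemma attr_period n m z : Per n b z -> Per m b z ->
  nm (itp (pol b) m.+1)^`().[z] < 1 -> nm (itp (pol b) n.+1)^`().[z] < 1.
Proof.
move=> Pn Pm h.
have := itp_deriv_fixed m.+1 Pn; have := itp_deriv_fixed n.+1 Pm; rewrite mulnC => -> /(congr1 (@nm R C)).
rewrite !nmX => e; rewrite ltNge; apply/negP => h1.
have : 1 <= nm (itp (pol b) n.+1)^`().[z] ^+ m.+1 by exact: exprn_ege1.
rewrite -e leNgt exprS => /negP; apply.
have h' := ltW h.
by apply: le_lt_trans h; rewrite ler_piMr ?nm_ge0 // exprn_ile1 ?nm_ge0.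
Qed.
End JuliaChar.

(** * Holomorphic motion of the Julia set *)

Section Stability.
Variables (R : realType) (d : nat).
Local Notation C := (Cplx R).
Local Notation V := 'rV[C]_d.+2.
Variables (a : V) (rho Rd beta : R).
Hypothesis d0 : (0 < d)%N.
Hypothesis rho0 : 0 < rho.
Hypothesis Rd1 : 1 <= Rd.
Hypothesis beta0 : 0 < beta.
Let U := [set b : V | nm (b - a) <= rho].
Hypothesis UP : forall b, U b -> inPd b /\ beta <= nm (b ord0 ord_max).
Hypothesis Uesc : forall b, U b -> forall x, Rd <= nm x -> 2 * nm x <= nm (pol b).[x].
Hypothesis NN : forall b, U b -> forall n x, it (pol b) n.+1 x = x ->
  nm ((itp (pol b) n.+1)^`().[x]) != 1.
Let W := [set b : V | nm (b - a) <= rho / 8].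
Let WU b : W b -> U b. Proof. by rewrite /W /U /=; have := rho0; lra. Qed.
Local Notation Sec := (Sec a rho).

Lemma lip_continuous (f : R -> R) (L : R) : (forall x y, `|f x - f y| <= L * `|x - y|) -> continuous f.
Proof.
move=> h x; apply/cvgrPdist_lt => e e0; have L0 : 0 < `|L| + 1 by rewrite ltr_wpDl.
apply/nbhs_normP; exists (e / (`|L| + 1)) => [|y] /=; first by rewrite divr_gt0.
rewrite ltr_pdivlMr // mulrC => hy; apply: le_lt_trans (h _ _) _; apply: le_lt_trans hy.
by rewrite ler_wpM2r // (le_trans (ler_norm _)) // lerDl.
Qed.

(** Along the segment from [b] to [b'] the modulus of the multiplier is continuous and never 1, so
    it stays on the same side. [clamp] retracts the line onto [[0, 1]], which makes the path defined
    on all of [R]. *)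
Lemma Sec_attr s b b' : Sec s -> U b -> U b' -> attr b (s b) -> attr b' (s b').
Proof.
move=> Ss Ub Ub' [m [Pm hm]]; have [[l [K [K0 _ _ _ hL]]] [n hn]] := Ss.
have h0 := attr_period (hn _ Ub) Pm hm; exists n; split; first exact: hn.
have [l' [B [B0 _ _ _ hB]]] := qd_mult a rho (Rd + 1) n.+1.
pose clamp (t : R) := (`|t| - `|t - 1| + 1) / 2.
have c01 t : 0 <= clamp t <= 1.
  have := ler_dist_dist t (t - 1); rewrite (_ : t - (t - 1) = 1) ?normr1 ?ler_norml; last by ring.
  rewrite ?ler_norml => /andP[h1 h2].
  by rewrite /clamp; apply/andP; split; move: h1 h2; xlra.
have clip t t' : `|clamp t' - clamp t| <= `|t' - t|.
  have := ler_dist_dist t' t; have := ler_dist_dist (t' - 1) (t - 1).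
  rewrite (_ : t' - 1 - (t - 1) = t' - t); last by ring.
  rewrite !ler_norml => /andP[h1 h2] /andP[h3 h4].
  by rewrite /clamp; apply/andP; split; move: h1 h2 h3 h4; xlra.
pose bt t := b + rc (clamp t) *: (b' - b).
have Ut t : U (bt t) by exact: ball_convex.
pose phi t := nm (itp (pol (bt t)) n.+1)^`().[s (bt t)].
have cphi : continuous phi.
  apply: (@lip_continuous _ (B * (1 + K) * nm (b' - b))) => t t'.
  have St v : nm (bt v - a) <= rho /\ nm (s (bt v)) <= Rd + 1.
    by split; [exact: Ut|rewrite (le_trans (Sec_bound Rd1 Uesc Ss (Ut v))) // lerDl].
  have [h1 _] := hB (bt t', s (bt t')) (bt t, s (bt t)) (St t') (St t).
  have bb : nm (bt t - bt t') <= `|t - t'| * nm (b' - b).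
    rewrite /bt opprD addrACA subrr add0r -scalerBl -rcN -rcD nmZ nm_rc.
    by rewrite ler_wpM2r ?nm_ge0.
  have [h2 _] := hL _ _ (Ut t') (Ut t).
  have h3 : nm ((bt t, s (bt t)) - (bt t', s (bt t')) : V * C) <= (1 + K) * nm (bt t - bt t').
    rewrite nm_pair_le /= mulrDl mul1r; have := nm_ge0 (bt t - bt t').
    have : 0 <= K * nm (bt t - bt t') by rewrite mulr_ge0 ?nm_ge0.
    by move=> k1 k2; apply/andP; split; move: h2 k1 k2; xlra.
  have h4 : `|phi t - phi t'| <= nm ((itp (pol (bt t)) n.+1)^`().[s (bt t)] - (itp (pol (bt t')) n.+1)^`().[s (bt t')]).
    rewrite ler_norml lerNl opprB; apply/andP; split; last exact: nm_lo.
    by rewrite [leRHS]nmB; exact: nm_lo.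
  apply: le_trans h4 _; apply: le_trans h1 _; rewrite -!mulrA ler_wpM2l //.
  apply: le_trans h3 _; rewrite ler_wpM2l ?addr_ge0 //.
  by rewrite mulrC [leRHS]mulrC in bb *.
have e0 : phi 0 = nm (itp (pol b) n.+1)^`().[s b].
  rewrite /phi /bt /clamp (_ : (`|0| - `|0 - 1| + 1) / 2 = 0 :> R) ?rc0 ?scale0r ?addr0 //.
  by rewrite normr0 !sub0r normrN normr1 addNr mul0r.
have e1 : phi 1 = nm (itp (pol b') n.+1)^`().[s b'].
  rewrite /phi /bt /clamp (_ : (`|1| - `|1 - 1| + 1) / 2 = 1 :> R) ?rc1 ?scale1r.
    by rewrite addrC subrK.
  by rewrite subrr normr0 normr1 subr0 divff // pnatr_eq0.
rewrite -e1 ltNge; apply/negP => h1.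
have [||c _ hc] := @IVT R phi 0 1 1 ler01; first exact: continuous_subspaceT.
  by rewrite e0 ge_min ltW //= le_max h1 orbT.
by have := NN (Ut c) (hn _ (Ut c)); rewrite -/(phi c) hc eqxx.
Qed.

Lemma Sec_near b z (e : R) : U b -> perclos b z -> 0 < e -> exists2 s, Sec s & nm (s b - z) < e.
Proof.
move=> Ub cz e0; have [n [x [Px hx]]] := cz _ e0.
by have [s Ss sx] := Sec_exists d0 rho0 Rd1 beta0 UP Uesc NN Ub Px; exists s; rewrite ?sx.
Qed.

(** The holonomy of the lamination by periodic sections, as a relation: [z'] over [b'] is the common
    limit of the sections whose values over [b] tend to [z]. *)
Definition trans b b' z z' := forall e : R, 0 < e -> exists2 del : R, 0 < del &
  forall s, Sec s -> nm (s b - z) < del -> nm (s b' - z') < e.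

Let lam := Sec_lambda d0 rho0 Rd1 beta0 UP Uesc NN.

Lemma trans_lim b b' z z' (e : R) : 0 < e -> trans b b' z z' -> U b -> perclos b z ->
  exists s, [/\ Sec s, nm (s b - z) < e & nm (s b' - z') < e].
Proof.
move=> e0 T Ub cz; have [del del0 h] := T _ e0.
have m0 : 0 < Num.min e del by rewrite lt_min e0.
have [s Ss] := Sec_near Ub cz m0; rewrite lt_min => /andP[h1 h2].
by exists s; split=> //; exact: h.
Qed.

(** A cluster point over [b'] exists because sections are bounded; [Sec_lambda] turns it into a
    limit. *)
Lemma trans_exists b b' z : W b -> W b' -> perclos b z -> exists2 z', trans b b' z z' & perclos b' z'.
Proof.
move=> Wb Wb' cz; have Ub := WU Wb; have Ub' := WU Wb'.
have /choice [s hs] : forall k : nat, exists s, Sec s /\ nm (s b - z) < k.+1%:R^-1.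
  move=> k; have k0 : 0 < k.+1%:R^-1 :> R by rewrite invr_gt0 ltr0n.
  by have [s Ss hs] := Sec_near Ub cz k0; exists s.
have [z' _ hz'] := @compact_cluster R C _ (fun k => s k b') (@compact_disc R Rd)
  (fun k => Sec_bound Rd1 Uesc (proj1 (hs k)) Ub').
have T : trans b b' z z'.
  move=> e e0; have e2 : 0 < e / 2 by rewrite divr_gt0.
  have [del del0 hd] := lam e2; have d2 : 0 < del / 2 by rewrite divr_gt0.
  exists (del / 2) => // t St ht; have [N hN] := inv_small d2.
  have [k Nk hk] := hz' _ N e2; have [Sk hk'] := hs k.
  have h1 : nm (t b - s k b) < del.
    have := nm_tri z (t b) (s k b); rewrite [nm (z - _)]nmB; have := lt_trans hk' (hN _ Nk).
    by move: ht; xlra.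
  have := hd _ _ St Sk _ _ Wb Wb' h1; have := nm_tri (s k b') (t b') z'.
  by move: hk; xlra.
exists z' => // e e0; have [t [St _ ht]] := trans_lim e0 T Ub cz.
by have [_ [n hn]] := St; exists n, (t b'); split=> //; exact: hn.
Qed.

Lemma trans_sym b b' z z' : W b -> W b' -> perclos b z -> trans b b' z z' -> trans b' b z' z.
Proof.
move=> Wb Wb' cz T e e0; have Ub := WU Wb.
have e2 : 0 < e / 2 by rewrite divr_gt0.
have [del del0 hd] := lam e2; have d2 : 0 < Num.min (del / 2) (e / 2) by rewrite lt_min divr_gt0.
have [s0 [S0 h1 h2]] := trans_lim d2 T Ub cz; exists (del / 2); first by rewrite divr_gt0.
move=> s Ss hs; move: h1 h2; rewrite !lt_min => /andP[_ h1] /andP[h2 _].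
have h3 : nm (s b' - s0 b') < del.
  by have := nm_tri z' (s b') (s0 b'); rewrite [nm (z' - _)]nmB; move: hs h2; xlra.
have := hd _ _ Ss S0 _ _ Wb' Wb h3; have := nm_tri (s0 b) (s b) z.
by move: h1; xlra.
Qed.

Lemma trans_unique b b' z z1 z2 : U b -> perclos b z -> trans b b' z z1 -> trans b b' z z2 -> z1 = z2.
Proof.
move=> Ub cz T1 T2; apply/eqP; rewrite -subr_eq0; apply/eqP/nm_small0 => e e0.
have e2 : 0 < e / 2 by rewrite divr_gt0.
have [del del0 hd] := T2 _ e2; have m0 : 0 < Num.min (e / 2) del by rewrite lt_min e2.
have [s [Ss]] := trans_lim m0 T1 Ub cz; rewrite !lt_min => /andP[_ h1] /andP[h2 _].
have := hd _ Ss h1; have := nm_tri (s b') z1 z2; rewrite [nm (z1 - s b')]nmB.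
by move: h2; xlra.
Qed.

Lemma trans_attr b b' z z' : W b -> W b' -> perclos b z -> trans b b' z z' -> attr b' z' -> attr b z.
Proof.
move=> Wb Wb' cz T az; have Ub := WU Wb; have Ub' := WU Wb'; have [n [Pz _]] := az.
have [s Ss sx] := Sec_exists d0 rho0 Rd1 beta0 UP Uesc NN Ub' Pz.
have T' := trans_sym Wb Wb' cz T.
have <- : s b = z.
  apply/eqP; rewrite -subr_eq0; apply/eqP/nm_small0 => e e0; have [del del0 hd] := T' _ e0.
  by apply/ltW/hd => //; rewrite sx subrr nm0.
by apply: (Sec_attr Ss Ub' Ub); rewrite sx.
Qed.

(** [h] is a limit of sections that share the quadratic bound of [unif_quad]. A cluster point of
    their derivatives at [b] is then the derivative of [h], with the same remainder. *)
Lemma trans_holo (h : V -> C) z b : perclos a z -> (forall b, W b -> trans a b z (h b)) ->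
  nm (b - a) < rho / 8 -> differentiable h b.
Proof.
move=> cz hT hb; have r0 := rho0; have Wa : W a by rewrite /W /= subrr nm0 divr_ge0 // ltW.
have Ua := WU Wa; have Wb : W b by exact: ltW.
have /choice [s hs] : forall k : nat, exists s, Sec s /\ nm (s a - z) < k.+1%:R^-1.
  move=> k; have k0 : 0 < k.+1%:R^-1 :> R by rewrite invr_gt0 ltr0n.
  by have [s Ss hs] := Sec_near Ua cz k0; exists s.
have /choice [l hl] : forall k, exists l, exists B, quad U (s k) l B.
  by move=> k; have [[[l [B q]] _] _] := hs k; exists l, B.
have sM k w : U w -> nm (s k w) <= Rd by move=> Uw; exact: (Sec_bound Rd1 Uesc (proj1 (hs k)) Uw).
pose Lam k : V := \row_i l k b (delta_mx 0 i).
have lb k v : nm (l k b v) * (rho / 2) <= Rd * nm v.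
  have [B q] := hl k; apply: (@line_cauchy R V U (s k) (l k) B Rd b v (rho / 2) q) => [|w hw]; first by rewrite divr_gt0.
  have Uw : U w by have := nm_tri b w a; rewrite /U /=; move: hw hb r0; xlra.
  by split=> //; exact: sM.
have Lbd k : nm (Lam k - 0) <= Rd / (rho / 2).
  rewrite subr0; apply: nm_row_le => i; rewrite mxE ler_pdivlMr ?divr_gt0 //.
  apply: le_trans (lb _ _) _; rewrite ler_piMr ?(le_trans ler01) //.
  by apply: nm_row_le => j; rewrite !mxE eqxx /=; case: (_ == _); rewrite ?nm1 ?nm0 ?ler01.
have [lm _ hlm] := compact_cluster (@compact_rdisc R _ 0 _) Lbd.
have lE k v : l k b v = \sum_i v ord0 i * Lam k ord0 i.
  have [B q] := hl k; have [_ _ _ hlin _] := q; have Ub := WU Wb.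
  have sumE (I : eqType) (r : seq I) (F : I -> V) : l k b (\sum_(i <- r) F i) = \sum_(i <- r) l k b (F i).
    elim: r => [|i r ih]; first by rewrite !big_nil (lin0 q Ub).
    by rewrite !big_cons -ih -[F i]scale1r hlin // mul1r scale1r.
  rewrite {1}(row_sum_delta v) sumE; apply: eq_bigr => i _.
  by rewrite (linZ _ _ q Ub) mxE.
pose ll (v : V) : C := \sum_i v ord0 i * lm ord0 i.
have llin : linear ll.
  move=> c v v'; rewrite /ll /GRing.scale /= mulr_sumr -big_split /=; apply: eq_bigr => i _.
  by rewrite !mxE; ring.
have nmll (x v : V) : nm (\sum_i v ord0 i * x ord0 i) <= d.+2%:R * nm x * nm v.
  rewrite (le_trans (nm_sum _ _ _)) // (le_trans (_ : _ <= \sum_(i < d.+2) nm x * nm v)) //.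
    by apply: ler_sum => i _; rewrite nmM mulrC ler_pM ?nm_ge0 ?nm_entry.
  by rewrite sumr_const card_ord -[X in X <= _]mulr_natl mulrA.
pose K := 16 * Rd / rho ^+ 2.
have K0 : 0 <= K by rewrite divr_ge0 ?exprn_ge0 ?(ltW r0) // mulr_ge0 // (le_trans ler01).
have key b' : W b' -> nm (h b' - h b - ll (b' - b)) <= K * nm (b' - b) ^+ 2.
  move=> Wb'; apply/ler_addgt0Pl => e e0.
  pose D := d.+2%:R * nm (b' - b) + 3.
  have D0 : 0 < D by rewrite ltr_wpDl // mulr_ge0 ?ler0n ?nm_ge0.
  have eD : 0 < e / D by rewrite divr_gt0.
  have [del1 d1 h1] := hT _ Wb _ eD; have [del2 d2 h2] := hT _ Wb' _ eD.
  have [N1 hN1] := inv_small d1; have [N2 hN2] := inv_small d2.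
  have [k Nk hk] := hlm _ (N1 + N2)%N eD; have [Sk hsk] := hs k.
  have k1 := h1 _ Sk (lt_trans hsk (hN1 _ (leq_trans (leq_addr _ _) Nk))).
  have k2 := h2 _ Sk (lt_trans hsk (hN2 _ (leq_trans (leq_addl _ _) Nk))).
  have [B q] := hl k; have k3 := unif_quad rho0 q (sM k) Wb Wb'; rewrite -/K in k3.
  have k4 : nm (l k b (b' - b) - ll (b' - b)) <= d.+2%:R * (e / D) * nm (b' - b).
    rewrite lE /ll -sumrB (eq_bigr (fun i => (b' - b) ord0 i * (Lam k - lm) ord0 i)); last first.
      by move=> i _; rewrite !mxE; ring.
    apply: le_trans (nmll _ _) _; rewrite ler_wpM2r ?nm_ge0 // ler_wpM2l ?ler0n //.
    exact: ltW.
  have -> : h b' - h b - ll (b' - b) = (h b' - s k b') + (s k b - h b) +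
    (s k b' - s k b - l k b (b' - b)) + (l k b (b' - b) - ll (b' - b)) by ring.
  rewrite (le_trans (nmD _ _)) // (le_trans (lerD (nmD _ _) (lexx _))) //.
  rewrite (le_trans (lerD (lerD (nmD _ _) (lexx _)) (lexx _))) // [nm (h b' - _)]nmB.
  have eE : d.+2%:R * (e / D) * nm (b' - b) + e / D * 3 = e.
    transitivity (e / D * D); last by rewrite divfK // gt_eqF.
    by move: (e / D) => E; rewrite /D; ring.
  apply: le_trans (lerD (lerD (lerD (ltW k2) (ltW k1)) k3) k4) _; rewrite -[X in _ <= X + _]eE.
  rewrite [leLHS]addrC -[leRHS]addrA lerD2l lerD2r mulr_natr !mulrS mulr0n addr0 addrA lerDl.
  exact: ltW.
have [//|//] := @diff_intro R V C h ll b (d.+2%:R * nm lm) llin (nmll lm) _.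
move=> e e0; have K1 : 0 < K + 1 by rewrite ltr_wpDl.
exists (Num.min (rho / 8 - nm (b - a)) (e / (K + 1))).
  by rewrite lt_min subr_gt0 hb divr_gt0.
move=> y; rewrite lt_min => /andP[y1 y2].
have Wy : W y by have := nm_tri b y a; rewrite /W /=; move: y1; xlra.
apply: le_trans (key _ Wy) _; rewrite expr2 mulrA ler_wpM2r ?nm_ge0 //.
move: y2; rewrite ltr_pdivlMr // mulrDr mulr1 mulrC.
by have := nm_ge0 (y - b); xlra.
Qed.

Lemma no_neutral_stable : Jstable a.
Proof.
have r0 := rho0; have Wa : W a by rewrite /W /= subrr nm0 divr_ge0 // ltW.
have JP b : W b -> forall z, julia b z <-> perclos b z /\ ~ attr b z.
  move=> Wb; have Ub := WU Wb; have [bP _] := UP Ub.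
  by move=> z; exact: (juliaP d0 bP Rd1 (Uesc Ub) (NN Ub)).
have /choice [h0 hh] : forall w : V * C, exists y, W w.1 -> perclos a w.2 -> trans a w.1 w.2 y /\ perclos w.1 y.
  move=> [b z] /=; have [[Wb cz]|hno] := pselect (W b /\ perclos a z).
    by have [y T cy] := trans_exists Wa Wb cz; exists y.
  by exists 0 => Wb cz; case: hno.
exists [set b | nm (b - a) < rho / 8]; split.
- have -> : [set b : V | nm (b - a) < rho / 8] = ball a (rc (rho / 8)).
    by rewrite -ball_normE; apply/seteqP; split=> b /=; rewrite nm_lt nmB.
  exact: ball_open.
- by rewrite /= subrr nm0 divr_gt0.
- by move=> b /= /ltW hb; have [] := UP (WU hb).
exists (fun b z => h0 (b, z)); split.
- move=> z /(JP _ Wa)[cz _]; have [T _] := hh (a, z) Wa cz.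
  apply: (trans_unique (WU Wa) cz T) => e e0; exists e => //.
- move=> b /= /ltW Wb z1 z2 /(JP _ Wa)[c1 _] /(JP _ Wa)[c2 _] e.
  have [T1 cb] := hh (b, z1) Wb c1; have [T2 _] := hh (b, z2) Wb c2; rewrite /= in T1 T2 cb.
  apply: (trans_unique (WU Wb) cb (trans_sym Wa Wb c1 T1)); rewrite e.
  exact: (trans_sym Wa Wb c2 T2).
- move=> b /= /ltW Wb; apply/seteqP; split=> y.
    move=> [z /(JP _ Wa)[cz nz] <-]; have [T cb] := hh (b, z) Wb cz.
    by apply/(JP _ Wb); split=> // az; apply: nz; exact: (trans_attr Wa Wb cz T).
  move=> /(JP _ Wb)[cy ny]; have [z T cz] := trans_exists Wb Wa cy.
  have T' := trans_sym Wb Wa cy T; exists z; last first.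
    by have [T2 _] := hh (b, z) Wb cz; exact: (trans_unique (WU Wa) cz T2 T').
  by apply/(JP _ Wa); split=> // az; apply: ny; exact: (trans_attr Wb Wa cy T).
- move=> z /(JP _ Wa)[cz _] b /= hb; apply: (trans_holo cz) => // c Wc.
  by have [T _] := hh (c, z) Wc cz.
Qed.
End Stability.

Lemma Bif_neutral (R : realType) d (a : 'rV[Cplx R]_d.+2) (e : R) : (0 < d)%N -> Bif a -> 0 < e ->
  exists b n z, [/\ nm (b - a) < e, inPd b, it (pol b) n.+1 z = z & nm ((itp (pol b) n.+1)^`().[z]) = 1].
Proof.
move=> d0 [aP nst] e0; apply: contrapT => hno; apply: nst.
have [r r0 hr] := near_inPd aP.
pose rho := Num.min (e / 2) r; have rho0 : 0 < rho by rewrite lt_min r0 divr_gt0.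
have rr : rho <= r by rewrite ge_min lexx orbT.
have re : rho < e by rewrite gt_min; apply/orP; left; move: e0; xlra.
have b0 : 0 < nm (a ord0 ord_max) / 2 by rewrite divr_gt0 // nm_gt0.
have [Rd [c [R1 _ _ hR]]] := escape_growth (nm a + rho) d0 b0.
have UP b : nm (b - a) <= rho -> inPd b /\ nm (a ord0 ord_max) / 2 <= nm (b ord0 ord_max).
  by move=> hb; have [h1 h2] := hr b (le_trans hb rr).
apply: (no_neutral_stable d0 rho0 R1 b0 UP).
  move=> b hb x hx; have [bP bl] := UP _ hb.
  have [||//] := hR (pol b) (size_pol bP) _ _ x hx; first by rewrite lead_pol.
  move=> i; apply: le_trans (coef_pol _ _) _.
  have hb' : nm (b - a) <= rho := hb.
  by have := nmD (b - a) a; rewrite subrK; move: hb'; xlra.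
move=> b hb n x Px; apply/eqP => hx; apply: hno; exists b, n, x; split=> //.
  by apply: le_lt_trans re.
by have [] := UP _ hb.
Qed.

(** * Multipliers as algebraic functions of a parameter *)

Section Multiplier.
Variable F : closedFieldType.
Hypothesis char0 : forall n, n.+1%:R != 0 :> F.
Definition itF (A : nzRingType) (q : {poly A}) n : {poly A} := iter n (fun r => q \Po r) 'X.

Lemma map_itF (A B : nzRingType) (f : {rmorphism A -> B}) (q : {poly A}) n :
  map_poly f (itF q n) = itF (map_poly f q) n.
Proof. by elim: n => [|n ih]; rewrite /= ?map_polyX // map_comp_poly ih. Qed.

(* eliminating the periodic point between [(p + s)^m z = z] and [((p + s)^m)' z = l] *)
Lemma mult_resultant (p : {poly F}) d m : (0 < d)%N -> size p = d.+2 ->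
  exists r : {poly {poly F}}, forall s l : F, (map_poly (horner_eval l) r).[s] = 0 <->
    exists z, (itF (p + s%:P) m.+1).[z] = z /\ ((itF (p + s%:P) m.+1)^`()).[z] = l.
Proof.
(* In [K] the outer variable is the parameter [s] and the inner one the multiplier [l]; [A] and [B]
   below are polynomials in the periodic point. *)
move=> d0 sp; pose K := {poly {poly F}}.
pose cK : {rmorphism F -> K} := polyC \o polyC.
have cKi : injective cK by move=> x y /polyC_inj/polyC_inj.
pose P : {poly K} := map_poly cK p + ('X : K)%:P.
have smp : size (map_poly cK p) = d.+2 by rewrite size_map_inj_poly // rmorph0.
have sP : size P = d.+2.
  by rewrite size_polyDl ?smp // (leq_ltn_trans (size_polyC_leq1 _)).
have lP : lead_coef P = cK (lead_coef p).
  rewrite lead_coefDl ?lead_coef_map_inj ?rmorph0 // smp.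
  by rewrite (leq_ltn_trans (size_polyC_leq1 _)).
have l0 : lead_coef p != 0 by rewrite lead_coef_eq0 -size_poly_eq0 sp.
(* The leading coefficients are nonzero constants, so degrees do not drop under evaluation and the
   resultant commutes with it. *)
have sl n : size (itF P n) = (d.+1 ^ n).+1 /\ exists2 c, c != 0 & lead_coef (itF P n) = cK c.
  elim: n => [|n [ih1 [c c0 ih2]]].
    by rewrite size_polyX; split=> //; exists 1; rewrite ?oner_eq0 // lead_coefX rmorph1.
  have h1 : (1 < size (itF P n))%N by rewrite ih1 ltnS expn_gt0.
  split; last first.
    exists (lead_coef p * c ^+ d.+1); first by rewrite mulf_neq0 // expf_neq0.
    by rewrite [itF P n.+1]/(P \Po itF P n) lead_coef_comp // lP ih2 sP [RHS](rmorphM cK) (rmorphXn cK).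
  have := size_comp_poly P (itF P n); rewrite sP ih1 /= => h.
  have : size (P \Po itF P n) != 0.
    by rewrite size_poly_eq0 comp_poly_eq0 // -size_poly_eq0 sP.
  by rewrite expnS -h; case: (size _).
have [sI [c c0 lI]] := sl m.+1; set I := itF P m.+1 in sI lI.
pose N := (d.+1 ^ m.+1)%N; have N2 : (1 < N)%N.
  by rewrite /N expnS (leq_trans _ (leq_pmulr _ _)) // expn_gt0.
pose A := I - 'X; pose B := I^`() - (('X : {poly F})%:P : K)%:P.
have lA : lead_coef A = cK c.
  by rewrite /A lead_coefDl ?lI // sI size_polyN size_polyX ltnS.
have N0 : (N.-1.+1)%:R != 0 :> F := char0 _.
have dN : (I^`())`_N.-1 = cK (c *+ N).
  rewrite coef_deriv prednK ?(ltnW N2) //; move: lI; rewrite lead_coefE sI /= => ->.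
  exact/esym/(rmorphMn cK).
have cN0 : c *+ N != 0 by rewrite -mulr_natr mulf_neq0 // -(prednK (ltnW N2)).
have sD : size (deriv I) = N.
  rewrite /deriv sI /= size_poly_eq //.
  have := dN; rewrite coef_deriv => ->; rewrite -(rmorph0 cK) (inj_eq cKi) //.
have lB : lead_coef B = cK (c *+ N).
  rewrite /B lead_coefDl ?sD; last by rewrite size_polyN (leq_ltn_trans (size_polyC_leq1 _)).
  by rewrite lead_coefE sD.
exists (resultant A B) => s l.
pose ev : {rmorphism K -> F} := horner_eval s \o map_poly (horner_eval l).
have evE (k : K) : ev k = (map_poly (horner_eval l) k).[s] by [].
have evc x : ev (cK x) = x by rewrite evE /= map_polyC /= /horner_eval !hornerC.
have evX : ev 'X = s by rewrite evE map_polyX hornerX.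
have evl : ev (('X : {poly F})%:P) = l by rewrite evE map_polyC /= /horner_eval hornerX hornerC.
clearbody ev.
have mD (u v : {poly K}) : map_poly ev (u + v) = map_poly ev u + map_poly ev v.
  exact: rmorphD.
have mN (u : {poly K}) : map_poly ev (- u) = - map_poly ev u by exact: rmorphN.
have mC (k : K) : map_poly ev k%:P = (ev k)%:P by exact: map_polyC.
have mP : map_poly ev P = p + s%:P.
  rewrite /P mD mC evX; congr (_ + _); apply/polyP => i; rewrite !coef_map; exact: evc.
have mI : map_poly ev I = itF (p + s%:P) m.+1 by rewrite map_itF mP.
have mA : map_poly ev A = itF (p + s%:P) m.+1 - 'X by rewrite /A mD mN mI map_polyX.
have mB : map_poly ev B = (itF (p + s%:P) m.+1)^`() - l%:P.
  by rewrite /B mD mN mC evl -deriv_map mI.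
rewrite -evE map_resultant; last 2 first.
- by rewrite lA evc.
- by rewrite lB evc.
rewrite mA mB; set A' := _ - 'X; set B' := _ - _%:P.
have A0 : A' != 0.
  rewrite /A' -mA map_poly_eq0_id0; last by rewrite lA evc.
  by apply: contra_neq c0 => A0; apply: cKi; rewrite -lA A0 lead_coef0 rmorph0.
split=> [/eqP|[z [z1 z2]]].
  rewrite resultant_eq0 => g1.
  have : size (gcdp A' B') != 1 by rewrite neq_ltn g1 orbT.
  case/closed_rootP => z hz; exists z.
  have h1 := dvdp_trans (_ : 'X - z%:P %| _) (dvdp_gcdl A' B').
  have h2 := dvdp_trans (_ : 'X - z%:P %| _) (dvdp_gcdr A' B').
  rewrite !dvdp_XsubCl in h1 h2; have := h1 hz; have := h2 hz.
  rewrite /root hornerD hornerN hornerC subr_eq0 => /eqP -> .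
  by rewrite hornerD hornerN hornerX subr_eq0 => /eqP ->.
apply/eqP; rewrite resultant_eq0.
have rA : root A' z by rewrite /root hornerD hornerN hornerX z1 subrr.
have rB : root B' z by rewrite /root hornerD hornerN hornerC z2 subrr.
have : 'X - z%:P %| gcdp A' B' by rewrite dvdp_gcd !dvdp_XsubCl rA rB.
move=> /dvdp_leq; rewrite size_XsubC; apply.
by rewrite gcdp_eq0 negb_and A0.
Qed.
End Multiplier.

(** * Moving the multiplier by a constant term *)

Section Cluster.
Variable R : realType.
Local Notation C := (Cplx R).
Implicit Types (p q f : {poly C}) (s z : C).

Lemma nonroot_near f (e : R) : f != 0 -> 0 < e -> exists2 s, nm s < e & f.[s] != 0.
Proof.
move=> f0 e0; apply: contrapT => hno.
pose t k : C := rc (e / k.+2%:R).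
have tr k : root f (t k).
  apply/negPn/negP => hr; apply: hno; exists (t k) => //.
  rewrite nm_rc gtr0_norm ?divr_gt0 ?ltr0n // ltr_pdivrMr ?ltr0n // ltr_pMr // ltr1n.
  by [].
have ti : injective t.
  move=> k k' /rc_inj /(mulfI (lt0r_neq0 e0)) /invr_inj /eqP.
  by rewrite eqr_nat => /eqP [].
have := max_poly_roots f0 (_ : all (root f) [seq t k | k <- iota 0 (size f)]).
rewrite size_map size_iota ltnn => h.
by have := h (ltac:(by apply/allP => x /mapP[k _ ->])) (ltac:(by rewrite map_inj_uniq ?iota_uniq)).
Qed.

Lemma poly_large f (M : R) : (1 < size f)%N -> exists2 T : R, 0 < T & forall z, T <= nm z -> M <= nm f.[z].
Proof.
move=> sf; have [r e] := closed_field_poly_normal f.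
have f0 : f != 0 by rewrite -size_poly_gt0 ltnW.
have sr : size r = (size f).-1 by rewrite {1}e size_scale ?lead_coef_eq0 // size_prod_XsubC.
have l0 : 0 < nm (lead_coef f) by rewrite nm_gt0 lead_coef_eq0.
pose X := 1 + `|M| / nm (lead_coef f).
have X1 : 1 <= X by rewrite lerDl divr_ge0 // ltW.
exists (X + \sum_(y <- r) nm y) => [|z hz].
  by rewrite ltr_wpDr ?(lt_le_trans ltr01) // sumr_ge0 // => y _; exact: nm_ge0.
have zy y : y \in r -> X <= nm (z - y).
  move=> yr; have : nm y <= \sum_(y <- r) nm y.
    by rewrite (big_rem y) //= lerDl sumr_ge0 // => y' _; exact: nm_ge0.
  by have := nm_lo z y; move: hz; xlra.
rewrite e hornerZ horner_prod nmM nm_prod.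
apply: le_trans (_ : nm (lead_coef f) * X <= _).
  by rewrite /X mulrDr mulr1 mulrCA divff ?gt_eqF // mulr1 (le_trans (ler_norm _)) // lerDr ltW.
rewrite ler_wpM2l ?(ltW l0) // big_seq.
under eq_bigr do rewrite hornerXsubC.
rewrite -big_seq; have : (0 < size r)%N by rewrite sr -ltnS prednK // ltnW.
case: (r) zy => // y r' zy _; rewrite big_cons -[leLHS]mulr1.
apply: ler_pM; rewrite ?ler01 ?zy ?mem_head //; first exact: le_trans X1.
rewrite big_seq; elim/big_ind: _ => [//|x x' hx hx'|y' hy']; first by rewrite -[1]mulr1 ler_pM ?ler01.
by rewrite (le_trans X1) // zy // inE hy' orbT.
Qed.

(** A Hurwitz argument. If the specialised polynomial has no root of modulus below [e], then
    [nm (s1 - y) <= 2 * nm y] for each of its roots [y], so its value at [s1] is at most [2 ^+ N]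
    times its value at 0. But the latter tends to 0 with [l - l0], and the former to a nonzero
    limit. *)
Lemma family_root (k : {poly {poly C}}) l0 (e : R) : map_poly (horner_eval l0) k != 0 ->
  (map_poly (horner_eval l0) k).[0] = 0 -> 0 < e ->
  exists2 eta : R, 0 < eta & forall l, nm (l - l0) < eta ->
    exists2 s, nm s < e & (map_poly (horner_eval l) k).[s] = 0.
Proof.
move=> k0 kz e0; have [s1 s1e hs1] := nonroot_near k0 e0.
have evE l s : (map_poly (horner_eval l) k).[s] = (k.[s%:P]).[l].
  have := horner_map (horner_eval l) k s%:P; rewrite /= /horner_eval hornerC => ->.
  by [].
have [B1 B10 h1] := poly_lip k.[s1%:P] (nm l0 + 1).
have [B2 B20 h2] := poly_lip k.[0%:P] (nm l0 + 1).
pose c := nm (map_poly (horner_eval l0) k).[s1]; have c0 : 0 < c by rewrite nm_gt0.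
pose N := size k; pose T := B1 + 2 ^+ N * B2.
have T0 : 0 < T by rewrite addr_gt0 // mulr_gt0.
exists (Num.min 1 (c / (2 * T))) => [|l]; first by rewrite lt_min ltr01 divr_gt0 // mulr_gt0.
rewrite lt_min => /andP[l1 l2]; apply: contrapT => hno.
have nl : nm l <= nm l0 + 1 by have := nm_lo l l0; move: l1; xlra.
have nl0 : nm l0 <= nm l0 + 1 by rewrite lerDl.
set f := map_poly (horner_eval l) k in hno *.
have nr s : nm s < e -> f.[s] != 0 by move=> hs; apply/eqP => h; apply: hno; exists s.
have f0 : f != 0 by apply: contraNneq (nr 0 _) => [->|]; rewrite ?horner0 // nm0.
have [r er] := closed_field_poly_normal f.
have re y : y \in r -> e <= nm y.
  move=> yr; rewrite leNgt; apply/negP => /nr; rewrite er hornerZ mulf_eq0 negb_or.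
  by rewrite -/(root _ y) root_prod_XsubC yr andbF.
have sr : (size r <= N)%N.
  have -> : size r = (size f).-1 by rewrite {1}er size_scale ?lead_coef_eq0 // size_prod_XsubC.
  by rewrite (leq_trans (leq_pred _)) // size_poly.
have key : nm f.[s1] <= 2 ^+ N * nm f.[0].
  have -> : nm f.[s1] = nm (lead_coef f) * \prod_(y <- r) nm (s1 - y).
    by rewrite {1}er hornerZ horner_prod nmM nm_prod; congr (_ * _); apply: eq_bigr => y _; rewrite hornerXsubC.
  have -> : nm f.[0] = nm (lead_coef f) * \prod_(y <- r) nm y.
    rewrite {1}er hornerZ horner_prod nmM nm_prod; congr (_ * _); apply: eq_bigr => y _.
    by rewrite hornerXsubC sub0r nmN.
  rewrite mulrCA ler_wpM2l ?nm_ge0 //; apply: le_trans (_ : 2 ^+ size r * \prod_(y <- r) nm y <= _).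
    rewrite -prod_const_seq -big_split /= big_seq [leRHS]big_seq; apply: ler_prod => y yr.
    rewrite nm_ge0 /=; have := re _ yr; have := nmBD s1 y; move: s1e; xlra.
  rewrite ler_wpM2r ?prodr_ge0 // => [y _|]; first exact: nm_ge0.
  by rewrite ler_weXn2l // ler1n.
have := h1 l l0 nl nl0; have := h2 l l0 nl nl0; rewrite -!evE kz -/f -/c sub0r nmN => k2 k1.
have := nm_lo (map_poly (horner_eval l0) k).[s1] f.[s1]; rewrite -/c => k3.
rewrite [nm (l0 - l)]nmB in k1 k2; set dl := nm (l - l0) in l2 k1 k2.
have k4 : 2 ^+ N * nm f.[0] <= 2 ^+ N * B2 * dl by rewrite -mulrA ler_wpM2l // ltW.
have : c <= T * dl by rewrite /T mulrDl; move: k1 k3 k4 key; xlra.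
by move: l2; rewrite ltr_pdivlMr ?mulr_gt0 // mulrCA [dl * T]mulrC; move: (T * dl) c0 => Y; xlra.
Qed.

Lemma it_itF q n : itp q n = itF q n. Proof. by []. Qed.

(* for large [s] every cycle of [p + s] avoids the region where [p'] is small *)
Lemma large_param p d m l : (0 < d)%N -> size p = d.+2 -> nm l = 1 ->
  exists s, forall z, it (p + s%:P) m.+1 z = z -> (itp (p + s%:P) m.+1)^`().[z] != l.
Proof.
move=> d0 sp l1; have [Rd [c [R1 c0 cR hR]]] := escape_radius d0 sp.
have sp' : (1 < size (deriv p))%N.
  have : (deriv p)`_d != 0.
    rewrite coef_deriv -mulr_natr; apply: mulf_neq0; last first.
      by apply/eqP => h; have := nm_nat R d.+1; rewrite h nm0 => /esym/eqP; rewrite pnatr_eq0.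
    by have := lead_coef_eq0 p; rewrite lead_coefE sp /= -size_poly_eq0 sp => ->.
  by apply: contraR; rewrite -leqNgt => h; rewrite nth_default // (leq_trans h).
have [T T0 hT] := poly_large 2 sp'.
have [B B0 hB] := nm_horner_le p T.
have [c4 [c40 R4 hc4]] : exists R4 : R, [/\ 0 < R4, Rd <= R4 & forall z, R4 <= nm z -> 4 * nm z <= nm p.[z]].
  exists (Rd + 4 / c); split; first by rewrite addr_gt0 ?divr_gt0 // (lt_le_trans ltr01).
    by rewrite lerDl divr_ge0 // ltW.
  move=> z hz; have zR : Rd <= nm z by apply: le_trans hz; rewrite lerDl divr_ge0 // ltW.
  have [h _] := hR _ zR; have z4 : 4 / c <= nm z by apply: le_trans hz; rewrite lerDr (le_trans ler01).
  have cz : 4 <= c * nm z by rewrite mulrC -ler_pdivrMr.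
  rewrite -(ler_pM2l c0); apply: le_trans h; rewrite mulrCA exprS mulrC.
  have cz0 : 0 <= c * nm z by rewrite (le_trans _ cz).
  rewrite ler_wpM2l // (le_trans cz) //; case: (d) d0 => // k _; rewrite exprS ler_peMr //.
  by rewrite exprn_ege1 // (le_trans _ cz) // ler1n.
(* A point of modulus at most [T] is sent beyond both [c4] and [nm s / 2]; from there [p + s]
   doubles moduli, so the point cannot be periodic. *)
pose s := rc (2 * (B + c4)); exists s => z ez.
have ns : nm s = 2 * (B + c4) by rewrite nm_rc gtr0_norm // mulr_gt0 // ltr_wpDl.
have stp y : c4 <= nm y -> nm s <= 2 * nm y -> 2 * nm y <= nm (p + s%:P).[y].
  move=> h1 h2; rewrite hornerD hornerC; have := hc4 _ h1; have := nm_loD p.[y] s.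
  by move: h2; xlra.
have esc y : c4 <= nm y -> nm s <= 2 * nm y -> forall k, nm y < nm (it (p + s%:P) k.+1 y) /\ nm s <= 2 * nm (it (p + s%:P) k.+1 y).
  move=> h1 h2; have y0 : 0 < nm y by exact: lt_le_trans h1.
  elim=> [|k [ih1 ih2]]; first by have /= := stp _ h1 h2; move: y0 h2; xlra.
  rewrite itS; have := stp _ (le_trans h1 (ltW ih1)) ih2; move: ih1 ih2 y0; xlra.
have orb k : T < nm (it (p + s%:P) k z).
  rewrite ltNge; apply/negP => h; set y := it (p + s%:P) k z in h.
  have ey : it (p + s%:P) m.+1 y = y by rewrite /y -itD addnC itD ez.
  set y1 := (p + s%:P).[y].
  have n1 : B + 2 * c4 <= nm y1.
    rewrite /y1 hornerD hornerC [p.[y] + s]addrC; have := nm_loD s p.[y]; have := hB _ h; rewrite ns.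
    by move: (nm p.[y]) (nm (s + _)) => u v; move: B0 c40; xlra.
  have h1 : c4 <= nm y1 by move: n1 B0 c40; xlra.
  have h2 : nm s <= 2 * nm y1 by rewrite ns; move: n1 B0 c40; xlra.
  have := esc _ h1 h2 m; rewrite -[it _ m.+1 y1]/(it (p + s%:P) m.+1 (p + s%:P).[y]) -itSr itS ey -/y1.
  by rewrite ltxx => -[].
apply/eqP => el; have := congr1 (@nm R C) el; rewrite l1 itp_deriv nm_prod => e.
have : (2 : R) ^+ m.+1 <= 1.
  have -> : (2 : R) ^+ m.+1 = \prod_(j < m.+1) 2 by rewrite prodr_const card_ord.
  rewrite -[leRHS]e; apply: ler_prod => j _.
  by rewrite ler0n derivD derivC addr0 hT // ltW.
rewrite exprS; have : 1 <= 2 ^+ m :> R by rewrite exprn_ege1 // ler1n.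
by xlra.
Qed.

(** The resultant specialised at [l] vanishes at [s = 0] and, by [large_param], not identically;
    [family_root] then follows its zero as [l] varies. *)
Lemma perturb_mult p d m z l (e : R) : (0 < d)%N -> size p = d.+2 ->
  it p m.+1 z = z -> (itp p m.+1)^`().[z] = l -> nm l = 1 -> 0 < e ->
  exists2 eta : R, 0 < eta & forall l', nm (l' - l) < eta -> exists s z',
    [/\ nm s < e, it (p + s%:P) m.+1 z' = z' & (itp (p + s%:P) m.+1)^`().[z'] = l'].
Proof.
move=> d0 sp ez el l1 e0.
have ch0 n : n.+1%:R != 0 :> C by rewrite -nm_eq0 nm_nat pnatr_eq0.
have [r hr] := mult_resultant ch0 m d0 sp.
have [s1 hs1] := large_param m d0 sp l1.
have [||eta eta0 h] := @family_root r l e _ _ e0.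
- apply/eqP => r0; have := hr s1 l; rewrite r0 horner0 => -[/(_ erefl)[z' [z1 z2]] _].
  by have := hs1 z'; rewrite -itpE; move=> /(_ z1); rewrite it_itF z2 eqxx.
- apply/hr; exists z; rewrite polyC0 addr0 -it_itF; split=> //.
  by rewrite itpE.
exists eta => // l' /h[s se /hr[z' [z1 z2]]]; exists s, z'; split=> //.
by rewrite -itpE.
Qed.
End Cluster.

(** * Neutral cycles whose multiplier is a cube root of unity *)

Section Continuity.
Variable R : realType.
Local Notation C := (Cplx R).
Implicit Types (p q f : {poly C}) (s z : C).

Lemma prod_cont (a0 b0 : C) (e : R) : 0 < e -> exists2 del : R, 0 < del &
  forall a b : C, nm (a - a0) < del -> nm (b - b0) < del -> nm (a * b - a0 * b0) < e.
Proof.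
move=> e0; pose K := 1 + nm a0 + nm b0.
have K0 : 0 < K by have := nm_ge0 a0; have := nm_ge0 b0; rewrite /K; lra.
exists (Num.min 1 (e / K)) => [|a b]; first by rewrite lt_min ltr01 divr_gt0.
rewrite !lt_min !ltr_pdivlMr // => /andP[a1 a2] /andP[b1 b2].
have -> : a * b - a0 * b0 = (a - a0) * (b - b0) + a0 * (b - b0) + (a - a0) * b0 by ring.
have h1 := nmD ((a - a0) * (b - b0) + a0 * (b - b0)) ((a - a0) * b0).
have h2 := nmD ((a - a0) * (b - b0)) (a0 * (b - b0)).
rewrite (nmM (a - a0)) (nmM a0) in h2; rewrite (nmM (a - a0) b0) in h1.
move: (nm (a - a0)) (nm (b - b0)) (nm_ge0 (a - a0)) (nm_ge0 (b - b0)) a1 a2 b1 b2 h1 h2 => x y x0 y0 a1 a2 b1 b2 h1 h2.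
pose t := Num.max x y.
have tx : x <= t by rewrite le_max lexx. have ty : y <= t by rewrite le_max lexx orbT.
have tK : t * K < e by rewrite /t /Num.max; case: ifP.
have h3 : x * y <= t by rewrite (le_trans _ tx) // ler_piMr // ltW.
have h4 : nm a0 * y <= nm a0 * t by rewrite ler_wpM2l ?nm_ge0.
have h5 : x * nm b0 <= t * nm b0 by rewrite ler_wpM2r ?nm_ge0.
apply: le_lt_trans tK; apply: le_trans h1 _; have -> : t * K = t + nm a0 * t + t * nm b0 by rewrite /K; ring.
by rewrite lerD // (le_trans h2) // lerD.
Qed.

Lemma horner_cont f (x0 : C) (e : R) : 0 < e -> exists2 del : R, 0 < del &
  forall x, nm (x - x0) < del -> nm (f.[x] - f.[x0]) < e.
Proof.
move=> e0; have [B B0 h] := poly_lip f (nm x0 + 1).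
exists (Num.min 1 (e / B)) => [|x]; first by rewrite lt_min ltr01 divr_gt0.
rewrite lt_min ltr_pdivlMr // mulrC => /andP[x1 x2]; apply: le_lt_trans x2; apply: h; first by rewrite lerDl.
by have := nm_lo x x0; move: x1; xlra.
Qed.

Lemma it_cont p n (z0 : C) (e : R) : 0 < e -> exists2 del : R, 0 < del &
  forall s z, nm s < del -> nm (z - z0) < del -> nm (it (p + s%:P) n z - it p n z0) < e.
Proof.
elim: n e => [|n ih] e e0; first by exists e.
have e2 : 0 < e / 2 by rewrite divr_gt0.
have [d1 d10 h1] := horner_cont p (it p n z0) e2; have [d2 d20 h2] := ih _ d10.
exists (Num.min d2 (e / 2)) => [|s z]; first by rewrite lt_min d20.
rewrite !lt_min => /andP[s1 s2] /andP[z1 _]; rewrite !itS hornerD hornerC addrAC.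
apply: le_lt_trans (nmD _ _) _; have := h1 _ (h2 _ _ s1 z1); move: s2; xlra.
Qed.

Lemma mult_cont p n (z0 : C) (e : R) : 0 < e -> exists2 del : R, 0 < del &
  forall s z, nm s < del -> nm (z - z0) < del ->
    nm ((itp (p + s%:P) n)^`().[z] - (itp p n)^`().[z0]) < e.
Proof.
elim: n e => [|n ih] e e0; first by exists 1 => // s z _ _; rewrite !itp_deriv !big_ord0 subrr nm0.
have [d1 d10 h1] := prod_cont (itp p n)^`().[z0] p^`().[it p n z0] e0.
have [d2 d20 h2] := ih _ d10; have [d3 d30 h3] := horner_cont p^`() (it p n z0) d10.
have [d4 d40 h4] := it_cont p n z0 d30.
exists (Num.min d2 d4) => [|s z]; first by rewrite lt_min d20.
rewrite !lt_min => /andP[s1 s2] /andP[z1 z2].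
rewrite !itp_deriv !big_ord_recr /= -!itp_deriv; apply: h1; first exact: h2.
by rewrite derivD derivC addr0; apply: h3; apply: h4.
Qed.

(* [p] is moved first to a multiplier [l] with [l ^+ 3 ^ n] the given cube root
   of unity, then radially to both sides of the unit circle *)
Lemma neutral_cluster p d m z (up : bool) (e : R) : (0 < d)%N -> size p = d.+2 ->
  it p m.+1 z = z -> nm (itp p m.+1)^`().[z] = 1 -> 0 < e ->
  exists s0 k z0 w, [/\ nm s0 < e, w ^+ 2 + w + 1 = 0 &
    let p0 := p + s0%:P in [/\ it p0 k.+1 z0 = z0, (itp p0 k.+1)^`().[z0] = w &
    forall eta : R, 0 < eta -> exists s z', [/\ nm s < eta, nm (z' - z0) < eta,
      it (p0 + s%:P) k.+1 z' = z' &
      if up then 1 < nm (itp (p0 + s%:P) k.+1)^`().[z'] else nm (itp (p0 + s%:P) k.+1)^`().[z'] < 1]]].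
Proof.
move=> d0 sp ez el e0; have [w ew] := cube_root_exists R.
have [w3 w1 _] := cube3 ew; set l0 := (itp p m.+1)^`().[z] in el.
have [eta eta0 h1] := perturb_mult d0 sp ez (erefl l0) el e0.
have [n hn] := pow_small (x := 2^-1) (e := eta / 2) (ltac:(lra)) (divr_gt0 eta0 (ltr0n _ 2)).
have l00 : l0 != 0 by rewrite -nm_gt0 el.
have [|v [v1 ev v2]] := @unit_root R w (w / l0 ^+ (3 ^ n)) n ew.
  by rewrite nm_div nmX w1 el expr1n divr1.
pose l := l0 * v; have nl : nm l = 1 by rewrite nmM el v1 mulr1.
have elw : l ^+ (3 ^ n) = w by rewrite exprMn ev mulrCA divff ?mulr1 // expf_neq0.
have [|s0 [z1 [s0e ez1 el1]]] := h1 l.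
  have -> : l - l0 = l0 * (v - 1) by rewrite mulrBr mulr1.
  rewrite nmM el mul1r (le_lt_trans v2) //; have := hn n (leqnn n).
  by rewrite exprVn ltr_pdivlMr // mulrC.
pose p0 := p + s0%:P; have sp0 : size p0 = d.+2.
  by rewrite size_polyDl // sp (leq_ltn_trans (size_polyC_leq1 _)).
pose del (k : nat) : R := k.+1%:R^-1; have del0 k : 0 < del k by rewrite invr_gt0 ltr0n.
have step k : exists sz : C * C, [/\ nm sz.1 < del k, it (p0 + sz.1%:P) m.+1 sz.2 = sz.2,
    nm ((itp (p0 + sz.1%:P) m.+1)^`().[sz.2] - l) < del k &
    if up then 1 < nm (itp (p0 + sz.1%:P) m.+1)^`().[sz.2] else nm (itp (p0 + sz.1%:P) m.+1)^`().[sz.2] < 1].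
  have [t t0 ht] := perturb_mult d0 sp0 ez1 el1 nl (del0 k).
  pose r := Num.min (Num.min (t / 2) (del k / 2)) 2^-1.
  have r0 : 0 < r by rewrite !lt_min !divr_gt0 //= invr_gt0 ltr0n.
  have [r1 r2 r3] : [/\ r <= t / 2, r <= del k / 2 & r <= 2^-1] by split; rewrite /r !ge_min lexx ?orbT.
  pose l' := l * rc (if up then 1 + r else 1 - r).
  have nl' : nm (l' - l) = r.
    rewrite /l' -{2}[l]mulr1 -mulrBr nmM nl mul1r -rc1 -rcN -rcD nm_rc.
    by case: (up); rewrite addrAC subrr add0r ?normrN gtr0_norm.
  have [|s [z' [s1 s2 s3]]] := ht l'; first by rewrite nl'; lra.
  exists (s, z'); rewrite /= s3 nl'; split=> //; first by have := del0 k; lra.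
  by rewrite /l' nmM nl mul1r nm_rc; case: (up); rewrite ger0_norm; lra.
have {step}[sz hsz] := choice step.
have b0 : 0 < nm (lead_coef p0) / 2 by rewrite divr_gt0 // nm_gt0 lead_coef_eq0 -size_poly_eq0 sp0.
have [B B0 hB] : exists2 B : R, 0 < B & forall i, nm p0`_i <= B.
  exists (1 + \sum_(i < d.+2) nm p0`_i) => [|i].
    by rewrite ltr_pwDl // sumr_ge0 // => i _; exact: nm_ge0.
  case: (ltnP i d.+2) => hi; last first.
    by rewrite nth_default ?sp0 // nm0 addr_ge0 // sumr_ge0 // => j _; exact: nm_ge0.
  rewrite (bigD1 (Ordinal hi)) //= addrCA lerDl addr_ge0 // sumr_ge0 // => j _; exact: nm_ge0.
have [Rd [c [Rd1 _ _ hR]]] := escape_growth (B + 1) d0 b0.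
have bd k : nm (sz k).2 <= Rd.
  have [s1 s2 _ _] := hsz k; have := per_bounded s2.
  have d1 : del k <= 1 by rewrite invf_le1 ?ltr0n // ler1n.
  have sc : (size (((sz k).1)%:P : {poly C}) < size p0)%N by rewrite sp0 (leq_ltn_trans (size_polyC_leq1 _)).
  move=> /(@bounded_orbitP R _ Rd _ Rd1) h; have := h _ 0%N; apply=> x hx.
  apply: (proj2 (hR _ _ _ _ x hx)); first by rewrite size_polyDl // sp0.
    by rewrite (lead_coefDl sc); move: b0; lra.
  move=> i; rewrite coefD coefC (le_trans (nmD _ _)) // lerD // ; case: eqP => _; last by rewrite nm0.
  by move: s1 d1; xlra.
(* The periodic points found for different [s] need not belong to one continuous family. Fixing a
   cluster point [z0] gives a cycle of [p0] itself that infinitely many of them approach. *)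
have [z0 _ hz0] := compact_cluster (@compact_disc R Rd) bd.
have lim (g : C * C -> C) (c0 : C) (T : R) : 0 < T ->
    (forall e : R, 0 < e -> exists2 del, 0 < del & forall s z, nm s < del -> nm (z - z0) < del -> nm (g (s, z) - c0) < e) ->
    (forall k, nm (g (sz k)) <= T * del k) -> c0 = 0.
  move=> T0 h hg; apply: nm_small0 => t t0.
  have t2 : 0 < t / 2 by rewrite divr_gt0.
  have [d1 d10 hd1] := h _ t2.
  have [N1 h1'] := inv_small d10; have [N2 h2'] := inv_small (divr_gt0 t2 T0).
  have [k kN hk] := hz0 _ (maxn N1 N2) d10; move: kN; rewrite geq_max => /andP[k1 k2].
  have [s1 _ _ _] := hsz k.
  have := hd1 (sz k).1 (sz k).2 (lt_trans s1 (h1' _ k1)) hk; rewrite -surjective_pairing.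
  have := hg k; have := h2' _ k2; rewrite ltr_pdivlMr // mulrC -/(del k) => h3.
  have := nm_lo c0 (g (sz k)); rewrite [nm (c0 - _)]nmB.
  by move: (T * del k) (nm (g (sz k) - c0)) (nm (g (sz k))) (nm c0) h3 => T' u1 u2 u3; lra.
have ez0 : it p0 m.+1 z0 = z0.
  apply/subr0_eq; apply: (lim (fun s : C * C => it (p0 + s.1%:P) m.+1 s.2 - s.2) _ 1) => //.
    move=> t t0; have t2 : 0 < t / 2 by rewrite divr_gt0.
    have [d1 d10 hd] := it_cont p0 m.+1 z0 t2.
    exists (Num.min d1 (t / 2)) => [|s z']; first by rewrite lt_min d10.
    rewrite !lt_min => /andP[s1 _] /andP[z1' z2'].
    have -> : it (p0 + s%:P) m.+1 z' - z' - (it p0 m.+1 z0 - z0) =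
      (it (p0 + s%:P) m.+1 z' - it p0 m.+1 z0) - (z' - z0) by ring.
    by apply: le_lt_trans (nmBD _ _) _; have := hd _ _ s1 z1'; move: z2'; xlra.
  by move=> k; have [_ -> _ _] := hsz k; rewrite subrr nm0 mul1r ltW.
have em0 : (itp p0 m.+1)^`().[z0] = l.
  apply/subr0_eq; apply: (lim (fun s : C * C => (itp (p0 + s.1%:P) m.+1)^`().[s.2] - l) _ 1) => //.
    move=> t t0; have [d1 d10 hd] := mult_cont p0 m.+1 z0 t0.
    by exists d1 => // s z' s1 s2; rewrite opprB addrA subrK; exact: hd.
  by move=> k; have [_ _ h _] := hsz k; rewrite mul1r ltW.
(* Along [3 ^ n] turns the multiplier [l] becomes [l ^+ (3 ^ n) = w]; the predecessor is there
   because periods are written as successors. *)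
have kE : ((3 ^ n * m.+1).-1.+1 = 3 ^ n * m.+1)%N by rewrite prednK // muln_gt0 expn_gt0.
exists s0, (3 ^ n * m.+1).-1, z0, w; split=> //; rewrite kE -/p0; split.
- exact: it_fixed.
- by rewrite itp_deriv_fixed // em0.
move=> t t0; have [N hN] := inv_small t0; have [k kN hk] := hz0 _ N t0.
have [s1 s2 _ s4] := hsz k; exists (sz k).1, (sz k).2; split=> //.
- exact: lt_trans s1 (hN _ kN).
- exact: it_fixed.
rewrite itp_deriv_fixed // nmX; have N3 : (3 ^ n != 0)%N by rewrite expn_eq0.
by case: up s4 {hsz} => h; rewrite ?exprn_egt1 ?exprn_ilt1 ?nm_ge0.
Qed.
End Continuity.

(** * A generic base polynomial *)

Section GenericQ.
Variable R : realType.
Local Notation C := (Cplx R).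
Implicit Types (p q f : {poly C}) (s z c : C).

(** Real parameters suffice: those to be avoided form a countable set, and an interval has positive
    measure. *)
Lemma avoid_roots (I : countType) (Q : I -> {poly C}) (e : R) : (forall j, Q j != 0) -> 0 < e ->
  exists2 s, nm s < e & forall j, (Q j).[s] != 0.
Proof.
move=> Q0 e0; apply: contrapT => hno.
pose A := \bigcup_(j in [set: I]) [set t : R | (Q j).[rc t] = 0].
have cA : countable A.
  apply: bigcup_countable => [|j _]; first exact: countableP.
  apply: finite_set_countable; have [r er] := closed_field_poly_normal (Q j).
  apply: (@sub_finite_set _ _ [set` [seq complex.Re x | x <- r]]); last exact: finite_seq.
  move=> t /= ht; apply/mapP; exists (rc t) => //.
  rewrite -root_prod_XsubC; apply/rootP; move: ht; rewrite {1}er hornerZ => /eqP.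
  by rewrite mulf_eq0 lead_coef_eq0 (negbTE (Q0 j)) => /eqP.
have sub : `]0, e[%classic `<=` A.
  rewrite set_itvoo => t /= /andP[t0 te]; apply: contrapT => nA; apply: hno.
  exists (rc t); first by rewrite nm_rc gtr0_norm.
  by move=> j; apply/eqP => h; apply: nA; exists j.
have := countable_lebesgue_measure0 (sub_countable (subset_card_le sub) cA).
rewrite lebesgue_measure_itv /= lte_fin e0 oppr0 adde0 => -[] /eqP.
by rewrite gt_eqF.
Qed.

(** The [n]-th iterate of [c] under [q + s], as a polynomial in [s]. Its degree increases with [n],
    so two successive iterates do not coincide identically. *)
Definition crit_value q c n : {poly C} := iter n (fun r => (q \Po r) + 'X) c%:P.

Lemma crit_valueE q c n s : (crit_value q c n).[s] = it (q + s%:P) n c.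
Proof.
elim: n => [|n ih]; first by rewrite hornerC.
by rewrite itS -ih /= !(hornerD, horner_comp, hornerX, hornerC).
Qed.

Lemma size_crit_value q c d n : (0 < d)%N -> size q = d.+2 -> size (crit_value q c n.+1) = (d.+1 ^ n).+1.
Proof.
move=> d0 sq; elim: n => [|n ih].
  by rewrite /= comp_polyCr addrC size_polyDl ?size_polyX // (leq_ltn_trans (size_polyC_leq1 _)).
rewrite [crit_value _ _ _]/((q \Po crit_value q c n.+1) + 'X).
have h := size_comp_poly q (crit_value q c n.+1); rewrite sq ih /= -expnS in h.
have h2 : (2 <= d.+1 ^ n.+1)%N by rewrite expnS (leq_trans _ (leq_pmulr _ _)) ?expn_gt0.
have sz : size (q \Po crit_value q c n.+1) = (d.+1 ^ n.+1).+1.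
  by move: h2; rewrite -h; case: (size _).
by rewrite size_polyDl sz // size_polyX ltnS.
Qed.

Lemma generic_points q d (pts : seq C) (e : R) : (0 < d)%N -> size q = d.+2 -> 0 < e ->
  exists2 s : C, nm s < e & forall c, c \in pts -> forall k,
    it (q + s%:P) k.+1 c != it (q + s%:P) k c /\ it (q + s%:P) k.+1 c != c.
Proof.
move=> d0 sq e0.
pose Q (j : nat * nat * bool) := crit_value q pts`_j.1.1 j.1.2.+1 -
  (if j.2 then crit_value q pts`_j.1.1 j.1.2 else (pts`_j.1.1)%:P).
have Q0 j : Q j != 0.
  apply/eqP => /subr0_eq h; have := congr1 (fun r : {poly C} => size r) h.
  rewrite /= (size_crit_value _ _ d0 sq) => h1.
  have h2 c : ((d.+1 ^ j.1.2).+1 != size (c%:P : {poly C}))%N.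
    by rewrite neq_ltn orbC (leq_ltn_trans (size_polyC_leq1 _)) // ltnS expn_gt0.
  case: j.2 h1 => [|/eqP]; last by rewrite (negbTE (h2 _)).
  case: j.1.2 h2 => [|n] h2 /eqP; first by rewrite (negbTE (h2 _)).
  by rewrite (size_crit_value _ _ d0 sq) eqSS eqn_exp2l // -[n in _ == n]addn0 -addn1 eqn_add2l.
have [s se hs] := avoid_roots Q0 e0; exists s => // c /(nthP 0)[i _ <-] k.
have h1 : (crit_value q pts`_i k.+1 - crit_value q pts`_i k).[s] != 0 := hs (i, k, true).
have h2 : (crit_value q pts`_i k.+1 - (pts`_i)%:P).[s] != 0 := hs (i, k, false).
by move: h1 h2; rewrite !(hornerD _ (- _)) !hornerN hornerC !subr_eq0 !crit_valueE.
Qed.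

(** The barycentre of the preimages of a point. By Vieta it depends only on the two leading
    coefficients, hence not on the point when the degree is at least 2. *)
Definition ybar q : C := - q`_(size q).-2 / ((size q).-1%:R * lead_coef q).

(** In this order, the clauses serve to keep critical points off the homoclinic orbits of a fixed
    point, to find a preimage off the cycle of a periodic point, to have simple fixed points and
    hence a repelling one, and to have spread-out preimages at one of two successive steps. *)
Definition generic q := [/\ forall c k, q^`().[c] = 0 -> it q k.+1 c != it q k c,
  forall c k, q^`().[c] = 0 -> it q k.+1 c != c,
  forall z, q.[z] = z -> q^`().[z] != 1 & q.[ybar q] != ybar q].

Lemma size_addC q d s : size q = d.+2 -> size (q + s%:P) = d.+2.
Proof. by move=> sq; rewrite size_polyDl // sq (leq_ltn_trans (size_polyC_leq1 _)). Qed.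

Lemma size_derivC q d : size q = d.+2 -> size (deriv q) = d.+1.
Proof.
move=> sq; rewrite /deriv sq /= size_poly_eq // -mulr_natr; apply: mulf_neq0.
  by have := lead_coef_eq0 q; rewrite lead_coefE sq /= -size_poly_eq0 sq => ->.
by rewrite -nm_eq0 nm_nat pnatr_eq0.
Qed.

(** Adding [s] changes neither the derivative nor [ybar], so critical points, points of derivative 1
    and [ybar] form a finite list independent of [s], to which [generic_points] applies. *)
Lemma generic_near q d (e : R) : (0 < d)%N -> size q = d.+2 -> 0 < e ->
  exists2 s : C, nm s < e & generic (q + s%:P).
Proof.
move=> d0 sq e0; have sd := size_derivC sq.
have roots f : f != 0 -> exists r : seq C, forall z, f.[z] = 0 -> z \in r.
  move=> f0; have [r er] := closed_field_poly_normal f; exists r => z; rewrite er hornerZ => /eqP.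
  by rewrite mulf_eq0 lead_coef_eq0 (negbTE f0) -/(root _ z) root_prod_XsubC.
have [|r1 h1] := roots (deriv q); first by rewrite -size_poly_eq0 sd.
have [|r2 h2] := roots (deriv q - 1).
  by rewrite -size_poly_eq0 size_polyDl sd // size_polyN size_poly1.
have [s se hs] := generic_points (ybar q :: r1 ++ r2) d0 sq e0; exists s => //.
have dq : deriv (q + s%:P) = deriv q by rewrite derivD derivC addr0.
have inl c : c \in r1 -> c \in ybar q :: r1 ++ r2 by move=> h; rewrite inE mem_cat h orbT.
split; rewrite ?dq.
- by move=> c k /h1 /inl /hs /(_ k) [].
- by move=> c k /h1 /inl /hs /(_ k) [].
- move=> z qz; apply/eqP => dz.
  have : z \in ybar q :: r1 ++ r2.
    by rewrite inE mem_cat h2 ?orbT // hornerD hornerN hornerC dz subrr.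
  by move/hs/(_ 0%N) => [_] /=; rewrite qz eqxx.
- have -> : ybar (q + s%:P) = ybar q.
    rewrite /ybar (size_addC s sq) sq lead_coefDl ?sq ?(leq_ltn_trans (size_polyC_leq1 _)) //=.
    by rewrite coefD coefC; case: (d) d0 => // k _; rewrite addr0.
  by have [_] := hs _ (mem_head _ _) 0%N.
Qed.

Lemma Re_sum (I : Type) (r : seq I) (F : I -> C) :
  complex.Re (\sum_(i <- r) F i) = \sum_(i <- r) complex.Re (F i).
Proof. by elim/big_rec2: _ => // i x y _ <-; rewrite ReD. Qed.

(** The fixed point formula: the sum of [1 / (1 - q')] over the simple fixed points is 0. It
    expresses that the coefficient of degree [d] vanishes in the Lagrange interpolation of the
    constant 1 at these points. If no fixed point were repelling, each term would have real part at
    least [1 / 2]. *)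
Lemma repelling_fixed q d : (0 < d)%N -> size q = d.+2 -> (forall z, q.[z] = z -> q^`().[z] != 1) ->
  exists2 w, q.[w] = w & 1 < nm q^`().[w].
Proof.
move=> d0 sq h1; apply: contrapT => hno.
have le1 z : q.[z] = z -> nm q^`().[z] <= 1.
  by move=> qz; rewrite leNgt; apply/negP => h; apply: hno; exists z.
pose Q := q - 'X; have sQ : size Q = d.+2 by rewrite size_polyDl ?sq // size_polyN size_polyX.
have [r er] := closed_field_poly_normal Q.
have l0 : lead_coef Q != 0 by rewrite lead_coef_eq0 -size_poly_eq0 sQ.
have sr : size r = d.+1 by have := sQ; rewrite {1}er size_scale // size_prod_XsubC => -[].
have rfix z : z \in r -> q.[z] = z.
  rewrite -root_prod_XsubC => /rootP h; apply: subr0_eq.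
  by have : Q.[z] = 0 by [rewrite er hornerZ h mulr0]; rewrite hornerD hornerN hornerX.
have dQ z : Q^`().[z] = q^`().[z] - 1 by rewrite derivB derivX hornerD hornerN hornerC.
pose L z := \prod_(y <- rem z r) ('X - y%:P).
have QL z : z \in r -> Q = lead_coef Q *: (('X - z%:P) * L z).
  by move=> zr; rewrite {1}er (perm_big _ (perm_to_rem zr)) big_cons.
have LQ z : z \in r -> lead_coef Q * (L z).[z] = q^`().[z] - 1.
  move=> zr; rewrite -dQ {2}(QL z zr) derivZ derivM derivXsubC hornerZ hornerD !hornerM.
  by rewrite hornerXsubC subrr mul0r addr0 hornerC mul1r.
have Lz z : z \in r -> (L z).[z] != 0.
  move=> zr; have : lead_coef Q * (L z).[z] != 0 by rewrite LQ // subr_eq0 h1 // rfix.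
  by rewrite mulf_eq0 negb_or => /andP[].
have Ly z y : z \in r -> y \in r -> y != z -> (L z).[y] = 0.
  move=> zr yr yz; apply/rootP; rewrite root_prod_XsubC.
  by move: yr; rewrite (perm_mem (perm_to_rem zr)) inE (negbTE yz).
have ur : uniq r.
  apply: count_mem_uniq => x.
  case: (boolP (x \in r)) => [xr|/count_memPn->//].
  rewrite (permP (perm_to_rem xr)) /= eqxx; congr S; apply/count_memPn.
  by apply: contra (Lz x xr) => h; rewrite -/(root _ x) root_prod_XsubC.
have sL z : z \in r -> size (L z) = d.+1 by move=> zr; rewrite size_prod_XsubC size_rem // sr.
pose A := \sum_(z <- r) ((L z).[z])^-1 *: L z - 1.
have A0 : A = 0.
  apply/eqP; apply: contraT => An0.
  have := max_poly_roots An0 (_ : all (root A) r) ur; rewrite sr.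
  have -> : (d.+1 < size A)%N = false.
    apply/negbTE; rewrite -leqNgt (leq_trans (size_polyD _ _)) // geq_max size_polyN size_poly1 andbT.
    rewrite big_seq; elim/big_ind: _ => [|x y hx hy|z zr]; first by rewrite size_poly0.
      by rewrite (leq_trans (size_polyD _ _)) // geq_max hx.
    by rewrite (leq_trans (size_scale_leq _ _)) ?sL.
  apply; apply/allP => y yr; apply/rootP; rewrite hornerD hornerN hornerC horner_sum.
  rewrite (big_rem y) //= hornerZ mulVf ?Lz // big_seq big1 ?addr0 ?subrr // => z.
  rewrite mem_rem_uniq // inE => /andP[zy zr]; rewrite hornerZ (Ly z y) ?mulr0 //.
  by rewrite eq_sym.
have : \sum_(z <- r) ((L z).[z])^-1 = 0.
  have : A`_d = 0 by rewrite A0 coef0.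
  rewrite /A coefB coef1 coef_sum eqn0Ngt d0 subr0 => hA; rewrite -[RHS]hA [LHS]big_seq [RHS]big_seq; apply: eq_bigr => z zr.
  have /monicP := monic_prod_XsubC (rem z r) predT id; rewrite lead_coefE -/(L z) (sL z zr) /=.
  by rewrite coefZ => ->; rewrite mulr1.
move=> S0; have {S0} : \sum_(z <- r) (1 - q^`().[z])^-1 = 0.
  rewrite big_seq (eq_bigr (fun z => - (lead_coef Q)^-1 * ((L z).[z])^-1)) => [|z zr].
    by rewrite -big_seq -mulr_sumr S0 mulr0.
  by rewrite -opprB -LQ // invrN invfM mulNr.
move/(congr1 (fun x : C => complex.Re x)); rewrite Re_sum /= => S0.
have : (size r)%:R / 2 <= \sum_(z <- r) complex.Re ((1 - q^`().[z])^-1 : C).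
  have -> : (size r)%:R / 2 = \sum_(z <- r) 2^-1 :> R.
    by rewrite big_const_seq count_predT iter_addr_0 -[RHS]mulr_natl.
  rewrite big_seq [leRHS]big_seq; apply: ler_sum => z zr.
  set m := q^`().[z]; set t := (1 - m)^-1.
  have m1 : 1 - m != 0 by rewrite subr_eq0 eq_sym h1 // rfix.
  have et : m * t = t - 1.
    have : (1 - m) * t = 1 by rewrite mulfV.
    by rewrite mulrBl mul1r => h; rewrite -[X in _ = _ - X]h; ring.
  have h : nm (t - 1) ^+ 2 <= nm t ^+ 2.
    rewrite ler_sqr ?nnegrE ?nm_ge0 // -et nmM ler_piMl ?nm_ge0 // le1 // rfix //.
  move: h; rewrite !nm_sqr !ReD !ImD.
  have -> : complex.Re (- 1 : C) = -1 by [].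
  have -> : complex.Im (- 1 : C) = 0 by rewrite /= oppr0.
  move: (complex.Re t) (complex.Im t) => x y; rewrite addr0 lerD2r sqrrD !sqrrN expr1n; lra.
by rewrite S0 sr leNgt divr_gt0.
Qed.
End GenericQ.

(** * Homoclinic orbits with a large weighted sum *)

Section Homoclinic.
Variables (R : realType) (q : {poly Cplx R}) (d : nat) (ws : Cplx R).
Local Notation C := (Cplx R).
Hypothesis d0 : (0 < d)%N.
Hypothesis sq : size q = d.+2.
Hypothesis gen : generic q.
Hypothesis qws : q.[ws] = ws.
Hypothesis rep : 1 < nm q^`().[ws].

Let it_ws k : it q k ws = ws.
Proof. by elim: k => // k ih; rewrite itS ih. Qed.

Lemma geo_sum (x : R) n : 0 <= x < 1 -> \sum_(j < n) x ^+ j <= (1 - x)^-1.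
Proof.
move=> /andP[x0 x1]; have h : 0 < 1 - x by lra.
rewrite -[leRHS]mul1r ler_pdivlMr //; have := subrX1 x n.
move=> e; have -> : (\sum_(j < n) x ^+ j) * (1 - x) = 1 - x ^+ n.
  by rewrite -[1 - x ^+ n]opprB e -mulNr opprB mulrC.
by rewrite lerBlDr lerDl exprn_ge0.
Qed.

(** The preimage is the root of [q - y] nearest to [ws]. By [root_near] it lies within [del] of
    [ws], where [q] multiplies distances to [ws] by at least [(mu + 1) / 2]. *)
Lemma local_inverse : exists sg th : R, [/\ 0 < sg <= 1, 0 < th < 1 & forall y, nm (y - ws) <= sg ->
  exists2 y', q.[y'] = y & nm (y' - ws) <= th * nm (y - ws)].
Proof.
pose mu := nm q^`().[ws]; have rep' : 1 < mu := rep; have [B B0 hB] := poly_quad q (nm ws + 1).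
pose del := Num.min 1 ((mu - 1) / (2 * B)).
have del0 : 0 < del by rewrite lt_min ltr01 divr_gt0 ?mulr_gt0 //; lra.
have l0 : 0 < nm (lead_coef q) by rewrite nm_gt0 lead_coef_eq0 -size_poly_eq0 sq.
have far y : nm (y - ws) <= del -> nm (y - ws) <= 2 / (mu + 1) * nm (q.[y] - ws).
  move=> hy; have [h1 h2] : nm (y - ws) <= 1 /\ nm (y - ws) * (2 * B) <= mu - 1.
    by move: hy; rewrite le_min ler_pdivlMr ?mulr_gt0 // => /andP.
  have := hB ws y; rewrite lerDl ler01 => /(_ isT); have := nm_lo y ws => h3 h4.
  have {h4} h4 := h4 (ltac:(by move: h1 h3; xlra)); rewrite qws in h4.
  have := nm_lo (q^`().[ws] * (y - ws)) (q^`().[ws] * (y - ws) - (q.[y] - ws)).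
  rewrite subKr (nmM q^`().[ws]) -/mu [nm (_ - (q.[y] - ws))]nmB => h5.
  have mu1 : 0 < mu + 1 by lra.
  rewrite mulrAC ler_pdivlMr //; set t := nm (y - ws) in h1 h2 h4 h5 *.
  have t0 : 0 <= t := nm_ge0 _.
  have h6 : B * t ^+ 2 * 2 <= (mu - 1) * t by rewrite expr2; have := ler_wpM2r t0 h2; lra.
  by move: h4 h5 h6; rewrite -/t; move: (nm (_ - _ - _)) (B * t ^+ 2) => u v; lra.
exists (Num.min 1 (nm (lead_coef q) * del ^+ d.+1)), (2 / (mu + 1)); split.
- by rewrite lt_min ltr01 mulr_gt0 ?exprn_gt0 //= ge_min lexx.
- by rewrite divr_gt0 ?ltr_pdivrMr; lra.
move=> y; rewrite le_min => /andP[_ hy].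
have [|y' e1 e2] := @root_near R (q - y%:P) ws.
  by rewrite -polyCN (size_addC _ sq).
have {}e1 : q.[y'] = y by apply: subr0_eq; rewrite -e1 hornerD hornerN hornerC.
exists y' => //; rewrite -[in leRHS]e1; apply: far.
rewrite -polyCN lead_coefDl ?sq ?(leq_ltn_trans (size_polyC_leq1 _)) // in e2.
rewrite (size_addC _ sq) hornerD hornerC qws -[nm (ws - y)]nmB /= in e2.
rewrite nmB -(ler_pXn2r (n := d.+1)) ?nnegrE ?nm_ge0 ?(ltW del0) // -(ler_pM2l l0).
exact: le_trans e2 hy.
Qed.

Lemma escape_near (sg : R) : 0 < sg -> exists2 x, nm (x - ws) < sg & ~ bounded_orbit q x.
Proof.
move=> s0; apply: contrapT => hno.
have [Rd [c [R1 c0 cR hR]]] := escape_radius d0 sq.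
have h u : nm (u - ws) < sg -> forall n, nm (it q n u) <= Rd.
  move=> hu; apply/(bounded_orbitP _ R1) => [x /hR[]//|]; apply: contrapT => hb; apply: hno.
  by exists u.
have : nm (itp q 1)^`().[ws] <= 1.
  by apply: (disc_nonrep s0 h) => //; rewrite subrr nm0 divr_ge0 // ltW.
by rewrite /= comp_polyXr leNgt rep.
Qed.

(** The preimage [t0] on the cycle is a simple root of [q - x], as no critical point is periodic, so
    there is another preimage [t]; and a periodic preimage of [x] can only be [t0]. *)
Lemma nonperiodic_preimage x n : it q n.+1 x = x -> exists2 t, q.[t] = x & forall i, it q i.+1 t != t.
Proof.
move=> ex; pose t0 := it q n x.
have h t k : q.[t] = x -> it q k.+1 t = t -> t = t0.
  move=> qt et; have := it_fixed n.+1 et.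
  have -> : (n.+1 * k.+1)%N = (n + k * n.+1).+1 by rewrite mulnC mulSn addSn.
  by rewrite itSr qt itD it_fixed.
have qt0 : q.[t0] = x by rewrite -itS.
have dt0 : q^`().[t0] != 0.
  apply/eqP => dt; have [_ /(_ t0 n dt)] := gen.
  by rewrite itSr qt0 => /eqP.
have /factor_theorem [g eg] : root (q - x%:P) t0 by rewrite /root hornerD hornerN hornerC qt0 subrr.
have sg : size g = d.+1.
  have : size (q - x%:P) = d.+2 by rewrite -polyCN (size_addC _ sq).
  have g0 : g != 0 by apply: contra_eq_neq eg => ->; rewrite mul0r -size_poly_eq0 -polyCN (size_addC _ sq).
  by rewrite eg size_Mmonic ?monicXsubC // size_XsubC addn2 => -[].
have gt0 : g.[t0] != 0.
  apply: contra dt0 => /eqP h0; have -> : deriv q = deriv (q - x%:P) by rewrite derivB derivC subr0.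
  by rewrite eg derivM hornerD !hornerM hornerXsubC subrr mulr0 add0r h0 mul0r.
have [t gt] : exists t, root g t by apply/closed_rootP; rewrite sg eqSS -lt0n.
have qt : q.[t] = x.
  apply: subr0_eq; have : (q - x%:P).[t] = 0 by rewrite eg hornerM (rootP gt) mul0r.
  by rewrite hornerD hornerN hornerC.
exists t => // i; apply/eqP => et; have tt := h t i qt et.
by move: gt gt0; rewrite tt /root => ->.
Qed.

(** [hit] with the constant [tau = x] asks that [x] be not periodic; a periodic [x] is replaced by a
    preimage off its cycle. *)
Lemma hit_point x (sg : R) : 0 < sg -> exists k y, nm (y - ws) < sg /\ it q k y = x.
Proof.
move=> s0; have [x0 x01 x02] := escape_near s0.
have np t : (forall i, it q i.+1 t != t) -> exists k y, nm (y - ws) < sg /\ it q k.+1 y = t.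
  move=> ht; have [|||n [y [y1 y2]]] := @hit R q d t%:P ws x0 sg d0 sq _ _ x02 x01.
  - by rewrite (leq_trans (size_polyC_leq1 _)).
  - by apply: (@per_bounded R q 0).
  - by move=> y _ i; rewrite hornerC.
  by exists n, y; rewrite y2 hornerC.
have [[n ex]|hx] := pselect (exists n, it q n.+1 x = x).
  have [t qt ht] := nonperiodic_preimage ex; have [k [y [y1 y2]]] := np t ht.
  by exists k.+2, y; rewrite itS y2.
have [|k [y [y1 y2]]] := np x; first by move=> i; apply/eqP => h; apply: hx; exists i.
by exists k.+1, y.
Qed.

(** If no time bound held, the counterexamples would have a cluster point [xl], with a preimage [y]
    of some order near [ws]; by [root_near], points close to [xl] have preimages of the same order
    close to [y]. *)
Lemma return_time (sg M : R) : 0 < sg -> exists k0, forall x, nm x <= M ->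
  exists k y, [/\ (k <= k0)%N, nm (y - ws) < sg & it q k y = x].
Proof.
move=> s0; apply: contrapT => hno.
have bad k0 : exists x, nm x <= M /\ forall k y, (k <= k0)%N -> nm (y - ws) < sg -> it q k y != x.
  apply: contrapT => h; apply: hno; exists k0 => x xM; apply: contrapT => h'; apply: h; exists x.
  by split=> // k y k1 y1; apply/eqP => e; apply: h'; exists k, y.
have [x hx] := choice bad.
have [xl _ hl] := compact_cluster (@compact_disc R M) (fun k => proj1 (hx k)).
have [k [y [y1 y2]]] := hit_point xl s0.
pose f := itp q k; have sf : size f = (d.+1 ^ k).+1 := size_itp k sq.
pose D := (d.+1 ^ k)%N; have l0 : 0 < nm (lead_coef f) by rewrite nm_gt0 lead_coef_eq0 -size_poly_eq0 sf.
pose r := sg - nm (y - ws); have r0 : 0 < r by rewrite subr_gt0.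
have [N kN hN] := hl (nm (lead_coef f) * (r / 2) ^+ D) k (mulr_gt0 l0 (exprn_gt0 _ (divr_gt0 r0 (ltr0n _ 2)))).
have sc : (size ((- x N)%:P : {poly C}) < size f)%N.
  by rewrite sf (leq_ltn_trans (size_polyC_leq1 _)) // ltnS expn_gt0.
have [|y' e1 e2] := @root_near R (f - (x N)%:P) y.
  by rewrite -polyCN size_polyDl // sf ltnS expn_gt0.
have {}e1 : it q k y' = x N by rewrite -itpE; apply: subr0_eq; rewrite -e1 hornerD hornerN hornerC.
have [_ /(_ k y' kN)] := hx N; rewrite e1 eqxx => h; suff /h : nm (y' - ws) < sg by [].
rewrite -polyCN lead_coefDl // size_polyDl // sf hornerD hornerC itpE y2 [nm (xl + _)]nmB in e2.
have := le_lt_trans e2 hN; rewrite ltr_pM2l // ltr_pXn2r ?nnegrE ?nm_ge0 //; last 2 first.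
- by rewrite expn_gt0.
- by rewrite ltW // divr_gt0.
move=> h4; have h5 := nm_tri y y' ws; rewrite [nm (y' - y)]nmB in h5; apply: le_lt_trans h5 _.
by move: h4 y1; rewrite /r; move: (nm (y - y')) (nm (y - ws)) => u1 u2; lra.
Qed.

Let yb := ybar q.

(** An average over the preimages of [x], whose barycentre is [yb]: the mean of
    [nm (P + b (y - yb)) ^+ 2] is [nm P ^+ 2] plus [nm b ^+ 2] times the variance, and some preimage
    reaches the mean. A single preimage [y'] already contributes [nm (y' - yb) ^+ 2 / d.+1] to the
    variance. *)
Lemma variance_gain x (P b : C) : exists2 y, q.[y] = x & forall y', q.[y'] = x ->
  nm P ^+ 2 + nm b ^+ 2 * nm (y' - yb) ^+ 2 / d.+1%:R <= nm (P + b * (y - yb)) ^+ 2.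
Proof.
have [r er] := closed_field_poly_normal (q - x%:P).
have sQ : size (q - x%:P) = d.+2 by rewrite -polyCN (size_addC _ sq).
have lQ : lead_coef (q - x%:P) = lead_coef q.
  by rewrite -polyCN lead_coefDl // sq (leq_ltn_trans (size_polyC_leq1 _)).
have l0 : lead_coef q != 0 by rewrite lead_coef_eq0 -size_poly_eq0 sq.
rewrite lQ in er; have sr : size r = d.+1 by have := sQ; rewrite er size_scale // size_prod_XsubC => -[].
have n0 : d.+1%:R != 0 :> C by rewrite -nm_eq0 nm_nat pnatr_eq0.
have rP y : (y \in r) = (q.[y] == x).
  rewrite -root_prod_XsubC -subr_eq0; have -> : q.[y] - x = (q - x%:P).[y] by rewrite hornerD hornerN hornerC.
  by rewrite er hornerZ mulf_eq0 (negbTE l0).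
have ey : \sum_(y <- r) (y - yb) = 0.
  have := coefPn_prod_XsubC (ps := r); rewrite sr => /(_ isT) /= h.
  have : (q - x%:P)`_d = q`_d by rewrite coefB coefC eqn0Ngt d0 subr0.
  rewrite er coefZ h => hq; rewrite big_split /= sumrN big_const_seq count_predT iter_addr_0 sr.
  rewrite /yb /ybar sq /= -hq -[_ *+ d.+1]mulr_natr; move: (\sum_(i <- r) i) => s.
  by move: (d.+1%:R : C) n0 => n n0; field; rewrite l0 n0.
pose T := \sum_(y <- r) nm (b * (y - yb)) ^+ 2.
have key : \sum_(y <- r) nm (P + b * (y - yb)) ^+ 2 = d.+1%:R * nm P ^+ 2 + T.
  have h1 : \sum_(y <- r) complex.Re (b * (y - yb) : C) = 0 by rewrite -Re_sum -mulr_sumr ey mulr0.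
  have h2 : \sum_(y <- r) complex.Im (b * (y - yb) : C) = 0.
    transitivity (complex.Im (\sum_(y <- r) (b * (y - yb)) : C)); last by rewrite -mulr_sumr ey mulr0.
    by elim/big_rec2: _ => // i u v _ ->; rewrite ImD.
  have -> : d.+1%:R * nm P ^+ 2 = \sum_(y <- r) nm P ^+ 2.
    by rewrite big_const_seq count_predT iter_addr_0 sr mulr_natl.
  have -> : \sum_(y <- r) nm (P + b * (y - yb)) ^+ 2 = \sum_(y <- r) (nm P ^+ 2 + nm (b * (y - yb)) ^+ 2 +
      2 * (complex.Re P * complex.Re (b * (y - yb) : C) + complex.Im P * complex.Im (b * (y - yb) : C))).
    by apply: eq_bigr => y _; rewrite !nm_sqr ReD ImD; ring.
  have hX : \sum_(y <- r) 2 * (complex.Re P * complex.Re (b * (y - yb) : C) + complex.Im P * complex.Im (b * (y - yb) : C)) = 0.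
    by rewrite -mulr_sumr big_split /= -!mulr_sumr h1 h2 !mulr0 addr0 mulr0.
  by rewrite 2!big_split /= hX addr0.
have [y yr hy] : exists2 y, y \in r & nm P ^+ 2 + T / d.+1%:R <= nm (P + b * (y - yb)) ^+ 2.
  apply: contrapT => hno.
  have : \sum_(y <- r) nm (P + b * (y - yb)) ^+ 2 < \sum_(y <- r) (nm P ^+ 2 + T / d.+1%:R).
    rewrite big_seq [ltRHS]big_seq; apply: ltr_sum => [|y yr]; last first.
      by rewrite ltNge; apply/negP => h; apply: hno; exists y.
    by apply/hasP; exists r`_0; rewrite mem_nth ?sr.
  rewrite key big_const_seq count_predT iter_addr_0 sr -[ltRHS]mulr_natl mulrDr.
  by rewrite [d.+1%:R * (T / _)]mulrC divfK ?ltxx // pnatr_eq0.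
exists y; first by apply/eqP; rewrite -rP.
move=> y' /eqP; rewrite -rP => y'r; apply: le_trans hy; rewrite lerD2l ler_wpM2r ?invr_ge0 ?ler0n //.
by rewrite /T (big_rem y') //= nmM exprMn lerDl sumr_ge0 // => z _; exact: sqr_ge0.
Qed.

(** One step may gain almost nothing, if all preimages of [x] are close to [yb]. Then [y1] is close
    to [yb], hence far from [q.[yb]], because [yb] is not fixed; so [y1] has a preimage far from
    [yb] and the second step gains. *)
Lemma two_step (a : R) : 0 < a -> exists2 g : R, 0 < g & forall x (P b1 b2 : C), a <= nm b1 -> a <= nm b2 ->
  exists y1 y2, [/\ q.[y1] = x, q.[y2] = y1 &
    nm P ^+ 2 + g <= nm (P + b1 * (y1 - yb) + b2 * (y2 - yb)) ^+ 2].
Proof.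
move=> a0; pose del := nm (q.[yb] - yb) / 2.
have del0 : 0 < del by rewrite divr_gt0 // nm_gt0 subr_eq0; have [] := gen.
have l0 : 0 < nm (lead_coef q) by rewrite nm_gt0 lead_coef_eq0 -size_poly_eq0 sq.
have far y : del <= nm (q.[yb] - y) -> exists2 y', q.[y'] = y & Num.min 1 (del / nm (lead_coef q)) <= nm (y' - yb).
  move=> hy; apply: contrapT => hno.
  have [r er] := closed_field_poly_normal (q - y%:P).
  have lQ : lead_coef (q - y%:P) = lead_coef q.
    by rewrite -polyCN lead_coefDl // sq (leq_ltn_trans (size_polyC_leq1 _)).
  have sr : size r = d.+1.
    have : size (q - y%:P) = d.+2 by rewrite -polyCN (size_addC _ sq).
    by rewrite er lQ size_scale ?size_prod_XsubC; [case|rewrite -nm_gt0].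
  have small z : z \in r -> nm (yb - z) < Num.min 1 (del / nm (lead_coef q)).
    move=> zr; rewrite ltNge nmB; apply/negP => h; apply: hno; exists z => //.
    apply: subr0_eq; have : (q - y%:P).[z] = 0.
      by rewrite er hornerZ; move: zr; rewrite -root_prod_XsubC => /rootP ->; rewrite mulr0.
    by rewrite hornerD hornerN hornerC.
  have : nm (q.[yb] - y) = nm (lead_coef q) * \prod_(z <- r) nm (yb - z).
    have -> : q.[yb] - y = (q - y%:P).[yb] by rewrite hornerD hornerN hornerC.
    rewrite er lQ hornerZ nmM horner_prod nm_prod; congr (_ * _).
    by apply: eq_bigr => z _; rewrite hornerXsubC.
  have : \prod_(z <- r) nm (yb - z) < del / nm (lead_coef q).
    case: r {er} sr small => // z r _ small; rewrite big_cons.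
    have := small z (mem_head _ _); rewrite lt_min => /andP[_]; apply: le_lt_trans.
    rewrite ler_piMr ?nm_ge0 //.
    have : 0 <= \prod_(j <- r) nm (yb - j) <= 1; last by case/andP.
    rewrite big_seq; elim/big_ind: _ => [|u v /andP[u0 u1] /andP[v0 v1]|z' zr].
    - by rewrite ler01 lexx.
    - by rewrite mulr_ge0 // mulr_ile1.
    by have := small z'; rewrite inE zr orbT nm_ge0 => /(_ isT); rewrite lt_min => /andP[/ltW].
  by rewrite ltr_pdivlMr // mulrC => h e; move: hy; rewrite e leNgt h.
set del' := Num.min 1 _ in far; pose t := Num.min del del'.
have t0 : 0 < t by rewrite !lt_min del0 ltr01 divr_gt0.
pose g := a ^+ 2 * t ^+ 2 / d.+1%:R.
have gle (b : C) x : a <= nm b -> t <= x -> g <= nm b ^+ 2 * x ^+ 2 / d.+1%:R.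
  by move=> h1 h2; rewrite ler_wpM2r ?invr_ge0 ?ler0n // ler_pM ?sqr_ge0 // ler_pXn2r ?nnegrE // ?nm_ge0 ?(ltW a0) ?(ltW t0) // ltW // (lt_le_trans t0).
exists g => [|x P b1 b2 hb1 hb2]; first by rewrite divr_gt0 ?mulr_gt0 ?exprn_gt0 ?ltr0n.
have [y1 qy1 h1] := variance_gain x P b1; set P1 := P + _ in h1.
have [y2 qy2 h2] := variance_gain y1 P1 b2; exists y1, y2; split=> //; rewrite -/P1.
have pos (b : C) y : 0 <= nm b ^+ 2 * nm (y - yb) ^+ 2 / d.+1%:R.
  by rewrite divr_ge0 ?ler0n // mulr_ge0 ?sqr_ge0.
have [[y' qy' hy']|hno] := pselect (exists2 y', q.[y'] = x & del <= nm (y' - yb)).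
  have := h1 _ qy'; have := h2 _ qy2; have := pos b2 y2; have := gle b1 (nm (y' - yb)) hb1.
  rewrite (le_trans _ hy') ?ge_min ?lexx // => /(_ isT); move: (nm P ^+ 2) (nm P1 ^+ 2) (nm (P1 + _) ^+ 2) (g) (nm b1 ^+ 2 * _ / _) (nm b2 ^+ 2 * _ / _) => *; lra.
have n1 : nm (y1 - yb) < del by rewrite ltNge; apply/negP => h; apply: hno; exists y1.
have [|y' qy' hy'] := far y1.
  have e2d : nm (q.[yb] - yb) = 2 * del by rewrite /del; lra.
  have h3 := nm_tri y1 q.[yb] yb; rewrite e2d in h3; move: n1 h3.
  by move: (del) (nm (y1 - yb)) (nm (q.[yb] - y1)) => *; lra.
have td : t <= del' by rewrite /t ge_min lexx orbT.
have := h2 _ qy'; have := h1 _ qy1; have := pos b1 y1; have := gle b2 (nm (y' - yb)) hb2.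
rewrite (le_trans td hy') => /(_ isT); move: (nm P ^+ 2) (nm P1 ^+ 2) (nm (P1 + _) ^+ 2) (g) (nm b1 ^+ 2 * _ / _) (nm b2 ^+ 2 * _ / _) => *; lra.
Qed.

Section Sums.
Variables (be : nat -> C) (a bt Bs : R).
Hypothesis a0 : 0 < a.
Hypothesis be_lo : forall r, a <= nm (be r).
Hypothesis be_hi : forall r, nm (be r) <= bt.
Hypothesis be_sum : forall n, nm (\sum_(r < n) be r.+1) <= Bs.

(** By [two_step] the squared modulus of the sum grows by at least [g] every two steps. *)
Lemma greedy (M : R) : exists n (x : nat -> C), [/\ x 0%N = ws, forall r, (r < n)%N -> q.[x r.+1] = x r &
  M <= nm (\sum_(r < n) be r.+1 * (x r.+1 - yb))].
Proof.
have [g g0 hg] := two_step a0.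
have step k : exists x : nat -> C, [/\ x 0%N = ws, forall r, (r < k.*2)%N -> q.[x r.+1] = x r &
    k%:R * g <= nm (\sum_(r < k.*2) be r.+1 * (x r.+1 - yb)) ^+ 2].
  elim: k => [|k [x [x0 xq ih]]]; first by exists (fun=> ws); split; rewrite // mul0r sqr_ge0.
  have [y1 [y2 [e1 e2 e3]]] := hg (x k.*2) (\sum_(r < k.*2) be r.+1 * (x r.+1 - yb)) _ _ (be_lo k.*2.+1) (be_lo k.*2.+2).
  exists (fun r => if (r <= k.*2)%N then x r else if r == k.*2.+1 then y1 else y2).
  have n1 : (k.*2.+1 <= k.*2)%N = false by rewrite ltnn.
  have n2 : (k.*2.+2 <= k.*2)%N = false by apply/negbTE; rewrite -ltnNge leqnSn.
  have n3 : (k.*2.+2 == k.*2.+1)%N = false by rewrite gtn_eqF.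
  split=> // [r rk|].
    have [->|[->|rk']] : r = k.*2.+1 \/ r = k.*2 \/ (r < k.*2)%N by move: rk; rewrite doubleS; clear; lia.
    - by rewrite n1 n2 n3 eqxx.
    - by rewrite n1 leqnn eqxx.
    by rewrite rk' (ltnW rk') xq.
  rewrite doubleS !big_ord_recr /= n1 n2 n3 eqxx.
  rewrite -[k.+1]addn1 natrD mulrDl mul1r; apply: le_trans (_ : _ + g <= _); first by rewrite lerD2r; exact: ih.
  apply: le_trans e3 _; rewrite le_eqVlt; apply/orP; left; apply/eqP; congr (nm (_ + _ + _) ^+ 2).
  by apply: eq_bigr => r _; rewrite ltn_ord.
have [k hk] := nat_above (M ^+ 2 / g); have [x [x0 xq h]] := step k.
exists k.*2, x; split=> //; case: (leP M 0) => M0; first exact: le_trans M0 (nm_ge0 _).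
rewrite -(ler_pXn2r (n := 2)) ?nnegrE ?nm_ge0 ?(ltW M0) //; apply: le_trans h.
by rewrite -ler_pdivrMr // ltW.
Qed.

(** The backward orbit of [greedy] is followed until its sum is large; it returns near [ws] in at
    most [k0] steps, then converges to [ws] by the local inverse. Return and tail change the sum by
    a bounded amount, and so does the replacement of [yb] by [ws], because the partial sums of the
    weights are bounded. [K] collects these losses, which do not depend on the length of the first
    stretch. *)
Lemma homoclinic (M : R) : exists (u : nat -> C) (r0 : nat) (th : R), [/\ u 0%N = ws,
  forall r, q.[u r.+1] = u r, 0 < th < 1, forall j, nm (u (r0 + j)%N - ws) <= th ^+ j &
  forall j, M <= nm (\sum_(r < r0 + j) be r.+1 * (u r.+1 - ws))].
Proof.
have [sg [th [/andP[sg0 sg1] /andP[th0 th1] inv]]] := local_inverse.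
have [Rd [c [R1 c0 cR hR]]] := escape_radius d0 sq.
have back y : nm q.[y] <= Rd -> nm y <= Rd.
  move=> h; rewrite leNgt; apply/negP => h'; have [_ h2] := hR _ (ltW h').
  by move: h h' h2 R1; lra.
have wsR : nm ws <= Rd.
  rewrite leNgt; apply/negP => h'; have [_] := hR _ (ltW h'); rewrite qws; move: h' R1; lra.
have [k0 hk0] := return_time Rd sg0.
have bt0 : 0 <= bt := le_trans (nm_ge0 _) (be_hi 0).
pose K := bt * (2 * Rd * k0%:R + (1 - th)^-1) + nm (yb - ws) * Bs.
have [n [x [x0 xq hx]]] := greedy (M + K).
have xR r : (r <= n)%N -> nm (x r) <= Rd.
  by elim: r => [|r ih] h; [rewrite x0|apply: back; rewrite xq // ih // ltnW].
have [k [y [kk y1 y2]]] := hk0 _ (xR n (leqnn n)).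
have [v [v0 vq vth]] : exists v : nat -> C, [/\ v 0%N = y, forall j, q.[v j.+1] = v j & forall j, nm (v j - ws) <= th ^+ j].
  have nxt (t : {t : C | nm (t - ws) <= sg}) : exists t' : {t : C | nm (t - ws) <= sg},
      q.[sval t'] = sval t /\ nm (sval t' - ws) <= th * nm (sval t - ws).
    case: t => t ht; have [t' e1 e2] := inv t ht.
    have ht' : nm (t' - ws) <= sg by apply: le_trans e2 (le_trans _ ht); rewrite ler_piMl ?nm_ge0 // ltW.
    by exists (exist _ t' ht').
  have [F hF] := choice nxt; pose w j := iter j F (exist _ y (ltW y1)).
  exists (fun j => sval (w j)); split=> // [j|]; first by have [] := hF (w j).
  elim=> [|j ih]; first by rewrite expr0 (le_trans (ltW y1)).
  have [_ h] := hF (w j); rewrite exprS; apply: le_trans h _; rewrite ler_wpM2l // ltW //.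
pose u r := if (r <= n)%N then x r else if (r <= n + k)%N then it q (n + k - r) y else v (r - (n + k))%N.
have uv j : u (n + k + j)%N = v j.
  rewrite /u; case: leqP => h1; last case: leqP => h2; last by rewrite addKn.
    have [k00 j0] : (k = 0 /\ j = 0)%N by move: h1; clear; lia.
    by rewrite k00 j0 !addn0 v0 -y2 k00.
  have -> : (j = 0)%N by move: h2; clear; lia.
  by rewrite addn0 subnn v0.
have uk j : (j <= k)%N -> u (n + j)%N = it q (k - j) y.
  move=> jk; rewrite /u leq_add2l jk subnDl; case: leqP => // h.
  have -> : (j = 0)%N by move: h; clear; lia.
  by rewrite addn0 subn0 y2.
have uq r : q.[u r.+1] = u r.
  case: (ltnP r n) => h1; first by rewrite /u h1 (ltnW h1) xq.
  case: (ltnP r (n + k)) => h2.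
    have [j -> jk] : exists2 j, r = (n + j)%N & (j < k)%N by exists (r - n)%N; move: h1 h2; clear; lia.
    by rewrite -addnS !uk ?(ltnW jk) // -itS subnSK.
  have [j ->] : exists j, r = (n + k + j)%N by exists (r - (n + k))%N; rewrite subnKC.
  by rewrite -addnS !uv vq.
have u0 : u 0%N = ws by rewrite /u leq0n x0.
have uR r : nm (u r) <= Rd by elim: r => [|r ih]; [rewrite u0|apply: back; rewrite uq].
exists u, (n + k)%N, th; split=> //; first by rewrite th0.
  by move=> j; rewrite uv.
move=> j; rewrite -addnA big_split_ord /=.
set S2 := \sum_(i < k + j) _; have hS2 : nm S2 <= bt * (2 * Rd * k0%:R + (1 - th)^-1).
  apply: le_trans (nm_sum _ _ _) _; apply: le_trans (_ : \sum_(i < k + j) bt * nm (u (n + i).+1 - ws) <= _).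
    by apply: ler_sum => i _; rewrite nmM ler_wpM2r ?nm_ge0.
  rewrite -mulr_sumr ler_wpM2l // big_split_ord /=; apply: lerD.
    apply: le_trans (_ : \sum_(i < k) 2 * Rd <= _).
      by apply: ler_sum => i _; apply: le_trans (nmBD _ _) _; rewrite mulr2n mulrDl mul1r lerD.
    rewrite sumr_const card_ord -[_ *+ k]mulr_natr; apply: ler_wpM2l; last by rewrite ler_nat.
    by rewrite mulr_ge0 // (le_trans _ R1).
  apply: le_trans (geo_sum j _); last by rewrite ltW.
  apply: ler_sum => i _; rewrite addnA -addnS uv; apply: le_trans (vth _) _.
  by rewrite exprS ler_piMl ?exprn_ge0 // ltW.
have -> : \sum_(i < n) be i.+1 * (u i.+1 - ws) =
    \sum_(r < n) be r.+1 * (x r.+1 - yb) + (yb - ws) * \sum_(r < n) be r.+1.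
  rewrite mulr_sumr -big_split /=; apply: eq_bigr => i _.
  by rewrite /u ltn_ord; ring.
set P := \sum_(r < n) _ in hx *; set B := \sum_(r < n) be r.+1.
have := nm_loD (P + (yb - ws) * B) S2; have := nm_loD P ((yb - ws) * B); rewrite nmM.
have : nm (yb - ws) * nm B <= nm (yb - ws) * Bs by rewrite ler_wpM2l ?nm_ge0 //; exact: be_sum.
move: hx hS2; rewrite /K; move: (bt * _) (nm _ * nm B) (nm _ * Bs) (nm S2) (nm P) (nm (P + _)) (nm (_ + S2)) => *; lra.
Qed.
End Sums.
End Homoclinic.

Lemma fin_unif (R : realType) (P : nat -> R -> Prop) N :
  (forall r, exists2 e : R, 0 < e & P r e) -> (forall r e e', 0 < e' -> e' <= e -> P r e -> P r e') ->
  exists2 e : R, 0 < e & forall r, (r < N)%N -> P r e.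
Proof.
move=> h hm; elim: N => [|N [e e0 he]]; first by exists 1.
have [e1 e10 h1] := h N; have m0 : 0 < Num.min e e1 by rewrite lt_min e0.
exists (Num.min e e1) => // r; rewrite ltnS leq_eqVlt => /orP[/eqP->|/he].
  by apply: hm h1; rewrite // ge_min lexx orbT.
by apply: hm; rewrite // ge_min lexx.
Qed.

(** * Distortion along homoclinic orbits *)

Section Distortion.
Variables (R : realType) (q : {poly Cplx R}).
Local Notation C := (Cplx R).
Implicit Types (x : nat -> C) (w : C).

(** For a backward orbit, [q.[x r.+1] = x r], this is the derivative of the [r]-th iterate of [q] at
    [x r]. *)
Definition dprod x r : C := \prod_(s < r) q^`().[x s.+1].

Lemma dprodS x r : dprod x r.+1 = dprod x r * q^`().[x r.+1].
Proof. exact: big_ord_recr. Qed.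

Lemma poly_ql (M : R) : exists2 L : R, 0 < L & forall y (r : R) a b, nm y <= M -> r <= 1 ->
  nm (a - y) <= r -> nm (b - y) <= r ->
  nm (q.[a] - q.[b] - q^`().[y] * (a - b)) <= L * r * nm (a - b).
Proof.
have [B B0 hB] := poly_quad q (M + 1); have [B' B'0 hB'] := poly_lip q^`() (M + 1).
exists (2 * B + B') => [|y r a b yM r1 ha hb]; first by rewrite addr_gt0 // mulr_gt0.
have aM : nm a <= M + 1 by have := nm_lo a y; move: ha yM r1; xlra.
have bM : nm b <= M + 1 by have := nm_lo b y; move: hb yM r1; xlra.
have yM1 : nm y <= M + 1 by rewrite (le_trans yM) // lerDl.
have -> : q.[a] - q.[b] - q^`().[y] * (a - b) =
  (q.[a] - q.[b] - q^`().[b] * (a - b)) + (q^`().[b] - q^`().[y]) * (a - b) by ring.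
have -> : (2 * B + B') * r * nm (a - b) = 2 * B * r * nm (a - b) + B' * r * nm (a - b) by ring.
apply: le_trans (nmD _ _) _; rewrite (nmM (_ - _)); apply: lerD.
  apply: le_trans (hB _ _ bM aM) _; rewrite expr2 mulrA ler_wpM2r ?nm_ge0 //.
  have : nm (a - b) <= 2 * r by have := nm_tri y a b; rewrite [nm (y - b)]nmB; move: ha hb; xlra.
  by move=> h; rewrite -mulrA [B * r]mulrC mulrA mulrC ler_wpM2r // ltW.
rewrite ler_wpM2r ?nm_ge0 // (le_trans (hB' _ _ yM1 bM)) // ler_wpM2l // ltW //.
Qed.

Section Orbit.
Variables (x : nat -> C) (N : nat) (L rho eta : R).
Hypothesis xq : forall r, q.[x r.+1] = x r.
Hypothesis xd : forall r, q^`().[x r] != 0.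
Let B := dprod x.
Let rad r := 4 * rho / nm (B r).
Hypothesis L0 : 0 < L.
Hypothesis rho0 : 0 < rho.
Hypothesis hL : forall r a b, (0 < r <= N)%N -> nm (a - x r) <= rad r -> nm (b - x r) <= rad r ->
  nm (q.[a] - q.[b] - q^`().[x r] * (a - b)) <= L * rad r * nm (a - b).
Hypothesis eta1 : eta <= 3^-1.
Hypothesis hsum : 2 * \sum_(s < N) L * rad s.+1 / nm q^`().[x s.+1] <= eta.

Lemma dprod_neq0 r : B r != 0.
Proof. by rewrite /B /dprod; elim/big_ind: _ => [|u v u0 v0|i _]; rewrite ?oner_eq0 ?mulf_neq0. Qed.

(** The disc of radius [3 * rho / nm (B N)] about [x N] is followed forward. Its image near [x r]
    stays within [rad r = 4 * rho / nm (B r)], the excess of 4 over 3 leaving room for a relative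
    error [1 / 3]. The relative errors of the steps add up, and [hsum] keeps their total below
    [eta]. *)
Lemma orbit_ql_aux w w' j : nm (w - x N) <= 3 * rho / nm (B N) -> nm (w' - x N) <= 3 * rho / nm (B N) ->
  (j <= N)%N ->
  nm (it q j w - it q j w' - B N / B (N - j)%N * (w - w')) <=
    2 * (\sum_(s < N | (N - j <= s)%N) L * rad s.+1 / nm q^`().[x s.+1]) * (nm (B N) / nm (B (N - j)%N) * nm (w - w')).
Proof.
pose t s := L * rad s.+1 / nm q^`().[x s.+1].
have Bp r : 0 < nm (B r) by rewrite nm_gt0 dprod_neq0.
have rp := rho0.
have rad0 r : 0 < rad r by rewrite /rad divr_gt0 // mulr_gt0.
have t0 s : 0 < t s by rewrite /t divr_gt0 ?nm_gt0 // mulr_gt0 //; exact: L0.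
elim: j w w' => [|j ih] w w' hw hw' jN.
  rewrite /= subn0 divff ?dprod_neq0 // mul1r subrr nm0; apply: mulr_ge0; last by rewrite mulr_ge0 ?divr_ge0 ?nm_ge0.
  by rewrite mulr_ge0 // sumr_ge0 // => s _; exact: ltW (t0 s).
pose r := (N - j.+1)%N; have er : (N - j)%N = r.+1 by rewrite /r subnSK.
have rN : (r < N)%N by rewrite /r ltn_subrL (leq_ltn_trans _ jN).
pose th := \sum_(s < N | (r.+1 <= s)%N) t s.
have th1 : 2 * (th + t r) <= eta.
  apply: le_trans hsum; rewrite ler_wpM2l // /th -/(t) [leRHS](bigID (fun s : 'I_N => (r.+1 <= s)%N)) /= lerD2l.
  rewrite (bigD1 (Ordinal rN)) /= ?ltnn // lerDl sumr_ge0 // => s _; exact: ltW (t0 s).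
have th0 : 0 <= th by rewrite sumr_ge0 // => s _; exact: ltW (t0 s).
have eth : \sum_(s < N | (r <= s)%N) t s = th + t r.
  rewrite (bigD1 (Ordinal rN)) //= addrC; congr (_ + _); apply: eq_bigl => s.
  by rewrite ltn_neqAle andbC eq_sym.
have et1 := eta1.
have near v : nm (v - x N) <= 3 * rho / nm (B N) -> nm (it q j v - x r.+1) <= rad r.+1.
  move=> hv; have hx : nm (x N - x N) <= 3 * rho / nm (B N) by rewrite subrr nm0 divr_ge0 ?(ltW (Bp _)) // mulr_ge0 // ltW.
  have := ih _ _ hv hx (ltnW jN); rewrite er -/th.
  have -> : it q j (x N) = x r.+1.
    rewrite -er; elim: (j) (ltnW jN) => [|k ihk] kN; first by rewrite subn0.
    by rewrite itS ihk ?(ltnW kN) // -(subnSK kN) xq.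
  have := nmD (it q j v - x r.+1 - B N / B r.+1 * (v - x N)) (B N / B r.+1 * (v - x N)); rewrite subrK.
  rewrite (nmM (B N / _)) nm_div => h1 h2.
  set T := nm (B N) / nm (B r.+1) * _ in h1 h2.
  have hT : T <= 3 * rho / nm (B r.+1).
    rewrite /T mulrAC ler_wpM2r ?invr_ge0 ?nm_ge0 //; move: hv; rewrite ler_pdivlMr ?Bp //.
    by rewrite mulrC.
  have T0 : 0 <= T by rewrite /T mulr_ge0 ?divr_ge0 ?nm_ge0.
  have h3 : 2 * th * T <= 3^-1 * T.
    by rewrite ler_wpM2r // (le_trans _ eta1) // (le_trans _ th1) // ler_wpM2l // lerDl ltW.
  have -> : rad r.+1 = 3 * rho / nm (B r.+1) + 3^-1 * (3 * rho / nm (B r.+1)) by rewrite /rad -!mulrA; move: (rho * _) => y; lra.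
  have h4 : 3^-1 * T <= 3^-1 * (3 * rho / nm (B r.+1)) by rewrite ler_wpM2l // invr_ge0.
  move: h1 h2 h3 h4 hT; move: (3 * rho / _) (nm (it q j v - x r.+1)) (nm (_ - _ - _)) (2 * th * T) => *; lra.
have := ih _ _ hw hw' (ltnW jN); rewrite er -/th -/r => h.
rewrite !itS; set W := it q j w in h *; set W' := it q j w' in h *.
have := hL _ (near _ hw) (near _ hw'); rewrite ltnS rN -/W -/W' => /(_ isT) h1.
rewrite eth; set qd := q^`().[x r.+1] in h1.
have eB : B r.+1 = B r * qd := dprodS x r.
have qd0 : 0 < nm qd by rewrite nm_gt0; exact: xd.
have fld (F : fieldType) (a b c : F) : b != 0 -> c != 0 -> a / b = c * (a / (b * c)).
  by move=> b0 c0; field; rewrite ?b0 ?c0.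
have eqB : B N / B r = qd * (B N / B r.+1).
  by rewrite eB; apply: fld; rewrite -?nm_gt0 ?dprod_neq0.
have eqn : nm (B N) / nm (B r) = nm qd * (nm (B N) / nm (B r.+1)) by rewrite eB nmM; apply: fld; rewrite gt_eqF.
have -> : q.[W] - q.[W'] - B N / B r * (w - w') =
  (q.[W] - q.[W'] - qd * (W - W')) + qd * (W - W' - B N / B r.+1 * (w - w')) by rewrite eqB; ring.
apply: le_trans (nmD _ _) _; rewrite (nmM qd) eqn.
have hW := nmD (W - W' - B N / B r.+1 * (w - w')) (B N / B r.+1 * (w - w')).
rewrite subrK (nmM (B N / _)) nm_div in hW.
set T := nm (B N) / nm (B r.+1) * nm (w - w') in h hW *.
have T0 : 0 <= T by rewrite /T mulr_ge0 ?divr_ge0 ?nm_ge0.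
have etr : L * rad r.+1 = t r * nm qd by rewrite /t divfK // gt_eqF.
rewrite etr in h1.
have hW2 : nm (W - W') <= 2 * T.
  have : 2 * th * T <= T.
    rewrite ler_piMl //; have := ltW (t0 r); move: th1 et1; move: (t r) (th) => u v; lra.
  by move: hW h; move: (nm _) (2 * th * T) (nm (W - W')) => *; lra.
have h2 : t r * nm qd * nm (W - W') <= t r * nm qd * (2 * T) by rewrite ler_wpM2l // mulr_ge0 ?nm_ge0 // ltW.
have h3 : nm qd * nm (W - W' - B N / B r.+1 * (w - w')) <= nm qd * (2 * th * T) by rewrite ler_wpM2l ?nm_ge0.
have -> : 2 * (th + t r) * (nm qd * (nm (B N) / nm (B r.+1)) * nm (w - w')) =
  t r * nm qd * (2 * T) + nm qd * (2 * th * T) by rewrite /T; ring.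
exact: lerD (le_trans h1 h2) h3.
Qed.

Lemma orbit_ql w w' j : nm (w - x N) <= 3 * rho / nm (B N) -> nm (w' - x N) <= 3 * rho / nm (B N) ->
  (j <= N)%N ->
  nm (it q j w - it q j w' - B N / B (N - j)%N * (w - w')) <= eta * (nm (B N) / nm (B (N - j)%N) * nm (w - w')).
Proof.
move=> hw hw' jN; apply: le_trans (orbit_ql_aux hw hw' jN) _.
have lp := L0.
apply: ler_wpM2r; first by rewrite mulr_ge0 ?divr_ge0 ?nm_ge0.
apply: le_trans hsum; apply: ler_wpM2l => //.
rewrite big_mkcond; apply: ler_sum => s _; case: ifP => // _.
by rewrite divr_ge0 ?nm_ge0 // mulr_ge0 ?(ltW lp) // divr_ge0 ?nm_ge0 // mulr_ge0 // ltW.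
Qed.
End Orbit.

Section Homoclinic.
Variable ws : C.
Hypothesis gen : generic q.
Hypothesis qws : q.[ws] = ws.
Hypothesis rep : 1 < nm q^`().[ws].
Definition homo x := [/\ x 0%N = ws, forall r, q.[x r.+1] = x r &
  forall e : R, 0 < e -> exists r0, forall r, (r0 <= r)%N -> nm (x r - ws) < e].

Lemma homo_crit x r : homo x -> q^`().[x r] != 0.
Proof.
move=> [x0 xq _]; have e : it q r (x r) = ws by elim: r => // r ih; rewrite itSr xq.
by apply/eqP => h; have [/(_ _ r h)] := gen; rewrite itS e qws eqxx.
Qed.

(** Near [ws] the derivative exceeds [ka > 1], so the products [dprod] grow geometrically and the
    sum of their inverses converges; one constant is kept for all the bounds. *)
Lemma homo_sum x : homo x -> exists C0 : R, [/\ 0 < C0,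
  (forall N, \sum_(s < N) (nm (dprod x s.+1))^-1 <= C0), (forall r, (nm q^`().[x r])^-1 <= C0),
  (forall r, nm (x r) <= C0) &
  forall K : R, exists n0, forall n, (n0 <= n)%N -> K <= nm (dprod x n)].
Proof.
move=> hx; have [x0 xq xl] := hx; have xd r := homo_crit r hx.
pose mu := nm q^`().[ws]; pose ka := (mu + 1) / 2; have rp : 1 < mu := rep.
have ka1 : 1 < ka by rewrite /ka; lra.
have [r1 [hr1 hr2]] : exists r1, (forall r, (r1 <= r)%N -> ka <= nm q^`().[x r]) /\
    forall r, (r1 <= r)%N -> nm (x r) <= nm ws + 1.
  have e0 : 0 < (mu - 1) / 2 by lra.
  have [del del0 hd] := horner_cont q^`() ws e0; have m0 : 0 < Num.min del 1 by rewrite lt_min del0 ltr01.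
  have [r0 h0] := xl _ m0; exists r0; split=> r /h0; rewrite lt_min => /andP[/hd h1 h2]; last first.
    by have := nm_lo (x r) ws; move: h2; xlra.
  have := nm_lo q^`().[ws] q^`().[x r]; rewrite nmB -/mu; move: h1; rewrite /ka.
  by move: (nm (_ - _)) (nm q^`().[x r]) => *; lra.
pose b r := nm (dprod x r); have b0 r : 0 < b r by rewrite nm_gt0 dprod_neq0.
have bg j : ka ^+ j * b r1 <= b (r1 + j)%N.
  elim: j => [|j ih]; first by rewrite mul1r addn0.
  have k0 : 0 <= ka := ltW (lt_trans ltr01 ka1).
  rewrite addnS /b dprodS nmM exprSr -mulrA [ka * _]mulrC mulrA; apply: ler_pM => //.
    by rewrite mulr_ge0 ?(ltW (b0 _)) // exprn_ge0.
  by rewrite hr1 // -addnS leq_addr.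
pose a1 := \sum_(s < r1) (b s.+1)^-1; pose g := (b r1)^-1 / (1 - ka^-1).
pose a2 := \sum_(r < r1) (nm q^`().[x r])^-1; pose a3 := \sum_(r < r1) nm (x r).
have kv : 0 <= ka^-1 < 1 by rewrite invr_ge0 invf_lt1 ?ka1 ?(ltW (lt_trans ltr01 ka1)) ?(lt_trans ltr01 ka1).
have a10 : 0 <= a1 by rewrite sumr_ge0 // => s _; rewrite invr_ge0 ltW.
have a20 : 0 <= a2 by rewrite sumr_ge0 // => s _; rewrite invr_ge0 nm_ge0.
have a30 : 0 <= a3 by rewrite sumr_ge0 // => s _; rewrite nm_ge0.
have g0 : 0 <= g by rewrite divr_ge0 ?invr_ge0 ?(ltW (b0 _)) //; move: kv => /andP[_]; lra.
have wn := nm_ge0 ws.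
exists (a1 + g + (1 + a2) + (a3 + nm ws + 1)); split.
- by lra.
- move=> N; apply: le_trans (_ : a1 + g <= _); last by lra.
  apply: le_trans (_ : \sum_(s < r1 + N) (b s.+1)^-1 <= _).
    rewrite addnC big_split_ord /= lerDl sumr_ge0 // => s _; rewrite invr_ge0 ltW //.
  rewrite big_split_ord /= lerD2l; apply: le_trans (_ : \sum_(j < N) (b r1)^-1 * ka^-1 ^+ j <= _).
    apply: ler_sum => j _; rewrite exprVn -invfM lef_pV2 ?posrE ?mulr_gt0 ?exprn_gt0 // ?(lt_trans ltr01) //.
    rewrite -addnS; apply: le_trans (bg j.+1).
    by rewrite mulrC ler_wpM2r ?(ltW (b0 _)) // exprS ler_peMl ?exprn_ge0 ?(ltW ka1) ?(ltW (lt_trans ltr01 ka1)).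
  by rewrite -mulr_sumr ler_wpM2l ?invr_ge0 ?(ltW (b0 _)) // geo_sum.
- move=> r; apply: le_trans (_ : 1 + a2 <= _); last by lra.
  case: (ltnP r r1) => h.
    rewrite /a2 (bigD1 (Ordinal h)) //= addrCA lerDl addr_ge0 // sumr_ge0 // => s _; by rewrite invr_ge0 nm_ge0.
  rewrite (le_trans (_ : _ <= 1)) ?lerDl // invf_le1 ?nm_gt0 // (le_trans (ltW ka1)) // hr1 //.
- move=> r; apply: le_trans (_ : a3 + nm ws + 1 <= _); last by lra.
  case: (ltnP r r1) => h; last by have := hr2 _ h; lra.
  rewrite /a3 (bigD1 (Ordinal h)) //= -!addrA lerDl !addr_ge0 // sumr_ge0 // => s _; exact: nm_ge0.
move=> K; have [n hn] := pow_large (K / b r1) ka1; exists (r1 + n)%N => k hk.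
have [j -> hj] : exists2 j, k = (r1 + j)%N & (n <= j)%N by exists (k - r1)%N; move: hk; clear; lia.
by apply: le_trans (bg _); rewrite -ler_pdivrMr // ltW // hn.
Qed.
End Homoclinic.
End Distortion.

(** * Weights of the neutral cycle *)

Section Weights.
Variables (R : realType) (m : nat) (D0 : nat -> Cplx R) (w : Cplx R).
Local Notation C := (Cplx R).
Hypothesis m0 : (0 < m)%N.
Hypothesis D00 : forall j, D0 j != 0.
Hypothesis D0m : forall j, D0 (j + m)%N = D0 j.
Hypothesis D0w : \prod_(j < m) D0 j = w.
Hypothesis ew : w ^+ 2 + w + 1 = 0.

(* the weights of a cycle read backwards from the point of index 0 *)
Definition wt r : C := \prod_(i < r) D0 (m * i.+1 - i.+1)%N.

Lemma per_mul j k : D0 (j + k * m)%N = D0 j.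
Proof. by elim: k => [|k ih]; rewrite ?addn0 // mulSnr addnA D0m. Qed.

(** The index [m * i.+1 - i.+1] in [wt] is [- i.+1] modulo the period, written without truncated
    subtraction; any multiple [n * m] that is long enough gives the same factor. *)
Lemma wtE n r : (r <= n * m)%N -> wt r = \prod_(i < r) D0 (n * m - i.+1)%N.
Proof.
move=> rn; apply: eq_bigr => i _; have iN : (i < n * m)%N := leq_trans (ltn_ord i) rn.
rewrite -(per_mul (n * m - i.+1) i.+1) -(per_mul (m * i.+1 - i.+1) n); congr D0.
have h : (i.+1 <= m * i.+1)%N by rewrite leq_pmull.
have arith (a b c : nat) : (c <= a -> c <= b -> a - c + b = b - c + a)%N by clear; lia.
by rewrite [(i.+1 * m)%N]mulnC; exact: arith.
Qed.

Let Dn i := D0 (m * i.+1 - i.+1)%N.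
Let Dnm i : Dn (i + m)%N = Dn i.
Proof.
rewrite /Dn -(per_mul (m * i.+1 - i.+1) m.-1); congr D0.
have h : (i.+1 <= m * i.+1)%N by rewrite leq_pmull.
by case: (m) m0 h => // k _ h /=; move: h; clear; nia.
Qed.

Lemma wt_shift r : wt (r + m)%N = w * wt r.
Proof.
have win s : \prod_(i < m) Dn (s + i)%N = w.
  elim: s => [|s ih].
    rewrite -D0w (reindex_inj rev_ord_inj) /=; apply: eq_bigr => i _; rewrite add0n /Dn.
    rewrite -(per_mul i (m - i.+1)); congr D0.
    have arith (j k M : nat) : M = (j.+1 + k)%N -> (M * k.+1 - k.+1 = j + k * M)%N by clear; nia.
    by apply: arith; rewrite subnKC.
  have e1 : \prod_(i < m.+1) Dn (s + i)%N = Dn s * \prod_(i < m) Dn (s.+1 + i)%N.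
    by rewrite big_ord_recl addn0; congr (_ * _); apply: eq_bigr => i _; rewrite /= addSnnS.
  have e2 : \prod_(i < m.+1) Dn (s + i)%N = \prod_(i < m) Dn (s + i)%N * Dn s by rewrite big_ord_recr /= Dnm.
  by apply: (mulfI (D00 _ : Dn s != 0)); rewrite -e1 e2 ih mulrC.
by rewrite /wt big_split_ord /= win mulrC.
Qed.

Lemma wt_shiftn r k : wt (r + k * m)%N = w ^+ k * wt r.
Proof. by elim: k => [|k ih]; rewrite ?addn0 ?mul1r // mulSnr addnA wt_shift ih exprS mulrA. Qed.

Lemma periodic_bound (f : nat -> R) K : (0 < K)%N -> (forall n, 0 <= f n) -> (forall n, f (n + K)%N = f n) ->
  exists2 B : R, 0 < B & forall n, f n <= B.
Proof.
move=> K0 f0 fK; exists (1 + \sum_(s < K) f s) => [|n]; first by rewrite ltr_pwDl // sumr_ge0.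
have -> : f n = f (n %% K)%N.
  by rewrite {1}(divn_eq n K); elim: (n %/ K)%N => [|k ih]; rewrite ?add0n // mulSnr addnAC fK.
rewrite (bigD1 (Ordinal (ltn_pmod n K0))) //= addrCA lerDl addr_ge0 // sumr_ge0 //.
Qed.

(** One turn multiplies the weights by [w], of modulus 1, so their moduli are periodic. The sum over
    three turns is [1 + w + w ^+ 2 = 0] times the sum over one, so the partial sums are periodic
    too. *)
Lemma wt_bounds : exists a bt Bs : R, [/\ 0 < a, 0 < bt, forall r, a <= nm (wt r),
  forall r, nm (wt r) <= bt & forall n, nm (\sum_(r < n) wt r) <= Bs].
Proof.
have [w3 w1 _] := cube3 ew.
have wt0 r : 0 < nm (wt r).
  by rewrite nm_gt0 /wt; elim/big_ind: _ => [|x y x0 y0|i _]; rewrite ?oner_eq0 ?mulf_neq0.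
have nwt r : nm (wt (r + m)%N) = nm (wt r) by rewrite wt_shift nmM w1 mul1r.
have [bt bt0 hbt] := periodic_bound m0 (fun r => nm_ge0 (wt r)) nwt.
have iwt0 r : 0 <= (nm (wt r))^-1 by rewrite invr_ge0 nm_ge0.
have iwt r : (nm (wt (r + m)%N))^-1 = (nm (wt r))^-1 by rewrite nwt.
have [a a0 ha] := periodic_bound m0 iwt0 iwt.
have [||Bs Bs0 hBs] := @periodic_bound (fun n => nm (\sum_(r < n) wt r)) (3 * m) _ (fun n => nm_ge0 _) _.
- by rewrite muln_gt0.
- move=> n; congr nm; rewrite addnC big_split_ord /=.
  have h : \sum_(i < n) wt (3 * m + i)%N = \sum_(i < n) wt i.
    by apply: eq_bigr => i _; rewrite addnC wt_shiftn w3 mul1r.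
  rewrite h -[RHS]add0r; congr (_ + _).
  have e k : \sum_(i < k * m) wt i = (\sum_(i < k) w ^+ i) * \sum_(i < m) wt i.
    elim: k => [|k ih]; first by rewrite !big_ord0 mul0r.
    rewrite mulSnr big_split_ord /= ih big_ord_recr /= mulrDl; congr (_ + _).
    by rewrite mulr_sumr; apply: eq_bigr => i _; rewrite addnC wt_shiftn.
  by rewrite e !big_ord_recr big_ord0 /= add0r expr0 expr1 addrAC [1 + w ^+ 2]addrC addrAC ew mul0r.
exists a^-1, bt, Bs; split=> //; first by rewrite invr_gt0.
by move=> r; rewrite -[leRHS]invrK lef_pV2 ?posrE ?invr_gt0 ?wt0 // ha.
Qed.
End Weights.

(** * Three delayed homoclinic orbits *)

Section Model.
Variables (R : realType) (q : {poly Cplx R}) (d : nat) (ws : Cplx R).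
Local Notation C := (Cplx R).
Hypothesis d0 : (0 < d)%N.
Hypothesis sq : size q = d.+2.
Hypothesis gen : generic q.
Hypothesis qws : q.[ws] = ws.
Hypothesis rep : 1 < nm q^`().[ws].

(** The solution at time [N] of [X_(j+1) = D j * X_j + (y_j - ws)], [X_0 = 0], along the orbit of
    [y]: the kick received [r + 1] steps before the end is transported by the last [r]
    derivatives. *)
Definition Sw (D : nat -> C) N y : C :=
  \sum_(r < N) (\prod_(i < r) D (N - i.+1)%N) * (it q (N - r.+1) y - ws).

Definition shift_orbit (u : nat -> C) k r := if (r <= k)%N then ws else u (r - k)%N.

Lemma shift_homo u k : homo q ws u -> homo q ws (shift_orbit u k).
Proof.
move=> [u0 uq ul]; split; first by rewrite /shift_orbit leq0n.
  move=> r; rewrite /shift_orbit; case: (leqP r k) => h1; last by rewrite leqNgt (leqW h1) /= subSn ?(ltnW h1).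
  case: ltnP => h2; first exact: qws.
  by rewrite subSn // uq; have -> : (r - k = 0)%N by apply/eqP.
move=> e e0; have [r0 h] := ul e e0; exists (r0 + k)%N => r hr; rewrite /shift_orbit.
case: leqP => h1; first by rewrite subrr nm0.
by apply: h; rewrite leq_subRL ?(ltnW h1) // addnC.
Qed.

Lemma prod_seq_cont (D0 : nat -> C) N (e : R) : 0 < e -> exists2 del : R, 0 < del &
  forall D : nat -> C, (forall j, (j < N)%N -> nm (D j - D0 j) < del) -> forall r, (r < N)%N ->
    nm (\prod_(i < r) D (N - i.+1)%N - \prod_(i < r) D0 (N - i.+1)%N) < e.
Proof.
move=> e0; pose P r (del : R) := forall D : nat -> C, (forall j, (j < N)%N -> nm (D j - D0 j) < del) ->
  (r < N)%N -> nm (\prod_(i < r) D (N - i.+1)%N - \prod_(i < r) D0 (N - i.+1)%N) < e.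
have [|r t t' t0 tt' h D hD|del del0 h] := @fin_unif R P N; last 2 first.
- by apply: h => j jN; apply: lt_le_trans (hD j jN) tt'.
- by exists del => // D hD r rN; apply: h.
move=> r; rewrite {}/P; elim: r e e0 => [|r ih] e e0.
  by exists 1 => // D _ _; rewrite !big_ord0 subrr nm0.
have [d1 d10 h1] := prod_cont (\prod_(i < r) D0 (N - i.+1)%N) (D0 (N - r.+1)%N) e0.
have [d2 d20 h2] := ih _ d10; exists (Num.min d1 d2) => [|D hD rN]; first by rewrite lt_min d10.
rewrite !big_ord_recr /=; apply: h1; last first.
  by apply: lt_le_trans (hD _ _) _; rewrite ?ge_min ?lexx // ltn_subrL (leq_ltn_trans _ rN).
by apply: h2 (ltnW rN) => j jN; apply: lt_le_trans (hD j jN) _; rewrite ge_min lexx orbT.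
Qed.

(** [v i] is the point [N] steps back on the homoclinic orbit delayed by [i] turns, and [A i] the
    derivative of the [N]-th iterate there. With [c] the inverse of the undelayed sum, the three
    sums are close to [w ^+ i]. The undelayed sum is at least 1 in modulus, hence [nm c <= 1]. [N]
    is a multiple of [3 * m] for the multiplier of the cycle over [N] steps to be
    [w ^+ (3 * n.+1) = 1]. *)
Lemma model_points m (D0 : nat -> C) (w : C) (eta K : R) : (0 < m)%N -> (forall j, D0 j != 0) ->
  (forall j, D0 (j + m)%N = D0 j) -> \prod_(j < m) D0 j = w -> w ^+ 2 + w + 1 = 0 -> 0 < eta <= 3^-1 ->
  exists (n : nat) (rho del : R) (c : C) (v A : 'I_3 -> C), let N := (n.+1 * 3 * m)%N in
  [/\ 0 < rho, 0 < del & forall i, [/\ K <= nm (A i), nm (v i - ws) + 3 * rho / nm (A i) <= rho, it q N (v i) = ws,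
    (forall y y', nm (y - v i) <= 3 * rho / nm (A i) -> nm (y' - v i) <= 3 * rho / nm (A i) ->
      nm (it q N y - it q N y' - A i * (y - y')) <= eta * nm (A i) * nm (y - y')) &
    forall D : nat -> C, (forall j, (j < N)%N -> nm (D j - D0 j) < del) ->
      nm (c * Sw D N (v i) - w ^+ i) <= eta /\
      forall y y', nm (y - v i) <= 3 * rho / nm (A i) -> nm (y' - v i) <= 3 * rho / nm (A i) ->
        nm (c * Sw D N y - c * Sw D N y') <= eta / rho * nm (A i) * nm (y - y')]].
Proof.
move=> m0 D00 D0m D0w ew /andP[eta0 eta1]; have [w3 w1 _] := cube3 ew.
have [a [bt [Bs [a0 bt0 be_lo be_hi be_sum]]]] := wt_bounds m0 D00 D0m D0w ew.
(* The shift by one makes [be r.+1], which [homoclinic] pairs with [u r.+1], the weight of index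
   [r]. *)
pose wb := wt m D0; pose be r := wb r.-1.
have [u [r0 [th [u0 uq /andP[th0 th1] uth hE]]]] := @homoclinic R q d ws d0 sq gen qws rep be a bt Bs a0
  (fun r => be_lo _) (fun r => be_hi _) be_sum 1.
have hu : homo q ws u.
  split=> // e e0; have [|n hn] := @pow_small R th e _ e0; first by rewrite (ltW th0).
  exists (r0 + n)%N => r hr; have -> : r = (r0 + (r - r0))%N by move: hr; clear; lia.
  by apply: le_lt_trans (uth _) (hn _ _); move: hr; clear; lia.
pose x (i : 'I_3) := shift_orbit u (i * m).
have hx i : homo q ws (x i) := shift_homo _ hu.
have [C0 hC] := choice (fun i => homo_sum gen qws rep (hx i)).
have [C1 C10 hC1] : exists2 C1 : R, 0 < C1 & forall i, C0 i <= C1.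
  have p i : 0 < C0 i by have [] := hC i.
  exists (\sum_i C0 i) => [|i]; last by rewrite (bigD1 i) //= lerDl sumr_ge0 // => j _; exact: ltW.
  by rewrite (bigD1 ord0) //= ltr_pwDl // sumr_ge0 // => j _; exact: ltW.
have [L L0 hL] := poly_ql q C1.
(* The three terms bound, in units of [rho]: the radii [rad], to be at most 1; the total distortion
   in [orbit_ql]; and the variation of the weighted sum over one disc. *)
pose K0 := 4 * C1 + 8 * L * C1 ^+ 2 + 4 * bt * C1.
have [t1 t2 t3] : [/\ 0 < 4 * C1, 0 < 8 * L * C1 ^+ 2 & 0 < 4 * bt * C1] by split; rewrite !mulr_gt0 ?exprn_gt0.
have K00 : 0 < K0 by rewrite /K0; lra.
pose rho := eta / K0; have rho0 : 0 < rho by rewrite divr_gt0.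
have rhoK : rho * K0 = eta by rewrite /rho divfK // gt_eqF.
have [s1 s2 s3] : [/\ rho * (4 * C1) <= eta, rho * (8 * L * C1 ^+ 2) <= eta & rho * (4 * bt * C1) <= eta].
  have := mulr_gt0 rho0 t1; have := mulr_gt0 rho0 t2; have := mulr_gt0 rho0 t3.
  by move: rhoK; rewrite /K0 !mulrDr; move: (rho * (4 * C1)) (rho * (8 * L * _)) (rho * (4 * bt * _)) => *; split; lra.
pose E n := \sum_(r < n) be r.+1 * (u r.+1 - ws).
have tail j n : nm (E (r0 + j + n)%N - E (r0 + j)%N) <= bt * (th ^+ j / (1 - th)).
  rewrite /E big_split_ord /= addrAC subrr add0r.
  apply: le_trans (nm_sum _ _ _) _; apply: le_trans (_ : \sum_(i < n) bt * (th ^+ j * th ^+ i) <= _).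
    apply: ler_sum => i _; rewrite nmM; apply: ler_pM; rewrite ?nm_ge0 //; first exact: be_hi.
    rewrite -addnA -addnS; apply: le_trans (uth _) _.
    by rewrite -exprD exprSr ler_piMr ?exprn_ge0 ?(ltW th0) ?(ltW th1).
  by rewrite -mulr_sumr -mulr_sumr ler_wpM2l ?(ltW bt0) // ler_wpM2l ?exprn_ge0 ?(ltW th0) // geo_sum // (ltW th0) //.
have q1 : 0 < 1 - th by lra.
have [|j0 hj0] := @pow_small R th (eta / 2 * (1 - th) / bt) _ (divr_gt0 (mulr_gt0 (divr_gt0 eta0 (ltr0n _ 2)) q1) bt0).
  by rewrite (ltW th0).
have big i : exists n0, forall n, (n0 <= n)%N -> [/\ nm (x i n - ws) < rho / 2, K <= nm (dprod q (x i) n) & 6 <= nm (dprod q (x i) n)].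
  have [_ _ xl] := hx i; have [n1 h1] := xl _ (divr_gt0 rho0 (ltr0n _ 2)).
  have [_ _ _ _ hK] := hC i; have [n2 h2] := hK K; have [n3 h3] := hK 6.
  have [n [? ? ? _]] := nat_ub4 n1 n2 n3 0; exists n => k kn; split; [apply: h1|apply: h2|apply: h3]; exact: leq_trans kn.
have [n0 hn0] := choice big.
pose n := (n0 ord0 + n0 (inord 1) + n0 (inord 2) + r0 + j0)%N.
have nle (i : 'I_3) : (n0 i <= n)%N.
  have : i \in [:: ord0; inord 1; inord 2].
    rewrite !inE -!val_eqE /= !inordK //; case: i => -[|[|[|]]] //.
  by rewrite !inE /n => /or3P[] /eqP ->; clear; lia.
pose N := (n.+1 * 3 * m)%N; have nN : (n <= N)%N by rewrite /N; move: m0; clear; nia.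
have imN (i : 'I_3) : exists2 k, N = (i * m + (r0 + j0 + k))%N & (i * m <= N)%N.
  have h : (i * m + (r0 + j0) <= N)%N.
    have : (i <= 2)%N by rewrite -ltnS.
    have : (r0 + j0 <= n)%N by rewrite /n; clear; lia.
    by rewrite /N; move: m0; clear; move: (nat_of_ord i) (r0 + j0)%N => I J; nia.
  by exists (N - (i * m + (r0 + j0)))%N; move: h; clear; lia.
pose v i := x i N; pose A i := dprod q (x i) N.
pose M1 := N.+1%:R * (C1 + nm ws + 1) : R.
have M10 : 0 < M1 by rewrite mulr_gt0 ?ltr0n // ltr_wpDl // addr_ge0 ?nm_ge0 // ltW.
pose e2 := Num.min bt (eta / 2 / M1).
have e20 : 0 < e2 by rewrite lt_min bt0 !divr_gt0.
have [del del0 hdel] := prod_seq_cont D0 N e20.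
have eW r : (r < N)%N -> \prod_(i < r) D0 (N - i.+1)%N = wb r.
  by move=> rN; rewrite /wb (@wtE R m D0 m0 D0m (n.+1 * 3)) // ltnW.
have [k0 eN0 _] := imN ord0; have EN : 1 <= nm (E N) by rewrite eN0 mul0n add0n -addnA; exact: hE.
pose c := (E N)^-1; have c1 : nm c <= 1.
  by rewrite nmV invf_le1 // (lt_le_trans ltr01).
exists n, rho, del, c, v, A; rewrite -/N; split=> // i.
have [h1 h2 h3] := hn0 i N (leq_trans (nle i) nN).
have [_ hS hd hb _] := hC i; have [xi0 xq _] := hx i.
have xd r := homo_crit gen qws r (hx i).
have iB s : (nm (dprod q (x i) s.+1))^-1 <= C1.
  apply: le_trans (hC1 i); apply: le_trans (hS s.+1); rewrite big_ord_recr /= lerDr sumr_ge0 // => j _.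
  by rewrite invr_ge0 nm_ge0.
have c8 : 0 <= 8 * L * rho := ltW (mulr_gt0 (mulr_gt0 (ltr0n _ 8) L0) rho0).
have qlx := @orbit_ql R q (x i) N L rho eta xq xd L0 rho0 _ eta1 _.
have {qlx} qlx : forall w0 w' : C, forall j, nm (w0 - v i) <= 3 * rho / nm (A i) ->
   nm (w' - v i) <= 3 * rho / nm (A i) -> (j <= N)%N ->
   nm (it q j w0 - it q j w' - A i / dprod q (x i) (N - j) * (w0 - w')) <=
   eta * (nm (A i) / nm (dprod q (x i) (N - j)) * nm (w0 - w')).
  move=> w0 w' j; apply: qlx.
    move=> r p p' /andP[rp _] hp hp'; apply: hL => //; first exact: le_trans (hb r) (hC1 i).
    case: r rp {hp hp'} => // r _; rewrite -mulrA mulrC -mulrA [_ * 4]mulrC.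
    apply: le_trans (_ : rho * (4 * C1) <= _); last by move: s1 eta1; lra.
    by rewrite ler_wpM2l ?(ltW rho0) // ler_wpM2l.
  apply: le_trans s2; rewrite mulr_sumr.
  apply: le_trans (_ : \sum_(s < N) (8 * L * rho * C1) * (nm (dprod q (x i) s.+1))^-1 <= _).
    apply: ler_sum => s _; have := le_trans (hd s.+1) (hC1 i).
    have -> : 2 * (L * (4 * rho / nm (dprod q (x i) s.+1)) / nm q^`().[x i s.+1]) =
      8 * L * rho * (nm (dprod q (x i) s.+1))^-1 * (nm q^`().[x i s.+1])^-1.
      by move: (nm (dprod _ _ _))^-1 (nm q^`().[x i s.+1])^-1 => y z; ring.
    have -> : 8 * L * rho * C1 / nm (dprod q (x i) s.+1) = 8 * L * rho * (nm (dprod q (x i) s.+1))^-1 * C1.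
      by move: (nm (dprod _ _ _))^-1 => y; ring.
    by move=> h; rewrite ler_wpM2l // divr_ge0 ?nm_ge0.
  rewrite -mulr_sumr; have -> : rho * (8 * L * C1 ^+ 2) = 8 * L * rho * C1 * C1 by ring.
  by apply: ler_wpM2l; [exact: mulr_ge0 c8 (ltW C10)|exact: le_trans (hS N) (hC1 i)].
split.
- exact: h2.
- have h6 : 3 * rho / nm (A i) <= rho / 2.
    by rewrite ler_pdivrMr //; have := ler_wpM2l (ltW rho0) h3; rewrite -/(A i); lra.
  by move: h1 h6; rewrite -/(v i); move: (_ / nm _) => z; lra.
- have orb j : it q j (x i j) = ws by elim: j => // j ih; rewrite itSr xq.
  exact: orb.
- move=> y y' hy hy'; have := qlx y y' N hy hy' (leqnn N).
  by rewrite subnn /dprod big_ord0 nm1 !divr1 mulrA.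
move=> D hD; have hpr r : (r < N)%N -> nm (\prod_(k < r) D (N - k.+1)%N - wb r) < e2.
  by move=> rN; rewrite -(eW r rN); apply: hdel.
have pbt r : (r < N)%N -> nm (\prod_(k < r) D (N - k.+1)%N) <= 2 * bt.
  move=> rN; have := hpr r rN; rewrite lt_min => /andP[h _].
  by have := be_hi r; have := nm_lo (\prod_(k < r) D (N - k.+1)%N) (wb r); move: h; rewrite /wb; xlra.
split; last first.
  move=> y y' hy hy'; rewrite -mulrBr nmM /Sw -sumrB.
  apply: le_trans (ler_piMl (nm_ge0 _) c1) _.
  apply: le_trans (nm_sum _ _ _) _.
  apply: le_trans (_ : \sum_(r < N) (4 * bt * nm (A i) * nm (y - y')) * (nm (dprod q (x i) r.+1))^-1 <= _).
    apply: ler_sum => r _; rewrite -mulrBr opprB addrA subrK nmM.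
    have rN := ltn_ord r; have := qlx y y' (N - r.+1)%N hy hy' (leq_subr _ _); rewrite subKn //.
    set B := dprod _ _ _; set W := it q _ y; set W' := it q _ y' => h.
    have h' : nm (W - W') <= 2 * (nm (A i) / nm B * nm (y - y')).
      have := nmD (W - W' - A i / B * (y - y')) (A i / B * (y - y')); rewrite subrK (nmM (A i / B)) nm_div.
      set T := nm (A i) / nm B * _ in h *; have T0 : 0 <= T by rewrite /T mulr_ge0 ?divr_ge0 ?nm_ge0.
      have : eta * T <= T by rewrite ler_piMl //; move: eta1; lra.
      by move: h; move: (eta * T) (nm (W - W' - _)) (nm (W - W')) => *; lra.
    apply: le_trans (ler_pM (nm_ge0 _) (nm_ge0 _) (pbt r rN) h') _.
    by rewrite le_eqVlt; apply/orP; left; apply/eqP; move: (nm B)^-1 => z; ring.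
  rewrite -mulr_sumr; apply: le_trans (_ : 4 * bt * nm (A i) * nm (y - y') * C1 <= _).
    by rewrite ler_wpM2l ?(le_trans (hS N)) // !mulr_ge0 ?nm_ge0 ?(ltW bt0).
  have : 4 * bt * C1 <= eta / rho by rewrite ler_pdivlMr // mulrC.
  move=> h; have -> : 4 * bt * nm (A i) * nm (y - y') * C1 = 4 * bt * C1 * (nm (A i) * nm (y - y')) by ring.
  by rewrite -[leRHS]mulrA ler_wpM2r // mulr_ge0 ?nm_ge0.
(* The first [i * m] terms vanish, the orbit being still at [ws], and the weights of the others are
   shifted by [i] turns. *)
have SE : \sum_(r < N) wb r * (x i r.+1 - ws) = w ^+ i * E (N - i * m)%N.
  have SEk k : \sum_(r < i * m + k) wb r * (x i r.+1 - ws) = w ^+ i * E k.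
    rewrite big_split_ord /= big1 ?add0r; last first.
      by move=> r _; rewrite /x /shift_orbit ltn_ord subrr mulr0.
    rewrite /E mulr_sumr; apply: eq_bigr => r _; rewrite mulrA; congr (_ * _).
      by rewrite /be /wb addnC (wt_shiftn m0 D00 D0m D0w).
    by rewrite /x /shift_orbit -addnS leqNgt -[X in (X < _)%N]addn0 ltn_add2l /= addKn.
  by have [k _ le] := imN i; have := SEk (N - i * m)%N; rewrite subnKC.
have orb k j : it q j (x i (j + k)%N) = x i k.
  by elim: j => // j ih; rewrite itSr addSn xq.
have SD : nm (Sw D N (v i) - w ^+ i * E (N - i * m)%N) <= eta / 2.
  rewrite -SE /Sw -sumrB; apply: le_trans (nm_sum _ _ _) _.
  apply: le_trans (_ : \sum_(r < N) e2 * (C1 + nm ws) <= _).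
    apply: ler_sum => r _; have rN := ltn_ord r.
    have -> : it q (N - r.+1) (v i) = x i r.+1.
      by have := orb r.+1 (N - r.+1)%N; rewrite subnK.
    rewrite -mulrBl nmM; apply: ler_pM; rewrite ?nm_ge0 ?(ltW (hpr r rN)) //.
    by apply: le_trans (nmBD _ _) _; rewrite lerD2r (le_trans (hb _)).
  rewrite sumr_const card_ord -[_ *+ N]mulr_natr.
  have h : e2 * M1 <= eta / 2 by rewrite -ler_pdivlMr // ge_min lexx orbT.
  apply: le_trans h; rewrite /M1 -mulrA ler_wpM2l ?(ltW e20) // mulrC ler_pM ?ler0n ?addr_ge0 ?nm_ge0 ?(ltW C10) //.
    by rewrite ler_nat.
  by rewrite lerDl.
have ED : nm (E (N - i * m)%N - E N) <= eta / 2.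
  have [k e1 _] := imN i; have -> : (N - i * m = r0 + (j0 + k))%N by rewrite e1; clear; lia.
  have -> : N = (r0 + (j0 + k) + i * m)%N by rewrite e1; clear; lia.
  rewrite nmB; apply: le_trans (tail _ _) _; have := hj0 (j0 + k)%N (leq_addr _ _).
  rewrite ltr_pdivlMr // mulrC mulrA ler_pdivrMr //; exact: ltW.
have En0 : E N != 0 by rewrite -nm_gt0 (lt_le_trans ltr01).
have -> : c * Sw D N (v i) - w ^+ i = c * (Sw D N (v i) - w ^+ i * E (N - i * m)%N) + c * w ^+ i * (E (N - i * m)%N - E N).
  have cE : c * E N = 1 by rewrite mulVf.
  transitivity (c * Sw D N (v i) - w ^+ i * (c * E N)); last by ring.
  by rewrite cE mulr1.
apply: le_trans (nmD _ _) _; rewrite (nmM c) (nmM (c * _)) (nmM c) nmX w1 expr1n mulr1.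
have := ler_pM (nm_ge0 c) (nm_ge0 _) c1 SD; have := ler_pM (nm_ge0 c) (nm_ge0 _) c1 ED; rewrite !mul1r.
by move: (nm c * _) (nm c * _) => *; lra.
Qed.
End Model.

(** * The skew product in units of [k] *)

Section Scaled.
Variables (R : realType) (P q : {poly Cplx R}) (z ws c : Cplx R).
Local Notation C := (Cplx R).

Definition skw (k : R) (p : C * C) : C * C := (P.[p.1] + rc k * c * (p.2 - ws), q.[p.2]).

(** The deviation of the [x]-coordinate from the orbit of [z], divided by [k]; [Ls] is its limit as
    [k] tends to 0. *)
Fixpoint Xs (k : R) (x w : C) j : C := if j is i.+1 then
  (P.[it P i z + rc k * Xs k x w i] - P.[it P i z]) / rc k + c * (it q i w - ws) else x.

Lemma iter_skw (k : R) x w j : 0 < k ->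
  iter j (skw k) (z + rc k * x, w) = (it P j z + rc k * Xs k x w j, it q j w).
Proof.
move=> k0; elim: j => // j ih; rewrite iterS ih /skw /=; congr pair.
have rk : rc k != 0 by rewrite -nm_gt0 nm_rc gtr0_norm.
by move: P.[it P j z + _] P.[it P j z] (it q j w - ws) => u v t; field.
Qed.

Let D j := P^`().[it P j z].
Definition Ls x w j : C := (\prod_(i < j) D i) * x + c * Sw q ws D j w.

Lemma Sw_rec j w : Sw q ws D j.+1 w = it q j w - ws + D j * Sw q ws D j w.
Proof.
rewrite /Sw big_ord_recl big_ord0 mul1r subSS subn0; congr (_ + _).
rewrite mulr_sumr; apply: eq_bigr => r _; rewrite big_ord_recl /= subSS subn0 -mulrA; congr (_ * (_ * _)).
Qed.

Lemma LsS x w j : Ls x w j.+1 = D j * Ls x w j + c * (it q j w - ws).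
Proof. by rewrite /Ls Sw_rec big_ord_recr /=; ring. Qed.

(** In units of [k] the second-order terms of [P] carry a factor [k]. Not only the values but also
    the differences of [Xs - Ls] are [O(k)], as a C^1 comparison with the affine model requires. The
    bound 3 on [x] is the radius of the boxes used later. *)
Lemma scaled (M : R) j : exists Cj k0 : R, [/\ 0 < Cj, 0 < k0 & forall k x w x' w', 0 < k <= k0 ->
  nm x <= 3 -> nm w <= M -> nm x' <= 3 -> nm w' <= M ->
  [/\ nm (Xs k x w j) <= Cj,
     nm (Xs k x w j - Xs k x' w' j) <= Cj * (nm (x - x') + nm (w - w')),
     nm (Xs k x w j - Ls x w j) <= Cj * k &
     nm (Xs k x w j - Ls x w j - (Xs k x' w' j - Ls x' w' j)) <= Cj * k * (nm (x - x') + nm (w - w'))]].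
Proof.
elim: j => [|j [Cj [k0 [C0 k00 ih]]]].
  exists 3, 1; split=> // k x w x' w' /andP[k0 _] hx _ _ _.
  have L0 y v : Ls y v 0 = y by rewrite /Ls /Sw !big_ord0 mul1r mulr0 addr0.
  have h := nm_ge0 (w - w'); have h' := nm_ge0 (x - x').
  rewrite !L0 !subrr nm0; split; rewrite ?mulr_ge0 ?addr_ge0 ?(ltW k0) //=.
  by move: h h'; lra.
have [L L0 hL] := poly_ql P (nm (it P j z)).
have [Bq Bq0 hBq] := nm_horner_le (itp q j) M; have [Lq Lq0 hLq] := poly_lip (itp q j) M.
pose T := nm (D j) * Cj + L * Cj ^+ 2 + nm c * (Bq + nm ws + Lq) + 1.
have p1 : 0 <= nm (D j) * Cj by rewrite mulr_ge0 ?nm_ge0 // ltW.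
have p2 : 0 <= L * Cj ^+ 2 by rewrite mulr_ge0 ?sqr_ge0 // ltW.
have p3 : 0 <= nm c * (Bq + nm ws) by rewrite mulr_ge0 ?addr_ge0 ?nm_ge0.
have p4 : 0 <= nm c * Lq by rewrite mulr_ge0 ?nm_ge0 ?(ltW Lq0).
have T0 : 0 < T by rewrite /T mulrDr; lra.
exists T, (Num.min k0 (Num.min 1 Cj^-1)); split=> //; first by rewrite !lt_min k00 ltr01 invr_gt0.
move=> k x w x' w' /andP[kp]; rewrite !le_min => /and3P[kk0 k1 kC] hx hw hx' hw'.
have kh : 0 < k <= k0 by rewrite kp.
have kC1 : k * Cj <= 1 by rewrite -ler_pdivlMr // div1r.
have rk0 : rc k != 0 by rewrite -nm_gt0 nm_rc gtr0_norm.
have nk : nm (rc k) = k by rewrite nm_rc gtr0_norm.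
have [a1 a2 a3 a4] := ih k x w x' w' kh hx hw hx' hw'.
have [b1 _ _ _] := ih k x' w' x w kh hx' hw' hx hw.
set X := Xs k x w j in a1 a2 a3 a4; set X' := Xs k x' w' j in a2 a4 b1.
set del := nm (x - x') + nm (w - w') in a2 a4 *.
have del0 : 0 <= del by rewrite addr_ge0 ?nm_ge0.
pose G Y := (P.[it P j z + rc k * Y] - P.[it P j z]) / rc k.
have hG Y Y' : nm Y <= Cj -> nm Y' <= Cj -> nm (G Y - G Y' - D j * (Y - Y')) <= L * Cj * k * nm (Y - Y').
  move=> hY hY'; have := hL (it P j z) (k * Cj) (it P j z + rc k * Y) (it P j z + rc k * Y') (lexx _) kC1.
  have e y : it P j z + rc k * y - it P j z = rc k * y by rewrite addrC addKr.
  rewrite !e !nmM !nk !ler_wpM2l ?(ltW kp) // => /(_ isT isT).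
  have -> : it P j z + rc k * Y - (it P j z + rc k * Y') = rc k * (Y - Y') by ring.
  have -> : P.[it P j z + rc k * Y] - P.[it P j z + rc k * Y'] - P^`().[it P j z] * (rc k * (Y - Y')) =
    rc k * (G Y - G Y' - D j * (Y - Y')).
    by rewrite /G /D; move: P.[_ + rc k * Y] P.[_ + rc k * Y'] => u v; field.
  rewrite !nmM nk => h; rewrite -(ler_pM2l kp); apply: le_trans h _.
  by rewrite le_eqVlt; apply/orP; left; apply/eqP; ring.
have hG0 Y : nm Y <= Cj -> nm (G Y - D j * Y) <= L * Cj ^+ 2 * k.
  move=> hY; have n0 : nm (0 : C) <= Cj by rewrite nm0 ltW.
  have := hG Y 0 hY n0; rewrite !subr0.
  have -> : G 0 = 0 by rewrite /G mulr0 addr0 subrr mul0r.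
  rewrite subr0 => h; apply: le_trans h _.
  have -> : L * Cj ^+ 2 * k = L * Cj * k * Cj by ring.
  by rewrite ler_wpM2l // !mulr_ge0 // ltW.
have hGX := hG X X' a1 b1.
have hGX2 : nm (G X - G X' - D j * (X - X')) <= L * Cj ^+ 2 * k * del.
  apply: le_trans hGX _; have -> : L * Cj ^+ 2 * k * del = L * Cj * k * (Cj * del) by ring.
  by rewrite ler_wpM2l // !mulr_ge0 // ltW.
have eX : Xs k x w j.+1 = G X + c * (it q j w - ws) by [].
have eX' : Xs k x' w' j.+1 = G X' + c * (it q j w' - ws) by [].
have qw : nm (it q j w - ws) <= Bq + nm ws.
  by apply: le_trans (nmBD _ _) _; rewrite lerD2r -itpE hBq.
have qww : nm (it q j w - it q j w') <= Lq * del.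
  rewrite -!itpE; apply: le_trans (hLq _ _ hw' hw) _; rewrite ler_wpM2l ?(ltW Lq0) // /del lerDr nm_ge0 //.
have k2 : L * Cj ^+ 2 * k <= L * Cj ^+ 2 by rewrite ler_piMr.
rewrite eX eX' !LsS; split.
- apply: le_trans (nmD _ _) _; rewrite (nmM c).
  have := nmD (G X - D j * X) (D j * X); rewrite subrK (nmM (D j)) => h.
  have h1 : nm (D j) * nm X <= nm (D j) * Cj by rewrite ler_wpM2l ?nm_ge0.
  have h2 : nm c * nm (it q j w - ws) <= nm c * (Bq + nm ws) by rewrite ler_wpM2l ?nm_ge0.
  have := hG0 _ a1; rewrite /T [nm c * (Bq + _ + Lq)]mulrDr.
  by move: h h1 h2 k2 p4; move: (nm c * nm _) (nm (D j) * nm X) (nm (G X)) (nm (G X - _)) => *; lra.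
- have -> : G X + c * (it q j w - ws) - (G X' + c * (it q j w' - ws)) =
    (G X - G X' - D j * (X - X')) + D j * (X - X') + c * (it q j w - it q j w') by ring.
  apply: le_trans (nmD _ _) _; rewrite (nmM c).
  have := nmD (G X - G X' - D j * (X - X')) (D j * (X - X')); rewrite (nmM (D j)) => h.
  have h1 : nm (D j) * nm (X - X') <= nm (D j) * Cj * del by rewrite -mulrA ler_wpM2l ?nm_ge0.
  have h2 : nm c * nm (it q j w - it q j w') <= nm c * Lq * del by rewrite -mulrA ler_wpM2l ?nm_ge0.
  have h3 : L * Cj ^+ 2 * k * del <= L * Cj ^+ 2 * del by rewrite ler_wpM2r.
  have p3' : 0 <= nm c * (Bq + nm ws) * del by rewrite mulr_ge0.
  rewrite /T [nm c * (Bq + _ + Lq)]mulrDr !mulrDl mul1r.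
  by move: h h1 h2 h3 hGX2 p3' del0; move: (nm c * nm _) (nm (D j) * nm _) (nm (_ + D j * _)) (nm (G X - _ - _)) => *; lra.
- have -> : G X + c * (it q j w - ws) - (D j * Ls x w j + c * (it q j w - ws)) =
    (G X - D j * X) + D j * (X - Ls x w j) by ring.
  apply: le_trans (nmD _ _) _; rewrite (nmM (D j)).
  have h1 : nm (D j) * nm (X - Ls x w j) <= nm (D j) * Cj * k by rewrite -mulrA ler_wpM2l ?nm_ge0.
  have p3' : 0 <= nm c * (Bq + nm ws + Lq) * k by rewrite mulrDr mulr_ge0 ?(ltW kp) // addr_ge0.
  have := hG0 _ a1; rewrite /T !mulrDl mul1r -!mulrDl mulrDl -/del.
  rewrite !mulrDl in p3' *; move: h1 p3' kp.
  by move: (nm (D j) * nm _) (nm (G X - _)) => *; lra.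
have -> : G X + c * (it q j w - ws) - (D j * Ls x w j + c * (it q j w - ws)) -
    (G X' + c * (it q j w' - ws) - (D j * Ls x' w' j + c * (it q j w' - ws))) =
  (G X - G X' - D j * (X - X')) + D j * (X - Ls x w j - (X' - Ls x' w' j)) by ring.
apply: le_trans (nmD _ _) _; rewrite (nmM (D j)).
have h1 : nm (D j) * nm (X - Ls x w j - (X' - Ls x' w' j)) <= nm (D j) * Cj * k * del.
  by rewrite -2!mulrA ler_wpM2l ?nm_ge0 // mulrA.
have p3' : 0 <= nm c * (Bq + nm ws + Lq) * k * del.
  by apply: mulr_ge0 (mulr_ge0 _ (ltW kp)) del0; rewrite mulrDr addr_ge0.
have p5 : 0 <= k * del by rewrite mulr_ge0 // ltW.
have -> : T * k * del = nm (D j) * Cj * k * del + L * Cj ^+ 2 * k * del + nm c * (Bq + nm ws + Lq) * k * del + k * del.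
  by rewrite /T; ring.
by move: h1 p3' p5 hGX2; move: (nm (D j) * nm _) (nm (G X - _ - _)) (nm (D j) * Cj * k * del) (L * _ * k * del) (nm c * _ * k * del) (k * del) => *; lra.
Qed.
End Scaled.

(** * Closeness to the affine model *)

Section Near.
Variable R : realType.
Local Notation C := (Cplx R).

(* on [S i], [g] is C^1-close to the affine map [(x, y) |-> (Lam * x + w ^+ i, A i * (y - yc i))] *)
Definition near (S : 'I_3 -> set (C * C)) (Lam : C) (A yc : 'I_3 -> C) (w : C) (eta ep : R) (g : C * C -> C * C) :=
  forall i, (forall p, S i p -> nm ((g p).1 - Lam * p.1 - w ^+ i) <= eta /\ nm ((g p).2 - A i * (p.2 - yc i)) <= eta) /\
  forall p p', S i p -> S i p' ->
    nm ((g p).1 - (g p').1 - Lam * (p.1 - p'.1)) <= ep * nm (p.1 - p'.1) + eta * nm (A i) * nm (p.2 - p'.2) /\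
    nm ((g p).2 - (g p').2 - A i * (p.2 - p'.2)) <= ep * nm (p.1 - p'.1) + eta * nm (A i) * nm (p.2 - p'.2).

Definition box (A yc : 'I_3 -> C) (r s : R) (i : 'I_3) : set (C * C) :=
  [set p | nm p.1 <= r /\ nm (p.2 - yc i) <= s / nm (A i)].

(** The last clause is the delicate one: the gap between [nm Lam] and 1 is chosen after the [A i]
    and may be tiny, yet the error in the direction of [x] has to be small against it, even when the
    coupling with [y] amplifies it by [nm (A i)]. *)
Definition geom (Lam : C) (A yc : 'I_3 -> C) (w : C) (eta ep : R) :=
  [/\ w ^+ 2 + w + 1 = 0, nm (Lam - 1) <= eta, 0 < ep & forall i, [/\ 20 <= nm (A i),
    nm (yc i) + 3 / nm (A i) <= 1 & ep * (1 + nm (A i)) <= eta * `|nm Lam - 1|]].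

(* rescaled coordinates around the fixed point of the model *)
Definition ofX (z ws : C) (kap rho : R) (p : C * C) : C * C := (z + rc kap * p.1, ws + rc rho * p.2).
Definition toX (z ws : C) (kap rho : R) (p : C * C) : C * C := ((p.1 - z) / rc kap, (p.2 - ws) / rc rho).

Lemma rc_neq0 (t : R) : 0 < t -> rc t != 0. Proof. by move=> t0; rewrite -nm_gt0 nm_rc gtr0_norm. Qed.
Lemma nm_rcp (t : R) : 0 < t -> nm (rc t) = t. Proof. by move=> t0; rewrite nm_rc gtr0_norm. Qed.
Lemma geom_A (Lam : C) A yc (w : C) eta ep i : geom Lam A yc w eta ep -> 20 <= nm (A i) /\ 0 < nm (A i).
Proof. by case=> _ _ _ /(_ i)[h _ _]; split=> //; apply: lt_le_trans h. Qed.

Lemma ofXK z ws (kap rho : R) : 0 < kap -> 0 < rho -> cancel (ofX z ws kap rho) (toX z ws kap rho).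
Proof.
move=> k0 r0 [x y]; rewrite /toX /ofX /=; by congr pair; rewrite addrC addKr mulrC mulKf // rc_neq0.
Qed.

Lemma toXK z ws (kap rho : R) : 0 < kap -> 0 < rho -> cancel (toX z ws kap rho) (ofX z ws kap rho).
Proof.
move=> k0 r0 [x y]; rewrite /toX /ofX /=; by congr pair; rewrite mulrC divfK ?rc_neq0 // addrC subrK.
Qed.

Section NearOfModel.
Variables (P q : {poly C}) (z ws c Lam w : C) (N : nat) (kap rho ep eta' Cj : R) (A v : 'I_3 -> C).
Hypothesis kap0 : 0 < kap.
Hypothesis rho0 : 0 < rho.
Hypothesis ep0 : 0 < ep.
Hypothesis eta'0 : 0 < eta'.
Hypothesis C0 : 0 < Cj.
Let D j := P^`().[it P j z].
Hypothesis ezN : it P N z = z.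
Hypothesis LamE : Lam = (itp P N)^`().[z].
Hypothesis k2 : Cj * kap <= ep.
Hypothesis k3 : Cj * kap * (1 + rho) <= eta'.
Hypothesis hsc : forall x y x' y', nm x <= 3 -> nm y <= nm ws + rho -> nm x' <= 3 -> nm y' <= nm ws + rho ->
  nm (Xs P q z ws c kap x y N - Ls P q z ws c x y N) <= Cj * kap /\
  nm (Xs P q z ws c kap x y N - Ls P q z ws c x y N - (Xs P q z ws c kap x' y' N - Ls P q z ws c x' y' N))
    <= Cj * kap * (nm (x - x') + nm (y - y')).
Hypothesis Ap : forall i, 20 <= nm (A i).
Hypothesis hv : forall i, nm (v i - ws) + 3 * rho / nm (A i) <= rho.
Hypothesis hN : forall i, it q N (v i) = ws.
Hypothesis hQL : forall i y y', nm (y - v i) <= 3 * rho / nm (A i) -> nm (y' - v i) <= 3 * rho / nm (A i) ->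
  nm (it q N y - it q N y' - A i * (y - y')) <= eta' * nm (A i) * nm (y - y').
Hypothesis hS1 : forall i, nm (c * Sw q ws D N (v i) - w ^+ i) <= eta'.
Hypothesis hS2 : forall i y y', nm (y - v i) <= 3 * rho / nm (A i) -> nm (y' - v i) <= 3 * rho / nm (A i) ->
  nm (c * Sw q ws D N y - c * Sw q ws D N y') <= eta' / rho * nm (A i) * nm (y - y').
Let yc i := (v i - ws) / rc rho.

(** Three errors add up in the first coordinate: at most [eta'] from the nonlinearity in [kap],
    [3 * eta'] from the variation of the weighted sum over the disc, and [eta'] from its value at
    [v i]. *)
Lemma near_of_model : near (box A yc 3 3) Lam A yc w (6 * eta') ep
  (fun p => toX z ws kap rho (iter N (skw P q ws c kap) (ofX z ws kap rho p))).
Proof.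
have [kp rp ep' etp] := And4 kap0 rho0 ep0 eta'0.
have Ap0 i : 0 < nm (A i) by apply: lt_le_trans (Ap i).
have gE p : toX z ws kap rho (iter N (skw P q ws c kap) (ofX z ws kap rho p)) =
    (Xs P q z ws c kap p.1 (ws + rc rho * p.2) N, (it q N (ws + rc rho * p.2) - ws) / rc rho).
  rewrite /ofX iter_skw // ezN /toX /=; congr pair.
  by rewrite addrC addKr mulrC mulKf // rc_neq0.
move=> i.
have inb p : box A yc 3 3 i p -> [/\ nm p.1 <= 3, nm (ws + rc rho * p.2 - v i) <= 3 * rho / nm (A i) &
    nm (ws + rc rho * p.2) <= nm ws + rho].
  move=> [h1 h2].
  have e1 : ws + rc rho * p.2 - v i = rc rho * (p.2 - yc i).
    by rewrite /yc mulrBr mulrCA mulfV ?rc_neq0 // mulr1; ring.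
  have h3 : nm (ws + rc rho * p.2 - v i) <= 3 * rho / nm (A i).
    by rewrite e1 nmM nm_rc gtr0_norm // mulrAC mulrC ler_wpM2r ?(ltW rho0).
  split=> //; have := nm_tri (v i) (ws + rc rho * p.2) ws; have := nm_lo (ws + rc rho * p.2) ws.
  by move: h3 (hv i); move: (_ / nm (A i)) => u; xlra.
have LE x y : Ls P q z ws c x y N = Lam * x + c * Sw q ws D N y by rewrite /Ls LamE -itp_deriv.
have yd (p p' : C * C) : nm (ws + rc rho * p.2 - (ws + rc rho * p'.2)) = rho * nm (p.2 - p'.2).
  have -> : ws + rc rho * p.2 - (ws + rc rho * p'.2) = rc rho * (p.2 - p'.2) by ring.
  by rewrite nmM nm_rc gtr0_norm.
have qy p : box A yc 3 3 i p -> forall p', box A yc 3 3 i p' ->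
   nm ((it q N (ws + rc rho * p.2) - ws) / rc rho - (it q N (ws + rc rho * p'.2) - ws) / rc rho - A i * (p.2 - p'.2))
     <= eta' * nm (A i) * nm (p.2 - p'.2).
  move=> /inb[_ b2 _] p' /inb[_ b2' _]; have := hQL b2 b2'; rewrite yd.
  set U := it q N _; set U' := it q N (ws + rc rho * p'.2).
  have -> : U - U' - A i * (ws + rc rho * p.2 - (ws + rc rho * p'.2)) =
    rc rho * ((U - ws) / rc rho - (U' - ws) / rc rho - A i * (p.2 - p'.2)) by field; exact: rc_neq0.
  by rewrite nmM nm_rc gtr0_norm // mulrCA ler_pM2l.
have bc : box A yc 3 3 i (0, yc i) by split; rewrite /= ?nm0 // subrr nm0 divr_ge0 ?nm_ge0.
have yr p : box A yc 3 3 i p -> nm (A i) * nm (p.2 - yc i) <= 3.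
  by case=> _; rewrite ler_pdivlMr // mulrC.
have yci : ws + rc rho * yc i = v i by rewrite /yc mulrCA mulfV ?rc_neq0 // mulr1 addrC subrK.
split=> [p bp|p p' bp bp']; rewrite !gE [(_, _).1]/=.
  have [b1 b2 b3] := inb p bp; split.
    have [h3 _] := hsc b1 b3 b1 b3.
    rewrite LE in h3; set X := Xs _ _ _ _ _ _ _ _ _ in h3 *; set S := Sw _ _ _ _ _ in h3.
    have vv : nm (v i - v i) <= 3 * rho / nm (A i) by rewrite subrr nm0 divr_ge0 ?nm_ge0 // mulr_ge0 // ltW.
    have := hS2 b2 vv; rewrite -/S.
    have -> : nm (ws + rc rho * p.2 - v i) = rho * nm (p.2 - yc i) by rewrite -yci -(yd p (0, yc i)).
    have -> : eta' / rho * nm (A i) * (rho * nm (p.2 - yc i)) = eta' * (nm (A i) * nm (p.2 - yc i)).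
      by move: (nm (A i)) (nm (_ - _)) => u u'; field; rewrite gt_eqF.
    have h4 : eta' * (nm (A i) * nm (p.2 - yc i)) <= eta' * 3 by rewrite ler_wpM2l ?(ltW eta'0) // yr.
    have h5 : Cj * kap <= eta' by apply: le_trans k3; rewrite ler_peMr ?lerDl ?(ltW rho0) // mulr_ge0 // ltW.
    have -> : X - Lam * p.1 - w ^+ i = (X - (Lam * p.1 + c * S)) + (c * S - c * Sw q ws D N (v i)) + (c * Sw q ws D N (v i) - w ^+ i).
      by ring.
    move=> h6; have := nmD (X - (Lam * p.1 + c * S) + (c * S - c * Sw q ws D N (v i))) (c * Sw q ws D N (v i) - w ^+ i).
    have := nmD (X - (Lam * p.1 + c * S)) (c * S - c * Sw q ws D N (v i)).
    move: h3 h4 h5 h6 (hS1 i) etp.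
    set s1 := X - _; set s2 := c * S - _; set s3 := _ - w ^+ i.
    by move: (nm s1) (nm s2) (nm s3) (nm (s1 + s2)) (nm (s1 + s2 + s3)) (eta' * (nm (A i) * _)) (Cj * kap) => *; lra.
  have := qy p bp _ bc; rewrite [(0, yc i).2]/(yc i) yci hN subrr mul0r subr0 => h; apply: le_trans h _.
  have := yr p bp; rewrite -mulrA => h; have := ler_wpM2l (ltW eta'0) h; move: (eta' * _) => u; move: etp; lra.
have [b1 b2 b3] := inb p bp; have [b1' b2' b3'] := inb p' bp'.
have ed : 0 <= nm (A i) * nm (p.2 - p'.2) by rewrite mulr_ge0 ?nm_ge0.
have ex : 0 <= ep * nm (p.1 - p'.1) by rewrite mulr_ge0 ?nm_ge0 // ltW.
split; last first.
  apply: le_trans (qy p bp _ bp') _; have := mulr_ge0 (ltW eta'0) ed; have -> : 6 * eta' * nm (A i) * nm (p.2 - p'.2) = 6 * (eta' * (nm (A i) * nm (p.2 - p'.2))) by ring.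
  by rewrite -mulrA; move: (eta' * _) (ep * _) ex => *; lra.
have [_ h3] := hsc b1 b3 b1' b3'.
rewrite !LE yd in h3; set X := Xs _ _ _ _ _ _ _ _ _ in h3 *; set X' := Xs _ _ _ _ _ _ _ _ _ in h3 *.
set S := Sw _ _ _ _ _ in h3; set S' := Sw _ _ _ _ _ in h3.
have := hS2 b2 b2'; rewrite -/S -/S' yd.
have -> : eta' / rho * nm (A i) * (rho * nm (p.2 - p'.2)) = eta' * (nm (A i) * nm (p.2 - p'.2)).
  by move: (nm (A i)) (nm (_ - _)) => u u'; field; rewrite gt_eqF.
have -> : X - X' - Lam * (p.1 - p'.1) = (X - (Lam * p.1 + c * S) - (X' - (Lam * p'.1 + c * S'))) + (c * S - c * S') by ring.
move=> h4; apply: le_trans (nmD _ _) _.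
have h5 : Cj * kap * (nm (p.1 - p'.1) + rho * nm (p.2 - p'.2)) <= ep * nm (p.1 - p'.1) + eta' * (nm (A i) * nm (p.2 - p'.2)).
  rewrite mulrDr lerD ?ler_wpM2r ?nm_ge0 // !mulrA ler_wpM2r ?nm_ge0 //.
  apply: le_trans (_ : eta' * 1 <= _); last by rewrite ler_wpM2l ?(ltW eta'0) // (le_trans _ (Ap i)) // ler1n.
  by rewrite mulr1; apply: le_trans k3; rewrite ler_wpM2l ?lerDr // mulr_ge0 // ltW.
have -> : 6 * eta' * nm (A i) * nm (p.2 - p'.2) = 6 * (eta' * (nm (A i) * nm (p.2 - p'.2))) by ring.
move: h3 h4 h5 (mulr_ge0 (ltW eta'0) ed) ex.
by move: (Cj * kap * _) (eta' * _) (ep * _) (nm (c * S - _)) (nm (_ - _ - (_ - _))) => *; lra.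
Qed.
End NearOfModel.

Definition coef_near (e : R) (f g : {poly C}) := forall i : nat, nm (f`_i - g`_i) < e.

(** The order of the choices: [q] and the neutral cycle of [P0], of multiplier [w]; the homoclinic
    orbits, hence [N] and the [A i]; then [s], which moves [nm Lam] off 1 while [Lam] and the
    derivatives along the cycle stay close over [N] steps; then [ep], from the gap [gam]; and [kap]
    last. *)
Lemma near_skew d (a b : 'rV[C]_d.+2) (up : bool) (e eta : R) : (0 < d)%N -> Bif a -> inPd b ->
  0 < e -> 0 < eta <= 1 ->
  exists (P q : {poly C}) (z ws c Lam w : C) (N : nat) (kap rho ep : R) (A yc : 'I_3 -> C),
  [/\ [/\ size P = d.+2, size q = d.+2, coef_near e P (pol a) & coef_near e q (pol b)],
     [/\ (0 < N)%N, 0 < kap, 0 < rho, nm (rc kap * c) < e & nm (rc kap * c * ws) < e],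
     geom Lam A yc w eta ep, (if up then 1 < nm Lam else nm Lam < 1) &
     near (box A yc 3 3) Lam A yc w eta ep
       (fun p => toX z ws kap rho (iter N (skw P q ws c kap) (ofX z ws kap rho p)))].
Proof.
move=> d0 Ba bP e0 /andP[eta0 eta1].
have e4 : 0 < e / 4 by rewrite divr_gt0.
have [s1 s1e gen] := generic_near d0 (size_pol bP) e4; set q := pol b + s1%:P in gen.
have sq : size q = d.+2 := size_addC _ (size_pol bP).
have [ws qws rep] : exists2 ws, q.[ws] = ws & 1 < nm q^`().[ws].
  by apply: (repelling_fixed d0 sq); have [] := gen.
have [b' [n1 [z1 [b'a b'P ez1 nz1]]]] := Bif_neutral d0 Ba e4.
have [s0 [k [z0 [w [s0e ew [ez0 ew0 clus]]]]]] := neutral_cluster up d0 (size_pol b'P) ez1 nz1 e4.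
set P0 := pol b' + s0%:P in ez0 ew0 clus; have [w3 w1 wn1] := cube3 ew.
have sP0 : size P0 = d.+2 := size_addC _ (size_pol b'P).
pose m := k.+1; pose D0 j := P0^`().[it P0 j z0].
have D0w : \prod_(j < m) D0 j = w by rewrite -ew0 itp_deriv.
have D0m j : D0 (j + m)%N = D0 j by rewrite /D0 itD ez0.
have D00 j : D0 j != 0.
  have -> : D0 j = D0 (j %% m)%N.
    by rewrite {1}(divn_eq j m); elim: (j %/ m)%N => [|i ih]; rewrite ?add0n // mulSnr addnAC D0m.
  apply/eqP => h; have : w = 0 by rewrite -D0w (bigD1 (Ordinal (ltn_pmod j (isT : (0 < m)%N)))) //= h mul0r.
  by move=> w0; move: w1; rewrite w0 nm0; lra.
pose eta' := eta / 6; have eta'0 : 0 < eta' by rewrite divr_gt0.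
have eta'1 : 0 < eta' <= 3^-1 by rewrite eta'0 /eta' /=; lra.
have [n [rho [del [c [v [A [rho0 del0 hmod]]]]]]] := model_points d0 sq gen qws rep 20 (isT : (0 < m)%N) D00 D0m D0w ew eta'1.
set N := (n.+1 * 3 * m)%N in hmod; have N0 : (0 < N)%N by rewrite !muln_gt0.
have Ap i : 20 <= nm (A i) by have [] := hmod i.
have [d1 d10 hd1] := mult_cont P0 N z0 eta0.
pose PD (j : nat) (t : R) := forall s z : C, nm s < t -> nm (z - z0) < t -> nm ((P0 + s%:P)^`().[it (P0 + s%:P) j z] - D0 j) < del.
have [|j t t' t0 tt' h s z hs hz|d2 d20 hd2] := @fin_unif R PD N.
- move=> j; have [t1 t10 ht1] := horner_cont P0^`() (it P0 j z0) del0.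
  have [t2 t20 ht2] := it_cont P0 j z0 t10; exists t2 => // s z hs hz.
  by rewrite derivD derivC addr0; apply: ht1; apply: ht2.
- by apply: h; apply: lt_le_trans tt'.
pose et := Num.min (Num.min d1 d2) (e / 4).
have et0 : 0 < et by rewrite !lt_min d10 d20.
have [s [z [hs hz ez hup]]] := clus _ et0.
have [[hs1 hz1] [hs2 hz2] hs3] : [/\ nm s < d1 /\ nm (z - z0) < d1, nm s < d2 /\ nm (z - z0) < d2 & nm s < e / 4].
  by move: hs hz; rewrite !lt_min => /andP[/andP[-> ->] ->] /andP[/andP[-> ->] _].
set P := P0 + s%:P in ez hup; pose D j := P^`().[it P j z].
have hD j : (j < N)%N -> nm (D j - D0 j) < del by move=> jN; apply: hd2.
pose Lam := (itp P N)^`().[z].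
have ezN : it P N z = z by rewrite /N it_fixed.
have LamE : Lam = (itp P m)^`().[z] ^+ (n.+1 * 3) by rewrite /Lam /N itp_deriv_fixed.
have Lam1 : nm (Lam - 1) <= eta.
  apply: ltW; have := hd1 _ _ hs1 hz1; rewrite -/P -/Lam.
  have -> : (itp P0 N)^`().[z0] = 1; last by [].
  by rewrite /N itp_deriv_fixed // ew0 mulnC exprM w3 expr1n.
have Lup : if up then 1 < nm Lam else nm Lam < 1.
  by rewrite LamE nmX; case: up hup {clus} => h; rewrite ?exprn_egt1 ?exprn_ilt1 ?nm_ge0.
pose gam := `|nm Lam - 1|; have gam0 : 0 < gam.
  by rewrite normr_gt0 subr_eq0; case: up Lup {clus hup} => h; rewrite ?(gt_eqF h) ?(lt_eqF h).
pose SA := \sum_i nm (A i); have SA0 i : nm (A i) <= SA.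
  by rewrite /SA (bigD1 i) //= lerDl sumr_ge0 // => j _; exact: nm_ge0.
have SAp : 0 < 1 + SA by rewrite ltr_pwDl // sumr_ge0 // => j _; exact: nm_ge0.
pose ep := eta * gam / (1 + SA); have ep0 : 0 < ep by rewrite divr_gt0 ?mulr_gt0.
have [Cj [k0 [C0 k00 hsc]]] := scaled P q z ws c (nm ws + rho) N.
pose T := 1 + nm c + nm (c * ws); have T0 : 0 < T by rewrite /T -addrA ltr_pwDl ?addr_ge0 ?nm_ge0.
pose kap := Num.min (Num.min k0 (ep / Cj)) (Num.min (eta' / (Cj * (1 + rho))) (e / (2 * T))).
have Cr0 : 0 < Cj * (1 + rho) by rewrite mulr_gt0 // addr_gt0.
have kap0 : 0 < kap by rewrite !lt_min k00 !divr_gt0 // ?mulr_gt0.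
have [k1 k2 k3 k4] : [/\ kap <= k0, Cj * kap <= ep, Cj * kap * (1 + rho) <= eta' & kap * (2 * T) <= e].
  have : kap <= kap by []; rewrite {2}/kap !le_min => /andP[/andP[-> h1] /andP[h2 h3]].
  rewrite ler_pdivlMr // in h1; rewrite ler_pdivlMr // in h2; rewrite ler_pdivlMr ?mulr_gt0 // in h3.
  by split=> //; [rewrite mulrC|rewrite [Cj * kap]mulrC -mulrA].
have kh : 0 < kap <= k0 by rewrite kap0.
pose yc i := (v i - ws) / rc rho.
exists P, q, z, ws, c, Lam, w, N, kap, rho, ep, A, yc; split=> //.
- split=> //; first exact: size_addC.
    move=> i; rewrite /P /P0 !coefD !coefC; set c1 := if _ then s0 else 0; set c2 := if _ then s else 0.
    have h1 : nm c1 < e / 4 by rewrite /c1; case: ifP => // _; rewrite nm0.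
    have h2 : nm c2 < e / 4 by rewrite /c2; case: ifP => // _; rewrite nm0.
    have h3 : nm ((pol b')`_i - (pol a)`_i) < e / 4.
      apply: le_lt_trans b'a; rewrite /pol !coef_poly; case: ifP => _; last by rewrite subrr nm0 nm_ge0.
      by have := nm_entry (b' - a) (inord i); rewrite !mxE.
    have -> : (pol b')`_i + c1 + c2 - (pol a)`_i = ((pol b')`_i - (pol a)`_i) + c1 + c2 by ring.
    have := nmD ((pol b')`_i - (pol a)`_i + c1) c2; have := nmD ((pol b')`_i - (pol a)`_i) c1.
    by move: h1 h2 h3; xlra.
  move=> i; rewrite /q coefD addrAC subrr add0r coefC; case: ifP => _; last by rewrite nm0.
  by move: s1e; xlra.
- have kT : kap * T < e by rewrite mulrCA in k4; apply: lt_le_trans k4; rewrite ltr_pMl ?mulr_gt0 // ltr1n.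
  have h t : 0 <= t -> t <= T -> kap * t < e by move=> t0 tT; apply: le_lt_trans kT; rewrite ler_wpM2l // ltW.
  split=> //; rewrite -?mulrA nmM nm_rc gtr0_norm //; apply: h; rewrite ?nm_ge0 // /T;
    [rewrite -addrA addrCA lerDl|rewrite lerDr]; by rewrite addr_ge0 ?nm_ge0.
- split=> // i; split=> //.
    have [_ h _ _ _] := hmod i; rewrite /yc nm_div nm_rc gtr0_norm // -(ler_pM2r rho0) mul1r mulrDl divfK ?gt_eqF //.
    by rewrite mulrAC.
  rewrite /ep mulrAC ler_pdivrMr // -/gam; apply: ler_wpM2l; last by rewrite lerD2l.
  by rewrite mulr_ge0 ?(ltW eta0) // ltW.
have -> : eta = 6 * eta' by rewrite /eta' mulrC divfK ?pnatr_eq0.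
apply: (@near_of_model P q z ws c Lam w N kap rho ep eta' Cj A v) => //.
- by move=> x y x' y' h1 h2 h3 h4; have [] := hsc kap x y x' y' kh h1 h2 h3 h4.
- by move=> i; have [] := hmod i.
- by move=> i; have [] := hmod i.
- by move=> i y y'; have [_ _ _ h _] := hmod i; exact: h.
- by move=> i; have [_ _ _ _ h] := hmod i; have [] := h D hD.
- by move=> i y y'; have [_ _ _ _ h] := hmod i; have [_] := h D hD; apply.
Qed.
End Near.

(** * Covering by the three maps, and transport of graphs *)

Section Cover.
Variable R : realType.
Local Notation C := (Cplx R).

(** The contraction is for a gauge [N] comparable to [nm]; a cluster point of the orbit of [u0] is
    the fixed point. *)
Lemma picard (V : normedModType R[i]) (K : set V) (T : V -> V) (N : V -> R) (c1 c2 : R) (u0 : V) :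
  compact K -> K u0 -> (forall u, K u -> K (T u)) -> 0 < c1 -> 0 < c2 ->
  (forall v, nm v <= c1 * N v) -> (forall v, N v <= c2 * nm v) ->
  (forall u v, K u -> K v -> N (T u - T v) <= 2^-1 * N (u - v)) -> exists2 u, K u & T u = u.
Proof.
move=> cK K0 KT c10 c20 n1 n2 ctr; pose u n := iter n T u0.
have Ku n : K (u n) by elim: n => // n ih; apply: KT.
have step n : N (u n.+1 - u n) <= 2^-1 ^+ n * N (u 1%N - u 0%N).
  elim: n => [|n ih]; first by rewrite mul1r.
  by apply: le_trans (ctr _ _ (Ku n.+1) (Ku n)) _; rewrite exprS -mulrA ler_wpM2l ?invr_ge0.
have [l Kl hl] := compact_cluster cK Ku; exists l => //; apply: subr0_eq; apply: nm_small0 => e e0.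
pose B := 1 + `|N (u 1%N - u 0%N)|; have B0 : 0 < B by rewrite ltr_pwDl.
have e1 : 0 < e / (2 * c1 * B) by rewrite divr_gt0 // !mulr_gt0.
have [|n0 hn0] := @pow_small R 2^-1 _ _ e1; first by lra.
have t0 : 0 < e / (4 * (1 + c1 * c2)) by rewrite divr_gt0 ?mulr_gt0 // addr_gt0 // mulr_gt0.
have [n nn hn] := hl _ n0 t0.
have uS : u n.+1 = T (u n) by [].
have -> : T l - l = (T l - T (u n)) + (u n.+1 - u n) + (u n - l) by rewrite uS !addrA !subrK.
have a1 : nm (T l - T (u n)) <= c1 * c2 * nm (u n - l).
  apply: le_trans (n1 _) _; rewrite -mulrA ler_wpM2l ?(ltW c10) //; apply: le_trans (ctr _ _ Kl (Ku n)) _.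
  rewrite [nm (u n - l)]nmB; apply: le_trans (n2 (l - u n)).
  have : 0 <= N (l - u n) by have := n1 (l - u n); have := nm_ge0 (l - u n) => h /(le_trans h); rewrite pmulr_rge0.
  by move: (N _) => x; lra.
have a2 : nm (u n.+1 - u n) <= e / 2.
  apply: le_trans (n1 _) _; have := step n; have := hn0 n nn; rewrite ltr_pdivlMr ?mulr_gt0 // => h1 h2.
  have h3 : 2^-1 ^+ n * N (u 1%N - u 0%N) <= 2^-1 ^+ n * B.
    by rewrite ler_wpM2l ?exprn_ge0 ?invr_ge0 // /B (le_trans (ler_norm _)) // lerDr.
  have h4 : c1 * N (u n.+1 - u n) <= c1 * (2^-1 ^+ n * B) by rewrite ler_wpM2l ?(ltW c10) // (le_trans h2).
  have : c1 * (2^-1 ^+ n * B) * 2 = 2^-1 ^+ n * (2 * c1 * B) by ring.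
  by move: h1 h4; move: (2^-1 ^+ n * _) (c1 * (_ * B)) (c1 * N _) => *; lra.
have a3 : (1 + c1 * c2) * nm (u n - l) <= e / 4.
  have p : 0 < 1 + c1 * c2 by rewrite addr_gt0 // mulr_gt0.
  move: (ltW hn); rewrite invfM mulrA ler_pdivlMr // mulrC => h; exact: h.
apply: le_trans (nmD _ _) _; apply: le_trans (lerD (nmD _ _) (lexx _)) _.
move: a1 a2 a3 e0; rewrite mulrDl mul1r.
by move: (nm (T l - T (u n))) (nm (u n.+1 - u n)) (c1 * c2 * nm (u n - l)) (nm (u n - l)) => *; lra.
Qed.

Lemma compact_cdisc (c : C) (M : R) : compact [set x : C | nm (x - c) <= M].
Proof.
apply: (subclosed_compact _ (@compact_disc R (nm c + M))); first exact: closed_nm.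
by move=> x /= h; have := nm_lo x c; move: h; xlra.
Qed.

Section Geom.
Variables (Lam : C) (A yc : 'I_3 -> C) (w : C) (eta ep : R).
Hypothesis geo : geom Lam A yc w eta ep.
Hypothesis eta0 : 0 < eta <= 100^-1.

Let ew : w ^+ 2 + w + 1 = 0. Proof. by case: geo. Qed.
Let A20 i := (geom_A i geo).1.
Let A0 i := (geom_A i geo).2.
Let An0 i : A i != 0. Proof. by rewrite -nm_gt0. Qed.

Lemma Lam_bounds : 99 / 100 <= nm Lam <= 101 / 100 /\ nm (Lam - 1) <= 100^-1.
Proof.
have [_ h _ _] := geo; have /andP[_ h2] := eta0.
have := nm_lo (1 : C) Lam; have := nm_lo Lam (1 : C); rewrite nm1 [nm ((1 : C) - Lam)]nmB; lra.
Qed.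

Lemma ep_small : 0 < ep <= 2000^-1.
Proof.
have [_ h1 e0 /(_ ord0)[h2 _ h3]] := geo; have /andP[h4 h5] := eta0; rewrite e0 /=.
have [h6 h7] := Lam_bounds.
have h8 : `|nm Lam - 1| <= 1 by rewrite ler_norml; move: h6; lra.
have : eta * `|nm Lam - 1| <= 100^-1 * 1 by rewrite ler_pM // ltW.
have : ep * 20 <= ep * (1 + nm (A ord0)) by rewrite ler_wpM2l ?(ltW e0) //; lra.
by move: h3; move: (ep * (1 + _)) (eta * _) => *; lra.
Qed.

(** [cube_dir] gives [nm (x + w ^+ i) ^+ 2 <= nm x ^+ 2 - nm x + 1] for some [i]; for [nm x] up to
    [r >= 2] this gains [1 / 5] on [r]. The gain does not depend on [Lam], which is why maps that
    are almost translations cover. *)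
Lemma closed_dir (x : C) (r : R) : 2 <= r -> nm x <= r -> exists i : 'I_3, nm (x + w ^+ i) <= r - 1 / 5 /\ nm (x - w ^+ i) <= r + 1.
Proof.
move=> r2 hx; have n1 : nm (- 1 : C) = 1 by rewrite nmN nm1.
have [i h] := @cube_dir R w x (- 1) ew n1; exists i; rewrite mulN1r opprK in h.
have [w3 w1 _] := cube3 ew.
split; last by apply: le_trans (nmBD _ _) _; rewrite nmX w1 expr1n lerD2r.
rewrite -(ler_pXn2r (n := 2)) ?nnegrE ?nm_ge0 //; last by lra.
apply: le_trans h _; have := nm_ge0 x; move: (nm x) hx => t; rewrite !expr2; nra.
Qed.

(** The translation is chosen by [closed_dir], and [g p = t] is solved by iterating [T], a Newton
    step with the inverse of the affine model. It contracts for the maximum of [nm x] and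
    [nm (A i) * nm y], a gauge in which the box has comparable sides. *)
Lemma near_cover S g (r : R) : near S Lam A yc w eta ep g -> 2 <= r <= 3 -> (forall i, box A yc (r - 1 / 10) 2 i `<=` S i) ->
  forall t : C * C, nm t.1 <= r -> nm t.2 <= 1 -> exists i p, box A yc (r - 1 / 10) 2 i p /\ g p = t.
Proof.
move=> hg /andP[r2 r3] sub t t1 t2; have [/andP[L1 L2] L3] := Lam_bounds; have /andP[et0 et1] := eta0.
have /andP[ep0 ep1] := ep_small.
have n1 : nm (- t.1) <= r by rewrite nmN.
have [i [hi _]] := closed_dir r2 n1; exists i.
have {}hi : nm (t.1 - w ^+ i) <= r - 1 / 5 by rewrite nmB addrC.
have Lp : 0 < nm Lam by lra.
have L0 : Lam != 0 by rewrite -nm_gt0.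
have [hp hd] := hg i; pose K := box A yc (r - 1 / 10) 2 i.
pose T (p : C * C) : C * C := (p.1 + (t.1 - (g p).1) / Lam, p.2 + (t.2 - (g p).2) / A i).
pose N (p : C * C) := Num.max (nm p.1) (nm (A i) * nm p.2).
have KT p : K p -> K (T p).
  move=> Kp; have [h1 h2] := hp p (sub i _ Kp); split=> /=.
    have -> : p.1 + (t.1 - (g p).1) / Lam = ((t.1 - w ^+ i) - ((g p).1 - Lam * p.1 - w ^+ i)) / Lam by field.
    rewrite nm_div ler_pdivrMr //; apply: le_trans (nmBD _ _) _.
    have : (r - 1 / 10) * (99 / 100) <= (r - 1 / 10) * nm Lam by rewrite ler_wpM2l //; lra.
    by move: ((r - _) * nm Lam) => u; move: h1 hi; lra.
  have -> : p.2 + (t.2 - (g p).2) / A i - yc i = (t.2 - ((g p).2 - A i * (p.2 - yc i))) / A i by field.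
  by rewrite nm_div ler_wpM2r ?invr_ge0 ?nm_ge0 //; apply: le_trans (nmBD _ _) _; move: h2 t2; lra.
have ctr u v : K u -> K v -> N (T u - T v) <= 2^-1 * N (u - v).
  move=> Ku Kv; have [h1 h2] := hd u v (sub i _ Ku) (sub i _ Kv).
  have m1 : nm (u.1 - v.1) <= N (u - v) by rewrite /N le_max lexx.
  have m2 : nm (A i) * nm (u.2 - v.2) <= N (u - v) by rewrite /N le_max lexx orbT.
  have e1 : ep * nm (u.1 - v.1) + eta * nm (A i) * nm (u.2 - v.2) <= 10^-1 * N (u - v).
    have := ler_pM (ltW ep0) (nm_ge0 _) ep1 m1; have := ler_pM (ltW et0) (mulr_ge0 (nm_ge0 _) (nm_ge0 _)) et1 m2.
    have : 0 <= N (u - v) by rewrite (le_trans (nm_ge0 _) m1).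
    by rewrite mulrA; move: (ep * _) (eta * _ * _) (N _) => *; lra.
  have N0 : 0 <= N (u - v) by rewrite (le_trans (nm_ge0 _) m1).
  rewrite {1}/N ge_max; apply/andP; split=> /=.
    have -> : u.1 + (t.1 - (g u).1) / Lam - (v.1 + (t.1 - (g v).1) / Lam) =
      - ((g u).1 - (g v).1 - Lam * (u.1 - v.1)) / Lam by field.
    rewrite mulNr nmN nm_div ler_pdivrMr //; apply: le_trans h1 (le_trans e1 _).
    have : 2^-1 * N (u - v) * (99 / 100) <= 2^-1 * N (u - v) * nm Lam by rewrite ler_wpM2l // mulr_ge0 ?invr_ge0.
    by move: (_ * nm Lam) => z; move: N0; move: (N _) => *; lra.
  have -> : u.2 + (t.2 - (g u).2) / A i - (v.2 + (t.2 - (g v).2) / A i) =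
    - ((g u).2 - (g v).2 - A i * (u.2 - v.2)) / A i by field.
  rewrite mulNr nmN nm_div mulrC divfK ?gt_eqF //; apply: le_trans h2 (le_trans e1 _).
  by move: N0; move: (N _) => *; lra.
have cK : compact K.
  have -> : K = [set x : C | nm x <= r - 1 / 10] `*` [set y : C | nm (y - yc i) <= 2 / nm (A i)] by [].
  apply: compact_setX; [exact: compact_disc|exact: compact_cdisc].
have K0 : K (0, yc i) by split; rewrite /= ?nm0 ?subrr ?nm0 ?divr_ge0 ?nm_ge0 //; lra.
have [v|v|p Kp ep2] := @picard _ K T N 1 (nm (A i)) (0, yc i) cK K0 KT ltr01 (A0 i) _ _ ctr.
- rewrite mul1r nm_pair ge_max !le_max lexx /= orbC -{1}[nm v.2]mul1r ler_wpM2r ?nm_ge0 //.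
  by rewrite (le_trans _ (A20 i)) // ler1n.
- have a1 : 1 <= nm (A i) by rewrite (le_trans _ (A20 i)) // ler1n.
  rewrite /N nm_pair ge_max; apply/andP; split; last by rewrite ler_wpM2l ?nm_ge0 // le_max lexx orbT.
  by rewrite (le_trans (_ : _ <= Num.max (nm v.1) (nm v.2))) ?le_max ?lexx // ler_peMl // le_max nm_ge0.
exists p; split=> //; have /(congr1 fst) /= e1 := ep2; have /(congr1 snd) /= e2 := ep2.
have z (a b k : C) : k != 0 -> a + b / k = a -> b = 0.
  by move=> k0 /eqP; rewrite addrC -subr_eq0 addrK mulf_eq0 invr_eq0 (negbTE k0) orbF => /eqP.
by rewrite [g p]surjective_pairing [RHS]surjective_pairing -(subr0_eq (z _ _ _ L0 e1)) -(subr0_eq (z _ _ _ (An0 i) e2)).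
Qed.

(** The condition bears on the image [Lam * x + w ^+ i] under the affine model rather than on [x].
    [Kg] is closed and lies inside the union of the [Sg i], with the margins [37 / 20 < 19 / 10] and
    [3 / 2 < 2], so that membership survives limits. *)
Definition Sg (i : 'I_3) : set (C * C) := [set p | nm (Lam * p.1 + w ^+ i) < 19 / 10 /\ nm (p.2 - yc i) < 2 / nm (A i)].
Definition Kg : set (C * C) := [set p | exists i : 'I_3, nm (Lam * p.1 + w ^+ i) <= 37 / 20 /\ nm (p.2 - yc i) <= 3 / 2 / nm (A i)].

Lemma yc_disc i y : nm (y - yc i) <= 3 / nm (A i) -> nm y <= 1.
Proof. by have [_ _ _ /(_ i)[_ h _]] := geo; have := nm_lo y (yc i); move: h; move: (3 / _) => *; lra. Qed.

(** A graph over a small disc of the [y]-plane is stretched by [A i] over the whole unit disc; [ch]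
    is the inverse branch, found by [picard]. Since distances in [y] are multiplied by about
    [nm (A i)], a slope up to [nm (A i) / 100] becomes at most [3 / 100]. *)
Lemma graph_step g i (sg : C -> C) : near Sg Lam A yc w eta ep g ->
  (forall y, nm (y - yc i) < 2 / nm (A i) -> Sg i (sg y, y)) ->
  (forall y y', nm (y - yc i) < 2 / nm (A i) -> nm (y' - yc i) < 2 / nm (A i) ->
     nm (sg y - sg y') <= 100^-1 * nm (A i) * nm (y - y')) ->
  exists ch : C -> C, [/\ forall Y, nm Y <= 1 -> nm (ch Y - yc i) <= 3 / 2 / nm (A i) /\ (g (sg (ch Y), ch Y)).2 = Y,
    forall Y, nm Y <= 1 -> nm (g (sg (ch Y), ch Y)).1 <= 2 &
    forall Y Y', nm Y <= 1 -> nm Y' <= 1 ->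
      nm ((g (sg (ch Y), ch Y)).1 - (g (sg (ch Y'), ch Y')).1) <= 3 / 100 * nm (Y - Y')].
Proof.
move=> hg hs hl; have [/andP[L1 L2] L3] := Lam_bounds; have /andP[et0 et1] := eta0.
have /andP[ep0 ep1] := ep_small; have [hp hd] := hg i.
have in2 y : nm (y - yc i) <= 3 / 2 / nm (A i) -> nm (y - yc i) < 2 / nm (A i).
  by move=> h; apply: le_lt_trans h _; rewrite ltr_pM2r ?invr_gt0 //; lra.
have dY y y' : nm (y - yc i) < 2 / nm (A i) -> nm (y' - yc i) < 2 / nm (A i) ->
    let D := nm (A i) * nm (y - y') in
    nm ((g (sg y, y)).2 - (g (sg y', y')).2 - A i * (y - y')) <= 50^-1 * D /\
    nm ((g (sg y, y)).1 - (g (sg y', y')).1) <= 21 / 1000 * D.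
  move=> hy hy' D; have [h1 h2] := hd _ _ (hs y hy) (hs y' hy'); rewrite /= in h1 h2.
  have hx := hl _ _ hy hy'; rewrite -mulrA -/D in hx.
  have D0 : 0 <= D by rewrite mulr_ge0 ?nm_ge0.
  have e1 : ep * nm (sg y - sg y') <= 2000^-1 * (100^-1 * D) by rewrite ler_pM ?nm_ge0 // ltW.
  have e2 : eta * nm (A i) * nm (y - y') <= 100^-1 * D by rewrite -mulrA ler_wpM2r.
  have e3 : nm Lam * nm (sg y - sg y') <= 101 / 100 * (100^-1 * D) by rewrite ler_pM ?nm_ge0.
  split; first by apply: le_trans h2 _; move: (ep * _) (eta * _ * _) e1 e2 => *; lra.
  move: h1; set dg := (g (sg y, y)).1 - _ => h1.
  have := nmD (dg - Lam * (sg y - sg y')) (Lam * (sg y - sg y')); rewrite subrK (nmM Lam); move: h1 e1 e2 e3.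
  by move: (ep * _) (eta * _ * _) (nm Lam * _) (nm (dg - _)) (nm dg) => *; lra.
have sol Y : exists y, nm Y <= 1 -> nm (y - yc i) <= 3 / 2 / nm (A i) /\ (g (sg y, y)).2 = Y.
  case: (leP (nm Y) 1) => hY; last by exists 0.
  pose K := [set y : C | nm (y - yc i) <= 3 / 2 / nm (A i)]; pose T y := y + (Y - (g (sg y, y)).2) / A i.
  have KT y : K y -> K (T y).
    move=> Ky; have [_ /= h] := hp _ (hs y (in2 _ Ky)); rewrite /K /T /=.
    have -> : y + (Y - (g (sg y, y)).2) / A i - yc i = (Y - ((g (sg y, y)).2 - A i * (y - yc i))) / A i by field.
    by rewrite nm_div ler_wpM2r ?invr_ge0 ?nm_ge0 //; apply: le_trans (nmBD _ _) _; move: h hY; lra.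
  have ctr u v : K u -> K v -> nm (T u - T v) <= 2^-1 * nm (u - v).
    move=> Ku Kv; have [h _] := dY _ _ (in2 _ Ku) (in2 _ Kv).
    have -> : T u - T v = - ((g (sg u, u)).2 - (g (sg v, v)).2 - A i * (u - v)) / A i by rewrite /T; field.
    rewrite mulNr nmN nm_div ler_pdivrMr //; apply: le_trans h _.
    by have : 0 <= nm (A i) * nm (u - v) by [rewrite mulr_ge0 ?nm_ge0]; rewrite -mulrA [nm (u - v) * _]mulrC; lra.
  have K0 : K (yc i) by rewrite /K /= subrr nm0 divr_ge0 ?nm_ge0.
  have [v|v|y Ky ey] := @picard C K T (@nm R C) 1 1 (yc i) (@compact_cdisc _ _) K0 KT ltr01 ltr01 _ _ ctr; rewrite ?mul1r //.
  exists y => _; split=> //; move/eqP: ey; rewrite /T addrC -subr_eq0 addrK mulf_eq0 invr_eq0 (negbTE (An0 i)) orbF.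
  by rewrite subr_eq0 => /eqP.
have [ch hch] := choice sol; exists ch; split=> // [Y hY|Y Y' hY hY'].
  have [h1 _] := hch Y hY; have hS := hs _ (in2 _ h1); have [/= h _] := hp _ hS; have [/= h2 _] := hS.
  have := nmD ((g (sg (ch Y), ch Y)).1 - Lam * sg (ch Y) - w ^+ i) (Lam * sg (ch Y) + w ^+ i).
  have -> : (g (sg (ch Y), ch Y)).1 - Lam * sg (ch Y) - w ^+ i + (Lam * sg (ch Y) + w ^+ i) = (g (sg (ch Y), ch Y)).1 by ring.
  by move: h h2; lra.
have [h1 e1] := hch Y hY; have [h2 e2] := hch Y' hY'; have [] := dY _ _ (in2 _ h1) (in2 _ h2); rewrite e1 e2.
move=> h3 h4; have := nm_lo (A i * (ch Y - ch Y')) (A i * (ch Y - ch Y') - (Y - Y')).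
rewrite subKr (nmM (A i)) [nm (A i * _ - _)]nmB => h5; apply: le_trans h4 _.
by move: h3 h5; move: (nm (A i) * _) (nm (Y - Y' - _)) (nm (Y - Y')) (nm_ge0 (Y - Y')) => *; lra.
Qed.

(** [closed_dir] at [Y = 0] gives [9 / 5]; the slope adds at most [3 / 100] and the factor [Lam] at
    most [2 / 100], in total [37 / 20]. *)
Lemma graph_pick (sg : C -> C) : (forall Y, nm Y <= 1 -> nm (sg Y) <= 2) ->
  (forall Y Y', nm Y <= 1 -> nm Y' <= 1 -> nm (sg Y - sg Y') <= 3 / 100 * nm (Y - Y')) ->
  exists i : 'I_3, forall y, nm (y - yc i) < 2 / nm (A i) -> nm (Lam * sg y + w ^+ i) <= 37 / 20.
Proof.
move=> h2 hl; have [_ L3] := Lam_bounds; have n0 : nm (0 : C) <= 1 by rewrite nm0.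
have [i [hi _]] := closed_dir (lexx 2) (h2 0 n0); exists i => y hy.
have y1 : nm y <= 1 by apply: (@yc_disc i); rewrite (le_trans (ltW hy)) // ler_wpM2r ?invr_ge0 ?nm_ge0 //; lra.
have -> : Lam * sg y + w ^+ i = (Lam - 1) * sg y + (sg y - sg 0) + (sg 0 + w ^+ i) by ring.
have := nmD ((Lam - 1) * sg y + (sg y - sg 0)) (sg 0 + w ^+ i); have := nmD ((Lam - 1) * sg y) (sg y - sg 0).
have := hl y 0 y1 n0; rewrite subr0 (nmM (Lam - 1)).
have : nm (Lam - 1) * nm (sg y) <= 100^-1 * 2 by rewrite ler_pM ?nm_ge0 // h2.
by move: hi y1; move: (nm (Lam - 1) * _) (nm (_ + w ^+ i)) (nm (sg y - _)) (nm (_ + _)) (nm (_ + _)) => *; lra.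
Qed.

(** [graph_step] and [graph_pick] alternate, and the point is pulled back to the first graph by
    composing the inverse branches. *)
Lemma graph_points g i (sg : C -> C) n : near Sg Lam A yc w eta ep g ->
  (forall y, nm (y - yc i) < 2 / nm (A i) -> Sg i (sg y, y)) ->
  (forall y y', nm (y - yc i) < 2 / nm (A i) -> nm (y' - yc i) < 2 / nm (A i) ->
     nm (sg y - sg y') <= 100^-1 * nm (A i) * nm (y - y')) ->
  exists2 y, nm (y - yc i) <= 3 / 2 / nm (A i) & forall j, (j < n)%N -> Kg (iter j.+1 g (sg y, y)).
Proof.
move=> hg hs hl.
suff [ps [s [h1 h2 h3 h4]]] : exists ps s : C -> C, [/\ forall Y, nm Y <= 1 -> nm (ps Y - yc i) <= 3 / 2 / nm (A i) /\
    iter n.+1 g (sg (ps Y), ps Y) = (s Y, Y), forall Y, nm Y <= 1 -> nm (s Y) <= 2,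
    forall Y Y', nm Y <= 1 -> nm Y' <= 1 -> nm (s Y - s Y') <= 3 / 100 * nm (Y - Y') &
    forall Y, nm Y <= 1 -> forall j, (j < n)%N -> Kg (iter j.+1 g (sg (ps Y), ps Y))].
  have n0 : nm (0 : C) <= 1 by rewrite nm0.
  by exists (ps 0); [have [] := h1 0 n0|exact: h4].
elim: n => [|n [ps [s [h1 h2 h3 h4]]]].
  have [ch [c1 c2 c3]] := graph_step hg hs hl; exists ch, (fun Y => (g (sg (ch Y), ch Y)).1); split=> // Y hY.
  by have [a b] := c1 Y hY; split=> //; rewrite /= [LHS]surjective_pairing b.
have [k hk] := graph_pick h2 h3.
have in1 y : nm (y - yc k) < 2 / nm (A k) -> nm y <= 1.
  by move=> hy; apply: (@yc_disc k); rewrite (le_trans (ltW hy)) // ler_wpM2r ?invr_ge0 ?nm_ge0 //; lra.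
have hs' y : nm (y - yc k) < 2 / nm (A k) -> Sg k (s y, y).
  by move=> hy; split=> //=; apply: le_lt_trans (hk y hy) _; lra.
have hl' y y' : nm (y - yc k) < 2 / nm (A k) -> nm (y' - yc k) < 2 / nm (A k) ->
   nm (s y - s y') <= 100^-1 * nm (A k) * nm (y - y').
  move=> hy hy'; apply: le_trans (h3 _ _ (in1 _ hy) (in1 _ hy')) _; rewrite ler_wpM2r ?nm_ge0 //.
  by have := A20 k; lra.
have [ch [c1 c2 c3]] := graph_step hg hs' hl'.
have chV Y : nm Y <= 1 -> nm (ch Y - yc k) < 2 / nm (A k).
  by move=> hY; have [a _] := c1 Y hY; apply: le_lt_trans a _; rewrite ltr_pM2r ?invr_gt0 //; lra.
exists (ps \o ch), (fun Y => (g (s (ch Y), ch Y)).1); split=> // Y hY; have [a b] := c1 Y hY;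
  have [p1 p2] := h1 _ (in1 _ (chV Y hY)).
  split=> //; have -> : iter n.+2 g (sg ((ps \o ch) Y), (ps \o ch) Y) = g (s (ch Y), ch Y) by rewrite iterS -p2.
  by rewrite [LHS]surjective_pairing b.
move=> j; rewrite ltnS leq_eqVlt => /orP[/eqP->|jn]; last exact: h4 (in1 _ (chV Y hY)) j jn.
rewrite (p2 : iter n.+1 g (sg ((ps \o ch) Y), (ps \o ch) Y) = _).
by exists k; split=> //=; apply: hk; apply: chV.
Qed.
End Geom.
End Cover.

(** * Continuity and derivatives by inequalities *)

Section MetricCalculus.
Variable R : realType.
Local Notation C := (Cplx R).
Implicit Types U V W : normedModType R[i].

Definition cont_at V W (f : V -> W) x := forall e : R, 0 < e ->
  exists2 del : R, 0 < del & forall y, nm (y - x) < del -> nm (f y - f x) < e.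

Lemma cont_comp U V W (f : U -> V) (g : V -> W) x : cont_at f x -> cont_at g (f x) -> cont_at (g \o f) x.
Proof.
move=> cf cg e e0; have [d1 d10 h1] := cg e e0; have [d2 d20 h2] := cf _ d10.
by exists d2 => // y /h2 /h1.
Qed.

Lemma nbhs_nmP V (x : V) (A : set V) : nbhs x A <-> exists2 e : R, 0 < e & forall y, nm (y - x) < e -> A y.
Proof.
split=> [/nbhs_normP[e /= /pos_rc[e' e'0 ->] h]|[e e0 h]].
  by exists e' => // y hy; apply: h; rewrite /ball_ /= nm_lt nmB.
by apply/nbhs_normP; exists (rc e); [rewrite /= -rc0 rc_lt|move=> y; rewrite /ball_ /= nm_lt nmB => /h].
Qed.

Lemma open_nmP V (A : set V) : (forall x, A x -> exists2 e : R, 0 < e & forall y, nm (y - x) < e -> A y) -> open A.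
Proof. by move=> h; rewrite openE => x /h /nbhs_nmP. Qed.

Lemma closure_nmP V (A : set V) x : closure A x <-> forall e : R, 0 < e -> exists2 p, A p & nm (p - x) < e.
Proof.
split=> [cA e e0|h B /nbhs_nmP[e e0 hB]]; last by have [p Ap /hB Bp] := h e e0; exists p.
have [|p [Ap hp]] := cA [set y | nm (y - x) < e]; first by apply/nbhs_nmP; exists e.
by exists p.
Qed.

Lemma closed_lip V (f : V -> C) (K c : R) : (forall x y, nm (f x - f y) <= K * nm (x - y)) -> closed [set x | nm (f x) <= c].
Proof.
move=> hf x /closure_nmP hx /=; apply/ler_addgt0Pl => e e0; have K0 : 0 < `|K| + 1 by rewrite ltr_wpDl.
have [y hy] := hx _ (divr_gt0 e0 K0); rewrite ltr_pdivlMr // nmB => hd.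
have h : K * nm (x - y) <= nm (x - y) * (`|K| + 1).
  by rewrite mulrC ler_wpM2l ?nm_ge0 // (le_trans (ler_norm K)) // lerDl.
by have := nm_lo (f x) (f y); have := hf x y; move: hy hd h; rewrite /=; move: (K * _) (_ * (`|K| + 1)) => *; lra.
Qed.

Lemma diff_cont V W (f : V -> W) x : differentiable f x -> cont_at f x.
Proof.
move=> /differentiable_continuous /cvgrPdist_lt h e e0.
have := h (rc e); rewrite -rc0 rc_lt => /(_ e0) /nbhs_nmP[del del0 hd].
by exists del => // y /hd; rewrite nm_lt nmB.
Qed.

Lemma cont_atP V W (f : V -> W) : (forall x, cont_at f x) -> continuous f.
Proof.
move=> h x; apply/cvgrPdist_lt => e /pos_rc[e' e'0 ->]; have [del del0 hd] := h x _ e'0.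
by apply/nbhs_nmP; exists del => // y /hd; rewrite nm_lt nmB.
Qed.

Lemma nmZr V (t : R) (v : V) : 0 <= t -> nm (rc t *: v) = t * nm v.
Proof. by move=> t0; rewrite nmZ nm_rc ger0_norm. Qed.

(** The local inequality is applied to a short multiple of [v]. It serves below with an adapted
    gauge instead of the norm. *)
Lemma diff_expand V W (f : V -> W) x (M : V -> R) (M' : W -> R) (k c2 : R) : differentiable f x ->
  (forall (t : R) v, 0 <= t -> M (rc t *: v) = t * M v) -> (forall (t : R) v, 0 <= t -> M' (rc t *: v) = t * M' v) ->
  (forall u v, M' (u + v) <= M' u + M' v) -> 0 <= c2 -> (forall v, M' v <= c2 * nm v) ->
  (exists2 del : R, 0 < del & forall y, nm (y - x) < del -> k * M (y - x) <= M' (f y - f x)) ->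
  forall v, k * M v <= M' ('d f x v).
Proof.
move=> df MZ MZ' tri c20 bd [del del0 hk] v; rewrite leNgt; apply/negP => hlt.
pose e := k * M v - M' ('d f x v); have e0 : 0 < e by rewrite subr_gt0.
have n1 : 0 < nm v + 1 by rewrite ltr_wpDl ?nm_ge0.
have c1 : 0 < c2 + 1 by rewrite ltr_wpDl.
have [d1 d10 h1] := diff_local df (divr_gt0 e0 (mulr_gt0 (mulr_gt0 (ltr0n _ 2) c1) n1)).
pose t := Num.min del d1 / (2 * (nm v + 1)).
have t0 : 0 < t by rewrite divr_gt0 ?lt_min ?del0 ?mulr_gt0.
have tv : nm (x + rc t *: v - x) < Num.min del d1.
  rewrite addrC addKr nmZr ?(ltW t0) // /t mulrAC ltr_pdivrMr ?mulr_gt0 // ltr_pM2l ?lt_min ?del0 //.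
  by have := nm_ge0 v; lra.
move: (tv); rewrite lt_min => /andP[tv1 tv2].
have ey : x + rc t *: v - x = rc t *: v by rewrite addrC addKr.
have := hk _ tv1; have := h1 _ tv2; rewrite !ey linearZ nmZr ?(ltW t0) //= MZ ?(ltW t0) // => r1 r2.
have := tri (rc t *: 'd f x v) (f (x + rc t *: v) - f x - rc t *: 'd f x v); rewrite addrC subrK MZ' ?(ltW t0) // => r3.
have r4 := bd (f (x + rc t *: v) - f x - rc t *: 'd f x v).
have r5 : c2 * nm (f (x + rc t *: v) - f x - rc t *: 'd f x v) <= t * (e / 2).
  apply: le_trans (ler_wpM2l c20 r1) _.
  have -> : c2 * (e / (2 * (c2 + 1) * (nm v + 1)) * (t * nm v)) = t * ((c2 / (c2 + 1)) * (nm v / (nm v + 1)) * (e / 2)).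
    by move: (c2 + 1) c1 (nm v + 1) n1 => a' a0 b' b0; field; rewrite !gt_eqF.
  rewrite ler_wpM2l ?(ltW t0) //.
  have a1 : c2 / (c2 + 1) <= 1 by rewrite ler_pdivrMr // mul1r lerDl.
  have a2 : nm v / (nm v + 1) <= 1 by rewrite ler_pdivrMr // mul1r lerDl.
  apply: ler_piMl; first by rewrite divr_ge0 ?(ltW e0).
  by apply: mulr_ile1; rewrite ?divr_ge0 ?nm_ge0 ?(ltW c1) ?(ltW n1).
have r6 : t * (k * M v) <= t * M' ('d f x v) + t * (e / 2).
  have -> : t * (k * M v) = k * (t * M v) by ring.
  by move: r2 r3 r4 r5; move: (k * (t * _)) (M' (f _ - f x)) (M' (_ - rc t *: _)) (c2 * _) (t * M' _) (t * (e / 2)) => *; lra.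
rewrite -mulrDr ler_pM2l // in r6; move: r6 e0; rewrite /e; move: (k * M v) (M' _) => *; lra.
Qed.

(** Bisection: nested intervals on which [f] moves at least at the rate [K + e] shrink to a point
    where the derivative contradicts this. *)
Lemma mvt_diff V W (f : V -> W) (a b : V) (K : R) :
  (forall t : R, 0 <= t <= 1 -> differentiable f (a + rc t *: (b - a)) /\ nm ('d f (a + rc t *: (b - a)) (b - a)) <= K) ->
  nm (f b - f a) <= K.
Proof.
move=> hd; rewrite leNgt; apply/negP => hlt; pose v := b - a; pose ph (t : R) := f (a + rc t *: v).
pose e := nm (f b - f a) - K; have e0 : 0 < e by rewrite subr_gt0.
pose bad (p : R * R) := [/\ 0 <= p.1, p.1 < p.2, p.2 <= 1 & (K + e) * (p.2 - p.1) <= nm (ph p.2 - ph p.1)].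
have nxt (p : {p | bad p}) : exists p' : {p | bad p}, [/\ (sval p).1 <= (sval p').1, (sval p').2 <= (sval p).2 &
    (sval p').2 - (sval p').1 = ((sval p).2 - (sval p).1) / 2].
  case: p => -[s t] [/= s0 st t1 hb]; pose m := (s + t) / 2.
  have [h|h] : (K + e) * (m - s) <= nm (ph m - ph s) \/ (K + e) * (t - m) <= nm (ph t - ph m).
    case: (leP ((K + e) * (m - s)) (nm (ph m - ph s))) => h1; first by left.
    right; rewrite leNgt; apply/negP => h2; have := nm_tri (ph m) (ph t) (ph s).
    have : (K + e) * (t - s) = (K + e) * (t - m) + (K + e) * (m - s) by ring.
    by move: hb h1 h2; move: ((K + e) * (t - s)) ((K + e) * (t - m)) ((K + e) * (m - s)) => *; lra.
  - have B : bad (s, m) by split=> //=; rewrite /m; lra.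
    by exists (exist _ _ B); split=> //=; rewrite /m; lra.
  have B : bad (m, t) by split=> //=; rewrite /m; lra.
  by exists (exist _ _ B); split=> //=; rewrite /m; lra.
have [F hF] := choice nxt.
have B0 : bad (0, 1).
  split=> //=; rewrite subr0 mulr1 /ph rc0 scale0r addr0 rc1 scale1r /v [a + _]addrC subrK /e.
  by move: (nm _) => x; lra.
pose I n := sval (iter n F (exist _ _ B0)).
have Ib n : bad (I n) := svalP _.
have Il n : (I n).2 - (I n).1 = 2^-1 ^+ n.
  elim: n => [|n ih]; first by rewrite /I /= subr0.
  by have [_ _ h] := hF (iter n F (exist _ _ B0)); rewrite [I n.+1]/(sval (F _)) h -/(I n) ih exprSr.
have In n k : (I n).1 <= (I (n + k)%N).1 /\ (I (n + k)%N).2 <= (I n).2.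
  elim: k => [|k [h1 h2]]; first by rewrite addn0.
  have [h3 h4 _] := hF (iter (n + k) F (exist _ _ B0)); rewrite addnS; split; first exact: le_trans h1 h3.
  exact: le_trans h4 h2.
have sb n : nm (rc (I n).1 : C) <= 1.
  by have [h1 h2 h3 _] := Ib n; rewrite nm_rc ger0_norm //; lra.
have [l _ hl] := compact_cluster (@compact_disc R 1) sb; pose c := complex.Re l.
have cl (e' : R) n : 0 < e' -> exists2 m, (n <= m)%N & `|(I m).1 - c| < e'.
  move=> /(hl e' n)[m mn hm]; exists m => //; apply: le_lt_trans hm.
  have -> : (I m).1 - c = complex.Re (rc (I m).1 - l : C) by rewrite ReD /c; case: (l).
  exact: nm_Re.
have cI n : (I n).1 <= c <= (I n).2.
  have aux : forall e' : R, 0 < e' -> (I n).1 - e' <= c <= (I n).2 + e'.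
    move=> e' e'0; have [m mn hm] := cl e' n e'0; have [h1 h2] := In n (m - n)%N; rewrite subnKC // in h1 h2.
    by have [_ h3 _ _] := Ib m; move: hm; rewrite ltr_norml; lra.
  rewrite !leNgt; apply/andP; split; apply/negP => h.
    by have := aux (((I n).1 - c) / 2); lra.
  by have := aux ((c - (I n).2) / 2); lra.
have /andP[c0 c1] := cI 0%N; have [df dK] := hd c (ltac:(by rewrite c0 c1)).
have n1 : 0 < nm v + 1 by rewrite ltr_wpDl ?nm_ge0.
have [d1 d10 h1] := diff_local df (divr_gt0 e0 (mulr_gt0 (ltr0n _ 4) n1)).
have [|n hn] := @pow_small R 2^-1 (d1 / (nm v + 1)) _ (divr_gt0 d10 n1); first by lra.
have {hn} := hn n (leqnn n); rewrite ltr_pdivlMr // -Il => hn.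
have [_ st _ hb] := Ib n; have /andP[c2 c3] := cI n; set s := (I n).1 in st hb c2 hn *; set t := (I n).2 in st hb c3 hn *.
have est u : s <= u <= t -> nm (ph u - ph c - rc (u - c) *: 'd f (a + rc c *: v) v) <= e / (4 * (nm v + 1)) * (`|u - c| * nm v).
  move=> /andP[u1 u2]; have ex : a + rc u *: v - (a + rc c *: v) = rc (u - c) *: v.
    by rewrite opprD addrACA subrr add0r -scalerBl rcD rcN.
  have := h1 (a + rc u *: v); rewrite ex linearZ nmZ nm_rc /=; apply.
  apply: le_lt_trans hn; rewrite ler_pM ?nm_ge0 ?lerDl //.
  by rewrite ler_norml; lra.
have e1 := est t (ltac:(by rewrite (ltW st) lexx)); have e2 := est s (ltac:(by rewrite (ltW st) lexx)).
set D := 'd f _ _ in dK e1 e2; rewrite ger0_norm ?subr_ge0 // in e1; rewrite ler0_norm ?subr_le0 // in e2.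
have q1 : e / (4 * (nm v + 1)) * ((t - c) * nm v) = (t - c) * (e / 4 * (nm v / (nm v + 1))) by field; rewrite gt_eqF.
have q2 : e / (4 * (nm v + 1)) * (- (s - c) * nm v) = (c - s) * (e / 4 * (nm v / (nm v + 1))) by field; rewrite gt_eqF.
rewrite q1 in e1; rewrite q2 in e2.
have h5 : e / 4 * (nm v / (nm v + 1)) <= e / 4.
  by rewrite ler_piMr ?divr_ge0 ?(ltW e0) // ler_pdivrMr // mul1r lerDl.
set q := e / 4 * _ in h5 e1 e2.
have h6 : (t - c) * q + (c - s) * q <= (t - s) * (e / 4).
  by rewrite -mulrDl addrA subrK ler_wpM2l // subr_ge0 ltW.
have h7 : nm (rc (t - s) *: D) <= (t - s) * K by rewrite nmZr ?subr_ge0 ?(ltW st) // ler_wpM2l // subr_ge0 ltW.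
have eq : ph t - ph s = (ph t - ph c - rc (t - c) *: D) - (ph s - ph c - rc (s - c) *: D) + rc (t - s) *: D.
  have gq (M : zmodType) (x1 x2 x3 x4 : M) : (x1 - x2) - (x3 - x4) + (x2 - x4) = x1 - x3.
    by rewrite opprB [x4 - x3]addrC addrACA subrK addrK.
  have -> : rc (t - s) *: D = rc (t - c) *: D - rc (s - c) *: D.
    by rewrite -scalerBl !rcD !rcN opprB addrA subrK.
  by rewrite gq opprB addrA subrK.
move: hb; rewrite eq => hb; have h8 := nmD (ph t - ph c - rc (t - c) *: D - (ph s - ph c - rc (s - c) *: D)) (rc (t - s) *: D).
have h9 := nmBD (ph t - ph c - rc (t - c) *: D) (ph s - ph c - rc (s - c) *: D).
have h10 : (K + e) * (t - s) = (t - s) * K + (t - s) * e by ring.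
have h11 : 0 < (t - s) * e by rewrite mulr_gt0 // subr_gt0.
have h12 : (t - s) * (e / 4) = (t - s) * e / 4 by ring.
move: hb h8 h9 h6 h7 e1 e2; rewrite h10 h12.
by move: ((t - s) * e) h11 ((t - s) * K) (nm (rc _ *: D)) (nm (ph t - _ - _)) (nm (ph s - _ - _)) (nm (_ - _)) (nm (_ + _)) ((t - c) * q) ((c - s) * q) => *; lra.
Qed.
End MetricCalculus.

(** * Infinite orbits through graphs *)

Section GraphOrbit.
Variable R : realType.
Local Notation C := (Cplx R).
Variables (Lam : C) (A yc : 'I_3 -> C) (w : C) (eta ep : R).
Hypothesis geo : geom Lam A yc w eta ep.
Hypothesis eta0 : 0 < eta <= 100^-1.
Local Notation Sg := (Sg Lam A yc w).
Local Notation Kg := (Kg Lam A yc w).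

Let A0 i := (geom_A i geo).2.

Lemma Sg_open i (p : C * C) : Sg i p -> exists2 e : R, 0 < e & forall p', nm (p' - p) < e -> Sg i p'.
Proof.
move=> [h1 h2]; have [/andP[L1 L2] _] := Lam_bounds geo eta0.
exists (Num.min ((19 / 10 - nm (Lam * p.1 + w ^+ i)) / 2) (2 / nm (A i) - nm (p.2 - yc i))).
  by rewrite lt_min subr_gt0 h2 andbT; lra.
move=> p'; rewrite nm_pair_lt !lt_min => /andP[/andP[a1 _] /andP[_ a2]]; split.
  have -> : Lam * p'.1 + w ^+ i = Lam * (p'.1 - p.1) + (Lam * p.1 + w ^+ i) by ring.
  apply: le_lt_trans (nmD _ _) _; rewrite (nmM Lam).
  have : nm Lam * nm (p'.1 - p.1) <= 101 / 100 * nm (p'.1 - p.1) by rewrite ler_wpM2r ?nm_ge0.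
  by move: a1; rewrite /=; move: (nm Lam * _) => *; lra.
by have := nm_tri p.2 p'.2 (yc i); move: a2; rewrite /=; move: (2 / _) => *; lra.
Qed.

Lemma near_cont S g i (p : C * C) : near S Lam A yc w eta ep g -> S i p ->
  (exists2 e : R, 0 < e & forall p', nm (p' - p) < e -> S i p') -> cont_at g p.
Proof.
move=> hg Sp [r r0 hr] e e0; have [_ hd] := hg i; have [/andP[L1 L2] _] := Lam_bounds geo eta0.
have /andP[ep0 ep1] := ep_small geo eta0; have /andP[et0 et1] := eta0.
pose T := 3 + 2 * nm (A i); have T0 : 0 < T by rewrite /T; have := A0 i; lra.
exists (Num.min r (e / T)) => [|p']; first by rewrite lt_min r0 divr_gt0.
rewrite lt_min => /andP[h0 h]; have Sp' := hr _ h0.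
rewrite (ltr_pdivlMr _ _ T0) in h.
apply: (le_lt_trans _ h).
have [h1 h2] := hd _ _ Sp' Sp; set D := nm (p' - p).
have /andP[d1 d2] : (nm (p' - p).1 <= D) && (nm (p' - p).2 <= D) by rewrite -nm_pair_le.
have D0 : 0 <= D := nm_ge0 _.
have e1 : ep * nm (p'.1 - p.1) <= 2000^-1 * D by rewrite ler_pM ?nm_ge0 ?(ltW ep0).
have e2 : eta * nm (A i) * nm (p'.2 - p.2) <= nm (A i) * D.
  rewrite ler_pM ?nm_ge0 ?mulr_ge0 ?nm_ge0 ?(ltW et0) //.
  by rewrite ler_piMl ?nm_ge0 //; lra.
have e3 : nm (Lam * (p'.1 - p.1)) <= 101 / 100 * D by rewrite nmM ler_pM ?nm_ge0.
have e4 : nm (A i * (p'.2 - p.2)) <= nm (A i) * D by rewrite nmM ler_wpM2l ?nm_ge0.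
have eT : D * T = 3 * D + 2 * (nm (A i) * D) by rewrite /T; ring.
have a0 : 0 <= nm (A i) * D by rewrite mulr_ge0 ?nm_ge0.
rewrite nm_pair_le eT; apply/andP; split=> /=.
  have := nmD ((g p').1 - (g p).1 - Lam * (p'.1 - p.1)) (Lam * (p'.1 - p.1)); rewrite subrK.
  move: h1 e1 e2 e3; move: (ep * _) (eta * _ * _) (nm (Lam * _)) (nm (A i) * D) a0 => t1 t2 t3 t4 a0; lra.
have := nmD ((g p').2 - (g p).2 - A i * (p'.2 - p.2)) (A i * (p'.2 - p.2)); rewrite subrK.
move: h2 e1 e2 e4; move: (ep * _) (eta * _ * _) (nm (A i * _)) (nm (A i) * D) a0 => t1 t2 t3 t4 a0; lra.
Qed.

Lemma Kg_closed p : (forall e : R, 0 < e -> exists2 p', Kg p' & nm (p' - p) < e) -> Kg p.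
Proof.
move=> /closure_nmP hp; have [/andP[L1 L2] _] := Lam_bounds geo eta0.
pose Ki (i : 'I_3) := [set p : C * C | nm (Lam * p.1 + w ^+ i) <= 37 / 20] `&` [set p : C * C | nm (p.2 - yc i) <= 3 / 2 / nm (A i)].
have fs (u : C * C) : nm u.1 <= nm u /\ nm u.2 <= nm u by apply/andP; rewrite -nm_pair_le.
suff cK : closed (\bigcup_(i in [set: 'I_3]) Ki i).
  have [i _ hi] : (\bigcup_(i in [set: 'I_3]) Ki i) p by apply: cK; apply: closureS hp => q [i hi]; exists i.
  by exists i.
apply: closed_bigcup => [|i _]; first exact: finite_finset.
apply: closedI; [apply: (@closed_lip _ _ _ 2)|apply: (@closed_lip _ _ _ 1)] => x y; have [f1 f2] := fs (x - y).
  have -> : Lam * x.1 + w ^+ i - (Lam * y.1 + w ^+ i) = Lam * (x - y).1 by rewrite /=; ring.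
  by rewrite nmM; apply: ler_pM; rewrite ?nm_ge0 //; lra.
by have -> : x.2 - yc i - (y.2 - yc i) = (x - y).2 by [rewrite /=; ring]; rewrite mul1r.
Qed.

(** The point is a cluster point of the starting points given by [graph_points]. Its later iterates
    are shown one by one to be in [Kg], hence in some [Sg k], together with the continuity of the
    iterates there, which is available only inside the domains [Sg k]. *)
Lemma graph_orbit g i (sg : C -> C) : near Sg Lam A yc w eta ep g ->
  (forall y, nm (y - yc i) < 2 / nm (A i) -> Sg i (sg y, y)) ->
  (forall y y', nm (y - yc i) < 2 / nm (A i) -> nm (y' - yc i) < 2 / nm (A i) ->
     nm (sg y - sg y') <= 100^-1 * nm (A i) * nm (y - y')) ->
  exists2 y, nm (y - yc i) < 2 / nm (A i) & forall j, exists k, Sg k (iter j g (sg y, y)).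
Proof.
move=> hg hs hl.
have gp n : exists y, nm (y - yc i) <= 3 / 2 / nm (A i) /\ forall j, (j < n)%N -> Kg (iter j.+1 g (sg y, y)).
  by have [y h1 h2] := graph_points geo eta0 n hg hs hl; exists y.
have [y hy] := choice gp.
have [l hl1 hc] := compact_cluster (@compact_cdisc R (yc i) (3 / 2 / nm (A i))) (fun n => proj1 (hy n)).
have lV : nm (l - yc i) < 2 / nm (A i) by apply: le_lt_trans hl1 _; rewrite ltr_pM2r ?invr_gt0 //; lra.
exists l => //; pose P j (t : C) := iter j g (sg t, t).
suff H j : (exists k, Sg k (P j l)) /\ cont_at (P j) l by move=> j; case: (H j).
elim: j => [|j [[k hk] ih]].
  split; first by exists i; apply: hs.
  move=> e e0; pose T := 1 + 100^-1 * nm (A i); have T0 : 0 < T by rewrite /T; have := A0 i; lra.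
  exists (Num.min (2 / nm (A i) - nm (l - yc i)) (e / T)) => [|t]; first by rewrite lt_min subr_gt0 lV divr_gt0.
  rewrite lt_min => /andP[h1]; rewrite ltr_pdivlMr // => h2.
  have tV : nm (t - yc i) < 2 / nm (A i) by have := nm_tri l t (yc i); move: h1; move: (2 / _) => *; lra.
  apply: le_lt_trans h2; rewrite nm_pair_le /= /T mulrDr mulr1; apply/andP; split.
    by apply: le_trans (hl _ _ tV lV) _; rewrite mulrC lerDr nm_ge0.
  by rewrite lerDl !mulr_ge0 ?nm_ge0 // invr_ge0.
have cj : cont_at (P j.+1) l := cont_comp ih (near_cont hg hk (Sg_open hk)).
split=> //; suff [k' [h1 h2]] : Kg (P j.+1 l).
  exists k'; split; first by apply: le_lt_trans h1 _; lra.
  by apply: le_lt_trans h2 _; rewrite ltr_pM2r ?invr_gt0 //; lra.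
apply: Kg_closed => e /cj[del del0 hd]; have [n jn hn] := hc del j.+1 del0.
by exists (P j.+1 (y n)); [apply: (proj2 (hy n))|apply: hd].
Qed.
End GraphOrbit.

Lemma diff_idE (R : realType) (V : normedModType R[i]) (p : V) : differentiable (fun q : V => q) p /\ forall v, 'd (fun q : V => q) p v = v.
Proof.
apply: (@diff_intro R _ _ _ idfun p 1 (fun _ _ _ => erefl)) => [v|e e0]; first by rewrite mul1r.
by exists 1 => // y _; rewrite subrr nm0 mulr_ge0 ?nm_ge0 // ltW.
Qed.

Lemma diff_iter (R : realType) (V : normedModType R[i]) (F : V -> V) n p : (forall p, differentiable F p) -> differentiable (iter n F) p.
Proof.
move=> dF; elim: n p => [|n ih] p; first by have [] := diff_idE p.
exact: (differentiable_comp (ih p) (dF _)).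
Qed.

(** * Repelling blenders *)

Section RepBlender.
Variables (R : realType) (F : Cplx R * Cplx R -> Cplx R * Cplx R) (z ws Lam w : Cplx R) (kap rho ep eta : R) (A yc : 'I_3 -> Cplx R).
Local Notation C := (Cplx R).
Hypothesis dF : forall p, differentiable F p.
Hypothesis kap0 : 0 < kap.
Hypothesis rho0 : 0 < rho.
Hypothesis geo : geom Lam A yc w eta ep.
Hypothesis eta0 : 0 < eta <= 200^-1.
Local Notation oX := (ofX z ws kap rho).
Local Notation tX := (toX z ws kap rho).
Hypothesis hg : near (box A yc 3 3) Lam A yc w eta ep (fun p => tX (F (oX p))).
Hypothesis Lam1 : 1 < nm Lam.
Local Notation Sg := (Sg Lam A yc w).

Let eta1 : 0 < eta <= 100^-1. Proof. by have := eta0; lra. Qed.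
Let A20 i := (geom_A i geo).1.
Let A0 i := (geom_A i geo).2.
Let rk := rc_neq0 kap0.
Let rr := rc_neq0 rho0.
Let nk := nm_rcp kap0.
Let nr := nm_rcp rho0.

Let tX1 (p p' : C * C) : nm ((tX p).1 - (tX p').1) = nm (p.1 - p'.1) / kap.
Proof. by rewrite /toX /= -mulrBl opprB addrA subrK nm_div nk. Qed.
Let tX2 (p p' : C * C) : nm ((tX p).2 - (tX p').2) = nm (p.2 - p'.2) / rho.
Proof. by rewrite /toX /= -mulrBl opprB addrA subrK nm_div nr. Qed.

Definition Zr (i : 'I_3) := [set x : C | nm (Lam * ((x - z) / rc kap) + w ^+ i) < 19 / 10] `*`
  [set y : C | nm ((y - ws) / rc rho - yc i) < 2 / nm (A i)].

Definition KB := \bigcup_(i in [set: 'I_3]) [set p | box A yc (59 / 20) 2 i (tX p)].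

Lemma KB_compact : compact KB.
Proof.
have cb i : compact [set p | box A yc (59 / 20) 2 i (tX p)].
  have -> : [set p | box A yc (59 / 20) 2 i (tX p)] =
      [set x : C | nm (x - z) <= 59 / 20 * kap] `*` [set y : C | nm (y - (ws + rc rho * yc i)) <= 2 / nm (A i) * rho].
    apply/seteqP; split=> -[x y] /=; rewrite /box /toX /= nm_div nk ler_pdivrMr //;
      have -> : (y - ws) / rc rho - yc i = (y - (ws + rc rho * yc i)) / rc rho by [field];
      by rewrite nm_div nr ler_pdivrMr.
  by apply: compact_setX; exact: compact_cdisc.
have -> : KB = \big[setU/set0]_(i <- enum 'I_3) [set p | box A yc (59 / 20) 2 i (tX p)].
  by rewrite -bigcup_seq; apply: eq_bigcupl; split=> i //= _; rewrite mem_enum.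
elim/big_ind: _ => [|X Y|i _]; [exact: compact0|exact: compactU|exact: cb].
Qed.

Let SA := \sum_i nm (A i).
Let SAi i : nm (A i) <= SA.
Proof. by rewrite /SA (bigD1 i) //= lerDl sumr_ge0 // => j _; exact: nm_ge0. Qed.
Let gam := nm Lam - 1.
Let be := SA / gam.
Let g0 : 0 < gam. Proof. by rewrite subr_gt0. Qed.
Let SA0 : 0 < SA. Proof. exact: lt_le_trans (A0 ord0) (SAi ord0). Qed.
Let be0 : 0 < be. Proof. by rewrite divr_gt0. Qed.
Let k1 := 1 + gam / 2.
(** An adapted norm. [F] couples [y] into [x] with strength [eta * nm (A i)], which need not be
    small against the weak expansion [gam] of [x]; the weight [be = SA / gam] of [y] makes this
    coupling negligible whenever the first entry is the maximum. When it is the second one, the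
    strong expansion of [y] is enough. *)
Definition Mx (p : C * C) : R := Num.max (nm p.1 / kap) (be * (nm p.2 / rho)).

Let epSA : ep * SA <= 3 * (eta * gam).
Proof.
have [_ _ e0 h] := geo; rewrite /SA !big_ord_recl big_ord0 addr0.
have h' i : ep * nm (A i) <= eta * gam.
  have [_ _ h3] := h i; rewrite ger0_norm ?subr_ge0 ?(ltW Lam1) // in h3.
  by apply: le_trans h3; rewrite ler_wpM2l ?(ltW e0) // lerDr.
rewrite [ep * _]mulrDr [ep * (_ + _)]mulrDr; have := h' ord0; have := h' (lift ord0 ord0).
have := h' (lift ord0 (lift ord0 ord0)); move: (eta * gam) => G.
by move: (ep * nm (A ord0)) (ep * nm (A (lift ord0 ord0))) (ep * nm (A (lift ord0 (lift ord0 ord0)))) => *; lra.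
Qed.

Lemma one_step i a b : box A yc 3 3 i (tX a) -> box A yc 3 3 i (tX b) -> k1 * Mx (a - b) <= Mx (F a - F b).
Proof.
move=> ha hb; have [_ hd] := hg i; have := hd _ _ ha hb; rewrite !toXK //= => -[h1 h2].
have /andP[et0 et1] := eta1; have /andP[ep0 ep1] := ep_small geo eta1; have [_ L2] := Lam_bounds geo eta1.
have ge : gam <= 100^-1 by have := nm_lo Lam (1 : C); rewrite nm1 /gam; move: L2; lra.

set u := (tX a).1 - (tX b).1 in h1 h2; set v := (tX a).2 - (tX b).2 in h1 h2.
set U := (tX (F a)).1 - _ in h1; set V := (tX (F a)).2 - _ in h2.
have -> : Mx (a - b) = Num.max (nm u) (be * nm v) by rewrite /Mx /u /v tX1 tX2.
have -> : Mx (F a - F b) = Num.max (nm U) (be * nm V) by rewrite /Mx /U /V tX1 tX2.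
have epg : ep <= eta * gam.
  have [_ _ _ /(_ i)[_ _ h3]] := geo; rewrite ger0_norm ?subr_ge0 ?(ltW Lam1) // in h3.
  by apply: le_trans h3; rewrite ler_peMr ?(ltW ep0) // lerDl ltW.
have eg : eta * gam <= 100^-1 * gam by rewrite ler_wpM2r // ltW.
have hU : (1 + gam) * nm u - nm U <= ep * nm u + eta * nm (A i) * nm v.
  apply: le_trans h1; have := nm_lo (Lam * u) U; rewrite nmB (nmM Lam).
  by have -> : 1 + gam = nm Lam by rewrite /gam; ring.
have hV : nm (A i) * nm v - nm V <= ep * nm u + eta * nm (A i) * nm v.
  by apply: le_trans h2; have := nm_lo (A i * v) V; rewrite nmB (nmM (A i)).
have [cs|cs] := leP (be * nm v) (nm u).
  have e1 : eta * nm (A i) * nm v <= eta * gam * nm u.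
    have -> : eta * gam * nm u = eta * (gam * nm u) by ring.
    rewrite -mulrA ler_wpM2l ?(ltW et0) //; apply: le_trans (_ : SA * nm v <= _).
      by rewrite ler_wpM2r ?nm_ge0.
    by move: cs; rewrite /be mulrAC ler_pdivrMr // [nm u * _]mulrC.
  rewrite le_max; apply/orP; left; have u0 := nm_ge0 u; rewrite /k1.
  have e2 := ler_wpM2r u0 epg; have e3 := ler_wpM2r u0 eg.
  move: hU; have -> : (1 + gam) * nm u = nm u + gam * nm u by ring.
  have -> : (1 + gam / 2) * nm u = nm u + gam * nm u / 2 by ring.
  have e4 : 100^-1 * gam * nm u = gam * nm u / 100 by ring.
  rewrite e4 in e3; have g1 : 0 <= gam * nm u by rewrite mulr_ge0 // ltW.
  by move: (gam * nm u) (eta * gam * nm u) (ep * nm u) (eta * nm (A i) * nm v) e1 e2 e3 g1 => *; lra.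
rewrite le_max; apply/orP; right; have v0 := nm_ge0 v; have bp := be0.
have e1 : ep * nm u <= 3 / 100 * nm v.
  apply: le_trans (_ : ep * (be * nm v) <= _); first by rewrite ler_wpM2l ?(ltW ep0) // ltW.
  rewrite mulrA ler_wpM2r // /be mulrA ler_pdivrMr //; apply: le_trans epSA _.
  by move: eg; lra.
have e2 : eta * nm (A i) * nm v <= 100^-1 * (nm (A i) * nm v) by rewrite -mulrA ler_wpM2r // mulr_ge0 ?nm_ge0.
have e3 : 20 * nm v <= nm (A i) * nm v by rewrite ler_wpM2r.
have e4 : 2 * nm v <= nm V by move: (nm (A i) * nm v) (ep * _) (eta * _ * _) hV e1 e2 e3 => *; lra.
apply: le_trans (_ : 2 * (be * nm v) <= _); last by rewrite mulrCA ler_wpM2l ?(ltW bp).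
apply: ler_wpM2r; first by rewrite mulr_ge0 // ltW.
by rewrite /k1; move: ge; lra.
Qed.

Definition Lr := [set p | forall n, KB (iter n F p)].

Let cF n p : cont_at (iter n F) p.
Proof.
elim: n p => [|n ih] p; first by move=> e e0; exists e.
exact: (cont_comp (ih p) (diff_cont (dF _))).
Qed.

Let dFn n p : differentiable (iter n F) p.
Proof. exact: diff_iter. Qed.

Lemma iter_expand p n : Lr p -> exists2 del : R, 0 < del & forall p', nm (p' - p) < del ->
  k1 ^+ n * Mx (p' - p) <= Mx (iter n F p' - iter n F p).
Proof.
move=> Lp; have k10 : 0 <= k1 by rewrite /k1; have := g0; lra.
elim: n => [|n [d1 d10 h1]]; first by exists 1 => // p' _; rewrite mul1r.
have [i _ [b1 b2]] := Lp n; have tau0 : 0 < Num.min (kap / 20) (rho / nm (A i)).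
  by rewrite lt_min !divr_gt0.
have [d2 d20 h2] := cF n p tau0; exists (Num.min d1 d2) => [|p']; first by rewrite lt_min d10.
rewrite lt_min => /andP[/h1 h3 /h2]; rewrite nm_pair_lt !lt_min => /andP[/andP[t1 _] /andP[_ t2]].
rewrite exprS -mulrA; apply: le_trans (ler_wpM2l k10 h3) _; rewrite !iterS.
set a := iter n F p' in t1 t2 *; set b := iter n F p in b1 b2 t1 t2 *.
apply: (@one_step i); last first.
  split; first by apply: le_trans b1 _; lra.
  by apply: le_trans b2 _; rewrite ler_wpM2r ?invr_ge0 ?nm_ge0 //; lra.
have s1 : nm ((tX a).1 - (tX b).1) <= 1 / 20 by rewrite tX1 ler_pdivrMr // mulrC mulrA mulr1; exact: ltW.
have s2 : nm ((tX a).2 - (tX b).2) <= 1 / nm (A i).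
  by rewrite tX2 ler_pdivrMr // mulrC mulrA mulr1; exact: ltW.
split; first by have := nm_lo (tX a).1 (tX b).1; move: b1 s1; lra.
have := nm_tri (tX b).2 (tX a).2 (yc i).
have -> : 3 / nm (A i) = 1 / nm (A i) + 2 / nm (A i) by rewrite -mulrDl; congr (_ / _); lra.
by move: b2 s2; move: (1 / _) (2 / _) => *; lra.
Qed.

(** Invariance comes from [near_cover] with [r = 59 / 20]: a point of [KB] has a preimage in a box
    of radius [57 / 20], again in [KB]. The expansion of [Mx] by [k1] at each step passes to
    derivatives by [diff_expand], and to the norm by [c2] and [c3]. *)
Lemma rep_hyp_Lr : rep_hyp setT F Lr.
Proof.
have LK : Lr `<=` KB by move=> p /(_ 0%N).
split=> //.
- apply: subclosed_compact KB_compact LK.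
  have -> : Lr = \bigcap_(n in [set: nat]) (iter n F @^-1` KB).
    by apply/seteqP; split=> p h n; [move=> _; exact: h|exact: h].
  apply: closed_bigI => n _; have cn : continuous (iter n F) by apply: cont_atP.
  move/continuous_closedP: cn; apply; apply: compact_closed KB_compact; exact: norm_hausdorff.
- apply/seteqP; split=> [_ [p Lp <-] n|p Lp]; first by rewrite -iterSr; apply: Lp.
  have [i _ [b1 b2]] := Lp 0%N.
  have t2 : nm (tX p).2 <= 1.
    apply: (yc_disc geo (i := i)); apply: le_trans b2 _; rewrite ler_wpM2r ?invr_ge0 ?nm_ge0 //; lra.
  have [||j [s [[s1 s2] es]]] := @near_cover R Lam A yc w eta ep geo eta1 _ _ (59 / 20) hg _ _ (tX p) b1 t2; first by lra.
    move=> j s [s1 s2]; split; first by lra.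
    by apply: le_trans s2 _; rewrite ler_wpM2r ?invr_ge0 ?nm_ge0 //; lra.
  have Fs : F (oX s) = p by rewrite -(toXK z ws kap0 rho0 (F (oX s))) es toXK.
  exists (oX s) => // -[|n]; last by rewrite iterSr Fs.
  by exists j => //; rewrite /= ofXK //; split=> //; lra.
have k11 : 1 < k1 by rewrite /k1; have := g0; lra.
have bp := be0.
pose c2 := kap^-1 + be / rho; pose c3 := kap + rho / be.
have c20 : 0 < c2 by rewrite addr_gt0 ?invr_gt0 ?divr_gt0.
have c30 : 0 < c3 by rewrite addr_gt0 ?divr_gt0.
have M2 u : Mx u <= c2 * nm u.
  have /andP[u1 u2] : (nm u.1 <= nm u) && (nm u.2 <= nm u) by rewrite -nm_pair_le.
  rewrite /Mx ge_max /c2 mulrDl; apply/andP; split.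
    rewrite mulrC; apply: le_trans (_ : kap^-1 * nm u <= _); first by rewrite ler_wpM2l ?invr_ge0 ?(ltW kap0).
    by rewrite lerDl mulr_ge0 ?nm_ge0 // divr_ge0 ?(ltW bp) ?(ltW rho0).
  rewrite mulrA mulrAC; apply: le_trans (_ : be / rho * nm u <= _); first by rewrite ler_wpM2l // divr_ge0 ?(ltW bp) ?(ltW rho0).
  by rewrite lerDr mulr_ge0 ?nm_ge0 // invr_ge0 ltW.
have M3 u : nm u <= c3 * Mx u.
  have m1 : nm u.1 / kap <= Mx u by rewrite le_max lexx.
  have m2 : be * (nm u.2 / rho) <= Mx u by rewrite le_max lexx orbT.
  have m0 : 0 <= Mx u by apply: le_trans m1; rewrite divr_ge0 ?nm_ge0 ?ltW.
  rewrite nm_pair_le /c3 mulrDl; apply/andP; split.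
    rewrite ler_pdivrMr // mulrC in m1; apply: le_trans m1 _; by rewrite lerDl mulr_ge0 // divr_ge0 ?(ltW bp) ?(ltW rho0).
  have : nm u.2 <= rho / be * Mx u.
    by rewrite mulrAC ler_pdivlMr //; move: m2; rewrite mulrA ler_pdivrMr // [Mx u * _]mulrC [be * _]mulrC.
  by move=> h; apply: le_trans h _; rewrite lerDr mulr_ge0 // ltW.
exists (rc (c3 * c2)), (rc k1^-1); split.
- by rewrite -rc0 rc_lt mulr_gt0.
- by rewrite -rc0 -rc1 !rc_lt invr_gt0 invf_lt1 ?k11 ?(lt_trans ltr01 k11).
move=> p Lp n v; rewrite (deriveE _ (dFn n p)) !normE -rcX -!rcM rc_le.
have := @diff_expand R _ _ (iter n F) p Mx Mx (k1 ^+ n) c2 (dFn n p) _ _ _ (ltW c20) M2 (iter_expand n Lp) v => h.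
have kn : 0 < k1 ^+ n by rewrite exprn_gt0 // (lt_trans ltr01 k11).
have MZ (t : R) u : 0 <= t -> Mx (rc t *: u) = t * Mx u.
  move=> t0; rewrite /Mx /= !nmM !nm_rc !ger0_norm //.
  by rewrite maxr_pMr //; congr Num.max; [rewrite mulrA|rewrite -mulrA mulrCA].
have Mtri u u' : Mx (u + u') <= Mx u + Mx u'.
  rewrite {1}/Mx ge_max /=; apply/andP; split.
    apply: le_trans (_ : nm u.1 / kap + nm u'.1 / kap <= _).
      by rewrite -mulrDl ler_wpM2r ?invr_ge0 ?(ltW kap0) // nmD.
    by rewrite lerD // /Mx le_max lexx.
  apply: le_trans (_ : be * (nm u.2 / rho) + be * (nm u'.2 / rho) <= _).
    by rewrite -mulrDr -mulrDl ler_wpM2l ?(ltW bp) // ler_wpM2r ?invr_ge0 ?(ltW rho0) // nmD.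
  by rewrite lerD // /Mx le_max lexx orbT.
have {h} h := h MZ MZ Mtri.
apply: le_trans (M3 v) _; rewrite -!mulrA ler_wpM2l ?(ltW c30) // exprVn mulrCA -ler_pdivrMl ?invr_gt0 // invrK.
exact: le_trans h (M2 _).
Qed.

(** Tolerances are doubled to make room for perturbations; this is why [eta] is at most [1 / 200]
    here, half of the bound in the covering lemmas. *)
Lemma geom_double : geom Lam A yc w (2 * eta) (2 * ep).
Proof.
have [h1 h2 h3 h4] := geo; have /andP[e0 _] := eta0; split=> //; first by move: h2; lra.
  by rewrite mulr_gt0.
by move=> i; have [a1 a2 a3] := h4 i; split=> //; rewrite -!mulrA ler_wpM2l.
Qed.
Let eta2 : 0 < 2 * eta <= 100^-1. Proof. by have := eta0; lra. Qed.

Let Sg_box i p : Sg i p -> box A yc 3 3 i p.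
Proof.
move=> [h1 h2]; have [w3 w1 _] : [/\ w ^+ 3 = 1, nm w = 1 & w != 1] by apply: cube3; case: geo.
split; last by apply: le_trans (ltW h2) _; rewrite ler_wpM2r ?invr_ge0 ?nm_ge0 //; lra.
have := nmBD (Lam * p.1 + w ^+ i) (w ^+ i); rewrite addrK nmX w1 expr1n (nmM Lam).
have : nm p.1 <= nm Lam * nm p.1 by rewrite ler_peMl ?nm_ge0 // ltW.
by move: h1; move: (nm Lam * _) => *; lra.
Qed.

Lemma ball_convex_lt (U : normedModType R[i]) (a b b' : U) (r t : R) : 0 <= t <= 1 ->
  nm (b - a) < r -> nm (b' - a) < r -> nm (b + rc t *: (b' - b) - a) < r.
Proof.
move=> t01 h1 h2; pose m := Num.max (nm (b - a)) (nm (b' - a)).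
have m1 : nm (b - a) <= m by rewrite le_max lexx.
have m2 : nm (b' - a) <= m by rewrite le_max lexx orbT.
by apply: le_lt_trans (ball_convex t01 m1 m2) _; rewrite gt_max h1.
Qed.

Let Sg_convex i p p' (t : R) : 0 <= t <= 1 -> Sg i p -> Sg i p' -> Sg i (p + rc t *: (p' - p)).
Proof.
move=> t01 [a1 a2] [b1 b2]; split=> /=.
  have -> : Lam * (p.1 + rc t * (p'.1 - p.1)) + w ^+ i =
    (Lam * p.1 + w ^+ i) + rc t * ((Lam * p'.1 + w ^+ i) - (Lam * p.1 + w ^+ i)) by ring.
  by have := @ball_convex_lt C 0 (Lam * p.1 + w ^+ i) (Lam * p'.1 + w ^+ i) (19 / 10) t t01; rewrite !subr0; apply.
exact: (@ball_convex_lt C).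
Qed.

Let oX_lin p p' (t : R) : oX p + rc t *: (oX p' - oX p) = oX (p + rc t *: (p' - p)).
Proof. by case: p p' => [x y] [x' y']; rewrite /ofX; congr pair; rewrite /= /GRing.scale /=; ring. Qed.

Let Zr_oX i p : Zr i (oX p) <-> Sg i p.
Proof.
rewrite /Zr /ofX /=; have -> : (z + rc kap * p.1 - z) / rc kap = p.1 by field.
by have -> : (ws + rc rho * p.2 - ws) / rc rho = p.2 by field.
Qed.

Lemma diff_sub (f g : C * C -> C * C) x v : differentiable f x -> differentiable g x ->
  'd (g \- f) x v = 'd g x v - 'd f x v.
Proof. by move=> df dg; have e := diffB dg df; exact: (congr1 (fun k : C * C -> C * C => k v) e). Qed.

(** Bounds the loss in passing from the C^1-size of a perturbation in the original coordinates to
    its size in the rescaled ones, where the two axes have different units. *)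
Definition distort : R := 1 + kap^-1 + rho^-1 + kap / rho + rho / kap.

Lemma near_perturb (S : 'I_3 -> set (C * C)) (G : C * C -> C * C) (alp : R) : (forall i, S i `<=` box A yc 3 3 i) -> 0 < alp ->
  alp * distort <= ep -> alp * distort <= eta ->
  (forall i p, S i p -> nm (G (oX p) - F (oX p)) <= alp) ->
  (forall i p p', S i p -> S i p' -> nm (G (oX p) - F (oX p) - (G (oX p') - F (oX p'))) <= alp * nm (oX p - oX p')) ->
  near S Lam A yc w (2 * eta) (2 * ep) (fun p => tX (G (oX p))).
Proof.
move=> Sb alp0 hep het hb0 hl0 i; have [hp hd] := hg i.
have /andP[e0 _] := eta0; have ep0 : 0 < ep by case: geo.
pose T := distort.
have [T1 T2 T3 T4] : [/\ kap^-1 <= T, rho^-1 <= T, 1 + kap / rho <= T & 1 + rho / kap <= T].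
  have a1 : 0 < kap^-1 by rewrite invr_gt0. have a2 : 0 < rho^-1 by rewrite invr_gt0.
  have a3 : 0 < kap / rho by rewrite divr_gt0. have a4 : 0 < rho / kap by rewrite divr_gt0.
  by rewrite /T /distort; move: (kap / rho) (rho / kap) (kap^-1) (rho^-1) a1 a2 a3 a4 => *; split; lra.
have aT t : t <= T -> alp * t <= ep /\ alp * t <= eta.
  by move=> tT; split; [apply: le_trans hep|apply: le_trans het]; rewrite ler_wpM2l // ltW.
pose h := G \- F.
have hb p : S i p -> nm (h (oX p)) <= alp by exact: hb0.
have hl p p' : S i p -> S i p' -> nm (h (oX p) - h (oX p')) <= alp * nm (oX p - oX p') by exact: hl0.
have od p p' : nm (oX p - oX p') <= kap * nm (p.1 - p'.1) + rho * nm (p.2 - p'.2).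
  rewrite nm_pair_le /ofX /= ; have -> : z + rc kap * p.1 - (z + rc kap * p'.1) = rc kap * (p.1 - p'.1) by ring.
  have -> : ws + rc rho * p.2 - (ws + rc rho * p'.2) = rc rho * (p.2 - p'.2) by ring.
  by rewrite !nmM nk nr lerDl lerDr !mulr_ge0 ?nm_ge0 ?(ltW kap0) ?(ltW rho0).
have e1 p : (tX (G (oX p))).1 = (tX (F (oX p))).1 + (h (oX p)).1 / rc kap by rewrite /toX /h /=; field.
have e2 p : (tX (G (oX p))).2 = (tX (F (oX p))).2 + (h (oX p)).2 / rc rho by rewrite /toX /h /=; field.
have fs (u : C * C) : (nm u.1 <= nm u) /\ (nm u.2 <= nm u) by apply/andP; rewrite -nm_pair_le.
split=> [p Sp|p p' Sp Sp'].
  have [b1 b2] := hp p (Sb i _ Sp); have [f1 f2] := fs (h (oX p)); have hbp := hb _ Sp.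
  have [_ a1] := aT _ T1; have [_ a2] := aT _ T2.
  have q1 : nm ((h (oX p)).1 / rc kap) <= eta.
    by rewrite nm_div nk (le_trans _ a1) // ler_wpM2r ?invr_ge0 ?(ltW kap0) // (le_trans f1).
  have q2 : nm ((h (oX p)).2 / rc rho) <= eta.
    by rewrite nm_div nr (le_trans _ a2) // ler_wpM2r ?invr_ge0 ?(ltW rho0) // (le_trans f2).
  rewrite e1 e2; split.
    have := nmD ((tX (F (oX p))).1 - Lam * p.1 - w ^+ i) ((h (oX p)).1 / rc kap).
    have -> : (tX (F (oX p))).1 - Lam * p.1 - w ^+ i + (h (oX p)).1 / rc kap =
      (tX (F (oX p))).1 + (h (oX p)).1 / rc kap - Lam * p.1 - w ^+ i by ring.
    by move: b1 q1; lra.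
  have := nmD ((tX (F (oX p))).2 - A i * (p.2 - yc i)) ((h (oX p)).2 / rc rho); rewrite addrAC.
  by move: b2 q2; lra.
have [b1 b2] := hd p p' (Sb i _ Sp) (Sb i _ Sp'); have [f1 f2] := fs (h (oX p) - h (oX p')).
have hlp := le_trans (hl _ _ Sp Sp') (ler_wpM2l (ltW alp0) (od p p')).
have [a1 a1'] := aT _ T3; have [a2 a2'] := aT _ T4.
set X := nm (p.1 - p'.1) in b1 b2 hlp *; set Y := nm (p.2 - p'.2) in b1 b2 hlp *.
have [X0 Y0] : 0 <= X /\ 0 <= Y by split; exact: nm_ge0.
have AY : eta * Y <= eta * nm (A i) * Y.
  by rewrite ler_wpM2r // ler_peMr ?(ltW e0) // (le_trans _ (A20 i)) // ler1n.
have r1 : alp * (kap * X + rho * Y) / kap = alp * X + alp * (rho / kap) * Y by field; rewrite gt_eqF.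
have r2 : alp * (kap * X + rho * Y) / rho = alp * (kap / rho) * X + alp * Y by field; rewrite gt_eqF.
have mono t c : 0 <= t -> alp * (1 + t) <= c -> alp <= c /\ alp * t <= c.
  by move=> t0; rewrite mulrDr mulr1 => hc; have := mulr_ge0 (ltW alp0) t0; move: hc; move: (alp * t) => *; split; lra.
have [m1 m2] := mono _ _ (divr_ge0 (ltW kap0) (ltW rho0)) a1; have [m3 m4] := mono _ _ (divr_ge0 (ltW rho0) (ltW kap0)) a2'.
have [m5 _] := mono _ _ (divr_ge0 (ltW rho0) (ltW kap0)) a2; have [m6 _] := mono _ _ (divr_ge0 (ltW kap0) (ltW rho0)) a1'.
have q1 : nm (((h (oX p)).1 - (h (oX p')).1) / rc kap) <= ep * X + eta * nm (A i) * Y.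
  rewrite nm_div nk; apply: le_trans (_ : alp * (kap * X + rho * Y) / kap <= _).
    by rewrite ler_wpM2r ?invr_ge0 ?(ltW kap0) // (le_trans f1).
  rewrite r1; have := ler_wpM2r X0 m5; have := ler_wpM2r Y0 m4; move: AY.
  by move: (alp * X) (alp * _ * Y) (ep * X) (eta * Y) (eta * _ * Y) => *; lra.
have q2 : nm (((h (oX p)).2 - (h (oX p')).2) / rc rho) <= ep * X + eta * nm (A i) * Y.
  rewrite nm_div nr; apply: le_trans (_ : alp * (kap * X + rho * Y) / rho <= _).
    by rewrite ler_wpM2r ?invr_ge0 ?(ltW rho0) // (le_trans f2).
  rewrite r2; have := ler_wpM2r X0 m2; have := ler_wpM2r Y0 m6; move: AY.
  by move: (alp * _ * X) (alp * Y) (ep * X) (eta * Y) (eta * _ * Y) => *; lra.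
have -> : 2 * ep * X + 2 * eta * nm (A i) * Y = (ep * X + eta * nm (A i) * Y) + (ep * X + eta * nm (A i) * Y) by ring.
rewrite !e1 !e2; split.
  have -> : (tX (F (oX p))).1 + (h (oX p)).1 / rc kap - ((tX (F (oX p'))).1 + (h (oX p')).1 / rc kap) - Lam * (p.1 - p'.1) =
    ((tX (F (oX p))).1 - (tX (F (oX p'))).1 - Lam * (p.1 - p'.1)) + ((h (oX p)).1 - (h (oX p')).1) / rc kap by field.
  exact: le_trans (nmD _ _) (lerD b1 q1).
have -> : (tX (F (oX p))).2 + (h (oX p)).2 / rc rho - ((tX (F (oX p'))).2 + (h (oX p')).2 / rc rho) - A i * (p.2 - p'.2) =
  ((tX (F (oX p))).2 - (tX (F (oX p'))).2 - A i * (p.2 - p'.2)) + ((h (oX p)).2 - (h (oX p')).2) / rc rho by field.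
exact: le_trans (nmD _ _) (lerD b2 q2).
Qed.

Lemma near_C1close (G : C * C -> C * C) (alp : R) : let Z := \bigcup_(i in setT) Zr i in
  holo_on Z G -> C1close Z G F (rc alp) -> 0 < alp ->
  alp * distort <= ep -> alp * distort <= eta ->
  near Sg Lam A yc w (2 * eta) (2 * ep) (fun p => tX (G (oX p))).
Proof.
move=> Z hG hC alp0 hep het.
have ZS i p : Sg i p -> Z (oX p) by move=> h; exists i => //; apply/Zr_oX.
apply: (near_perturb _ alp0) => // [i p Sp|i p p' Sp Sp'].
  by have [] := hC _ (ZS _ _ Sp); rewrite nm_le.
apply: (@mvt_diff _ _ _ (G \- F)) => t t01; rewrite oX_lin.
have Zt := ZS _ _ (Sg_convex t01 Sp' Sp); have dG := hG _ Zt; have dFt := dF (oX (p' + rc t *: (p - p'))).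
split; first exact: differentiableB.
have [_ /(_ (oX p - oX p'))] := hC _ Zt; rewrite !deriveE // [`|oX p - oX p'|]normE -rcM nm_le => h1.
apply: le_trans h1; rewrite le_eqVlt; apply/orP; left; apply/eqP.
by congr nm; exact: diff_sub.
Qed.


Lemma open_disc_aff (a b : C) (r : R) : open [set x : C | nm (a * x + b) < r].
Proof.
apply: open_nmP => x /= hx; have a1 : 0 < nm a + 1 by rewrite ltr_wpDl ?nm_ge0.
exists ((r - nm (a * x + b)) / (nm a + 1)) => [|y]; first by rewrite divr_gt0 // subr_gt0.
rewrite ltr_pdivlMr // => hy; have -> : a * y + b = a * (y - x) + (a * x + b) by ring.
apply: le_lt_trans (nmD _ _) _; rewrite (nmM a (_ - _)).
have : nm a * nm (y - x) <= nm (y - x) * (nm a + 1) by rewrite mulrC ler_wpM2l ?nm_ge0 // lerDl.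
by move: hy; move: (nm a * _) (_ * (_ + 1)) => *; lra.
Qed.

Lemma rep_blender_near : exists L, rep_blender setT F L.
Proof.
pose Z := \bigcup_(i in setT) Zr i; exists (LamC2 setT F Z).
pose H (i : 'I_3) := [set x : C | nm (Lam * ((x - z) / rc kap) + w ^+ i) < 19 / 10].
pose V i := [set y : C | nm ((y - ws) / rc rho - yc i) < 2 / nm (A i)].
pose T := 1 + kap^-1 + rho^-1 + kap / rho + rho / kap.
have T0 : 0 < T by rewrite /T !addr_gt0 ?invr_gt0 ?divr_gt0.
have /andP[e0 e1] := eta0; have ep0 : 0 < ep by case: geo.
pose alp := Num.min ep eta / T; have alp0 : 0 < alp by rewrite divr_gt0 // lt_min ep0.
(* In rescaled coordinates a slope of at most [del] becomes one of at most [1 / 5], hence at most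
   [nm (A i) / 100], as [graph_orbit] requires. *)
pose del := kap / (5 * rho); have del0 : 0 < del by rewrite divr_gt0 // mulr_gt0.
have L0 : Lam != 0 by rewrite -nm_gt0 (lt_trans ltr01).
(* From [nm (Lam * x + w ^+ i) < 19 / 10] and [nm Lam > 1] follows [nm x < 29 / 10 < 59 / 20]. *)
have ZK : closure Z `<=` KB.
  have cK : closed KB by apply: compact_closed KB_compact; exact: norm_hausdorff.
  rewrite [X in _ `<=` X]((closure_id _).1 cK); apply: closureS => p [i _ Zp]; exists i => //.
  have Sp : Sg i (tX p) := Zp; have [b1 b2] := Sg_box Sp; case: Sp => h1 h2.
  split; last exact: ltW.
  have [w3 w1 _] : [/\ w ^+ 3 = 1, nm w = 1 & w != 1] by apply: cube3; case: geo.
  have := nmBD (Lam * (tX p).1 + w ^+ i) (w ^+ i); rewrite addrK nmX w1 expr1n (nmM Lam).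
  have : nm (tX p).1 <= nm Lam * nm (tX p).1 by rewrite ler_peMl ?nm_ge0 // ltW.
  by move: h1; move: (nm Lam * _) => *; lra.
exists H, V, (rc del), (rc alp); split=> //.
- by rewrite -rc0 !rc_lt.
- move=> i; split.
  + have -> : H i = [set x | nm (Lam / rc kap * x + (w ^+ i - Lam / rc kap * z)) < 19 / 10].
      by apply/seteqP; split=> x /=; rewrite /H /=; (have -> : Lam * ((x - z) / rc kap) + w ^+ i = Lam / rc kap * x + (w ^+ i - Lam / rc kap * z) by field).
    exact: open_disc_aff.
  + have -> : V i = [set y | nm ((rc rho)^-1 * y + (- ws / rc rho - yc i)) < 2 / nm (A i)].
      by apply/seteqP; split=> y /=; rewrite /V /=; (have -> : (y - ws) / rc rho - yc i = (rc rho)^-1 * y + (- ws / rc rho - yc i) by field).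
    exact: open_disc_aff.
  + exists (z - rc kap * w ^+ i / Lam); rewrite /H /=.
    have -> : Lam * ((z - rc kap * w ^+ i / Lam - z) / rc kap) + w ^+ i = 0 by field; rewrite L0 rk.
    by rewrite nm0; lra.
  + exists (ws + rc rho * yc i); rewrite /V /=.
    have -> : (ws + rc rho * yc i - ws) / rc rho - yc i = 0 by field.
    by rewrite nm0 divr_gt0.
split; first by exists Lr; split; [exact: rep_hyp_Lr|move=> p h n; apply: ZK; have [] := h n].
move=> G hG hC i sig hs sH [d' [d'1 d'2]].
have nG : near Sg Lam A yc w (2 * eta) (2 * ep) (fun p => tX (G (oX p))).
  by apply: (@near_C1close G alp) => //; rewrite -/T /alp divfK ?gt_eqF // ge_min lexx ?orbT.
pose sg y := (sig (ws + rc rho * y) - z) / rc kap.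
have Vy y : nm (y - yc i) < 2 / nm (A i) -> V i (ws + rc rho * y).
  by rewrite /V /=; have -> : (ws + rc rho * y - ws) / rc rho = y by field.
have [||y yV orb] := @graph_orbit R Lam A yc w (2 * eta) (2 * ep) geom_double eta2 _ i sg nG.
- by move=> y hy; split=> //=; rewrite /sg; exact: sH (Vy y hy).
- move=> y y' hy hy'; have := @mvt_diff R _ _ sig (ws + rc rho * y') (ws + rc rho * y) (del * nm (rc rho * (y - y'))).
  have ed : ws + rc rho * y - (ws + rc rho * y') = rc rho * (y - y') by ring.
  rewrite ed => h.
  have : nm (sig (ws + rc rho * y) - sig (ws + rc rho * y')) <= del * nm (rc rho * (y - y')).
    apply: h => t t01; have -> : ws + rc rho * y' + rc t *: (rc rho * (y - y')) = ws + rc rho * (y' + rc t * (y - y')).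
      by rewrite /GRing.scale /=; ring.
    have Vt : V i (ws + rc rho * (y' + rc t * (y - y'))).
      by apply: Vy; exact: (@ball_convex_lt C).
    have dt := hs _ Vt; split=> //; set x := ws + _ in Vt dt *; set v := rc rho * (y - y').
    have -> : 'd sig x v = v *: 'd sig x 1 by rewrite -linearZ; congr ('d sig x _); rewrite /GRing.scale /= mulr1.
    rewrite nmZ mulrC ler_wpM2r ?nm_ge0 //; have := d'2 _ Vt; rewrite derive1E' // => h1.
    by have := le_lt_trans h1 d'1; rewrite nm_lt => /ltW.
  have -> : sg y - sg y' = (sig (ws + rc rho * y) - sig (ws + rc rho * y')) / rc kap by rewrite /sg; field.
  rewrite nm_div nk nmM nr ler_pdivrMr // => h2; apply: le_trans h2 _.
  have -> : del * (rho * nm (y - y')) = 5^-1 * kap * nm (y - y') by rewrite /del; field; rewrite gt_eqF.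
  have -> : 100^-1 * nm (A i) * nm (y - y') * kap = 100^-1 * nm (A i) * kap * nm (y - y') by ring.
  by rewrite ler_wpM2r ?nm_ge0 // ler_wpM2r ?(ltW kap0) //; have := A20 i; lra.
exists (ws + rc rho * y); split; first exact: Vy.
have conj j : iter j G (sig (ws + rc rho * y), ws + rc rho * y) = oX (iter j (fun p => tX (G (oX p))) (sg y, y)).
  elim: j => [|j ih]; last by rewrite !iterS ih toXK.
  by rewrite /ofX /sg /=; congr pair; field.
have Zj j : Z (iter j G (sig (ws + rc rho * y), ws + rc rho * y)).
  by rewrite conj; have [k hk] := orb j; exists k => //; apply/Zr_oX.
by move=> n; split=> [j _|]; [exact: Zj|apply: subset_closure; exact: Zj].
Qed.
End RepBlender.

(** * Invariant slopes by Moebius contractions *)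

Section MoebiusSlope.
Variables (R : realType) (X : Type) (K : set X) (F : X -> set_system X) (sh : X -> X).
Local Notation C := (Cplx R).
Variables (al be ga de : X -> C) (th : R).
Hypothesis FF : forall x, Filter (F x).
Hypothesis FK : forall x, K x -> F x K.
Hypothesis shK : forall x, K x -> K (sh x).
Hypothesis shF : forall x, K x -> sh @ F x --> F (sh x).
(** [F x] stands for the neighbourhoods of [x]: continuity is taken with respect to a family of
    filters, later that of the natural extension. *)
Definition cts (phi : X -> C) := forall x, K x -> phi @ F x --> phi x.
Hypothesis ctal : cts al.
Hypothesis ctbe : cts be.
Hypothesis ctga : cts ga.
Hypothesis ctde : cts de.
Hypothesis th0 : 0 <= th.
Hypothesis dpos : forall x, K x -> 0 < nm (de x) - nm (ga x) * th.
Hypothesis hself : forall x, K x -> nm (al x) * th + nm (be x) <= th * (nm (de x) - nm (ga x) * th).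
Hypothesis hctr : forall x, K x -> 2 * nm (al x * de x - be x * ga x) <= (nm (de x) - nm (ga x) * th) ^+ 2.

Definition moebius x s := (al x * s + be x) / (ga x * s + de x).

Let den x s : K x -> nm s <= th -> nm (de x) - nm (ga x) * th <= nm (ga x * s + de x).
Proof.
move=> Kx hs; have := nm_loD (de x) (ga x * s); rewrite [de x + _]addrC nmM.
by have := ler_wpM2l (nm_ge0 (ga x)) hs; move: (nm (ga x) * nm s) => *; lra.
Qed.
Let den0 x s : K x -> nm s <= th -> ga x * s + de x != 0.
Proof. by move=> Kx hs; rewrite -nm_gt0; apply: lt_le_trans (dpos Kx) (den Kx hs). Qed.

Let mb_self x s : K x -> nm s <= th -> nm (moebius x s) <= th.
Proof.
move=> Kx hs; rewrite /moebius nm_div ler_pdivrMr ?nm_gt0 ?den0 //.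
apply: le_trans (_ : th * (nm (de x) - nm (ga x) * th) <= _); last by rewrite ler_wpM2l // den.
apply: le_trans (hself Kx); apply: le_trans (nmD _ _) _; rewrite nmM lerD2r.
by rewrite ler_wpM2l ?nm_ge0.
Qed.

Let mb_ctr x s s' : K x -> nm s <= th -> nm s' <= th -> nm (moebius x s - moebius x s') <= 2^-1 * nm (s - s').
Proof.
move=> Kx hs hs'; have d1 := den0 Kx hs; have d2 := den0 Kx hs'.
have -> : moebius x s - moebius x s' = (al x * de x - be x * ga x) * (s - s') / ((ga x * s + de x) * (ga x * s' + de x)).
  by rewrite /moebius; field; rewrite d1 d2.
rewrite nm_div nmM ler_pdivrMr; last by rewrite nmM mulr_gt0 ?nm_gt0.
rewrite mulrAC ler_wpM2r ?nm_ge0 // -ler_pdivrMl ?invr_gt0 // invrK.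
apply: le_trans (hctr Kx) _; rewrite nmM expr2; have := dpos Kx => dp.
by apply: ler_pM; rewrite ?(ltW dp) ?den.
Qed.

Fixpoint slope_approx n x : C := if n is n'.+1 then moebius x (slope_approx n' (sh x)) else 0.

Let ap_th n x : K x -> nm (slope_approx n x) <= th.
Proof. by elim: n x => [|n ih] x Kx /=; [rewrite nm0|exact: mb_self (ih _ (shK Kx))]. Qed.

Let ap_step n x : K x -> nm (slope_approx n.+1 x - slope_approx n x) <= 2^-1 ^+ n * th.
Proof.
elim: n x => [|n ih] x Kx; first by rewrite mul1r subr0 ap_th.
have h := mb_ctr Kx (ap_th n.+1 (shK Kx)) (ap_th n (shK Kx)); apply: le_trans h _.
by rewrite exprS -mulrA ler_wpM2l ?invr_ge0 //; exact: ih (shK Kx).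
Qed.

Let ap_cauchy n m x : K x -> nm (slope_approx (m + n) x - slope_approx m x) <= 2 * 2^-1 ^+ m * th.
Proof.
move=> Kx; suff : nm (slope_approx (m + n) x - slope_approx m x) <= 2 * (2^-1 ^+ m - 2^-1 ^+ (m + n)) * th.
  move=> /le_trans; apply; rewrite ler_wpM2r // ler_wpM2l // gerBl exprn_ge0 // invr_ge0.
elim: n => [|n ih]; first by rewrite addn0 !subrr nm0 mulr0 mul0r.
have := nm_tri (slope_approx (m + n) x) (slope_approx (m + n.+1) x) (slope_approx m x).
rewrite addnS; have := ap_step (m + n) Kx; move: ih; rewrite exprS.
have -> : 2 * (2^-1 ^+ m - 2^-1 * 2^-1 ^+ (m + n)) * th =
  2 * (2^-1 ^+ m - 2^-1 ^+ (m + n)) * th + 2^-1 ^+ (m + n) * th by field.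
by move: (2 * (2^-1 ^+ m - 2^-1 ^+ (m + n)) * th) (2^-1 ^+ (m + n) * th) => *; lra.
Qed.

Let lim_ex x : K x -> exists l : C, forall m, nm (slope_approx m x - l) <= 2 * 2^-1 ^+ m * th.
Proof.
move=> Kx; have [l _ hl] := compact_cluster (@compact_disc R th) (fun n => ap_th n Kx).
exists l => m; apply/ler_addgt0Pl => e e0; have [n mn hn] := hl e m e0.
have := nm_tri (slope_approx n x) (slope_approx m x) l.
by have := ap_cauchy (n - m) m Kx; rewrite subnKC // [nm (_ - slope_approx m x)]nmB; move: hn; move: (2 * _ * th) => *; lra.
Qed.

(** The graph transform: [S x] is the image, by the Moebius map at [x], of the slope at [sh x].
    These maps preserve the disc of radius [th] and halve distances, so the approximations started
    from slope 0 converge uniformly and the limit is continuous. The shift goes forwards for stable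
    slopes and backwards for unstable ones. *)
Lemma moebius_slope : exists S : X -> C,
  (forall x, K x -> nm (S x) <= th /\ S x * (ga x * S (sh x) + de x) = al x * S (sh x) + be x) /\ cts S.
Proof.
have [S hS] : exists S : X -> C, forall x, K x -> forall m, nm (slope_approx m x - S x) <= 2 * 2^-1 ^+ m * th.
  have ex x : exists l : C, K x -> forall m, nm (slope_approx m x - l) <= 2 * 2^-1 ^+ m * th.
    by case: (pselect (K x)) => [/lim_ex[l hl]|nK]; [exists l|exists 0].
  by have [S hS] := choice ex; exists S.
have small (e : R) : 0 < e -> exists m, 2 * 2^-1 ^+ m * th < e.
  move=> e0; have th1 : 0 < 2 * (th + 1) by have := th0; lra.
  have [|m hm] := @pow_small R 2^-1 _ _ (divr_gt0 e0 th1); first by lra.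
  exists m; have := hm m (leqnn m); rewrite ltr_pdivlMr //; have : 0 < (2^-1 : R) ^+ m by rewrite exprn_gt0.
  have -> : 2^-1 ^+ m * (2 * (th + 1)) = 2 * 2^-1 ^+ m * th + 2 * 2^-1 ^+ m by ring.
  by move: (2 * _ * th) => *; lra.
have Sth x : K x -> nm (S x) <= th.
  move=> Kx; apply/ler_addgt0Pl => e e0; have [m hm] := small e e0.
  by have := nm_lo (S x) (slope_approx m x); rewrite nmB; have := hS x Kx m; have := ap_th m Kx; move: hm; move: (2 * _ * th) => *; lra.
have apc n : cts (slope_approx n).
  elim: n => [|n ih] x Kx /=; first exact: cvg_cst.
  have c1 : slope_approx n (sh y) @[y --> F x] --> slope_approx n (sh x).
    by apply: (cvg_comp sh (slope_approx n) (shF Kx)); exact: ih (shK Kx).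
  apply: cvgM; first by apply: cvgD; [apply: cvgM; [exact: ctal|exact: c1]|exact: ctbe].
  apply: cvgV; first by apply: den0 => //; apply: ap_th; exact: shK.
  by apply: cvgD; [apply: cvgM; [exact: ctga|exact: c1]|exact: ctde].
exists S; split=> [x Kx|x Kx]; last first.
  apply/cvgrPdist_lt => e /pos_rc[e' e'0 ->]; have [m hm] := small (e' / 3) (ltac:(lra)).
  have e3 : 0 < rc (e' / 3) by rewrite -rc0 rc_lt; lra.
  have /cvgrPdist_lt /(_ _ e3) h := apc m x Kx.
  near=> y; have Ky : K y by near: y; exact: FK.
  have h1 : nm (slope_approx m x - slope_approx m y) < e' / 3 by rewrite -nm_lt; near: y; exact: h.
  rewrite nm_lt; have h2 := hS x Kx m; have h3 := hS y Ky m; rewrite nmB in h2.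
  have := nm_tri (slope_approx m x) (S x) (S y); have := nm_tri (slope_approx m y) (slope_approx m x) (S y).
  by move: hm h1 h2 h3; move: (2 * _ * th) => *; lra.
split; first exact: Sth.
suff -> : S x = moebius x (S (sh x)) by rewrite /moebius divfK // den0 //; apply: Sth; exact: shK.
apply: subr0_eq; apply: nm_small0 => e e0; have [m hm] := small (e / 2) (ltac:(lra)).
have h1 := hS x Kx m.+1; have h2 := mb_ctr Kx (ap_th m (shK Kx)) (Sth _ (shK Kx)); have h3 := hS (sh x) (shK Kx) m.
have := nm_tri (slope_approx m.+1 x) (S x) (moebius x (S (sh x))); rewrite [nm (S x - slope_approx _ _)]nmB.
have h4 : 2 * 2^-1 ^+ m.+1 * th <= 2 * 2^-1 ^+ m * th.
  rewrite ler_wpM2r // ler_wpM2l // exprS ler_piMl ?exprn_ge0 ?invr_ge0 //; lra.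
by move: h1 h2 h3 h4 hm; rewrite [slope_approx m.+1 x]/=; move: (2 * 2^-1 ^+ m.+1 * th) (2 * 2^-1 ^+ m * th) => *; lra.
Unshelve. all: by end_near.
Qed.
End MoebiusSlope.

(** * Lifts in homogeneous coordinates *)

Section RowThree.
Variable R : realType.
Local Notation C := (Cplx R).

Lemma cc_r0 (a b c : C) : cc (row3 a b c) 0 = a. Proof. by rewrite /cc mxE inordK. Qed.
Lemma cc_r1 (a b c : C) : cc (row3 a b c) 1 = b. Proof. by rewrite /cc mxE inordK. Qed.
Lemma cc_r2 (a b c : C) : cc (row3 a b c) 2 = c. Proof. by rewrite /cc mxE inordK. Qed.
Definition ccE := (cc_r0, cc_r1, cc_r2).
Lemma cc0 k : cc (0 : 'rV[C]_3) k = 0. Proof. by rewrite /cc mxE. Qed.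
Lemma cc_lin (c : C) (x v : 'rV[C]_3) k : cc (c *: x + v) k = c * cc x k + cc v k. Proof. by rewrite /cc !mxE. Qed.
Lemma ccZ (c : C) (x : 'rV[C]_3) k : cc (c *: x) k = c * cc x k. Proof. by rewrite /cc !mxE. Qed.
Lemma ccB (x v : 'rV[C]_3) k : cc (x - v) k = cc x k - cc v k. Proof. by rewrite /cc !mxE. Qed.
Lemma nm_cc (x : 'rV[C]_3) k : nm (cc x k) <= nm x. Proof. exact: nm_entry. Qed.

Lemma ord3P (P : 'I_3 -> Prop) : P (inord 0) -> P (inord 1) -> P (inord 2) -> forall i, P i.
Proof. by move=> h0 h1 h2 i; rewrite -(inord_val i); case: i => [[|[|[|i]]] /=]. Qed.

Lemma row_cc (x v : 'rV[C]_3) : cc x 0 = cc v 0 -> cc x 1 = cc v 1 -> cc x 2 = cc v 2 -> x = v.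
Proof. by move=> h0 h1 h2; apply/rowP; apply: ord3P. Qed.

Lemma nm_row3_le (x : 'rV[C]_3) (e : R) : nm (cc x 0) <= e -> nm (cc x 1) <= e -> nm (cc x 2) <= e -> nm x <= e.
Proof. by move=> h0 h1 h2; apply: nm_row_le; apply: ord3P. Qed.

Lemma diff_of_quad (V : normedModType R[i]) n (f : V -> 'rV[C]_n.+1) (S : set V) l (B : 'I_n.+1 -> R) (x : V) (r : R) :
  0 < r -> (forall y, nm (y - x) < r -> S y) -> (forall i, quad S (fun y => f y ord0 i) (l i) (B i)) ->
  differentiable f x /\ forall v, 'd f x v = \row_i l i x v.
Proof.
move=> r0 Sr hB; pose M := \sum_i B i.
have B0 i : 0 <= B i by have [] := hB i.
have BM i : B i <= M by rewrite /M (bigD1 i) //= lerDl sumr_ge0.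
have M0 : 0 <= M by rewrite sumr_ge0.
have Sx : S x by apply: Sr; rewrite subrr nm0.
apply: (@diff_intro R V _ f (fun v => \row_i l i x v) x M) => [c u v|v|e e0].
- by apply/rowP => i; rewrite !mxE; have [_ _ _ h _] := hB i; exact: h.
- apply: nm_row_le => i; rewrite mxE; have [_ _ h _ _] := hB i.
  by apply: le_trans (h _ Sx v) _; rewrite ler_wpM2r ?nm_ge0.
- have M1 : 0 < M + 1 by rewrite ltr_wpDl.
  exists (Num.min r (e / (M + 1))) => [|y]; first by rewrite lt_min r0 divr_gt0.
  rewrite lt_min => /andP[yr ye]; apply: nm_row_le => i; rewrite !mxE.
  have [_ _ _ _ h] := hB i; have [_ {}h] := h _ _ Sx (Sr _ yr); apply: le_trans h _.
  rewrite expr2 mulrA ler_wpM2r ?nm_ge0 //; move: ye; rewrite ltr_pdivlMr // => /ltW; apply: le_trans.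
  by rewrite mulrC ler_wpM2l ?nm_ge0 // (le_trans (BM i)) // lerDl.
Qed.

Lemma diff_rel (V W : normedModType R[i]) (f : V -> W) (x : V) (ph : W -> C) (l : V -> C) (N : V -> R) : differentiable f x ->
  (forall c u v, ph (c *: u + v) = c * ph u + ph v) -> (forall u, nm (ph u) <= nm u) ->
  (forall c v, l (c *: v) = c * l v) -> (forall (t : R) v, 0 <= t -> N (rc t *: v) = t * N v) ->
  (exists2 del : R, 0 < del & forall y, nm (y - x) < del -> nm (ph (f y) - ph (f x) - l (y - x)) <= N (y - x)) ->
  forall v, nm (ph ('d f x v) - l v) <= N v.
Proof.
move=> df phl phn lZ NZ [del del0 h] v; apply/ler_addgt0Pl => e e0.
have n1 : 0 < nm v + 1 by rewrite ltr_wpDl ?nm_ge0.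
have [d1 d10 h1] := diff_local df (divr_gt0 e0 n1).
pose t := Num.min del d1 / (nm v + 1).
have t0 : 0 < t by rewrite divr_gt0 ?lt_min ?del0.
have ey : x + rc t *: v - x = rc t *: v by rewrite addrC addKr.
have : nm (x + rc t *: v - x) < Num.min del d1.
  rewrite ey nmZr ?(ltW t0) // /t mulrAC ltr_pdivrMr // ltr_pM2l ?lt_min ?del0 //; lra.
rewrite lt_min => /andP[/h r1 /h1 r2]; rewrite ey linearZ nmZr ?(ltW t0) //= in r1 r2.
rewrite NZ ?(ltW t0) // lZ in r1.
have e1 : rc t * (ph ('d f x v) - l v) = (ph (f (x + rc t *: v)) - ph (f x) - rc t * l v)
    - ph (f (x + rc t *: v) - f x - rc t *: 'd f x v).
  have phB u u' : ph (u - u') = ph u - ph u' by rewrite -scaleN1r addrC phl mulN1r addrC.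
  have ph0 : ph 0 = 0 by have := phB 0 0; rewrite !subrr.
  have phZ c u : ph (c *: u) = c * ph u by have := phl c u 0; rewrite ph0 !addr0.
  by rewrite !phB phZ; ring.
have := nmBD (ph (f (x + rc t *: v)) - ph (f x) - rc t * l v) (ph (f (x + rc t *: v) - f x - rc t *: 'd f x v)).
rewrite -e1 nmM nm_rc gtr0_norm // => r3.
have r4 : e / (nm v + 1) * (t * nm v) <= t * e.
  have -> : e / (nm v + 1) * (t * nm v) = t * e * (nm v / (nm v + 1)) by field; rewrite gt_eqF.
  by apply: ler_piMr; [rewrite mulr_ge0 ?(ltW t0) ?(ltW e0)|rewrite ler_pdivrMr // mul1r lerDl].
rewrite -(ler_pM2l t0) mulrDr.
have := phn (f (x + rc t *: v) - f x - rc t *: 'd f x v).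
by move: r1 r2 r3 r4; move: (t * nm _) (e / _ * _) (t * e) (t * N v) => *; lra.
Qed.

Lemma diff_near (V W : normedModType R[i]) (f g : V -> W) (x : V) (r : R) : differentiable f x -> differentiable g x -> 0 < r ->
  (forall y, nm (y - x) < r -> f y = g y) -> forall v, 'd f x v = 'd g x v.
Proof.
move=> df dg r0 h v; have fg : \near x, f x = g x by apply/nbhs_nmP; exists r.
have e1 := deriveE v df; have e2 := deriveE v dg.
have e3 := @near_eq_derive _ V W f g x v fg.
by etransitivity; [exact: esym e1|exact: etrans e3 e2].
Qed.
End RowThree.

Section Homogeneous.
Variables (R : realType) (D : nat) (G : coefs R D).
Local Notation C := (Cplx R).

Lemma hev_cc x k : (k < 3)%N -> cc (hev G x) k = \sum_(m : mon D)
  G (inord k) m * cc x 0 ^+ expx m * cc x 1 ^+ expy m * cc x 2 ^+ (D - expx m - expy m).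
Proof. by move=> k3; rewrite /cc mxE. Qed.

Lemma mon_le (m : mon D) : (expx m + expy m <= D)%N. Proof. exact: (svalP m). Qed.

Lemma hevZ (c : C) x : hev G (c *: x) = c ^+ D *: hev G x.
Proof.
apply/rowP => i; rewrite !mxE mulr_sumr; apply: eq_bigr => m _; rewrite !ccZ !exprMn.
have -> : c ^+ D = c ^+ expx m * c ^+ expy m * c ^+ (D - expx m - expy m).
  by rewrite -!exprD; congr (_ ^+ _); have := mon_le m; lia.
by ring.
Qed.

Lemma qd_hev x i : qd [set y : 'rV[C]_3 | nm (y - x) < 1] (fun y => hev G y ord0 i).
Proof.
set S := [set y | _].
have qc k : qd S (fun y => cc y k).
  apply: (@qd_lin _ _ _ _ 1 (nm x + 1)) => // [c h h'|h|y].
  - exact: cc_lin.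
  - by rewrite mul1r nm_cc.
  - by rewrite /S /= => h; have := nm_lo y x; lra.
have h : qd S (fun y => \sum_(m : mon D) G i m * cc y 0 ^+ expx m * cc y 1 ^+ expy m * cc y 2 ^+ (D - expx m - expy m)).
  by apply: qd_sum => m; do !apply: qd_mul; try exact: qd_exp; exact: qd_cst.
by apply: qd_ext h => y; rewrite mxE.
Qed.

Lemma quad_hev x : exists l, (forall i, exists B, quad [set y : 'rV[C]_3 | nm (y - x) < 1] (fun y => hev G y ord0 i) (l i) B) /\
  forall y, nm (y - x) < 1 -> differentiable (hev G) y /\ forall v, 'd (hev G) y v = \row_i l i y v.
Proof.
have [l hl] := choice (qd_hev x); have [B hB] := choice hl; exists l; split=> // y hy.
apply: (diff_of_quad (r := 1 - nm (y - x)) _ _ hB) => [|y' hy']; first by rewrite subr_gt0.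
by rewrite /=; have := nm_tri y y' x; move: hy'; lra.
Qed.

Lemma diff_hev x : differentiable (hev G) x.
Proof. by have [l [_ /(_ x)[|]]] := quad_hev x; rewrite ?subrr ?nm0. Qed.

Lemma diff_iter_hev n x : differentiable (iter n (hev G)) x.
Proof. by apply: diff_iter; exact: diff_hev. Qed.
End Homogeneous.

(** * The rescaled affine chart *)

Section Chart.
Variables (R : realType) (z ws : Cplx R) (kap rho : R).
Local Notation C := (Cplx R).
Hypothesis kap0 : 0 < kap.
Hypothesis rho0 : 0 < rho.
Local Notation oX := (ofX z ws kap rho).
Local Notation tX := (toX z ws kap rho).
Implicit Types x v : 'rV[C]_3.

Let rk := rc_neq0 kap0.
Let rr := rc_neq0 rho0.
Let nk := nm_rcp kap0.
Let nr := nm_rcp rho0.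

Definition kx x : C * C := tX (cc x 0 / cc x 2, cc x 1 / cc x 2).
Definition io (p : C * C) : 'rV[C]_3 := row3 (oX p).1 (oX p).2 1.
(** The derivative of the chart [kx] at [x] in the direction [v]. It vanishes on multiples of [x],
    hence is a function on the tangent space of the projective plane. *)
Definition tv x v : C * C :=
  ((cc v 0 * cc x 2 - cc x 0 * cc v 2) / cc x 2 ^+ 2 / rc kap, (cc v 1 * cc x 2 - cc x 1 * cc v 2) / cc x 2 ^+ 2 / rc rho).

Lemma kxZ (c : C) x : c != 0 -> kx (c *: x) = kx x.
Proof. by move=> c0; rewrite /kx !ccZ !invfM; congr tX; congr pair; rewrite mulrACA divff // mul1r. Qed.

Lemma cc_io p : [/\ cc (io p) 0 = (oX p).1, cc (io p) 1 = (oX p).2 & cc (io p) 2 = 1].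
Proof. by rewrite /io !ccE. Qed.

Lemma kx_io p : kx (io p) = p.
Proof. by rewrite /kx; have [-> -> ->] := cc_io p; rewrite !divr1 -surjective_pairing ofXK. Qed.

Lemma oX_kx x : oX (kx x) = (cc x 0 / cc x 2, cc x 1 / cc x 2).
Proof. by rewrite /kx toXK. Qed.

Lemma io_kx x : cc x 2 != 0 -> x = cc x 2 *: io (kx x).
Proof.
move=> x2; have [e0 e1 e2] := cc_io (kx x); rewrite oX_kx /= in e0 e1.
by apply: row_cc; rewrite ccZ ?e0 ?e1 ?e2 ?mulr1 // mulrC divfK.
Qed.

Lemma kx_inj x y : cc x 2 != 0 -> cc y 2 != 0 -> cross x y = 0 -> kx x = kx y.
Proof.
move=> x2 y2 h; have c0 := congr1 (fun v => cc v 0) h; have c1 := congr1 (fun v => cc v 1) h.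
rewrite /cross !ccE !cc0 in c0 c1.
rewrite /kx; congr tX; congr pair; apply/eqP; rewrite eqr_div //; apply/eqP.
  by apply/esym/subr0_eq; rewrite [cc y 0 * _]mulrC -c1.
by apply: subr0_eq; rewrite [cc y 1 * _]mulrC -c0.
Qed.

Definition dio (u : C * C) : 'rV[C]_3 := row3 (rc kap * u.1) (rc rho * u.2) 0.

Lemma diff_io p : differentiable io p /\ forall u, 'd io p u = dio u.
Proof.
apply: (@diff_intro _ _ _ io dio p (kap + rho)).
- by move=> c u v; apply: row_cc; rewrite cc_lin /dio !ccE /= /GRing.scale /=; ring.
- move=> u; have /andP[u1 u2] : (nm u.1 <= nm u) && (nm u.2 <= nm u) by rewrite -nm_pair_le.
  have b1 : kap * nm u.1 <= kap * nm u by rewrite ler_wpM2l // ltW.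
  have b2 : rho * nm u.2 <= rho * nm u by rewrite ler_wpM2l // ltW.
  have p1 := mulr_ge0 (ltW kap0) (nm_ge0 u); have p2 := mulr_ge0 (ltW rho0) (nm_ge0 u).
  rewrite mulrDl; apply: nm_row3_le; rewrite /dio ccE ?nmM ?nk ?nr ?nm0.
  - by apply: le_trans b1 _; rewrite lerDl.
  - by apply: le_trans b2 _; rewrite lerDr.
  - exact: addr_ge0.
- move=> e e0; exists 1 => // y _; rewrite [X in nm X](_ : _ = 0) ?nm0 ?mulr_ge0 ?nm_ge0 ?(ltW e0) //.
  by apply: row_cc; rewrite cc0 !ccB /io /dio !ccE /ofX /=; ring.
Qed.

Lemma diff_kx x : cc x 2 != 0 -> differentiable kx x /\ forall v, 'd kx x v = tv x v.
Proof.
move=> x2; have p2 : 0 < nm (cc x 2) by rewrite nm_gt0.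
pose t := nm (cc x 2); pose a := (nm x + nm x) / t ^+ 2; pose K := a * (kap^-1 + rho^-1).
have x2t : (nm x + nm x) / t ^+ 2 = a by [].
have a0 : 0 <= a by rewrite /a /t divr_ge0 ?exprn_ge0 ?addr_ge0 ?nm_ge0.
have ik : 0 < kap^-1 by rewrite invr_gt0. have ir : 0 < rho^-1 by rewrite invr_gt0.
have num k v : nm (cc v k * cc x 2 - cc x k * cc v 2) <= (nm x + nm x) * nm v.
  apply: le_trans (nmBD _ _) _; rewrite !nmM mulrDl; apply: lerD; last by apply: ler_pM; rewrite ?nm_ge0 ?nm_cc.
  by rewrite mulrC; apply: ler_pM; rewrite ?nm_ge0 ?nm_cc.
have q k v : nm ((cc v k * cc x 2 - cc x k * cc v 2) / cc x 2 ^+ 2) <= a * nm v.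
  by rewrite nm_div nmX /a mulrAC ler_wpM2r ?invr_ge0 ?exprn_ge0 ?nm_ge0 // num.
have bnd v : nm (tv x v) <= K * nm v.
  rewrite nm_pair_le /tv /= ![nm (_ / _ / rc _)]nm_div nk nr /K.
  have h := mulr_ge0 a0 (nm_ge0 v).
  apply/andP; split.
    by apply: le_trans (ler_wpM2r (ltW ik) (q 0%N v)) _; rewrite [leRHS]mulrAC ler_wpM2l // lerDl ltW.
  by apply: le_trans (ler_wpM2r (ltW ir) (q 1%N v)) _; rewrite [leRHS]mulrAC ler_wpM2l // lerDr ltW.
apply: (@diff_intro _ _ _ kx (tv x) x K) => // [c u v|e e0].
  by rewrite /tv !cc_lin; congr pair; rewrite /= /GRing.scale /=; field; rewrite x2 ?rk ?rr.
have K0 : 0 <= K by rewrite mulr_ge0 // addr_ge0 // ltW.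
have K1 : 0 < K + 1 by rewrite ltr_wpDl.
have tp : 0 < t by [].
exists (Num.min (t / 2) (e * t / (2 * (K + 1)))) => [|y]; first by rewrite lt_min !divr_gt0 ?mulr_gt0.
rewrite lt_min => /andP[h1 h2]; have hy := le_lt_trans (nm_cc (y - x) 2) h1; rewrite ccB in hy.
have ty : t / 2 < nm (cc y 2).
  by have := nm_lo (cc x 2) (cc y 2); rewrite nmB -/t; move: hy; lra.
have y2 : cc y 2 != 0 by rewrite -nm_gt0; apply: lt_trans ty; rewrite divr_gt0.
have -> : kx y - kx x - tv x (y - x) = (- (cc (y - x) 2) / cc y 2) *: tv x (y - x).
  by rewrite /kx /toX /tv !ccB; congr pair; rewrite /= /GRing.scale /=; field; rewrite x2 y2 ?rk ?rr.
rewrite nmZ nm_div nmN.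
have s1 : nm (cc (y - x) 2) / nm (cc y 2) <= nm (y - x) * (2 / t).
  apply: ler_pM; rewrite ?invr_ge0 ?nm_ge0 ?nm_cc //.
  by rewrite -[2 / t]invf_div lef_pV2 ?posrE ?(ltW ty) ?nm_gt0 ?divr_gt0.
apply: le_trans (ler_pM _ (nm_ge0 _) s1 (bnd _)) _; first by rewrite divr_ge0 ?nm_ge0.
rewrite mulrA ler_wpM2r ?nm_ge0 //.
move: (ltW h2); rewrite ler_pdivlMr ?mulr_gt0 // => h3.
have -> : nm (y - x) * (2 / t) * K = nm (y - x) * (2 * K) / t by ring.
rewrite ler_pdivrMr //; apply: le_trans h3; rewrite ler_wpM2l ?nm_ge0 //; lra.
Qed.

(** The link between the projective tangent norm and the chart: up to the factor [cc x 2 ^+ 2],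
    [cross x v] is linear in [tv x v], with coefficients given by the scales and the affine
    coordinates of [x]. *)
Lemma crossE x v : cc x 2 != 0 -> let t := tv x v in let o := oX (kx x) in
  cross x v = cc x 2 ^+ 2 *: row3 (- (rc rho * t.2)) (rc kap * t.1) (o.1 * (rc rho * t.2) - o.2 * (rc kap * t.1)).
Proof.
move=> x2 t o; have eo : o = (cc x 0 / cc x 2, cc x 1 / cc x 2) by exact: oX_kx.
by apply: row_cc; rewrite ccZ /cross !ccE ?eo /t /tv /=; field; rewrite x2 ?rk ?rr.
Qed.
End Chart.

Section QuadDerivative.
Variable R : realType.
Local Notation C := (Cplx R).

(** The expansions from [x] to [y], from [y] to [y + t h] and from [x] to [y + t h] are compared;
    when [y - x] is of the order of [t] their remainders are [O(t ^+ 2)], so [l y h - l x h] is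
    [O(t)]. *)
Lemma quad_dcont (V : normedModType R[i]) (S : set V) f l B (x h : V) (r : R) : quad S f l B -> 0 < r ->
  (forall y, nm (y - x) < r -> S y) -> cont_at (fun y => l y h) x.
Proof.
move=> q r0 Sr e e0; have [B0 _ _ hlin hq] := q; pose H := nm h + 1.
have H0 : 0 < H by rewrite ltr_wpDl ?nm_ge0.
pose t := Num.min (r / (4 * H)) (e / (7 * (B + 1) * H ^+ 2)).
have B1 : 0 < B + 1 by rewrite ltr_wpDl.
have t0 : 0 < t by rewrite lt_min !divr_gt0 ?mulr_gt0 ?exprn_gt0.
have tH : t * H <= r / 4.
  apply: le_trans (_ : r / (4 * H) * H <= _); first by rewrite ler_wpM2r ?(ltW H0) // ge_min lexx.
  by rewrite le_eqVlt; apply/orP; left; apply/eqP; field; rewrite gt_eqF.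
have p0 : 0 < t * H by rewrite mulr_gt0.
exists (t * H) => // y hy; have Sx : S x by apply: Sr; rewrite subrr nm0.
have Sy : S y by apply: Sr; move: hy tH; lra.
have ht : nm (rc t *: h) <= t * H by rewrite nmZr ?(ltW t0) // ler_wpM2l ?(ltW t0) // lerDl.
have eh : y + rc t *: h - x = (y - x) + rc t *: h by rewrite addrAC.
have h2 : nm (y + rc t *: h - x) <= 2 * (t * H).
  by rewrite eh; apply: le_trans (nmD _ _) _; move: hy ht; lra.
have St : S (y + rc t *: h) by apply: Sr; move: h2 tH; lra.
have lZ u : S u -> l u (rc t *: h) = rc t * l u h by exact: linZ q.
have [_ q1] := hq _ _ Sx St; have [_ q2] := hq _ _ Sx Sy; have [_ q3] := hq _ _ Sy St.
have eE : l x (y + rc t *: h - x) = rc t * l x h + l x (y - x) by rewrite eh [y - x + _]addrC hlin.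
rewrite eE in q1; rewrite [y + _]addrC addrK lZ // [_ + y]addrC in q3.
have sq (a b : R) : 0 <= a -> a <= b -> B * a ^+ 2 <= B * b ^+ 2.
  by move=> a0 ab; rewrite ler_wpM2l // lerXn2r ?nnegrE ?(le_trans a0).
have s1 := le_trans q1 (sq _ _ (nm_ge0 _) h2).
have s2 := le_trans q2 (sq _ _ (nm_ge0 _) (ltW hy)).
have s3 := le_trans q3 (sq _ _ (nm_ge0 _) ht).
have key : rc t * (l y h - l x h) = (f (y + rc t *: h) - f x - (rc t * l x h + l x (y - x)))
    - (f y - f x - l x (y - x)) - (f (y + rc t *: h) - f y - rc t * l y h) by ring.
have : t * nm (l y h - l x h) <= 6 * (B * (t * H) ^+ 2).
  have -> : t * nm (l y h - l x h) = nm (rc t * (l y h - l x h)) by rewrite nmM nm_rc gtr0_norm.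
  rewrite key; apply: le_trans (nmBD _ _) _; apply: le_trans (lerD (nmBD _ _) (lexx _)) _.
  have e4 : B * (2 * (t * H)) ^+ 2 = 4 * (B * (t * H) ^+ 2) by ring.
  by rewrite e4 in s1; move: s1 s2 s3; move: (B * _ ^+ 2) => *; lra.
have -> : 6 * (B * (t * H) ^+ 2) = t * (6 * (B * H ^+ 2) * t) by ring.
rewrite ler_pM2l // => fin; apply: le_lt_trans fin _.
have BH : 0 <= B * H ^+ 2 by rewrite mulr_ge0 // exprn_ge0 // ltW.
have te : t <= e / (7 * (B + 1) * H ^+ 2) by rewrite ge_min lexx orbT.
rewrite ler_pdivlMr ?mulr_gt0 ?exprn_gt0 // in te.
have T0 : 0 < t * H ^+ 2 by rewrite mulr_gt0 ?exprn_gt0.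
have TB : 0 <= t * H ^+ 2 * B by rewrite mulr_ge0 // ltW.
have -> : 6 * (B * H ^+ 2) * t = 6 * (t * H ^+ 2 * B) by ring.
have e7 : t * (7 * (B + 1) * H ^+ 2) = 7 * (t * H ^+ 2 * B) + 7 * (t * H ^+ 2) by ring.
by rewrite e7 in te; move: te T0 TB; move: (t * H ^+ 2 * B) (t * H ^+ 2) => *; lra.
Qed.

Lemma dhev_cont D (G : coefs R D) x (v : 'rV[C]_3) k : cont_at (fun y => cc ('d (hev G) y v) k) x.
Proof.
move=> e e0; have [l [hl hd]] := quad_hev G x; have [B hB] := hl (inord k).
have le y : nm (y - x) < 1 -> cc ('d (hev G) y v) k = l (inord k) y v by move=> /hd[_ ->]; rewrite /cc mxE.
have [del del0 h] := @quad_dcont _ _ _ _ _ x v 1 hB ltr01 (fun _ hy => hy) _ e0.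
exists (Num.min 1 del) => [|y]; first by rewrite lt_min ltr01.
rewrite lt_min => /andP[h1 h2]; have x1 : nm (x - x) < 1 by rewrite subrr nm0.
by have := h _ h2; rewrite -(le y h1) -(le x x1).
Qed.
End QuadDerivative.

(** * Saddle hyperbolicity on the natural extension *)

Lemma cvg_at (R : realType) (V W : normedModType R[i]) (f : V -> W) x : cont_at f x -> f @ x --> f x.
Proof.
move=> h; apply/cvgrPdist_lt => e /pos_rc[e' e'0 ->]; have [del del0 hd] := h _ e'0.
by apply/nbhs_nmP; exists del => // y /hd; rewrite nm_lt nmB.
Qed.

(** [a], [b], [c], [e] are the moduli of the entries of the derivative in the chart. The two groups
    provide the hypotheses of [moebius_slope], for stable slopes with [th = ep] and for unstable
    ones with [th = 1 / 20]. *)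
Lemma saddle_arith (R : realType) (a b c e A ep : R) : 20 <= A -> 0 < ep <= 2000^-1 -> 0 <= a <= 102 / 100 ->
  0 <= b <= 100^-1 * A -> 0 <= c <= ep -> 99 / 100 * A <= e <= 101 / 100 * A ->
  [/\ 0 < e - b * ep, a * ep + c <= ep * (e - b * ep) & 2 * (a * e + c * b) <= (e - b * ep) ^+ 2] /\
  [/\ 19 <= e - c * 20^-1, a * 20^-1 + b <= 20^-1 * (e - c * 20^-1) & 2 * (a * e + b * c) <= (e - c * 20^-1) ^+ 2].
Proof.
move=> A20 /andP[p0 p1] /andP[a0 a1] /andP[b0 b1] /andP[c0 c1] /andP[e1 e2].
have bep : b * ep <= 100^-1 * A * 2000^-1 by apply: ler_pM => //; exact: ltW.
have ae : a * e <= 102 / 100 * (101 / 100 * A) by apply: ler_pM => //; lra.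
have cb : c * b <= 2000^-1 * (100^-1 * A) by apply: ler_pM => //; lra.
have aep : a * ep <= 102 / 100 * ep by rewrite ler_wpM2r // ltW.
have sq (E : R) : 98 / 100 * A <= E -> 19 * A <= E ^+ 2.
  move=> hE; rewrite expr2; have h : 98 / 100 * A * (98 / 100 * A) <= E * E by move: A20 hE; clear => *; apply: ler_pM => //; lra.
  have h' : 20 * A <= A * A by move: A20; clear => *; rewrite ler_wpM2r //; lra.
  have e98 : 98 / 100 * A * (98 / 100 * A) = 98 / 100 * (98 / 100) * (A * A) by ring.
  by rewrite e98 in h; move: h h' A20; clear; move: (A * A) (E * E) => *; lra.
split; split; try (by move: A20 p0 p1 a0 a1 b0 b1 c0 c1 e1 e2 bep; clear; move: (b * ep) => *; lra).
- have : ep * 10 <= ep * (e - b * ep) by rewrite ler_wpM2l ?(ltW p0) //; move: A20 e1 bep; clear; move: (b * ep) => *; lra.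
  by move: aep c1; move: (ep * (e - _)) (a * ep) => *; lra.
- by have := sq (e - b * ep) (ltac:(move: A20 e1 bep; clear; move: (b * ep) => *; lra)); move: ae cb; move: (_ ^+ 2) (a * e) (c * b) A20; clear => *; lra.
- by rewrite [b * c]mulrC; have := sq (e - c * 20^-1) (ltac:(move: A20 e1 c1 p1; clear => *; lra)); move: ae cb; move: (_ ^+ 2) (a * e) (c * b) A20; clear => *; lra.
Qed.

Section Saddle.
Variables (R : realType) (D : nat) (G : coefs R D) (z ws Lam w : Cplx R) (kap rho eta ep : R) (A yc : 'I_3 -> Cplx R).
Local Notation C := (Cplx R).
Hypothesis kap0 : 0 < kap.
Hypothesis rho0 : 0 < rho.
Hypothesis geo : geom Lam A yc w eta ep.
Hypothesis eta0 : 0 < eta <= 100^-1.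
Local Notation oX := (ofX z ws kap rho).
Local Notation kx := (kx z ws kap rho).
Local Notation io := (io z ws kap rho).
Local Notation tv := (tv kap rho).
Local Notation h := (hev G).
Local Notation g := (fun p => kx (h (io p))).
Hypothesis hg : near (box A yc 3 3) Lam A yc w eta ep g.
Hypothesis h2 : forall i p, box A yc 3 3 i p -> cc (h (io p)) 2 != 0.
Hypothesis GH : inH G.
Implicit Types x y v : 'rV[C]_3.

Let rk := rc_neq0 kap0.
Let rr := rc_neq0 rho0.
Let nk := nm_rcp kap0.
Let nr := nm_rcp rho0.
Let A20 i := (geom_A i geo).1.
Let A0 i := (geom_A i geo).2.

Definition Zs : set 'rV[C]_3 := [set x | cc x 2 != 0 /\ exists i : 'I_3, nm (kx x).1 < 59 / 20 /\ nm ((kx x).2 - yc i) < 2 / nm (A i)].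
Definition Qs : set 'rV[C]_3 := [set x | cc x 2 != 0 /\ exists i, box A yc (59 / 20) 2 i (kx x)].
Definition Ms : R := 1 + nm z + nm ws + 3 * kap + rho.

Lemma cc_neq0 x k : cc x k != 0 -> x != 0.
Proof. by apply: contra => /eqP->; rewrite cc0. Qed.

Lemma box_big i p : box A yc (59 / 20) 2 i p -> box A yc 3 3 i p.
Proof.
move=> [b1 b2]; split; first by apply: le_trans b1 _; lra.
by apply: le_trans b2 _; rewrite ler_wpM2r ?invr_ge0 ?nm_ge0 //; lra.
Qed.

Lemma closed_ratio (k : nat) (a : C) (c : R) : 0 <= c ->
  closed [set x : 'rV[C]_3 | nm (cc x k - a * cc x 2) <= c * nm (cc x 2)].
Proof.
move=> c0 x /closure_nmP hx /=; apply/ler_addgt0Pl => e e0; pose K := 1 + nm a + c.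
have K0 : 0 < K by rewrite /K; have := nm_ge0 a; lra.
have [y hy hd] := hx _ (divr_gt0 e0 K0); rewrite ltr_pdivlMr // in hd.
have d1 := nm_cc (y - x) k; have d2 := nm_cc (y - x) 2; rewrite !ccB in d1 d2.
have e1 : cc x k - a * cc x 2 = (cc y k - a * cc y 2) - ((cc y k - cc x k) - a * (cc y 2 - cc x 2)) by ring.
have t1 := nmBD (cc y k - a * cc y 2) ((cc y k - cc x k) - a * (cc y 2 - cc x 2)); rewrite -e1 in t1.
have t2 := nmBD (cc y k - cc x k) (a * (cc y 2 - cc x 2)); rewrite (nmM a) in t2.
have t3 : nm a * nm (cc y 2 - cc x 2) <= nm a * nm (y - x) by rewrite ler_wpM2l ?nm_ge0.
have t4 : c * nm (cc y 2) <= c * nm (cc x 2) + c * nm (y - x).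
  by rewrite -mulrDr ler_wpM2l //; have := nm_lo (cc y 2) (cc x 2); move: d2; lra.
have : nm (y - x) * K = nm (y - x) + nm a * nm (y - x) + c * nm (y - x) by rewrite /K; ring.
move: hy hd d1 t1 t2 t3 t4; rewrite /=; move: (nm a * nm (y - x)) (nm a * _) (c * nm (y - x)) (c * nm (cc y 2)) (c * _) (_ * K) => *; lra.
Qed.

Let ratio1 x (c : R) : cc x 2 != 0 -> (nm (kx x).1 <= c) = (nm (cc x 0 - z * cc x 2) <= c * kap * nm (cc x 2)).
Proof.
move=> x2; have -> : cc x 0 - z * cc x 2 = (kx x).1 * (rc kap * cc x 2) by rewrite /kx /toX /=; field; rewrite x2 rk.
by rewrite nmM (nmM (rc kap)) nk -[c * kap * _]mulrA ler_pM2r // mulr_gt0 ?nm_gt0.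
Qed.
Let ratio2 x i (c : R) : cc x 2 != 0 -> (nm ((kx x).2 - yc i) <= c) = (nm (cc x 1 - (ws + rc rho * yc i) * cc x 2) <= c * rho * nm (cc x 2)).
Proof.
move=> x2; have -> : cc x 1 - (ws + rc rho * yc i) * cc x 2 = ((kx x).2 - yc i) * (rc rho * cc x 2) by rewrite /kx /toX /=; field; rewrite x2 rr.
by rewrite nmM (nmM (rc rho)) nr -[c * rho * _]mulrA ler_pM2r // mulr_gt0 ?nm_gt0.
Qed.

(** The conditions defining [Qs] are multiplied out by [cc x 2], so that they are closed also where
    [cc x 2 = 0]. There they force the other two coordinates to vanish, and 0 is excluded from the
    projective closure. *)
Lemma clZ_Q : P2closure Zs `<=` Qs.
Proof.
move=> x [cx x0].
pose Ti (i : 'I_3) := [set y : 'rV[C]_3 | nm (cc y 0 - z * cc y 2) <= 59 / 20 * kap * nm (cc y 2)] `&`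
   [set y : 'rV[C]_3 | nm (cc y 1 - (ws + rc rho * yc i) * cc y 2) <= 2 / nm (A i) * rho * nm (cc y 2)].
have [i _ [t1 t2]] : (\bigcup_(i in [set: 'I_3]) Ti i) x.
  have cT : closed (\bigcup_(i in [set: 'I_3]) Ti i).
    apply: closed_bigcup => [|i _]; first exact: finite_finset.
    apply: closedI; apply: closed_ratio; first by rewrite mulr_ge0 ?(ltW kap0) //; lra.
    by rewrite mulr_ge0 ?(ltW rho0) // divr_ge0 ?nm_ge0.
  apply: cT; apply: closureS cx => y [y2 [i [b1 b2]]]; exists i => //; split; rewrite /= -?ratio1 -?ratio2 //; exact: ltW.
have x2 : cc x 2 != 0.
  apply/eqP => e2; apply: x0; move: t1 t2; rewrite /= e2 nm0 !mulr0 !subr0.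
  rewrite !(le_eqVlt _ 0) !(ltNge _ 0) !nm_ge0 !orbF !nm_eq0 => /eqP e0 /eqP e1.
  by apply: row_cc; rewrite cc0.
by split=> //; exists i; split; rewrite ?ratio1 ?ratio2.
Qed.

Lemma Z_cone : cone Zs.
Proof.
split=> [[/eqP]|x c [x2 [i hi]] c0]; first by rewrite cc0.
by split; [rewrite ccZ mulf_neq0|exists i; rewrite kxZ].
Qed.

Lemma Z_cl x : Zs x -> P2closure Zs x.
Proof. by move=> Zx; split; [exact: subset_closure|move=> e; have [] := Z_cone; rewrite e in Zx]. Qed.

Lemma clZ_cone x c : P2closure Zs x -> c != 0 -> P2closure Zs (c *: x).
Proof.
move=> [/closure_nmP cx /= x0] c0; split; last by move=> /= /eqP; rewrite scaler_eq0 (negPf c0) => /eqP.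
have nc : 0 < nm c by rewrite nm_gt0.
apply/closure_nmP => e e0; have [p Zp hp] := cx _ (divr_gt0 e0 nc).
by exists (c *: p); [apply: (Z_cone.2)|rewrite -scalerBr nmZ mulrC -ltr_pdivlMr].
Qed.

Lemma kx_cont x : cc x 2 != 0 -> cont_at kx x.
Proof. by move=> x2; have [d _] := diff_kx z ws kap0 rho0 x2; exact: diff_cont. Qed.

Lemma cc_ball x y : nm (y - x) < nm (cc x 2) -> cc y 2 != 0.
Proof.
move=> hy; have := nm_cc (y - x) 2; rewrite ccB => h3; rewrite -nm_gt0.
by have := nm_lo (cc x 2) (cc y 2); rewrite nmB; move: h3 hy; lra.
Qed.

Lemma Z_open : P2open Zs.
Proof.
split; first exact: Z_cone.
apply: open_nmP => x [x2 [i [b1 b2]]].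
pose m := Num.min (59 / 20 - nm (kx x).1) (2 / nm (A i) - nm ((kx x).2 - yc i)).
have m0 : 0 < m by rewrite lt_min !subr_gt0 b1.
have [del del0 hd] := kx_cont x2 m0.
exists (Num.min del (nm (cc x 2))) => [|y]; first by rewrite lt_min del0 nm_gt0.
rewrite lt_min => /andP[/hd hy y2]; split; first exact: cc_ball y2.
move: hy; rewrite nm_pair_lt !lt_min /= => /andP[/andP[c1 _] /andP[_ c2]]; exists i; split.
  by have := nm_lo (kx y).1 (kx x).1; move: c1; lra.
by have := nm_tri (kx x).2 (kx y).2 (yc i); move: c2; move: (2 / _) => *; lra.
Qed.

Lemma kx_hev x : cc x 2 != 0 -> kx (h x) = g (kx x).
Proof. by move=> x2; rewrite {1}(io_kx z ws kap0 rho0 x2) hevZ kxZ // expf_neq0. Qed.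

Lemma hev2 x : Qs x -> cc (h x) 2 != 0.
Proof.
move=> [x2 [i /box_big hb]]; rewrite (io_kx z ws kap0 rho0 x2) hevZ ccZ mulf_neq0 ?expf_neq0 //.
exact: h2 hb.
Qed.

(** [near_cover] finds a preimage with first coordinate at most [57 / 20], and the strict bound on
    the second follows from [nm (A j * (y - yc j)) <= 1 + eta < 2]; these margins put it in the open
    set [Zs]. *)
Lemma Q_cover : Qs `<=` P2img G Zs.
Proof.
move=> x [x2 [i [b1 b2]]]; split; first exact: cc_neq0 x2.
have t2 : nm (kx x).2 <= 1.
  by apply: (yc_disc geo (i := i)); apply: le_trans b2 _; rewrite ler_wpM2r ?invr_ge0 ?nm_ge0 //; lra.
have [|j q [q1 q2]|j [p [[p1 p2] ep']]] := near_cover geo eta0 hg (r := 59 / 20) _ _ (t := kx x) b1 t2; first by lra.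
  by split; [apply: le_trans q1 _; lra|apply: le_trans q2 _; rewrite ler_wpM2r ?invr_ge0 ?nm_ge0 //; lra].
have B3 : box A yc 3 3 j p by split; [apply: le_trans p1 _; lra|apply: le_trans p2 _; rewrite ler_wpM2r ?invr_ge0 ?nm_ge0 //; lra].
have y2 := h2 B3; have [_ _ i2] := cc_io z ws kap rho p.
exists (io p), (cc x 2 / cc (h (io p)) 2); split; last first.
- by rewrite [X in _ *: X](io_kx z ws kap0 rho0 y2) scalerA divfK // ep' -io_kx.
- by rewrite mulf_neq0 ?invr_eq0.
split; first by rewrite i2 oner_neq0.
exists j; rewrite kx_io //; split; first by apply: le_lt_trans p1 _; lra.
have [/(_ p B3)[_ d2] _] := hg j; rewrite ep' in d2; have /andP[_ e1] := eta0.
rewrite ltr_pdivlMr // mulrC -nmM; have := nm_tri (kx x).2 (A j * (p.2 - yc j)) 0; rewrite !subr0 nmB.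
by move: d2 t2 e1; move: (nm (A j * _)) => *; lra.
Qed.

Local Notation L := (LamP2 G Zs).

Lemma L_Q x : L x -> Qs x.
Proof. by move=> [_ /(_ 0%N)]; exact: clZ_Q. Qed.

Lemma L_hev x : L x -> L (h x).
Proof.
move=> [x0 hx]; split=> [|n]; last by have := hx n.+1; rewrite iterSr.
by apply/negP => /eqP /GH /eqP; rewrite (negPf x0).
Qed.

Lemma iter_hevZ n (c : C) x : iter n h (c *: x) = c ^+ (D ^ n) *: iter n h x.
Proof. by elim: n => [|n ih]; rewrite ?expr1 // !iterS ih hevZ -exprM expnSr. Qed.

Lemma L_scale x c : L x -> c != 0 -> L (c *: x).
Proof.
move=> [x0 hx] c0; split=> [|n]; first by rewrite scaler_eq0 negb_or c0.
by rewrite iter_hevZ; apply: clZ_cone; rewrite ?expf_neq0.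
Qed.

Lemma iter_hev_neq0 n x : x != 0 -> iter n h x != 0.
Proof. by move=> x0; elim: n => // n ih; apply/negP => /eqP /GH /eqP; rewrite (negPf ih). Qed.

Lemma L_closed : P2closed L.
Proof.
split; first by split=> [[/eqP]//|x c Lx c0]; exact: L_scale.
move=> x /closure_nmP cx; case: (eqVneq x 0) => [->|x0]; [by right|left; split=> // n].
split; last by move=> /= /eqP; rewrite (negPf (iter_hev_neq0 n x0)).
apply/closure_nmP => e e0; have e2 : 0 < e / 2 by lra.
have [del del0 hd] := diff_cont (diff_iter_hev G n x) e2.
have [|y [Ly|y0] hy] := cx (Num.min del (nm x)); first by rewrite lt_min del0 nm_gt0.
  move: hy; rewrite lt_min => /andP[/hd hy _]; have [_ /(_ n)[/closure_nmP cy _]] := Ly.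
  by have [p Zp hp] := cy _ e2; exists p => //; have := nm_tri (iter n h y) p (iter n h x); move: hp hy; lra.
by move: hy; rewrite y0 sub0r nmN lt_min ltxx andbF.
Qed.

Lemma L_img : P2img G L = L.
Proof.
apply/seteqP; split=> [y [y0 [x [c [Lx c0 ->]]]]|y Ly]; first by apply: L_scale => //; exact: L_hev.
have [y0 [x [c [Zx c0 e]]]] := Q_cover (L_Q Ly); split=> //; exists x, c; split=> //.
have x2 : cc x 2 != 0 by case: Zx.
split; first exact: cc_neq0 x2.
case=> [|n]; first exact: Z_cl.
rewrite iterSr; have -> : h x = c^-1 *: y by rewrite e scalerA mulVf ?scale1r.
by rewrite iter_hevZ; apply: clZ_cone; [case: Ly => _; exact|rewrite expf_neq0 ?invr_eq0].
Qed.

Lemma L_nonempty : L !=set0.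
Proof.
have [/andP[L1 L2] L3] := Lam_bounds geo eta0; have [w3 w1 _] : [/\ w ^+ 3 = 1, nm w = 1 & w != 1] by apply: cube3; case: geo.
have S0 k p : Sg Lam A yc w k p -> nm p.1 < 59 / 20 /\ nm (p.2 - yc k) < 2 / nm (A k).
  move=> [s1 s2]; split=> //; have := nmBD (Lam * p.1 + w ^+ k) (w ^+ k); rewrite addrK nmX w1 expr1n (nmM Lam).
  have : 99 / 100 * nm p.1 <= nm Lam * nm p.1 by rewrite ler_wpM2r ?nm_ge0.
  by move: s1; move: (nm Lam * _) => *; lra.
have S3 k p : Sg Lam A yc w k p -> box A yc 3 3 k p.
  by move=> /S0[a1 a2]; apply: box_big; split; exact: ltW.
(* The constant graph at height [-1] over the disc of index 0 is admissible, because [1 - Lam] is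
   small. *)
have [|||y hy orb] := @graph_orbit _ Lam A yc w eta ep geo eta0 g ord0 (fun=> -1).
- by move=> i; have [n1 n2] := hg i; split=> [p /S3|p p' /S3 s /S3]; [exact: n1|exact: n2].
- move=> y hy; split=> //=; rewrite expr0 mulrN1 addrC nmB.
  by move: L3; lra.
- by move=> y y' _ _; rewrite subrr nm0 !mulr_ge0 ?nm_ge0 // invr_ge0.
have kn n : cc (iter n h (io (-1, y))) 2 != 0 /\ kx (iter n h (io (-1, y))) = iter n g (-1, y).
  elim: n => [|n [n2 ih]]; first by have [_ _ i2] := cc_io z ws kap rho (-1, y); rewrite /= i2 oner_neq0 kx_io.
  have [k Sk] := orb n; rewrite [iter n.+1 h _]iterS; split; last by exact: (etrans (kx_hev n2) (congr1 g ih)).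
  by apply: hev2; split=> //; exists k; rewrite ih; have [a1 a2] := S0 _ _ Sk; split; exact: ltW.
exists (io (-1, y)); split=> [|n]; first by have [i2 _] := kn 0%N; exact: cc_neq0 i2.
have [n2 e] := kn n; apply: Z_cl; split=> //; have [k Sk] := orb n.
by exists k; rewrite e; exact: S0.
Qed.
Hypothesis Lam1 : nm Lam < 1.
Local Notation dio := (dio kap rho).
Local Notation X := (nat -> 'rV[C]_3).
Local Notation M := Ms.
Local Notation Kn := (natext G L).

Let nat_Q xs i : Kn xs -> Qs (xs i).
Proof. by move=> K; have [/L_Q] := K i. Qed.

Let cross_id x : cross x x = 0.
Proof. by apply: row_cc; rewrite /cross !ccE cc0; ring. Qed.

Let fs_nat xs : Kn xs -> Kn (fshift G xs).
Proof. by move=> K [|[|i]] /=; [split; [apply: L_hev => //; case: (K 0%N)|exact: cross_id]|exact: K|exact: K]. Qed.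
Definition bshift (xs : X) : X := fun i => xs i.+1.
Let bs_nat xs : Kn xs -> Kn (bshift xs). Proof. by move=> K i; exact: K. Qed.

(** The derivative at [p] of the map [g] read in the chart, as [diff_g] shows inside the boxes. *)
Definition Ts p u := tv (h (io p)) ('d h (io p) (dio u)).

#[local] Arguments Ts : simpl never.

Lemma diff_g i p : box A yc 3 3 i p -> differentiable g p /\ forall u, 'd g p u = Ts p u.
Proof.
move=> /h2 y2; have [d1 e1] := diff_io z ws kap0 rho0 p; have d2 := diff_hev G (io p).
have [d3 e3] := diff_kx z ws kap0 rho0 y2.
have d12 := differentiable_comp d1 d2; split; first exact: (differentiable_comp d12 d3).
move=> u; have c1 := congr1 (fun f : C * C -> C * C => f u) (diff_comp d12 d3).
apply: etrans c1 _; rewrite /= e3 /Ts; congr tv.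
by apply: etrans (congr1 (fun f : C * C -> 'rV[C]_3 => f u) (diff_comp d1 d2)) _; rewrite /= e1.
Qed.

Lemma tv_step x v : Qs x -> tv (h x) ('d h x v) = Ts (kx x) (tv x v).
Proof.
move=> Qx; have [x2 [i /box_big hb]] := Qx; have y2 := hev2 Qx.
have [dg eg] := diff_g hb; have [dk ek] := diff_kx z ws kap0 rho0 x2; have [dk' ek'] := diff_kx z ws kap0 rho0 y2.
have d1 := differentiable_comp (diff_hev G x) dk'; have d2 := differentiable_comp dk dg.
have r0 : 0 < nm (cc x 2) by rewrite nm_gt0.
have e := diff_near d1 d2 r0 (fun y hy => kx_hev (cc_ball hy)) v.
have c1 := congr1 (fun f : 'rV[C]_3 -> C * C => f v) (diff_comp (diff_hev G x) dk').
have c2 := congr1 (fun f : 'rV[C]_3 -> C * C => f v) (diff_comp dk dg).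
by rewrite -eg -ek -ek'; exact: etrans (esym c1) (etrans e c2).
Qed.

Lemma Ts_lin p u : Ts p u = u.1 *: Ts p (1, 0) + u.2 *: Ts p (0, 1).
Proof.
rewrite /Ts; have -> : dio u = u.1 *: dio (1, 0) + u.2 *: dio (0, 1).
  by apply: row_cc; rewrite cc_lin ccZ /dio !ccE /=; ring.
rewrite linearD !linearZ /= /tv; congr pair; rewrite /= !cc_lin !ccZ /GRing.scale /=; ring.
Qed.

Lemma Ts_bound i p u : box A yc (59 / 20) 2 i p ->
  nm ((Ts p u).1 - Lam * u.1) <= ep * nm u.1 + eta * nm (A i) * nm u.2 /\
  nm ((Ts p u).2 - A i * u.2) <= ep * nm u.1 + eta * nm (A i) * nm u.2.
Proof.
move=> hb; have hB := box_big hb; have [dg eg] := diff_g hB; have [_ hd] := hg i; have [b1 b2] := hb.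
have NZ (t : R) (v : C * C) : 0 <= t -> ep * nm (rc t *: v).1 + eta * nm (A i) * nm (rc t *: v).2 = t * (ep * nm v.1 + eta * nm (A i) * nm v.2).
  by move=> t0; rewrite /= !(@nmM R (rc t)) nm_rc ger0_norm //; ring.
have near_p : exists2 del : R, 0 < del & forall q, nm (q - p) < del -> box A yc 3 3 i q.
  exists (Num.min (1 / 20) (nm (A i))^-1) => [|q]; first by rewrite lt_min invr_gt0 A0; lra.
  rewrite nm_pair_lt !lt_min /= => /andP[/andP[q1 _] /andP[_ q2]]; split.
    by have := nm_lo q.1 p.1; move: q1 b1; lra.
  by have := nm_tri p.2 q.2 (yc i); move: q2 b2; move: (_^-1) => *; lra.
have [del del0 hq] := near_p; rewrite -eg; split.
  apply: (@diff_rel _ _ _ g p (fun q : C * C => q.1) (fun q => Lam * q.1) (fun q => ep * nm q.1 + eta * nm (A i) * nm q.2) dg) => //.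
  - by move=> q; have /andP[] : (nm q.1 <= nm q) && (nm q.2 <= nm q) by rewrite -nm_pair_le.
  - by move=> c v; rewrite /= /GRing.scale /=; ring.
  - by exists del => // q /hq Bq; have [] := hd q p Bq hB.
apply: (@diff_rel _ _ _ g p (fun q : C * C => q.2) (fun q => A i * q.2) (fun q => ep * nm q.1 + eta * nm (A i) * nm q.2) dg) => //.
- by move=> q; have /andP[] : (nm q.1 <= nm q) && (nm q.2 <= nm q) by rewrite -nm_pair_le.
- by move=> c v; rewrite /= /GRing.scale /=; ring.
- by exists del => // q /hq Bq; have [] := hd q p Bq hB.
Qed.

Lemma Ts_cont p u : cc (h (io p)) 2 != 0 ->
  (fun q => (Ts q u).1) @ p --> (Ts p u).1 /\ (fun q => (Ts q u).2) @ p --> (Ts p u).2.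
Proof.
move=> y2; have [dio1 _] := diff_io z ws kap0 rho0 p; have ci := diff_cont dio1.
have ccc k x : cont_at (fun y => cc y k) x.
  by move=> e e0; exists e => // y; apply: le_lt_trans; rewrite -ccB nm_cc.
have c1 k : (fun q => cc (h (io q)) k) @ p --> cc (h (io p)) k.
  exact: cvg_at (cont_comp ci (cont_comp (diff_cont (diff_hev G (io p))) (ccc k _))).
have c2 k : (fun q => cc ('d h (io q) (dio u)) k) @ p --> cc ('d h (io p) (dio u)) k.
  exact: cvg_at (cont_comp ci (@dhev_cont _ _ G (io p) (dio u) k)).
have c3 : (fun q => (cc (h (io q)) 2 ^+ 2)^-1) @ p --> (cc (h (io p)) 2 ^+ 2)^-1.
  by apply: cvgV; [rewrite expf_neq0|rewrite expr2; apply: cvgM; exact: c1].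
by split; apply: cvgM (cvg_cst _); apply: cvgM c3; apply: cvgB; apply: cvgM; first [exact: c1|exact: c2].
Qed.

Let M1 : 1 <= M. Proof. by rewrite /Ms; have := nm_ge0 z; have := nm_ge0 ws; have := kap0; have := rho0; lra. Qed.

Lemma oX_bound x : Qs x -> nm (oX (kx x)).1 <= M /\ nm (oX (kx x)).2 <= M.
Proof.
move=> [_ [i hb]]; have [b1 b2] := box_big hb; have b3 := yc_disc geo b2.
have h1 : kap * nm (kx x).1 <= kap * 3 by rewrite ler_wpM2l // ltW.
have h3 : rho * nm (kx x).2 <= rho * 1 by rewrite ler_wpM2l // ltW.
rewrite /Ms /ofX /=; have := nm_ge0 z; have := nm_ge0 ws; have k0 := kap0; have r0 := rho0.
have := nmD z (rc kap * (kx x).1); have := nmD ws (rc rho * (kx x).2); rewrite !(@nmM R (rc _)) nk nr.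
by move: h1 h3; move: (kap * nm _) (rho * nm _) => *; split; lra.
Qed.

Lemma nm_x2 x : Qs x -> [/\ 0 < nm (cc x 2), nm (cc x 2) <= nm x & nm x <= M * nm (cc x 2)].
Proof.
move=> Qx; have [x2 _] := Qx; have [bo bo'] := oX_bound Qx; rewrite oX_kx //= in bo bo'.
have p2 : 0 < nm (cc x 2) by rewrite nm_gt0.
rewrite !nm_div !ler_pdivrMr // in bo bo'; split=> //; first exact: nm_cc.
by apply: nm_row3_le => //; rewrite ler_peMl // nm_ge0.
Qed.

Lemma row_bound (o1 o2 om ze : C) : nm o1 <= M -> nm o2 <= M ->
  [/\ nm om <= nm (row3 (- om) ze (o1 * om - o2 * ze)), nm ze <= nm (row3 (- om) ze (o1 * om - o2 * ze)) &
    nm (row3 (- om) ze (o1 * om - o2 * ze)) <= M * (nm om + nm ze)].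
Proof.
move=> b1 b2; have p1 := nm_ge0 om; have p2 := nm_ge0 ze; have m0 : 0 <= M := le_trans ler01 M1.
have q1 : nm om <= M * nm om by rewrite ler_peMl. have q2 : nm ze <= M * nm ze by rewrite ler_peMl.
have r1 := mulr_ge0 m0 p1; have r2 := mulr_ge0 m0 p2; rewrite mulrDr.
split; first by have := nm_cc (row3 (- om) ze (o1 * om - o2 * ze)) 0; rewrite ccE nmN.
  by have := nm_cc (row3 (- om) ze (o1 * om - o2 * ze)) 1; rewrite ccE.
apply: nm_row3_le; rewrite ccE ?nmN.
- by apply: le_trans q1 _; rewrite lerDl.
- by apply: le_trans q2 _; rewrite lerDr.
- by apply: le_trans (nmBD _ _) _; rewrite !nmM; apply: lerD; rewrite ler_wpM2r.
Qed.

Let ratio_bound (t s a b N : R) : 0 < t -> t <= a -> a <= M * t -> 0 < s -> s <= b -> b <= M * s -> 0 <= N ->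
  N <= M ^+ 2 * (t * s * N / (a * b)) /\ t * s * N / (a * b) <= N.
Proof.
move=> t0 ta at' s0 sb bs N0; have a0 := lt_le_trans t0 ta; have b0 := lt_le_trans s0 sb; have ab := mulr_gt0 a0 b0.
split; last by rewrite ler_pdivrMr // mulrC ler_wpM2l // ler_pM // ltW.
have -> : M ^+ 2 * (t * s * N / (a * b)) = N * ((M * t) * (M * s) / (a * b)) by ring.
by rewrite ler_peMr // ler_pdivlMr // mul1r ler_pM // ltW.
Qed.

Definition tn x v : R := nm (cross x v) / nm x ^+ 2.
Lemma tnormE x v : tnorm x v = rc (tn x v).
Proof. by rewrite /tnorm /tn !normE rcM rcV rcX. Qed.

Lemma tn_bound x v : Qs x -> let u := tv x v in
  [/\ kap * nm u.1 <= M ^+ 2 * tn x v, rho * nm u.2 <= M ^+ 2 * tn x v & tn x v <= M * (kap * nm u.1 + rho * nm u.2)].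
Proof.
move=> Qx u; have [x2 _] := Qx; have [bo bo'] := oX_bound Qx; have [p2 l1 l2] := nm_x2 Qx.
have := row_bound (rc rho * u.2) (rc kap * u.1) bo bo'; rewrite !(@nmM R (rc _)) nk nr.
have ec := crossE z ws kap0 rho0 v x2; rewrite /= -/u in ec; rewrite /tn ec [nm (_ *: row3 _ _ _)]nmZ (nmX (cc x 2)).
set N := nm (row3 _ _ _) => -[n1 n2 n3]; rewrite !expr2.
have [q1 q2] := ratio_bound p2 l1 l2 p2 l1 l2 (nm_ge0 _ : 0 <= N); rewrite expr2 in q1.
by split; [exact: le_trans n2 q1|exact: le_trans n1 q1|rewrite addrC; exact: le_trans q2 n3].
Qed.

Definition dd x y : R := nm (cross x y) / (nm x * nm y).
Lemma dP2E x y : dP2 x y = rc (dd x y).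
Proof. by rewrite /dP2 /dd !normE -rcM -rcV -rcM. Qed.

Lemma dd_bound x y : Qs x -> Qs y ->
  [/\ kap * nm ((kx x).1 - (kx y).1) <= M ^+ 2 * dd x y, rho * nm ((kx x).2 - (kx y).2) <= M ^+ 2 * dd x y &
    dd x y <= M * (kap * nm ((kx x).1 - (kx y).1) + rho * nm ((kx x).2 - (kx y).2))].
Proof.
move=> Qx Qy; have [x2 _] := Qx; have [y2 _] := Qy; have [bo bo'] := oX_bound Qx.
have [p2 l1 l2] := nm_x2 Qx; have [q2 m1 m2] := nm_x2 Qy.
have := row_bound (rc rho * ((kx y).2 - (kx x).2)) (rc kap * ((kx y).1 - (kx x).1)) bo bo'; rewrite !(@nmM R (rc _)) nk nr.
have ec : cross x y = (cc x 2 * cc y 2) *: row3 (- (rc rho * ((kx y).2 - (kx x).2))) (rc kap * ((kx y).1 - (kx x).1))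
   ((oX (kx x)).1 * (rc rho * ((kx y).2 - (kx x).2)) - (oX (kx x)).2 * (rc kap * ((kx y).1 - (kx x).1))).
  by rewrite oX_kx //; apply: row_cc; rewrite ccZ /cross !ccE /kx /toX /=; field; rewrite x2 y2 ?rk ?rr.
rewrite /dd ec nmZ nmM ![nm ((kx y).1 - _)]nmB ![nm ((kx y).2 - _)]nmB.
set N := nm (row3 _ _ _) => -[n1 n2 n3].
have [q1 q'] := ratio_bound p2 l1 l2 q2 m1 m2 (nm_ge0 _ : 0 <= N).
by split; [exact: le_trans n2 q1|exact: le_trans n1 q1|rewrite addrC; exact: le_trans q' n3].
Qed.

(** The neighbourhoods of [xs] in the natural extension: finitely many coordinates are close for the
    projective distance, as in [linefield]. *)
Definition Fx (xs : X) : set_system X := [set P | exists N (del : R), 0 < del /\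
  forall ys, Kn ys -> (forall i, (i <= N)%N -> dd (ys i) (xs i) < del) -> P ys].

#[local] Instance Fx_filter xs : Filter (Fx xs).
Proof.
split=> [|P Q [N [del [d0 hP]]] [N' [del' [d0' hQ]]]|P Q PQ [N [del [d0 hP]]]].
- by exists 0%N, 1.
- exists (maxn N N'), (Num.min del del'); rewrite lt_min d0 d0'; split=> // ys K hy; split.
    by apply: hP => // i iN; have := hy i (leq_trans iN (leq_maxl _ _)); rewrite lt_min => /andP[].
  by apply: hQ => // i iN; have := hy i (leq_trans iN (leq_maxr _ _)); rewrite lt_min => /andP[].
- by exists N, del; split=> // ys K hy; apply/PQ/hP.
Qed.

Let Fx_K xs : Fx xs Kn. Proof. by exists 0%N, 1. Qed.
Let Fx_dd xs N (del : R) : 0 < del -> Fx xs [set ys | forall i, (i <= N)%N -> dd (ys i) (xs i) < del].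
Proof. by exists N, del. Qed.

Let kr0 : 0 < kap^-1 + rho^-1. Proof. by rewrite addr_gt0 // invr_gt0. Qed.
Let M2 : 0 < M ^+ 2. Proof. by rewrite exprn_gt0 // (lt_le_trans ltr01 M1). Qed.

Let kx_cvg xs i : Kn xs -> kx (ys i) @[ys --> Fx xs] --> kx (xs i).
Proof.
move=> K; apply/cvgrPdist_lt => e /pos_rc[e' e'0 ->].
pose c := M ^+ 2 * (kap^-1 + rho^-1); have c0 : 0 < c by rewrite mulr_gt0.
have d0 : 0 < e' / c by rewrite divr_gt0.
exists i, (e' / c); split=> // ys Ky /(_ i (leqnn i)); rewrite ltr_pdivlMr // => hd.
have [b1 b2 _] := dd_bound (nat_Q i Ky) (nat_Q i K); have q0 : 0 <= dd (ys i) (xs i) by rewrite divr_ge0 ?mulr_ge0 ?nm_ge0.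
have aux (t s : R) : 0 < t -> t^-1 <= kap^-1 + rho^-1 -> t * s <= M ^+ 2 * dd (ys i) (xs i) -> s < e'.
  move=> t0 tc hs; apply: le_lt_trans hd; rewrite -ler_pdivlMl // in hs; apply: le_trans hs _.
  by rewrite /c mulrCA [leRHS]mulrCA ler_wpM2l ?(ltW M2) // mulrC ler_wpM2l.
rewrite nm_lt nmB nm_pair_lt; apply/andP; split; [apply: aux b1|apply: aux b2] => //.
  by rewrite lerDl invr_ge0 ltW.
by rewrite lerDr invr_ge0 ltW.
Qed.

Let ent_cts i u : cts Kn Fx (fun xs => (Ts (kx (xs i)) u).1) /\ cts Kn Fx (fun xs => (Ts (kx (xs i)) u).2).
Proof.
split=> xs K; have [x2 [j /box_big /h2 y2]] := nat_Q i K; have [c1 c2] := Ts_cont u y2.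
  exact: (cvg_comp _ (fun p => (Ts p u).1) (@kx_cvg xs i K) c1).
exact: (cvg_comp _ (fun p => (Ts p u).2) (@kx_cvg xs i K) c2).
Qed.

Let fs_cvg xs : Kn xs -> fshift G @ Fx xs --> Fx (fshift G xs).
Proof.
move=> K P [N [del [d0 hP]]].
have A1 : Fx xs [set ys | dd (h (ys 0%N)) (h (xs 0%N)) < del].
  have [x2 [i /box_big hb]] := nat_Q 0 K; have [dg _] := diff_g hb.
  have c1 := cvg_comp _ g (@kx_cvg xs 0%N K) (cvg_at (diff_cont dg)).
  have mk : 0 < M * (kap + rho) by exact: mulr_gt0 (lt_le_trans ltr01 M1) (addr_gt0 kap0 rho0).
  have e0 : 0 < rc (del / (M * (kap + rho))) by rewrite -rc0 rc_lt divr_gt0.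
  have /cvgrPdist_lt /(_ _ e0) hn := c1; apply: filterS2 (Fx_K xs) hn => ys Ky /=.
  have Kf := nat_Q 0 (fs_nat K); have Kf' := nat_Q 0 (fs_nat Ky); rewrite /= in Kf Kf'.
  have [_ _ b] := dd_bound Kf' Kf; have [y2 _] := nat_Q 0 Ky.
  rewrite -!kx_hev // nm_lt nmB nm_pair_lt /= => /andP[s1 s2]; apply: le_lt_trans b _.
  set e := del / _ in s1 s2.
  have -> : del = M * (kap * e + rho * e) by rewrite -mulrDl mulrA [_ * e]mulrC divfK ?gt_eqF.
  by rewrite ltr_pM2l ?ltrD ?ltr_pM2l // (lt_le_trans ltr01 M1).
apply: filterS3 (Fx_K xs) A1 (Fx_dd xs N d0) => ys Ky a1 a2; apply: hP; first exact: fs_nat.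
by case=> [|i] iN //=; apply: a2; exact: ltnW.
Qed.

Let bs_cvg xs : Kn xs -> bshift @ Fx xs --> Fx (bshift xs).
Proof.
move=> K P [N [del [d0 hP]]]; exists N.+1, del; split=> // ys Ky hy.
by apply: hP => [|i iN]; [exact: bs_nat|exact: hy].
Qed.

Local Notation Ea p := (Ts p (1, 0)).1.
Local Notation Eb p := (Ts p (0, 1)).1.
Local Notation Ec p := (Ts p (1, 0)).2.
Local Notation Ee p := (Ts p (0, 1)).2.

Lemma ent_bound i p : box A yc (59 / 20) 2 i p ->
  [/\ nm (Ea p) <= nm Lam + ep, nm (Eb p) <= eta * nm (A i), nm (Ec p) <= ep & nm (Ee p - A i) <= eta * nm (A i)].
Proof.
move=> hb; have [a1 c1] := Ts_bound (1, 0) hb; have [b1 e1] := Ts_bound (0, 1) hb.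
rewrite /= !nm1 !nm0 !(mulr0, mulr1, addr0, add0r, subr0) in a1 b1 c1 e1; split=> //.
by have := nm_lo (Ea p) Lam; move: a1; lra.
Qed.

Lemma ent_arith p : (exists i, box A yc (59 / 20) 2 i p) ->
  [/\ 0 < nm (Ee p) - nm (Eb p) * ep, nm (Ea p) * ep + nm (Ec p) <= ep * (nm (Ee p) - nm (Eb p) * ep) &
    2 * (nm (Ea p) * nm (Ee p) + nm (Ec p) * nm (Eb p)) <= (nm (Ee p) - nm (Eb p) * ep) ^+ 2] /\
  [/\ 19 <= nm (Ee p) - nm (Ec p) * 20^-1, nm (Ea p) * 20^-1 + nm (Eb p) <= 20^-1 * (nm (Ee p) - nm (Ec p) * 20^-1) &
    2 * (nm (Ea p) * nm (Ee p) + nm (Eb p) * nm (Ec p)) <= (nm (Ee p) - nm (Ec p) * 20^-1) ^+ 2].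
Proof.
move=> [i hb]; have [a1 b1 c1 e1] := ent_bound hb; have [/andP[L1 L2] _] := Lam_bounds geo eta0; have e9 := ep_small geo eta0.
have /andP[_ et] := eta0; have eA : eta * nm (A i) <= 100^-1 * nm (A i) by rewrite ler_wpM2r ?nm_ge0.
have n1 := nm_lo (Ee p) (A i); have n2 := nm_lo (A i) (Ee p); rewrite [nm (A i - _)]nmB in n2.
apply: (saddle_arith (A20 i) e9); rewrite ?nm_ge0 ?andTb //.
- by have /andP[_ e9'] := e9; move: a1 L2 e9'; lra.
- exact: le_trans b1 eA.
- by move: e1 eA n1 n2; move: (eta * _) (nm (Ee p - _)) => *; apply/andP; split; lra.
Qed.

Let nat_box xs i : Kn xs -> exists j, box A yc (59 / 20) 2 j (kx (xs i)).
Proof. by move=> K; have [] := nat_Q i K. Qed.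

(** The stable direction [(1, S xs)] is the one that the derivative sends to the direction
    [(1, S (fshift G xs))] one step later. Solving for [S xs] gives a Moebius map whose dominating
    coefficient is [Ee], the expansion in [y]. *)
Lemma stable_slope : exists S : X -> C, (forall xs, Kn xs -> nm (S xs) <= ep /\
  S xs * (- Eb (kx (xs 0%N)) * S (fshift G xs) + Ee (kx (xs 0%N))) = Ea (kx (xs 0%N)) * S (fshift G xs) - Ec (kx (xs 0%N))) /\ cts Kn Fx S.
Proof.
have [_ _ e0 _] := geo; have [ca cc'] := ent_cts 0 (1, 0); have [cb ce] := ent_cts 0 (0, 1).
have ms := (@moebius_slope R X Kn Fx (fshift G) (fun xs => Ea (kx (xs 0%N))) (fun xs => - Ec (kx (xs 0%N)))
  (fun xs => - Eb (kx (xs 0%N))) (fun xs => Ee (kx (xs 0%N))) ep Fx_filter (fun xs _ => Fx_K xs) fs_nat fs_cvg ca _ _ ce (ltW e0)); apply: ms.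
- by move=> xs K; apply: cvgN; exact: cc'.
- by move=> xs K; apply: cvgN; exact: cb.
- by move=> xs K; have [[h1 _ _] _] := ent_arith (nat_box 0 K); rewrite nmN.
- by move=> xs K; have [[_ h1 _] _] := ent_arith (nat_box 0 K); rewrite !nmN.
- move=> xs K; have [[_ _ hc] _] := ent_arith (nat_box 0 K); rewrite nmN; apply: le_trans hc.
  rewrite ler_wpM2l // mulrNN; apply: le_trans (nmBD _ _) _.
  by rewrite !nmM.
Qed.

(** The unstable direction [(U xs, 1)] is the image, under the derivative at the previous point
    [xs 1], of the unstable direction there; it thus depends on the chosen past. *)
Lemma unstable_slope : exists U : X -> C, (forall xs, Kn xs -> nm (U xs) <= 20^-1 /\
  U xs * (Ec (kx (xs 1%N)) * U (bshift xs) + Ee (kx (xs 1%N))) = Ea (kx (xs 1%N)) * U (bshift xs) + Eb (kx (xs 1%N))) /\ cts Kn Fx U.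
Proof.
have [ca cc'] := ent_cts 1 (1, 0); have [cb ce] := ent_cts 1 (0, 1).
have t0 : 0 <= 20^-1 :> R by rewrite invr_ge0.
have ms := (@moebius_slope R X Kn Fx bshift (fun xs => Ea (kx (xs 1%N))) (fun xs => Eb (kx (xs 1%N)))
  (fun xs => Ec (kx (xs 1%N))) (fun xs => Ee (kx (xs 1%N))) 20^-1 Fx_filter (fun xs _ => Fx_K xs) bs_nat bs_cvg ca cb cc' ce t0); apply: ms.
- by move=> xs K; have [_ [h1 _ _]] := ent_arith (nat_box 1 K); apply: lt_le_trans h1.
- by move=> xs K; have [_ [_ h1 _]] := ent_arith (nat_box 1 K).
- move=> xs K; have [_ [_ _ hc]] := ent_arith (nat_box 1 K); apply: le_trans hc.
  by rewrite ler_wpM2l //; apply: le_trans (nmBD _ _) _; rewrite !nmM.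
Qed.

(** The covector [al u.1 + be u.2] of the chart, written as a normal vector in homogeneous
    coordinates; the last entry makes it vanish on [xs 0]. *)
Definition nf (al be : X -> C) (xs : X) : 'rV[C]_3 := let o := oX (kx (xs 0%N)) in
  row3 (al xs / rc kap) (be xs / rc rho) (- (al xs * o.1 / rc kap + be xs * o.2 / rc rho)).

Lemma bilE (n v : 'rV[C]_3) : bil n v = cc n 0 * cc v 0 + cc n 1 * cc v 1 + cc n 2 * cc v 2.
Proof.
rewrite /bil /cc !big_ord_recl big_ord0 addr0 addrA.
by congr (n _ _ * v _ _ + n _ _ * v _ _ + n _ _ * v _ _); apply: val_inj; rewrite /= inordK.
Qed.

Lemma bil_nf al be xs v : cc (xs 0%N) 2 != 0 ->
  bil (nf al be xs) v = cc (xs 0%N) 2 * (al xs * (tv (xs 0%N) v).1 + be xs * (tv (xs 0%N) v).2).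
Proof.
by move=> x2; rewrite bilE /nf oX_kx //= !ccE /tv /=; field; rewrite x2 rk rr.
Qed.

Lemma nm_cross x y : nm (cross x y) <= 2 * (nm (x - y) * nm y).
Proof.
have b k j : nm (cc x k * cc y j - cc x j * cc y k) <= 2 * (nm (x - y) * nm y).
  have -> : cc x k * cc y j - cc x j * cc y k = cc (x - y) k * cc y j - cc (x - y) j * cc y k by rewrite !ccB; ring.
  have q a b : nm (cc (x - y) a * cc y b) <= nm (x - y) * nm y by rewrite nmM; apply: ler_pM; rewrite ?nm_ge0 ?nm_cc.
  by apply: le_trans (nmBD _ _) _; have q1 := q k j; have q2 := q j k; rewrite mulr2n mulrDl mul1r; exact: lerD.
by apply: nm_row3_le; rewrite /cross !ccE.
Qed.

Lemma nf_linefield (al be : X -> C) (m0 : R) : cts Kn Fx al -> cts Kn Fx be -> 0 < m0 ->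
  (forall xs, Kn xs -> m0 <= nm (nf al be xs)) ->
  (forall xs u, Kn xs -> al xs * u.1 + be xs * u.2 = 0 ->
     al (fshift G xs) * (Ts (kx (xs 0%N)) u).1 + be (fshift G xs) * (Ts (kx (xs 0%N)) u).2 = 0) ->
  linefield G L (nf al be).
Proof.
move=> ca cb m00 hm inv; split=> [xs K|xs K v|xs K e /pos_rc[e' e'0 ->]].
- have [x2 _] := nat_Q 0 K; split; first by rewrite -nm_gt0; apply: lt_le_trans (hm _ K).
  by rewrite bil_nf // /tv /= [cc _ 0 * _]mulrC [cc _ 1 * _]mulrC !subrr !mul0r !mulr0 addr0 mulr0.
- have [x2 _] := nat_Q 0 K; have [y2 _] := nat_Q 0 (fs_nat K).
  rewrite !bil_nf // => /eqP; rewrite mulf_eq0 (negPf x2) => /eqP e0; have e1 := inv xs _ K e0.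
  have ed := deriveE v (diff_hev G (xs 0%N)); rewrite ed [fshift G xs 0%N]/= tv_step ?e1 ?mulr0 //; exact: nat_Q.
- have e2 : 0 < e' * m0 / 3 by rewrite divr_gt0 ?mulr_gt0.
  have ck k : cc (nf al be ys) k @[ys --> Fx xs] --> cc (nf al be xs) k.
    have c0 : (fun ys => (oX (kx (ys 0%N))).1) @ Fx xs --> (oX (kx (xs 0%N))).1.
      by apply: cvgD (cvg_cst _) _; apply: cvgM (cvg_cst _) _; apply: (cvg_comp _ _ (@kx_cvg xs 0%N K)); exact: cvg_fst.
    have c1 : (fun ys => (oX (kx (ys 0%N))).2) @ Fx xs --> (oX (kx (xs 0%N))).2.
      by apply: cvgD (cvg_cst _) _; apply: cvgM (cvg_cst _) _; apply: (cvg_comp _ _ (@kx_cvg xs 0%N K)); exact: cvg_snd.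
    suff : forall i : 'I_3, (fun ys => nf al be ys ord0 i) @ Fx xs --> nf al be xs ord0 i by apply.
    have E ys : [/\ nf al be ys ord0 (inord 0) = al ys / rc kap, nf al be ys ord0 (inord 1) = be ys / rc rho &
      nf al be ys ord0 (inord 2) = - (al ys * (oX (kx (ys 0%N))).1 / rc kap + be ys * (oX (kx (ys 0%N))).2 / rc rho)] by rewrite -!/(cc _ _) /nf !ccE.
    apply: ord3P.
    + have -> : (fun ys => nf al be ys ord0 (inord 0)) = (fun ys => al ys / rc kap) by apply/funext => ys; have [] := E ys.
      by have [-> _ _] := E xs; apply: cvgM (cvg_cst _); exact: ca.
    + have -> : (fun ys => nf al be ys ord0 (inord 1)) = (fun ys => be ys / rc rho) by apply/funext => ys; have [] := E ys.
      by have [_ -> _] := E xs; apply: cvgM (cvg_cst _); exact: cb.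
    + have -> : (fun ys => nf al be ys ord0 (inord 2)) = (fun ys => - (al ys * (oX (kx (ys 0%N))).1 / rc kap + be ys * (oX (kx (ys 0%N))).2 / rc rho)).
        by apply/funext => ys; have [] := E ys.
      have [_ _ ->] := E xs; apply: cvgN; apply: cvgD; apply: cvgM (cvg_cst _); apply: cvgM; [exact: ca|exact: c0|exact: cb|exact: c1].
  have e3 : 0 < rc (e' * m0 / 3) by rewrite -rc0 rc_lt.
  have q k : Fx xs [set ys | nm (cc (nf al be ys - nf al be xs) k) < e' * m0 / 3].
    by have /cvgrPdist_lt /(_ _ e3) := ck k; apply: filterS => ys; rewrite nm_lt nmB /= ccB.
  have [N [del [d0 hN]]] := filterI (filterI (q 0%N) (q 1%N)) (q 2%N).
  exists N, (rc del); split=> [|ys Ky hy]; first by rewrite -rc0 rc_lt.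
  have [[a0 a1] a2] : ([set ys | nm (cc (nf al be ys - nf al be xs) 0) < e' * m0 / 3] `&`
     [set ys | nm (cc (nf al be ys - nf al be xs) 1) < e' * m0 / 3] `&`
     [set ys | nm (cc (nf al be ys - nf al be xs) 2) < e' * m0 / 3]) ys.
    by apply: hN => // i iN; rewrite -rc_lt -dP2E; exact: hy.
  have n1 : nm (nf al be ys - nf al be xs) <= e' * m0 / 3 by apply: nm_row3_le; exact: ltW.
  rewrite dP2E rc_lt /dd; have my := hm _ Ky; have mx := hm _ K.
  have y0 : 0 < nm (nf al be ys) := lt_le_trans m00 my; have x0 : 0 < nm (nf al be xs) := lt_le_trans m00 mx.
  rewrite ltr_pdivrMr ?mulr_gt0 //; apply: le_lt_trans (nm_cross _ _) _.
  rewrite !mulrA ltr_pM2r //; apply: lt_le_trans (ler_wpM2l (ltW e'0) my).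
  by have : 0 < e' * m0 by [rewrite mulr_gt0]; move: n1; move: (e' * m0) (nm (_ - _)) => *; lra.
Qed.

Let nf_lo al be xs : nm (al xs) / kap <= nm (nf al be xs) /\ nm (be xs) / rho <= nm (nf al be xs).
Proof.
have := nm_cc (nf al be xs) 0; have := nm_cc (nf al be xs) 1.
by rewrite /nf !ccE !nm_div nk nr.
Qed.

Let it0 n (xs : X) : iter n (fshift G) xs 0%N = iter n h (xs 0%N).
Proof. by elim: n => [//|n ih]; rewrite [in RHS]iterS -ih. Qed.
Let Kit n xs : Kn xs -> Kn (iter n (fshift G) xs).
Proof. by move=> K; elim: n => // n ih; exact: fs_nat. Qed.

Let un x v n := tv (iter n h x) ('d (iter n h) x v).
Let unS xs v n : Kn xs -> un (xs 0%N) v n.+1 = Ts (kx (iter n (fshift G) xs 0%N)) (un (xs 0%N) v n).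
Proof.
move=> K; rewrite it0 -tv_step; last by rewrite -it0; apply: nat_Q; exact: Kit.
rewrite /un; congr tv.
exact: (congr1 (fun f : 'rV[C]_3 -> 'rV[C]_3 => f v) (diff_comp (diff_iter_hev G n (xs 0%N)) (diff_hev G _))).
Qed.

Let TsE p u : (Ts p u).1 = u.1 * Ea p + u.2 * Eb p /\ (Ts p u).2 = u.1 * Ec p + u.2 * Ee p.
Proof. by split; [exact: (congr1 fst (Ts_lin p u))|exact: (congr1 snd (Ts_lin p u))]. Qed.

Definition lamS : R := 1 - (1 - nm Lam) / 2.

(** On the stable line the derivative acts by the factor [Ea p + s * Eb p], of modulus at most
    [nm Lam + ep * (1 + nm (A i))]; the last clause of [geom] keeps this below [lamS], halfway
    between [nm Lam] and 1. *)
Lemma Ts_stable i p u (s s' : C) : box A yc (59 / 20) 2 i p -> nm s <= ep ->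
  s * (- Eb p * s' + Ee p) = Ea p * s' - Ec p -> u.2 = s * u.1 ->
  (Ts p u).2 = s' * (Ts p u).1 /\ nm (Ts p u).1 <= lamS * nm u.1.
Proof.
move=> hb hs s2 e; have [-> ->] := TsE p u; rewrite e; split.
  have -> : u.1 * Ec p + s * u.1 * Ee p = (s * (- Eb p * s' + Ee p) + s * Eb p * s' + Ec p) * u.1 by ring.
  by rewrite s2; ring.
have -> : u.1 * Ea p + s * u.1 * Eb p = (Ea p + s * Eb p) * u.1 by ring.
rewrite nmM ler_wpM2r ?nm_ge0 //; apply: le_trans (nmD _ _) _; rewrite nmM.
have [a1 b1 _ _] := ent_bound hb; have /andP[et0 et] := eta0; have /andP[ep0 _] := ep_small geo eta0.
have [_ _ _ /(_ i)[_ _ g3]] := geo; rewrite ler0_norm ?subr_le0 ?(ltW Lam1) // in g3.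
have p1 : nm s * nm (Eb p) <= ep * (eta * nm (A i)) by apply: ler_pM; rewrite ?nm_ge0.
have et1 : eta <= 1 by move: et; lra.
have p2 : ep * (eta * nm (A i)) <= ep * nm (A i) by rewrite ler_wpM2l ?(ltW ep0) // ler_piMl ?nm_ge0.
have p3 : eta * - (nm Lam - 1) <= 100^-1 * - (nm Lam - 1) by rewrite ler_wpM2r // oppr_ge0 subr_le0 ltW.
rewrite mulrDr mulr1 in g3; have l1 := Lam1; rewrite /lamS; move: a1 p1 p2 p3 g3 l1.
by move: (nm s * _) (ep * (eta * _)) (ep * nm _) (eta * - _) (nm (Ea p)) => *; lra.
Qed.

Lemma Ts_unstable p u (s s' : C) : (exists i, box A yc (59 / 20) 2 i p) -> nm s <= 20^-1 ->
  s' * (Ec p * s + Ee p) = Ea p * s + Eb p -> u.1 = s * u.2 ->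
  (Ts p u).1 = s' * (Ts p u).2 /\ nm u.2 <= lamS * nm (Ts p u).2.
Proof.
move=> hb hs s2 e; have [_ [g1 _ _]] := ent_arith hb; have [/andP[L1 L2] _] := Lam_bounds geo eta0.
have [-> ->] := TsE p u; rewrite e; split.
  have -> : s * u.2 * Ea p + u.2 * Eb p = (Ea p * s + Eb p) * u.2 by ring.
  by rewrite -s2; ring.
have -> : s * u.2 * Ec p + u.2 * Ee p = (Ee p + Ec p * s) * u.2 by ring.
rewrite nmM mulrA ler_peMl ?nm_ge0 //.
have r1 := nm_loD (Ee p) (Ec p * s); rewrite nmM in r1.
have r2 : nm (Ec p) * nm s <= nm (Ec p) * 20^-1 by rewrite ler_wpM2l ?nm_ge0.
have r3 : 19 <= nm (Ee p + Ec p * s) by move: r1 r2 g1; move: (nm (Ec p) * _) (nm (Ec p) * _) (nm (_ + _)) => *; lra.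
have r4 : 2^-1 * 19 <= lamS * nm (Ee p + Ec p * s) by apply: ler_pM => //; rewrite /lamS; move: L1; lra.
by apply: le_trans r4; lra.
Qed.

Lemma saddle_hyp : hyp_saddle G L.
Proof.
have [S [hS cS]] := stable_slope; have [U [hU cU]] := unstable_slope.
have /andP[ep0 ep1] := ep_small geo eta0; have [/andP[L1 L2] _] := Lam_bounds geo eta0.
have ep1' : ep <= 1 by move: ep1; lra.
have cst1 (c : C) : cts Kn Fx (fun=> c) by move=> xs K; exact: cvg_cst.
split; [exact: L_closed|exact: L_img|].
pose ns := nf (fun xs => - S xs) (fun=> 1); pose nu := nf (fun=> 1) (fun xs => - U xs).
(* [Kc] is the cost of passing from the projective tangent norm to the chart and back. *)
pose lam := lamS; pose Kc := M * (kap + rho) * (M ^+ 2 * (kap^-1 + rho^-1)).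
have lam0 : 0 < lam < 1 by rewrite /lam /lamS; have := Lam1; move: L1; lra.
have invS xs u : Kn xs -> u.2 = S xs * u.1 -> (Ts (kx (xs 0%N)) u).2 = S (fshift G xs) * (Ts (kx (xs 0%N)) u).1 /\
    nm (Ts (kx (xs 0%N)) u).1 <= lam * nm u.1.
  by move=> K; have [s1 s2] := hS _ K; have [i hb] := nat_box 0 K; exact: Ts_stable hb s1 s2.
have invU xs u : Kn xs -> u.1 = U xs * u.2 -> (Ts (kx (xs 0%N)) u).1 = U (fshift G xs) * (Ts (kx (xs 0%N)) u).2 /\
    nm u.2 <= lam * nm (Ts (kx (xs 0%N)) u).2.
  by move=> K; have [_ s2] := hU _ (fs_nat K); have [s1 _] := hU _ K; exact: Ts_unstable (nat_box 0 K) s1 s2.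
have bS xs v : Kn xs -> bil (ns xs) v = 0 -> (tv (xs 0%N) v).2 = S xs * (tv (xs 0%N) v).1.
  move=> K; have [x2 _] := nat_Q 0 K; rewrite bil_nf // => /eqP; rewrite mulf_eq0 (negPf x2) /= mul1r => /eqP e.
  by apply: subr0_eq; rewrite -e; ring.
have bU xs v : Kn xs -> bil (nu xs) v = 0 -> (tv (xs 0%N) v).1 = U xs * (tv (xs 0%N) v).2.
  move=> K; have [x2 _] := nat_Q 0 K; rewrite bil_nf // => /eqP; rewrite mulf_eq0 (negPf x2) /= mul1r => /eqP e.
  by apply: subr0_eq; rewrite -e; ring.
have k1 : 0 < kap^-1 by rewrite invr_gt0. have r1 : 0 < rho^-1 by rewrite invr_gt0.
have M0 : 0 < M := lt_le_trans ltr01 M1.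
have Kc0 : 0 < Kc by rewrite /Kc mulr_gt0 // mulr_gt0 // addr_gt0.
exists ns, nu, (rc Kc), (rc lam); split.
- split.
    have cN : cts Kn Fx (fun xs => - S xs) by move=> xs K; apply: cvgN; exact: cS.
    apply: (nf_linefield cN (cst1 1) r1) => [xs K|xs u K].
      by have [_] := nf_lo (fun xs => - S xs) (fun=> 1) xs; rewrite nm1 mul1r.
    rewrite mul1r => e; have e1 : u.2 = S xs * u.1 by apply: subr0_eq; rewrite -e; ring.
    by have [-> _] := invS _ _ K e1; ring.
  have cN : cts Kn Fx (fun xs => - U xs) by move=> xs K; apply: cvgN; exact: cU.
  apply: (nf_linefield (cst1 1) cN k1) => [xs K|xs u K].
    by have [+ _] := nf_lo (fun=> 1) (fun xs => - U xs) xs; rewrite nm1 mul1r.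
  rewrite mul1r => e; have e1 : u.1 = U xs * u.2 by apply: subr0_eq; rewrite -e; ring.
  by have [-> _] := invU _ _ K e1; ring.
- move=> xs K; have [s1 _] := hS _ K; have [u1 _] := hU _ K; apply: (@cc_neq0 _ 2).
  rewrite /cross ccE /ns /nu /nf !ccE.
  have -> : - S xs / rc kap * (- U xs / rc rho) - 1 / rc rho * (1 / rc kap) = (S xs * U xs - 1) / (rc kap * rc rho).
    by field; rewrite rk rr.
  rewrite mulf_neq0 ?invr_eq0 ?mulf_neq0 // subr_eq0; apply/eqP => e.
  have : nm (S xs * U xs) <= 2000^-1 * 20^-1 by rewrite nmM; apply: ler_pM; rewrite ?nm_ge0 // (le_trans s1).
  by rewrite e nm1; lra.
- by rewrite -rc0 rc_lt.
- by rewrite -rc0 -rc1 !rc_lt.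
move=> xs K n v x; have Q0 := nat_Q 0 K; have Qn : Qs (iter n h x) by rewrite -it0; apply: nat_Q; exact: Kit.
have [x1 x2 x3] := tn_bound v Q0; have [y1 y2 y3] := tn_bound ('d (iter n h) x v) Qn.
rewrite deriveE; last exact: diff_iter_hev.
have u0 : un x v 0 = tv x v.
  by rewrite /un /=; congr tv; have [_ e] := diff_idE x; exact: e.
have base (s t c d : R) : c * s <= M ^+ 2 * d -> 0 < c -> c^-1 <= kap^-1 + rho^-1 -> 0 <= d -> t <= M * (kap * s + rho * s) -> t <= Kc * d.
  move=> h1 c0 hc d0 /le_trans; apply; rewrite -mulrDl mulrA /Kc -[leRHS]mulrA (ler_wpM2l (mulr_ge0 (ltW M0) (addr_ge0 (ltW kap0) (ltW rho0)))) //.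
  rewrite -ler_pdivlMl // in h1; apply: le_trans h1 _; rewrite mulrCA -[leRHS]mulrA ler_wpM2l ?(ltW M2) // ler_wpM2r //.
have tn0 y v' : 0 <= tn y v' by rewrite divr_ge0 ?exprn_ge0 ?nm_ge0.
have t20 : 20^-1 <= 1 :> R by lra.
have lam1 : 0 <= lam by have /andP[/ltW] := lam0.
rewrite !tnormE -rcX -!rcM !rc_le; split=> [/(bS _ _ K) e|/(bU _ _ K) e].
  have [en ln] : (un x v n).2 = S (iter n (fshift G) xs) * (un x v n).1 /\ nm (un x v n).1 <= lam ^+ n * nm (un x v 0).1.
    elim: (n) => [|m [em lm]]; first by rewrite mul1r u0.
    rewrite unS // iterS; have [f1 f2] := invS _ _ (Kit m K) em; split; first exact: f1.
    by apply: le_trans f2 _; rewrite exprS -mulrA ler_wpM2l.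
  have [s1 _] := hS _ (Kit n K); have l2 : nm (un x v n).2 <= nm (un x v n).1.
    by rewrite en nmM ler_piMl ?nm_ge0 // (le_trans s1 ep1').
  rewrite u0 in ln; rewrite -mulrA; apply: (base (lam ^+ n * nm (tv x v).1) _ kap) => //.
  - by rewrite mulrCA [leRHS]mulrCA ler_wpM2l ?exprn_ge0.
  - by rewrite lerDl ltW.
  - by rewrite mulr_ge0 ?exprn_ge0.
  apply: le_trans y3 _; rewrite ler_wpM2l ?(ltW M0) // -!/(un x v n).
  by apply: lerD; rewrite ler_wpM2l ?(ltW kap0) ?(ltW rho0) // (le_trans l2).
have [en ln] : (un x v n).1 = U (iter n (fshift G) xs) * (un x v n).2 /\ nm (un x v 0).2 <= lam ^+ n * nm (un x v n).2.
  elim: (n) => [|m [em lm]]; first by rewrite mul1r u0.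
  rewrite unS // iterS; have [f1 f2] := invU _ _ (Kit m K) em; split; first exact: f1.
  by apply: le_trans lm _; rewrite exprSr -mulrA ler_wpM2l ?exprn_ge0.
have [s1 _] := hU _ K; have l2 : nm (tv x v).1 <= nm (tv x v).2.
  by rewrite e nmM ler_piMl ?nm_ge0 // (le_trans s1 t20).
rewrite u0 in ln; rewrite -mulrA; apply: (base (lam ^+ n * nm (un x v n).2) _ rho) => //.
- by rewrite mulrCA [leRHS]mulrCA ler_wpM2l ?exprn_ge0.
- by rewrite lerDr ltW.
- by rewrite mulr_ge0 ?exprn_ge0.
apply: le_trans x3 _; rewrite ler_wpM2l ?(ltW M0) //.
by apply: lerD; rewrite ler_wpM2l ?(ltW kap0) ?(ltW rho0) // (le_trans l2).
Qed.
End Saddle.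

(** * Perturbations of the lift *)

Section LipschitzClass.
Variables (R : realType) (T : set (Cplx R * Cplx R)).
Local Notation C := (Cplx R).

(** Bound and Lipschitz constant together: a C^1-size without derivatives, handled well by sums,
    products and inverses. *)
Definition lipb (e : R) (f : C * C -> C) := forall p p', T p -> T p' -> nm (f p) <= e /\ nm (f p - f p') <= e * nm (p - p').

Lemma lipb_ext e f f' : (forall p, T p -> f p = f' p) -> lipb e f -> lipb e f'.
Proof. by move=> h hf p p' Tp Tp'; rewrite -(h p Tp) -(h p' Tp'); exact: hf. Qed.

Lemma lipbW e e' f : e <= e' -> lipb e f -> lipb e' f.
Proof.
move=> ee h p p' Tp Tp'; have [a1 a2] := h _ _ Tp Tp'; split; first exact: le_trans ee.
by apply: le_trans a2 _; rewrite ler_wpM2r ?nm_ge0.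
Qed.

Lemma lipb_add e e' f f' : lipb e f -> lipb e' f' -> lipb (e + e') (fun p => f p + f' p).
Proof.
move=> h h' p p' Tp Tp'; have [a1 a2] := h _ _ Tp Tp'; have [b1 b2] := h' _ _ Tp Tp'; split.
  exact: le_trans (nmD _ _) (lerD a1 b1).
rewrite mulrDl opprD addrACA; exact: le_trans (nmD _ _) (lerD a2 b2).
Qed.

Lemma lipb_mul e e' f f' : 0 <= e -> lipb e f -> lipb e' f' -> lipb (2 * e * e') (fun p => f p * f' p).
Proof.
move=> e0 h h' p p' Tp Tp'; have [a1 a2] := h _ _ Tp Tp'; have [b1 b2] := h' _ _ Tp Tp'; have [b1' _] := h' _ _ Tp' Tp.
have e'0 : 0 <= e' := le_trans (nm_ge0 _) b1; have ee : 0 <= e * e' by rewrite mulr_ge0.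
split; first by rewrite nmM -mulrA; apply: le_trans (ler_pM (nm_ge0 _) (nm_ge0 _) a1 b1) _; move: ee; move: (e * e') => *; lra.
have -> : f p * f' p - f p' * f' p' = f p * (f' p - f' p') + (f p - f p') * f' p' by ring.
have -> : 2 * e * e' * nm (p - p') = e * (e' * nm (p - p')) + e * nm (p - p') * e' by ring.
by apply: le_trans (nmD _ _) _; rewrite !nmM; apply: lerD; apply: ler_pM; rewrite ?nm_ge0.
Qed.

Lemma lipb_scale e f (c : C) (t : R) : nm c <= t -> lipb e f -> lipb (t * e) (fun p => c * f p).
Proof.
move=> ct h p p' Tp Tp'; have [a1 a2] := h _ _ Tp Tp'.
by rewrite -mulrBr !nmM -mulrA; split; apply: ler_pM; rewrite ?nm_ge0.
Qed.

Lemma lipb_sum (I : finType) (e : I -> R) (f : I -> C * C -> C) : (forall i, lipb (e i) (f i)) ->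
  lipb (\sum_i e i) (fun p => \sum_i f i p).
Proof.
move=> h; rewrite unlock; elim: (index_enum I) => [|i s ih] /=; last exact: lipb_add.
by move=> p p' _ _; rewrite subrr nm0 mul0r.
Qed.

Lemma lipb_inv e f : e <= 2^-1 -> lipb e f -> lipb 2 (fun p => (1 + f p)^-1).
Proof.
move=> e2 h p p' Tp Tp'; have [a1 a2] := h _ _ Tp Tp'; have [b1 _] := h _ _ Tp' Tp.
have lo q : nm (f q) <= e -> 2^-1 <= nm (1 + f q) by move=> hq; have := nm_loD (1 : C) (f q); rewrite nm1; move: hq e2; lra.
have l1 := lo _ a1; have l2 := lo _ b1.
have n1 : 0 < nm (1 + f p) by apply: lt_le_trans l1; lra. have n2 : 0 < nm (1 + f p') by apply: lt_le_trans l2; lra.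
split; first by rewrite nmV -[2]invrK lef_pV2 ?posrE ?invr_gt0.
have -> : (1 + f p)^-1 - (1 + f p')^-1 = - (f p - f p') / ((1 + f p) * (1 + f p')) by field; rewrite -!nm_gt0 n1 n2.
rewrite nm_div nmN nmM ler_pdivrMr ?mulr_gt0 //; apply: le_trans a2 _.
have q0 : 2^-1 * 2^-1 <= nm (1 + f p) * nm (1 + f p') by apply: ler_pM => //; lra.
have d0 := nm_ge0 (p - p'); have e1 : e * nm (p - p') <= 2^-1 * nm (p - p') by rewrite ler_wpM2r.
apply: le_trans e1 _; have -> : 2^-1 * nm (p - p') = 2 * nm (p - p') * (2^-1 * 2^-1) by field.
by rewrite ler_wpM2l // mulr_ge0.
Qed.

Lemma lipb_qd f : qd T f -> exists2 B : R, 0 <= B & lipb B f.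
Proof. by move=> [l [B [B0 h1 _ _ h4]]]; exists B => // p p' Tp Tp'; split; [exact: h1|have [+ _] := h4 _ _ Tp' Tp]. Qed.
End LipschitzClass.

Section ClosePerturbation.
Variables (R : realType) (D : nat) (F : coefs R D) (M : R).
Local Notation C := (Cplx R).
Hypothesis F1 : forall a b : C, cc (hev F (row3 a b 1)) 2 = 1.
Let T := [set p : C * C | nm p <= M].
Let ph (G : coefs R D) k (p : C * C) := cc (hev G (row3 p.1 p.2 1)) k.

Let mono (m : mon D) (p : C * C) : C := p.1 ^+ expx m * p.2 ^+ expy m.

Let phE G k p : (k < 3)%N -> ph G k p = \sum_(m : mon D) G (inord k) m * mono m p.
Proof.
move=> k3; rewrite /ph hev_cc //; apply: eq_bigr => m _; by rewrite !ccE expr1n mulr1 /mono mulrA.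
Qed.

(** As the last coordinate of [F] is 1, the difference of the quotients is
    [(G_k - F_k - F_k (G_2 - 1)) / G_2], with a numerator of size [O(e)] and a denominator close to
    1. *)
Lemma affmap_close (alp : R) : 0 < alp -> exists2 e : R, 0 < e & forall G : coefs R D, coef_close G F (rc e) ->
  (forall p : C * C, nm p <= M -> cc (hev G (row3 p.1 p.2 1)) 2 != 0) /\
  forall p p' : C * C, nm p <= M -> nm p' <= M -> nm (affmap G p - affmap F p) <= alp /\
    nm (affmap G p - affmap F p - (affmap G p' - affmap F p')) <= alp * nm (p - p').
Proof.
move=> alp0.
have qc (k : bool) : qd T (fun p : C * C => if k then p.1 else p.2).
  apply: (@qd_lin _ _ _ _ 1 M) => // [c u u'|u]; first by case: k.
  by rewrite mul1r; have /andP[u1 u2] : (nm u.1 <= nm u) && (nm u.2 <= nm u) by [rewrite -nm_pair_le]; case: k.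
have qm m : qd T (mono m) by apply: qd_mul; apply: qd_exp; [exact: (qc true)|exact: (qc false)].
have [B hB] : exists B : mon D -> R, forall m, 0 <= B m /\ lipb T (B m) (mono m).
  have ex m : exists b, 0 <= b /\ lipb T b (mono m) by have [b b0 hb] := lipb_qd (qm m); exists b.
  by have [B hB] := choice ex; exists B.
pose K := \sum_m B m; have K0 : 0 <= K by rewrite sumr_ge0 // => m _; case: (hB m).
have [KF KF0 hF] : exists2 KF : R, 0 <= KF & forall k, (k < 3)%N -> lipb T KF (ph F k).
  have ex k : (k < 3)%N -> exists2 b : R, 0 <= b & lipb T b (ph F k).
    move=> k3; apply: lipb_qd; have q : qd T (fun p => \sum_(m : mon D) F (inord k) m * mono m p).
      by apply: qd_sum => m; apply: qd_mul; [exact: qd_cst|exact: qm].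
    by apply: qd_ext q => p; rewrite phE.
  have [b0 b00 h0] := ex 0%N isT; have [b1 b10 h1] := ex 1%N isT; have [b2 b20 h2] := ex 2%N isT.
  exists (b0 + b1 + b2); first by rewrite !addr_ge0.
  by case=> [|[|[|k]]] // _; [apply: lipbW h0|apply: lipbW h1|apply: lipbW h2]; lra.
have K1 : 0 < K + 1 by rewrite ltr_wpDl.
have F0 : 0 < 1 + 2 * KF by move: KF0; lra.
have cp : 0 < 4 * (K + 1) * (1 + 2 * KF) by rewrite !mulr_gt0.
pose e := Num.min (alp / (4 * (K + 1) * (1 + 2 * KF))) (2 * (K + 1))^-1.
have e0 : 0 < e by rewrite lt_min divr_gt0 // invr_gt0 mulr_gt0.
exists e => // G hG.
have eK2 : e * K <= 2^-1.
  have : e <= (2 * (K + 1))^-1 by rewrite ge_min lexx orbT.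
  rewrite -[leRHS]div1r ler_pdivlMr ?mulr_gt0 // => h; have := mulr_ge0 (ltW e0) K0; move: h e0; rewrite mulrCA mulrDr mulr1.
  by move: (e * K) => *; lra.
have dl k : (k < 3)%N -> lipb T (e * K) (fun p => ph G k p - ph F k p).
  move=> k3; have h : lipb T (\sum_m e * B m) (fun p => \sum_(m : mon D) (G (inord k) m - F (inord k) m) * mono m p).
    by apply: lipb_sum => m; apply: lipb_scale; [rewrite ltW // -nm_lt; exact: hG|case: (hB m)].
  have Q q : ph G k q - ph F k q = \sum_m (G (inord k) m - F (inord k) m) * mono m q.
    by rewrite !phE // -sumrB; apply: eq_bigr => m _; rewrite mulrBl.
  by move=> p p' Tp Tp'; rewrite !Q /K mulr_sumr; exact: h.
have eK0 : 0 <= e * K by rewrite mulr_ge0 // ltW.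
have dQ p : ph G 2 p = 1 + (ph G 2 p - ph F 2 p) by rewrite [ph F 2 p](F1 p.1 p.2) addrC subrK.
have d2 := dl 2%N isT; have iv := lipb_inv eK2 d2.
have Q0 p : T p -> ph G 2 p != 0.
  move=> Tp; have [a1 _] := d2 _ _ Tp Tp; rewrite dQ -nm_gt0.
  by have := nm_loD (1 : C) (ph G 2 p - ph F 2 p); rewrite nm1; move: a1 eK2; lra.
have main k : (k < 3)%N -> lipb T alp (fun p => ph G k p / ph G 2 p - ph F k p).
  move=> k3; have s1 := lipb_mul KF0 (hF k k3) d2.
  have s2 := lipb_scale (c := -1) (t := 1) (ltac:(by rewrite nmN nm1)) s1.
  have s3 := lipb_add (dl k k3) s2.
  have p3 : 0 <= e * K + 1 * (2 * KF * (e * K)) by rewrite mul1r; have := mulr_ge0 (mulr_ge0 (ler0n R 2) KF0) eK0; move: eK0; exact: addr_ge0.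
  have s4 := lipb_mul p3 s3 iv.
  have bd : 2 * (e * K + 1 * (2 * KF * (e * K))) * 2 <= alp.
    have -> : 2 * (e * K + 1 * (2 * KF * (e * K))) * 2 = e * (4 * K * (1 + 2 * KF)) by ring.
    have : e <= alp / (4 * (K + 1) * (1 + 2 * KF)) by rewrite ge_min lexx.
    by rewrite ler_pdivlMr // => h; apply: le_trans h; rewrite ler_wpM2l ?(ltW e0) // ler_wpM2r ?(ltW F0) // ler_wpM2l ?ler0n // lerDl ler01.
  have eqf p : T p -> (ph G k p - ph F k p + -1 * (ph F k p * (ph G 2 p - ph F 2 p))) * (1 + (ph G 2 p - ph F 2 p))^-1 = ph G k p / ph G 2 p - ph F k p.
    by move=> Tp; have q0 := Q0 p Tp; rewrite -dQ [ph F 2 p](F1 p.1 p.2); field.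
  exact: lipb_ext eqf (lipbW bd s4).
split; first exact: Q0.
move=> p p' Tp Tp'; have [m1 m2] := main 0%N isT p p' Tp Tp'; have [n1 n2] := main 1%N isT p p' Tp Tp'.
have fE q : affmap F q = (ph F 0 q, ph F 1 q) by rewrite /affmap (F1 q.1 q.2) !divr1.
by split; rewrite !fE nm_pair_le; apply/andP; split; [exact: m1|exact: n1|exact: m2|exact: n2].
Qed.
End ClosePerturbation.

(** * Saddle blenders *)

Section SaddleBlender.
Variables (R : realType) (D : nat) (F : coefs R D) (z ws Lam w : Cplx R) (kap rho eta ep : R) (A yc : 'I_3 -> Cplx R).
Local Notation C := (Cplx R).
Hypothesis kap0 : 0 < kap.
Hypothesis rho0 : 0 < rho.
Hypothesis geo : geom Lam A yc w eta ep.
Hypothesis eta0 : 0 < eta <= 200^-1.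
Hypothesis hg : near (box A yc 3 3) Lam A yc w eta ep (fun p => toX z ws kap rho (affmap F (ofX z ws kap rho p))).
Hypothesis F1 : forall a b : C, cc (hev F (row3 a b 1)) 2 = 1.
Hypothesis Lam1 : nm Lam < 1.

Lemma saddle_blender_near : exists L, saddle_blender F L.
Proof.
have eta1 : 0 < eta <= 100^-1 by have := eta0; lra.
have eta2 : 0 < 2 * eta <= 100^-1 by have := eta0; lra.
have F2 i p : box A yc 3 3 i p -> cc (hev F (io z ws kap rho p)) 2 != 0 by rewrite F1 oner_neq0.
pose T := distort kap rho.
have T0 : 0 < T by rewrite !addr_gt0 ?divr_gt0 ?invr_gt0.
have [_ _ ep0 _] := geo; have /andP[et0 _] := eta0.
pose alp := Num.min ep eta / T; have alp0 : 0 < alp by rewrite divr_gt0 // lt_min ep0.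
have aT : alp * T = Num.min ep eta by rewrite divfK ?gt_eqF.
have oM i p : box A yc 3 3 i p -> nm (ofX z ws kap rho p) <= Ms z ws kap rho.
  move=> [b1 b2]; have b3 := yc_disc geo b2; rewrite nm_pair_le /ofX /Ms /=.
  have h1 : kap * nm p.1 <= kap * 3 by rewrite ler_wpM2l // ltW.
  have h3 : rho * nm p.2 <= rho * 1 by rewrite ler_wpM2l // ltW.
  have := nm_ge0 z; have := nm_ge0 ws; have k0 := kap0; have r0 := rho0.
  have := nmD z (rc kap * p.1); have := nmD ws (rc rho * p.2); rewrite !(@nmM R (rc _)) !nm_rc !gtr0_norm //.
  by move: h1 h3; move: (kap * nm _) (rho * nm _) => *; apply/andP; split; lra.
have [e e0 he] := @affmap_close _ _ F (Ms z ws kap rho) F1 _ alp0.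
exists (LamP2 F (Zs z ws kap rho A yc)), (Zs z ws kap rho A yc); split=> //.
- exact: Z_open.
- by move=> x /(clZ_Q kap0 rho0) Qx; exact: (Q_cover kap0 rho0 geo eta1 hg F2 Qx).
- exact: (L_nonempty kap0 rho0 geo eta1 hg F2).
exists (rc e); split=> [|G GH /he[G2 Gc]]; first by rewrite -rc0 rc_lt.
have hn : near (box A yc 3 3) Lam A yc w (2 * eta) (2 * ep) (fun p => toX z ws kap rho (affmap G (ofX z ws kap rho p))).
  apply: (near_perturb kap0 rho0 geo eta0 hg (alp := alp)) => //; rewrite -/T ?aT ?ge_min ?lexx ?orbT //.
  - by move=> i p.
  - by move=> i p /oM Tp; have [] := Gc _ _ Tp Tp.
  - by move=> i p p' /oM Tp /oM Tp'; have [] := Gc _ _ Tp Tp'.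
apply: (saddle_hyp kap0 rho0 (geom_double geo eta0) eta2 hn) => // i p /oM Tp.
exact: (G2 _ Tp).
Qed.
End SaddleBlender.

(** * Coefficients of the iterates of a lift *)

Section HomogeneousComposition.
Variable R : realType.
Local Notation C := (Cplx R).

Lemma sum_mon1 D i j (v : C) : (i + j <= D)%N -> \sum_(m : mon D) (if (expx m == i) && (expy m == j) then v else 0) = v.
Proof.
move=> ij; have i1 : (i < D.+1)%N by rewrite ltnS (leq_trans _ ij) // leq_addr.
have j1 : (j < D.+1)%N by rewrite ltnS (leq_trans _ ij) // leq_addl.
pose m0 : mon D := exist _ (Ordinal i1, Ordinal j1) ij.
rewrite (bigD1 m0) //= /expx /expy /= !eqxx big1 ?addr0 // => m mm; case: ifP => // /andP[/eqP e1 /eqP e2].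
case/eqP: mm; apply: val_inj; rewrite /=; case: (val m) e1 e2 => a b /= e1 e2.
by congr pair; apply: val_inj.
Qed.

Definition hom D (f : 'rV[C]_3 -> C) := exists c : mon D -> C, forall x,
  f x = \sum_(m : mon D) c m * cc x 0 ^+ expx m * cc x 1 ^+ expy m * cc x 2 ^+ (D - expx m - expy m).

Lemma hom_mon D i j (v : C) : (i + j <= D)%N -> hom D (fun x => v * cc x 0 ^+ i * cc x 1 ^+ j * cc x 2 ^+ (D - i - j)).
Proof.
move=> ij; exists (fun m => if (expx m == i) && (expy m == j) then v else 0) => x.
rewrite -[LHS](sum_mon1 _ ij); apply: eq_bigr => m _.
by case: ifP => [/andP[/eqP-> /eqP->]|_] //; rewrite !mul0r.
Qed.

Lemma hom_sum D (I : finType) (f : I -> 'rV[C]_3 -> C) : (forall i, hom D (f i)) -> hom D (fun x => \sum_i f i x).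
Proof.
move=> h; have [c hc] := choice h; exists (fun m => \sum_i c i m) => x; under eq_bigr do rewrite hc.
by rewrite exchange_big /=; apply: eq_bigr => m _; rewrite !mulr_suml.
Qed.

Lemma hom_mul D E f g : hom D f -> hom E g -> hom (D + E) (fun x => f x * g x).
Proof.
move=> [c hc] [c' hc'].
have h : hom (D + E) (fun x => \sum_(m : mon D) \sum_(m' : mon E) (c m * c' m') * cc x 0 ^+ (expx m + expx m')
    * cc x 1 ^+ (expy m + expy m') * cc x 2 ^+ (D + E - (expx m + expx m') - (expy m + expy m'))).
  apply: hom_sum => m; apply: hom_sum => m'; apply: hom_mon.
  by have := mon_le m; have := mon_le m'; lia.
have [k hk] := h; exists k => x; rewrite -hk hc hc' mulr_suml; apply: eq_bigr => m _; rewrite mulr_sumr; apply: eq_bigr => m' _.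
have -> : (D + E - (expx m + expx m') - (expy m + expy m') = (D - expx m - expy m) + (E - expx m' - expy m'))%N.
  by have := mon_le m; have := mon_le m'; lia.
by rewrite !exprD; ring.
Qed.

Lemma hom_exp D f k : hom D f -> hom (D * k) (fun x => f x ^+ k).
Proof.
move=> hf; elim: k => [|k ih].
  rewrite muln0; have [c hc] := @hom_mon 0 0 0 1 isT; exists c => x; rewrite -hc /= !expr0 !mulr1 //.
by rewrite mulnS; have [c hc] := hom_mul hf ih; exists c => x; rewrite -hc exprS.
Qed.

Lemma iter_coefs D (F : coefs R D) n : exists Fn : coefs R (D ^ n), forall x, hev Fn x = iter n (hev F) x.
Proof.
have build E (f : 'rV[C]_3 -> 'rV[C]_3) : (forall i, hom E (fun x => f x ord0 i)) -> exists Fn : coefs R E, forall x, hev Fn x = f x.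
  by move=> h; have [c hc] := choice h; exists c => x; apply/rowP => i; rewrite mxE hc.
apply: build; elim: n => [|n ih] i.
  have h0 : hom 1 (fun x : 'rV[C]_3 => cc x 0) by have [c hc] := @hom_mon 1 1 0 1 isT; exists c => x; rewrite -hc /= !mulr1 mul1r.
  have h1 : hom 1 (fun x : 'rV[C]_3 => cc x 1) by have [c hc] := @hom_mon 1 0 1 1 isT; exists c => x; rewrite -hc /= !mulr1 !mul1r.
  have h2 : hom 1 (fun x : 'rV[C]_3 => cc x 2) by have [c hc] := @hom_mon 1 0 0 1 isT; exists c => x; rewrite -hc /= !mulr1 !mul1r.
  by move: i; apply: ord3P; [exact: h0|exact: h1|exact: h2].
have step (m : mon D) : hom (D ^ n.+1) (fun x => F i m * cc (iter n (hev F) x) 0 ^+ expx m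
    * cc (iter n (hev F) x) 1 ^+ expy m * cc (iter n (hev F) x) 2 ^+ (D - expx m - expy m)).
  have e1 := hom_exp (expx m) (ih (inord 0)); have e2 := hom_exp (expy m) (ih (inord 1)).
  have e3 := hom_exp (D - expx m - expy m) (ih (inord 2)).
  have [c0 hc0] := @hom_mon 0 0 0 (F i m) isT.
  have [c hc] := hom_mul (hom_mul (hom_mul (ex_intro _ c0 hc0) e1) e2) e3.
  have ed : (0 + D ^ n * expx m + D ^ n * expy m + D ^ n * (D - expx m - expy m) = D ^ n.+1)%N.
    by rewrite add0n -!mulnDr expnSr; congr (_ * _)%N; have := mon_le m; lia.
  by rewrite -ed; exists c => x; rewrite -hc /= !mulr1.
have [c hc] := hom_sum step; exists c => x; rewrite -hc iterS mxE.
by [].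
Qed.
End HomogeneousComposition.

(** * The lift of the skew product, and the conclusion *)

Section SkewCoefs.
Variables (R : realType) (d : nat) (P q : {poly Cplx R}) (ws c : Cplx R) (kap : R).
Local Notation C := (Cplx R).
Hypothesis d0 : (0 < d)%N.
Hypothesis sP : size P = d.+2.
Hypothesis sq : size q = d.+2.

Definition skc : coefs R d.+1 := fun i m =>
  if i == 0 :> nat then (if expy m == 0%N then P`_(expx m) else 0) +
    ((if (expx m == 0%N) && (expy m == 1%N) then rc kap * c else 0) + (if (expx m == 0%N) && (expy m == 0%N) then - (rc kap * c * ws) else 0))
  else if i == 1 :> nat then (if expx m == 0%N then q`_(expy m) else 0)
  else (if (expx m == 0%N) && (expy m == 0%N) then 1 else 0).

Let sum_x (f : nat -> C) : \sum_(m : mon d.+1) (if expy m == 0%N then f (expx m) else 0) = \sum_(i < d.+2) f i.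
Proof.
rewrite (eq_bigr (fun m => \sum_(i < d.+2) (if (expx m == i) && (expy m == 0%N) then f i else 0))); last first.
  move=> m _; rewrite (bigD1 (val m).1) //= big1 ?addr0 ?eqxx //= => i im.
  by case: eqP => //= e; case/eqP: im; apply: val_inj.
by rewrite exchange_big /=; apply: eq_bigr => i _; rewrite sum_mon1 // addn0 -ltnS.
Qed.
Let sum_y (f : nat -> C) : \sum_(m : mon d.+1) (if expx m == 0%N then f (expy m) else 0) = \sum_(i < d.+2) f i.
Proof.
rewrite (eq_bigr (fun m => \sum_(i < d.+2) (if (expx m == 0%N) && (expy m == i) then f i else 0))); last first.
  move=> m _; rewrite (bigD1 (val m).2) //= big1 ?addr0 ?eqxx ?andbT //= => i im.
  by rewrite andbC; case: eqP => //= e; case/eqP: im; apply: val_inj.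
by rewrite exchange_big /=; apply: eq_bigr => i _; rewrite sum_mon1 // add0n -ltnS.
Qed.

Lemma hev_skc x : [/\ cc (hev skc x) 0 = \sum_(i < d.+2) P`_i * cc x 0 ^+ i * cc x 2 ^+ (d.+1 - i)
      + (rc kap * c * cc x 1 * cc x 2 ^+ d - rc kap * c * ws * cc x 2 ^+ d.+1),
    cc (hev skc x) 1 = \sum_(i < d.+2) q`_i * cc x 1 ^+ i * cc x 2 ^+ (d.+1 - i) & cc (hev skc x) 2 = cc x 2 ^+ d.+1].
Proof.
have ifM (b : bool) (u v : C) : (if b then u else 0) * v = if b then u * v else 0 by case: b; rewrite ?mul0r.
split; rewrite hev_cc // /skc inordK //=.
- rewrite -(sum_x (fun i => P`_i * cc x 0 ^+ i * cc x 2 ^+ (d.+1 - i))).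
  rewrite -(@sum_mon1 R d.+1 0 1 (rc kap * c * cc x 1 * cc x 2 ^+ d) isT) -[- (_ * cc x 2 ^+ d.+1)]mulNr.
  rewrite -(@sum_mon1 R d.+1 0 0 (- (rc kap * c * ws) * cc x 2 ^+ d.+1) isT) -!big_split; apply: eq_bigr => m _ /=.
  rewrite !mulrDl !ifM; congr (_ + (_ + _)); case: ifP => //.
  + by move=> /eqP->; rewrite expr0 mulr1 subn0.
  + by move=> /andP[/eqP-> /eqP->]; rewrite expr0 mulr1 expr1 subn0 subn1.
  + by move=> /andP[/eqP-> /eqP->]; rewrite !expr0 !mulr1 !subn0.
- rewrite -(sum_y (fun i => q`_i * cc x 1 ^+ i * cc x 2 ^+ (d.+1 - i))); apply: eq_bigr => m _.
  by rewrite !ifM; case: ifP => // /eqP->; rewrite expr0 mulr1 subn0.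
- rewrite -[RHS](@sum_mon1 R d.+1 0 0 _ isT); apply: eq_bigr => m _; rewrite !ifM; case: ifP => // /andP[/eqP-> /eqP->].
  by rewrite !expr0 !mul1r !subn0.
Qed.

Lemma skc_row (p : C * C) : hev skc (row3 p.1 p.2 1) = row3 (skw P q ws c kap p).1 (skw P q ws c kap p).2 1.
Proof.
have [e0 e1 e2] := hev_skc (row3 p.1 p.2 1); rewrite !ccE in e0 e1 e2.
have hs (f : {poly C}) (t : C) : size f = d.+2 -> \sum_(i < d.+2) f`_i * t ^+ i * 1 ^+ (d.+1 - i) = f.[t].
  by move=> sf; rewrite horner_coef sf; apply: eq_bigr => i _; rewrite expr1n mulr1.
apply: row_cc; rewrite ?e0 ?e1 ?e2 ccE ?hs ?expr1n //=.
by ring.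
Qed.

Lemma affmap_skc p : affmap skc p = skw P q ws c kap p.
Proof.
by rewrite /affmap skc_row !ccE !divr1 -surjective_pairing.
Qed.

Lemma iter_skc n p : iter n (hev skc) (row3 p.1 p.2 1) = row3 (iter n (skw P q ws c kap) p).1 (iter n (skw P q ws c kap) p).2 1.
Proof. by elim: n => //= n ->; rewrite skc_row. Qed.

Lemma skc_skew : skewprod skc.
Proof.
split=> [x h|m hm|m|m e1 e2]; rewrite /skc /= ?(negPf hm) ?e1 ?e2 ?oner_neq0 //; last first.
  by rewrite -negb_and => /negPf->.
have z0 k : cc (hev skc x) k = 0 by rewrite h cc0.
have [e0 e1 e2] := hev_skc x; rewrite !z0 in e0 e1 e2.
have x2 : cc x 2 = 0 by apply/eqP; have /esym/eqP := e2; rewrite expf_eq0.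
have top (f : {poly C}) (t : C) : size f = d.+2 -> \sum_(i < d.+2) f`_i * t ^+ i * 0 ^+ (d.+1 - i) = f`_d.+1 * t ^+ d.+1.
  move=> sf; rewrite (bigD1 ord_max) //= subnn mulr1 big1 ?addr0 // => i im.
  have : (0 < d.+1 - i)%N by rewrite subn_gt0 ltn_neqAle -ltnS ltn_ord andbT; apply: contraNneq im => e; apply/eqP/val_inj.
  by case: (_ - _)%N => // k _; rewrite expr0n mulr0.
have lc (f : {poly C}) (t : C) : size f = d.+2 -> f`_d.+1 * t ^+ d.+1 = 0 -> t = 0.
  move=> sf /eqP; rewrite mulf_eq0 expf_eq0 => /orP[|/andP[_ /eqP]//].
  have := lead_coef_eq0 f; rewrite lead_coefE sf => -> /eqP f0; by rewrite f0 size_poly0 in sf.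
rewrite x2 top // in e1; rewrite x2 !expr0n (gtn_eqF d0) /= !mulr0 subr0 addr0 top // in e0.
by apply: row_cc; rewrite cc0 //; [apply: (lc P)|apply: (lc q)].
Qed.

(** With scales 1 and centre 0 the chart is the standard one, and differentiability is inherited
    from the lift. *)
Lemma diff_skw p : differentiable (skw P q ws c kap) p.
Proof.
have k1 : 0 < 1 :> R := ltr01.
have y2 : cc (hev skc (io 0 0 1 1 p)) 2 != 0.
  have [_ _ ->] := hev_skc (io 0 0 1 1 p); have [_ _ ->] := cc_io (0 : C) 0 1 1 p; by rewrite expr1n oner_neq0.
have [di _] := diff_io (0 : C) 0 k1 k1 p; have [dk _] := diff_kx (0 : C) 0 k1 k1 y2.
have dd := differentiable_comp (differentiable_comp di (diff_hev skc _)) dk.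
suff -> : skw P q ws c kap = kx 0 0 1 1 \o (hev skc \o io 0 0 1 1) by exact: dd.
apply/funext => t; rewrite -affmap_skc /= /affmap /kx /io /toX /ofX /= !add0r !subr0 !rc1 !mul1r !divr1.
by [].
Qed.
End SkewCoefs.

Lemma skc_close (R : realType) d (a b : 'rV[Cplx R]_d.+2) (P q : {poly Cplx R}) (ws c : Cplx R) (kap e : R) : 0 < e ->
  coef_near (e / 4) P (pol a) -> coef_near (e / 4) q (pol b) -> nm (rc kap * c) < e / 4 -> nm (rc kap * c * ws) < e / 4 ->
  coef_close (skc P q ws c kap) (prodmap a b) (rc e).
Proof.
move=> e0 hP hq h1 h2 i m.
have E (v : 'rV[Cplx R]_d.+2) (k : 'I_d.+2) : (pol v)`_k = v ord0 k by rewrite coef_poly ltn_ord inord_val.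
rewrite nm_lt /skc /prodmap; case: ifP => [_|_]; last first.
  case: ifP => _; last by rewrite subrr nm0.
  case: ifP => _; last by rewrite subrr nm0.
  by rewrite -E; apply: lt_trans (hq _) _; lra.
set u1 := if _ then _ else _; set u2 := if _ then _ else _; set u3 := if _ then _ else _; set u4 := if _ then _ else _.
have b1 : nm (u1 - u4) < e / 4.
  by rewrite /u1 /u4; case: ifP => _; [rewrite -E; exact: hP|rewrite subrr nm0; lra].
have b2 : nm u2 < e / 4 by rewrite /u2; case: ifP => _ //; rewrite nm0; lra.
have b3 : nm u3 < e / 4 by rewrite /u3; case: ifP => _; rewrite ?nmN // nm0; lra.
have -> : u1 + (u2 + u3) - u4 = (u1 - u4) + (u2 + u3) by ring.
by have := nmD (u1 - u4) (u2 + u3); have := nmD u2 u3; move: b1 b2 b3; lra.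
Qed.

(* p, q in P_d are given by their coefficient vectors a, b (a_d, b_d <> 0);
   (p,q) is the limit in H_d(P^2) of skew products G with property P iff
   every neighbourhood of the lift prodmap a b contains such a lift G. *)
Theorem theorem1p1 (R : realType) (d : nat) (a b : 'rV[Cplx R]_(d.+1)) :
  (2 <= d)%N -> inPd a -> inPd b -> Bif a ->
  (forall e : Cplx R, 0 < e ->
     exists G : coefs R d,
       [/\ skewprod G, coef_close G (prodmap a b) e & iter_rep_blender G]) /\
  (forall e : Cplx R, 0 < e ->
     exists G : coefs R d,
       [/\ skewprod G, coef_close G (prodmap a b) e & iter_saddle_blender G]).
Proof.
case: d a b => [|[|d]] // a b _ aP bP Ba.
(* The value [1 / 200] because perturbations double the tolerance, and the covering and cone
   estimates need [1 / 100]. *)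
have eta0 : 0 < (200^-1 : R) <= 1 by lra.
have eta1 : 0 < (200^-1 : R) <= 200^-1 by lra.
split=> e /pos_rc[e' e'0 ->]; have e4 : 0 < e' / 4 by lra.
  have [P [q [z [ws [c [Lam [w [N [kap [rho [ep [A [yc [[sP sq hP hq] [N0 k0 r0 c1 c2] geo L1 hn]]]]]]]]]]]]]] :=
    near_skew true (ltn0Sn d) Ba bP e4 eta0.
  exists (@skc R d.+1 P q ws c kap); split; [exact: skc_skew|exact: skc_close|exists N; split=> //].
  have -> : affmap (@skc R d.+1 P q ws c kap) = skw P q ws c kap by apply/funext => p; exact: affmap_skc.
  apply: (rep_blender_near _ k0 r0 geo eta1 hn L1) => p; apply: diff_iter => p'.
  exact: (@diff_skw _ d.+1).
have [P [q [z [ws [c [Lam [w [N [kap [rho [ep [A [yc [[sP sq hP hq] [N0 k0 r0 c1 c2] geo L1 hn]]]]]]]]]]]]]] :=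
  near_skew false (ltn0Sn d) Ba bP e4 eta0.
have sk := skc_skew ws c kap (ltn0Sn d) sP sq.
exists (@skc R d.+1 P q ws c kap); split; [exact: sk|exact: skc_close|exists N; split=> //].
have [Fn hF] := iter_coefs (@skc R d.+1 P q ws c kap) N; exists Fn; split=> //.
have row p : hev Fn (row3 p.1 p.2 1) = row3 (iter N (skw P q ws c kap) p).1 (iter N (skw P q ws c kap) p).2 1.
  by rewrite hF; exact: iter_skc.
have aff p : affmap Fn p = iter N (skw P q ws c kap) p.
  by rewrite /affmap row !ccE !divr1 -surjective_pairing.
apply: (saddle_blender_near k0 r0 geo eta1 _ _ L1).
- by move=> i; have [n1 n2] := hn i; split=> [p|p p']; rewrite !aff; [exact: n1|exact: n2].
- by move=> u v; rewrite (row (u, v)) ccE.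
Qed.
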